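(* Let $\Omega$ be a piecewise smooth bounded convex Reinhardt domain in $\mathbb{C}^2$. Assume that the symbols $\phi,\psi\in C(\overline{\Omega})$ are such that $\phi\circ f$ and $\psi\circ f$ are harmonic for every holomorphic function $f:\mathbb{D}\to\partial\Omega$. If $H^*_{\psi}H_{\phi}$ is compact on $A^2(\Omega)$, then for every holomorphic function $f:\mathbb{D}\to\partial\Omega$ either $\phi\circ f$ or $\psi\circ f$ is holomorphic.
   Context: $\mathbb{D}$ is the open unit disk in $\mathbb{C}$ and $\partial\Omega$ is the boundary of $\Omega$. A holomorphic function $f:\mathbb{D}\to\partial\Omega$ means a holomorphic map $f:\mathbb{D}\to\mathbb{C}^2$ with $f(\mathbb{D})\subset\partial\Omega$. Smooth means $C^\infty$-smooth. A domain $\Omega\subset\mathbb{C}^n$ is Reinhardt if $(z_1,\ldots,z_n)\in\Omega$ and $\theta_1,\ldots,\theta_n\in\mathbb{R}$ imply $(e^{i\theta_1}z_1,\ldots,e^{i\theta_n}z_n)\in\Omega$. $C(\overline{\Omega})$ denotes the complex-valued continuous functions on the closure of $\Omega$. $A^2(\Omega)$ is the Bergman space, i.e. the space of holomorphic functions on $\Omega$ that are square integrable with respect to Lebesgue measure, and $P$ is the Bergman projection, the orthogonal projection from $L^2(\Omega)$ onto $A^2(\Omega)$. For $\phi\in L^\infty(\Omega)$ the Hankel operator $H_\phi:A^2(\Omega)\to L^2(\Omega)$ with symbol $\phi$ is $H_\phi f=\phi f-P(\phi f)$; $H_\psi^*$ is the Hilbert space adjoint of $H_\psi$, so that $H_\psi^*H_\phi:A^2(\Omega)\to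 A^2(\Omega)$. *)

(* Defs.v *)
From HB Require Import structures.
From mathcomp Require Import all_boot all_order all_algebra.
From mathcomp Require Import all_classical all_reals all_analysis.
From mathcomp Require Import complex.

Set Implicit Arguments.
Unset Strict Implicit.
Unset Printing Implicit Defensive.

Import Order.TTheory GRing.Theory Num.Theory.
Import numFieldNormedType.Exports.

Local Open Scope classical_set_scope.
Local Open Scope ring_scope.
Local Open Scope complex_scope.

(* The field R[i] with the topology of its norm, as a normed space over itself.
   Hence [differentiable f z], for f between normed spaces over R[i], means that
   f has a C-linear Frechet derivative at z. *)
HB.instance Definition _ (R : rcfType) := NormedModule.copy R[i] R[i]^o.

Section Coordinates.
Variable R : realType.

(* C^2 is [R[i] * R[i]].  Real derivatives and Lebesgue measure live on R^2 and
   R^4; [toC] and [toC2] are the standard identifications. *)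
Definition toC (p : R * R) : R[i] := let: (x, y) := p in x +i* y.

Definition toC2 (p : R * R * R * R) : R[i] * R[i] :=
  let: (x1, y1, x2, y2) := p in (x1 +i* y1, x2 +i* y2).

End Coordinates.

Section RealCalculus.
Variables (R : realType) (V : normedModType R).

(* For V of finite dimension and U open this is C^k-smoothness: all iterated
   directional derivatives of order at most k exist and are continuous on U. *)
Fixpoint C_k (k : nat) (U : set V) (g : V -> R) : Prop :=
  (forall x, U x -> continuous_at x g) /\
  if k is j.+1 then
    forall v, (forall x, U x -> derivable g x v) /\ C_k j U ('D_v g)
  else True.

Definition C_infty (U : set V) (g : V -> R) : Prop := forall k, C_k k U g.

End RealCalculus.

Section ComplexFunctions.
Variable R : realType.
Notation C := R[i].

Definition holomorphic_on (V W : normedModType C) (D : set V) (f : V -> W) :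
  Prop := forall z, D z -> differentiable f z.

Definition unit_disk : set C := [set z | `|z| < 1].

Definition laplacian (g : R * R -> R) (p : R * R) : R :=
  let e1 : R * R := (1, 0) in
  let e2 : R * R := (0, 1) in
  'D_e1 ('D_e1 g) p + 'D_e2 ('D_e2 g) p.

Definition harmonic_real_on (D : set (R * R)) (g : R * R -> R) : Prop :=
  C_k 2 D g /\ forall p, D p -> laplacian g p = 0.

Definition harmonic_on (D : set C) (u : C -> C) : Prop :=
  harmonic_real_on (@toC R @^-1` D) (fun p => complex.Re (u (toC p))) /\
  harmonic_real_on (@toC R @^-1` D) (fun p => complex.Im (u (toC p))).

End ComplexFunctions.

Section Domains.
Variable R : realType.
Notation C := R[i].
Implicit Types Omega : set (C * C).

Definition boundary (T : topologicalType) (A : set T) : set T :=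
  closure A `\` interior A.

Definition domain (T : topologicalType) (A : set T) : Prop :=
  [/\ A !=set0, open A & connected A].

Definition expi (theta : R) : C := cos theta +i* sin theta.

Definition reinhardt Omega : Prop :=
  forall z1 z2 (theta1 theta2 : R), Omega (z1, z2) ->
    Omega (expi theta1 * z1, expi theta2 * z2).

(* Piecewise smooth boundary in the sense of Range and Siu: boundary Omega is
   covered by finitely many open sets U j carrying C^infty functions rho j such
   that, on the union of the U j, Omega is the set of those x at which
   rho j < 0 for all j with x in U j; and the gradients of the rho j that vanish
   simultaneously at a boundary point are linearly independent there
   (equivalently, their wedge product does not vanish). *)
Definition piecewise_smooth Omega : Prop :=
  exists (N : nat) (U : 'I_N -> set (R * R * R * R))
         (rho : 'I_N -> R * R * R * R -> R),
  [/\ forall j, open (U j),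
      forall j, C_infty (U j) (rho j),
      forall x, boundary Omega (toC2 x) -> exists j, U j x,
      forall x, (exists j, U j x) ->
        (Omega (toC2 x) <-> forall j, U j x -> rho j x < 0)
    & forall (x : R * R * R * R) (J : {set 'I_N}) (c : 'I_N -> R),
        boundary Omega (toC2 x) ->
        (forall j, j \in J -> U j x /\ rho j x = 0) ->
        (forall v, \sum_(j in J) c j * 'D_v (rho j) x = 0) ->
        forall j, j \in J -> c j = 0].

Definition boundary_disk Omega (f : C -> C * C) : Prop :=
  holomorphic_on (@unit_disk R) f /\
  forall z, unit_disk z -> boundary Omega (f z).

End Domains.

Section BergmanSpace.
Variables (R : realType) (Omega : set (R[i] * R[i])).
Notation C := R[i].
Notation T := (measurableTypeR R). (* R with its Borel sets *)
Notation leb := (@lebesgue_measure R).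
Notation mu := (leb \x leb \x leb \x leb)%E.
Implicit Types F G f g h k : C * C -> C.

Definition real_coords : set (T * T * T * T) := @toC2 R @^-1` Omega.
Notation dom := real_coords.

Definition sqint F : \bar R :=
  (\int[mu]_(p in dom)
     ((complex.Re (F (toC2 p)) ^+ 2 + complex.Im (F (toC2 p)) ^+ 2)%:E))%E.

(* Elements of L^2(Omega) and A^2(Omega) are represented by functions on C^2;
   only their values on Omega matter, and those of L^2(Omega) matter only up to
   null sets. *)
Definition L2 F : Prop :=
  [/\ measurable_fun dom (fun p : T * T * T * T => complex.Re (F (toC2 p))),
      measurable_fun dom (fun p : T * T * T * T => complex.Im (F (toC2 p)))
    & (sqint F < +oo)%E].

Definition L2norm F : R := Num.sqrt (fine (sqint F)).

Definition inner F G : C :=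
  let H p := F (toC2 p) * (G (toC2 p))^* in
  (\int[mu]_(p in dom) complex.Re (H p)) +i*
  (\int[mu]_(p in dom) complex.Im (H p)).

Definition A2 f : Prop := L2 f /\ holomorphic_on Omega f.

(* For F in L^2(Omega), the functions h below are exactly the representatives of
   the orthogonal projection of F onto A^2(Omega): they agree on Omega. *)
Definition bergman_projection F : C * C -> C :=
  xget (fun=> 0)
    [set h | A2 h /\ forall k, A2 k -> inner (fun z => F z - h z) k = 0].

Definition hankel (phi f : C * C -> C) : C * C -> C :=
  fun z => phi z * f z - bergman_projection (fun w => phi w * f w) z.

(* Hilbert space adjoint of S : A^2(Omega) -> L^2(Omega). *)
Definition adjoint (S : (C * C -> C) -> C * C -> C) (g : C * C -> C) :
    C * C -> C :=
  xget (fun=> 0) [set h | A2 h /\ forall k, A2 k -> inner h k = inner g (S k)].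

(* S : A^2(Omega) -> A^2(Omega) is compact: the image of a bounded sequence has
   a subsequence converging in A^2(Omega). *)
Definition compact_on_A2 (S : (C * C -> C) -> C * C -> C) : Prop :=
  forall u : nat -> C * C -> C,
    (forall n, A2 (u n)) ->
    (exists M : R, forall n, L2norm (u n) <= M) ->
    exists (s : nat -> nat) (g : C * C -> C),
      [/\ {homo s : m n / (m < n)%N},
          A2 g
        & (fun n => L2norm (fun z => S (u (s n)) z - g z)) @ \oo --> (0 : R)].

End BergmanSpace.

(* Main.v *)
(* A support line of the convex set of moduli of Omega shows that one coordinate of a
   holomorphic disc in the boundary is constant. Up to exchanging the coordinates, a
   nonconstant disc therefore lies in a face {|z| < r} x {w0}, where Omega contains
   D_r x D_s with s = |w0| and is contained in {|w| < s}.

   Let p_j be a normalised multiple of (w + w0)^j. The functions z^m p_j and z^n p_j are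
   weakly null and concentrate at the face, where phi and psi are close to the harmonic
   functions phi(z, w0) and psi(z, w0). Compactness of H_psi^* H_phi thus forces the
   components of phi(z, w0) z^m and psi(z, w0) z^n orthogonal to the Bergman space of D_r
   to be orthogonal to each other. If b_k and b'_k are the coefficients of conj(z)^k in
   the expansions of phi(r z, w0) and psi(r z, w0), this says for n = m + d that
     sum_k b_k conj(b'_(k+d)) min(k,x) (min(k,x) + d) / (k + x + d) = 0,   x = m + 1.
   With y = x + d, the difference of x y / (k + y) and this weight is the ramp
   max(x - k, 0). Let e_k be the real or imaginary parts of the products and M the
   maximum of E(t) = sum_k e_k t^k on [0, 1]. The ramp sums of the coefficients of M - E
   are x y times the integrals of t^(y-1) (M - E(t)), hence nonnegative, and their
   generating function vanishes where E attains M; if that is only at t = 1, the minimum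
   serves instead. So all ramp sums vanish, and then the e_k, that is,
   b_k conj(b'_(k+d)) = 0 for all k and d >= 0. Exchanging phi and psi gives d < 0.
   Hence all b_k or all b'_k with k >= 1 vanish, i.e. phi or psi is holomorphic on the
   face. *)
Require Import Defs.
From HB Require Import structures.
From mathcomp Require Import all_boot all_order all_algebra.
From mathcomp Require Import all_classical all_reals all_analysis.
From mathcomp Require Import complex measurable_realfun.
From mathcomp Require Import zify ring lra.

Set Implicit Arguments.
Unset Strict Implicit.
Unset Printing Implicit Defensive.

Import Order.TTheory GRing.Theory Num.Theory.
Import numFieldNormedType.Exports.

Local Open Scope classical_set_scope.
Local Open Scope ring_scope.
Local Open Scope complex_scope.

(** The expansion of a symbol on the face is controlled only on discs strictly inside it, so the
    relation between the [b_k] cannot be read off at radius [r]. The symbols are compared with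
    truncated expansions of their dilates by [t < 1]; each truncation gives finitely many residuals
    with explicit inner products, and [t] tends to 1 at the end. The limit is legitimate because
    Parseval bounds the sums of [|b_k|^2] and [|b'_k|^2], which makes the products [e_k] absolutely
    summable. The same summability makes [E] continuous on the closed interval, so that its extrema
    exist. Passing from [E] to [M - E] keeps the Gram relations because the weight vanishes at
    [k = 0]. Conversely [E] has no constant term, so once all coefficients of [M - E] vanish,
    [M = 0] and every [e_k] is 0. The ramp sums have generating function [s / (1 - s)^2] times
    [M - E(s)], which says nothing if the extremum is attained at [s = 0]. In that case the moments
    of [M - E] are used: they are nonnegative and nonincreasing, and the first is already 0. *)

Notation normc := (ComplexField.Normc.normc).
Arguments ComplexField.Normc.normc : simpl never.
Notation Rec := complex.Re.
Notation Imc := complex.Im.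

(* Conjugation restricted to R[i] for R : realType, so that unification has a
   single structure on R to infer. *)
Definition cj (R : realType) (z : R[i]) : R[i] := conjc z.
HB.instance Definition _ (R : realType) := GRing.RMorphism.copy (@cj R) (@conjc R).
Notation "z ^*" := (cj z) : complex_scope.
Notation "z ^*" := (cj z) : ring_scope.

(** * Complex numbers and complex derivatives *)

Section Modulus.
Variable R : realType.
Notation C := R[i].
Implicit Types z w : C.

Lemma normrC z : `|z| = (normc z)%:C. Proof. by []. Qed.

Lemma normcE2 z : normc z = Num.sqrt (Rec z ^+ 2 + Imc z ^+ 2).
Proof. by case: z. Qed.

Lemma normc_ge0 z : 0 <= normc z.
Proof. by rewrite normcE2 sqrtr_ge0. Qed.
Hint Resolve normc_ge0 : core.

Lemma sqr_normcE z : normc z ^+ 2 = Rec z ^+ 2 + Imc z ^+ 2.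
Proof. by rewrite normcE2 sqr_sqrtr// addr_ge0// sqr_ge0. Qed.

Lemma normc0 : normc (0 : C) = 0. Proof. exact: ComplexField.Normc.normc0. Qed.
Lemma normc1 : normc (1 : C) = 1. Proof. exact: ComplexField.Normc.normc1. Qed.
Lemma normcM z w : normc (z * w) = normc z * normc w.
Proof. exact: ComplexField.Normc.normcM. Qed.
Lemma normcV z : normc z^-1 = (normc z)^-1.
Proof. exact: ComplexField.Normc.normcV. Qed.
Lemma normcD z w : normc (z + w) <= normc z + normc w.
Proof. exact: le_normcD. Qed.
Lemma normcNE z : normc (- z) = normc z. Proof. exact: normcN. Qed.
Lemma normcB z w : normc (z - w) <= normc z + normc w.
Proof. by rewrite -(normcNE w); exact: normcD. Qed.
Lemma distcC z w : normc (z - w) = normc (w - z).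
Proof. by rewrite -normcNE opprB. Qed.
Lemma normcX z n : normc (z ^+ n) = normc z ^+ n.
Proof.
by elim: n => [|n IH]; rewrite ?expr0 ?normc1// !exprS normcM IH.
Qed.
Lemma normc_conj z : normc z^* = normc z.
Proof. by case: z => a b; rewrite !normcE2 /= sqrrN. Qed.
Lemma normc_real (x : R) : normc x%:C = `|x|.
Proof. by rewrite normcE2 /= expr0n addr0 sqrtr_sqr. Qed.
Lemma normc_eq0 z : (normc z == 0) = (z == 0).
Proof.
by apply/eqP/eqP => [/ComplexField.Normc.eq0_normc|->//]; rewrite ?normc0.
Qed.
Lemma normc_gt0 z : (0 < normc z) = (z != 0).
Proof. by rewrite lt0r normc_ge0 andbT normc_eq0. Qed.
Lemma normc_nat n : normc (n%:R : C) = n%:R.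
Proof. by rewrite -(rmorph_nat (real_complex R)) normc_real normr_nat. Qed.

Lemma Re_le_normc z : `|Rec z| <= normc z.
Proof.
rewrite -(@ler_pXn2r _ 2)// ?nnegrE// sqr_normcE -normrX ger0_norm ?sqr_ge0//.
by rewrite lerDl sqr_ge0.
Qed.
Lemma Im_le_normc z : `|Imc z| <= normc z.
Proof.
rewrite -(@ler_pXn2r _ 2)// ?nnegrE// sqr_normcE -normrX ger0_norm ?sqr_ge0//.
by rewrite lerDr sqr_ge0.
Qed.
Lemma normc_le_ReIm z : normc z <= `|Rec z| + `|Imc z|.
Proof.
rewrite -(@ler_pXn2r _ 2)// ?nnegrE ?addr_ge0// sqr_normcE sqrrD.
rewrite !real_normK ?num_real// addrAC lerDl.
by rewrite mulrn_wge0// mulr_ge0.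
Qed.

Lemma ReM z w : Rec (z * w) = Rec z * Rec w - Imc z * Imc w.
Proof. by case: z => a b; case: w. Qed.
Lemma ImM z w : Imc (z * w) = Rec z * Imc w + Imc z * Rec w.
Proof. by case: z => a b; case: w => c d /=; rewrite [b * c]mulrC addrC mulrC addrC. Qed.
Lemma ReD z w : Rec (z + w) = Rec z + Rec w.
Proof. by case: z => a b; case: w. Qed.
Lemma ImD z w : Imc (z + w) = Imc z + Imc w.
Proof. by case: z => a b; case: w. Qed.
Lemma ReN z : Rec (- z) = - Rec z. Proof. by case: z. Qed.
Lemma ImN z : Imc (- z) = - Imc z. Proof. by case: z. Qed.
Lemma ReJ z : Rec z^* = Rec z. Proof. by case: z. Qed.
Lemma ImJ z : Imc z^* = - Imc z. Proof. by case: z. Qed.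
Definition ReImE := (ReD, ImD, ReN, ImN, ReM, ImM, ReJ, ImJ).

Lemma eqC z w : Rec z = Rec w -> Imc z = Imc w -> z = w.
Proof. by case: z => a b; case: w => c d /= -> ->. Qed.

Lemma cj0 : @cj R 0 = 0. Proof. exact: rmorph0. Qed.
Lemma cj1 : @cj R 1 = 1. Proof. exact: rmorph1. Qed.
Lemma cjD z w : (z + w)^* = z^* + w^*. Proof. exact: rmorphD. Qed.
Lemma cjB z w : (z - w)^* = z^* - w^*. Proof. exact: rmorphB. Qed.
Lemma cjM z w : (z * w)^* = z^* * w^*. Proof. exact: rmorphM. Qed.
Lemma cjX z n : (z ^+ n)^* = z^* ^+ n. Proof. exact: rmorphXn. Qed.
Lemma cjK : involutive (@cj R). Proof. exact: conjcK. Qed.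
Lemma cjV z : (z^-1)^* = (z^*)^-1. Proof. exact: conjc_inv. Qed.
Lemma cj_real (x : R) : (x%:C)^* = x%:C. Proof. exact: conjc_real. Qed.
Lemma cj_eq0 z : (z^* == 0) = (z == 0). Proof. exact: conjc_eq0. Qed.

Lemma mulcJ z : z * z^* = (normc z ^+ 2)%:C.
Proof.
by apply: eqC; rewrite ?ReImE sqr_normcE /=; case: z => a b /=; ring.
Qed.

Lemma ler_distC_normc z w : `|normc z - normc w| <= normc (z - w).
Proof.
rewrite ler_norml; apply/andP; split.
- have := normcD z (w - z); rewrite addrC subrK distcC; lra.
- have := normcD w (z - w); rewrite addrC subrK; lra.
Qed.

(** The order of [R[i]] compares only numbers with equal imaginary parts, so the radii and epsilons
    of its topology are real. All estimates below use real ones. *)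
Lemma real_pos_C (e : C) : 0 < e -> exists2 r : R, 0 < r & e = r%:C.
Proof.
by case: e => a b; rewrite ltcE /= => /andP[/eqP -> a0]; exists a.
Qed.

Lemma normrC2 (x : C * C) :
  `|x| = (Num.max (normc x.1) (normc x.2))%:C.
Proof. by rewrite prod_normE /= !normrC /Order.max ltcR; case: ifP. Qed.

Lemma nbhsCP (z : C) (P : set C) :
  nbhs z P <-> exists2 e : R, 0 < e & forall w, normc (w - z) < e -> P w.
Proof.
split=> [/nbhs_normP[e /= /real_pos_C[r r0 ->] H]|[e e0 H]].
  exists r => // w wz; apply: H => /=.
  by rewrite normrC distcC ltcR.
apply/nbhs_normP; exists e%:C => /=; first by rewrite ltcR.
by move=> w /=; rewrite normrC distcC ltcR; exact: H.
Qed.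

Lemma nbhsC2P (x : C * C) (P : set (C * C)) : nbhs x P <->
  exists2 e : R, 0 < e &
    forall y, normc (y.1 - x.1) < e -> normc (y.2 - x.2) < e -> P y.
Proof.
split=> [[[A B] [/= /nbhsCP[e e0 HA] /nbhsCP[f f0 HB]] H]|[e e0 H]].
  exists (Num.min e f); first by rewrite lt_min e0.
  move=> [y1 y2] /=; rewrite !lt_min => /andP[a _] /andP[_ b].
  by apply: H; split => /=; [exact: HA|exact: HB].
exists ([set w | normc (w - x.1) < e], [set w | normc (w - x.2) < e]) => /=.
  by split; apply/nbhsCP; exists e.
by move=> [y1 y2] [/= a b]; exact: H.
Qed.

Lemma openC2P (U : set (C * C)) : open U <-> forall x, U x ->
  exists2 e : R, 0 < e &
    forall y, normc (y.1 - x.1) < e -> normc (y.2 - x.2) < e -> U y.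
Proof.
rewrite openE; split=> [H x Ux|H x Ux]; first exact/nbhsC2P/H.
exact/nbhsC2P/H.
Qed.

Lemma closureC2P (U : set (C * C)) x : closure U x <->
  forall e : R, 0 < e ->
    exists y, [/\ U y, normc (y.1 - x.1) < e & normc (y.2 - x.2) < e].
Proof.
split=> [H e e0|H B /nbhsC2P[e e0 HB]].
  have /H[y [Uy [a b]]] : nbhs x [set y | normc (y.1 - x.1) < e /\
    normc (y.2 - x.2) < e] by apply/nbhsC2P; exists e.
  by exists y.
by have [y [Uy a b]] := H e e0; exists y; split => //; exact: HB.
Qed.

Lemma interiorC2P (U : set (C * C)) x : interior U x <->
  exists2 e : R, 0 < e &
    forall y, normc (y.1 - x.1) < e -> normc (y.2 - x.2) < e -> U y.
Proof. exact: nbhsC2P. Qed.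

End Modulus.
#[global] Hint Resolve normc_ge0 : core.

Section Derivatives.
Variable R : realType.
Notation C := R[i].

(** By uniqueness of the differential, an explicit estimate with any continuous linear candidate
    suffices. *)
Lemma differentiable_intro (K : numFieldType) (V W : normedModType K)
    (f : V -> W) (x : V) (df : {linear V -> W}) : continuous df ->
  (forall e : K, 0 < e ->
    \forall h \near (0 : V), `|f (h + x) - f x - df h| <= e * `|h|) ->
  differentiable f x.
Proof.
move=> dfc H.
have E : f \o shift x = cst (f x) + df +o_ (0 : V) id.
  apply/eqaddoP => e e0; have := H e e0; apply: filterS => h /=.
  by rewrite -![(_ + _ : _ -> _) _]/(_ + _) -![(- _ : _ -> _) _]/(- _) /cst opprD addrA.
apply/diff_locallyP.
by rewrite (diff_unique dfc E).
Qed.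

(** Keeps the derivative as a visible number and all bounds real. [cderiv2] measures increments by
    the sum of the two moduli, which suits the later estimates better than the maximum norm of the
    product. *)
Definition cderiv (f : C -> C) z l := forall e : R, 0 < e ->
  exists2 d : R, 0 < d & forall h, normc h < d ->
    normc (f (z + h) - f z - l * h) <= e * normc h.

Definition cderiv2 (f : C * C -> C) x l1 l2 := forall e : R, 0 < e ->
  exists2 d : R, 0 < d & forall h1 h2, normc h1 < d -> normc h2 < d ->
    normc (f (x.1 + h1, x.2 + h2) - f x - (l1 * h1 + l2 * h2))
      <= e * (normc h1 + normc h2).

Lemma diff_cderiv f z : differentiable f z <-> exists l, cderiv f z l.
Proof.
split=> [/diff_locallyP [_ /eqaddoP H]|[l H]].
  exists ('d f z 1) => e e0.
  have /nbhsCP[d d0 Hd] := H e%:C (eq_ind_r is_true e0 (ltcR 0 e)).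
  exists d => // h hd; have := Hd h; rewrite subr0 => /(_ hd).
  rewrite -![(_ + _ : _ -> _) _]/(_ + _) -![(- _ : _ -> _) _]/(- _) /cst /=.
  rewrite opprD addrA -[X in _ - X](_ : 'd f z 1 * h = _); last first.
    have LZ a u : 'd f z (a *: u) = a *: 'd f z u by rewrite linearZ.
    by have := LZ h 1; rewrite /GRing.scale /= mulr1 => ->; rewrite mulrC.
  by rewrite [z + h]addrC !normrC -rmorphM lecR.
apply: (@differentiable_intro _ _ _ _ _
  (( *:%R l : C -> C) : {linear C -> C})).
  by move=> y; exact: scaler_continuous.
move=> _ /real_pos_C[e e0 ->].
have [d d0 Hd] := H e e0; apply/nbhsCP; exists d => // h; rewrite subr0 => hd.
rewrite !normrC -rmorphM lecR [h + z]addrC; exact: Hd.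
Qed.

Lemma diff_cderiv2 f x : differentiable f x <-> exists l1 l2, cderiv2 f x l1 l2.
Proof.
split=> [/diff_locallyP [_ /eqaddoP H]|[l1 [l2 H]]].
  exists ('d f x (1, 0)), ('d f x (0, 1)) => e e0.
  have /nbhsC2P[d d0 Hd] := H e%:C (eq_ind_r is_true e0 (ltcR 0 e)).
  exists d => // h1 h2 h1d h2d; have := Hd (h1, h2) => /=; rewrite !subr0.
  move=> /(_ h1d h2d).
  rewrite -![(_ + _ : _ -> _) _]/(_ + _) -![(- _ : _ -> _) _]/(- _) /cst /=.
  rewrite opprD addrA -[X in _ - X](_ : 'd f x (1, 0) * h1 +
      'd f x (0, 1) * h2 = _); last first.
    have LZ a u : 'd f x (a *: u) = a *: 'd f x u by rewrite linearZ.
    have := LZ h1 (1, 0); rewrite /GRing.scale /= mulrC => <-.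
    have := LZ h2 (0, 1); rewrite /GRing.scale /= mulrC => <-.
    rewrite -linearD /GRing.scale /=; congr ('d f x _); congr pair => /=.
      by rewrite [LHS](_ : _ = h1 * 1 + h2 * 0)//; ring.
    by rewrite [LHS](_ : _ = h1 * 0 + h2 * 1)//; ring.
  rewrite [X in f X](_ : _ = (x.1 + h1, x.2 + h2)); last first.
    by case: x {H Hd} => x1 x2 /=; rewrite [x1 + _]addrC [x2 + _]addrC.
  have E : `|(h1, h2) : (C * C)%type| <= (normc h1 + normc h2)%:C.
    by rewrite normrC2 lecR ge_max lerDl lerDr !normc_ge0.
  have e0' : 0 <= e%:C by rewrite ler0c ltW.
  by move=> /le_trans/(_ (ler_wpM2l e0' E)); rewrite !normrC -rmorphM lecR.
pose df := (fun h : C * C => l1 * h.1 + l2 * h.2).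
have dfl : linear df.
  move=> a [u1 u2] [v1 v2]; rewrite /df /GRing.scale /=.
  by rewrite [LHS](_ : _ = l1 * (a * u1 + v1) + l2 * (a * u2 + v2))//; ring.
pose dfL := GRing.isLinear.Build C (C * C)%type C *:%R df dfl.
pose dfP : {linear (C * C)%type -> C} := HB.pack df dfL.
apply: (@differentiable_intro _ _ _ _ _ dfP).
  move=> y; apply: (@continuousD _ _ _ (fun h : C * C => l1 * h.1) (fun h : C * C => l2 * h.2)).
    by apply: continuous_comp; [exact: cvg_fst|exact: scaler_continuous].
  by apply: continuous_comp; [exact: cvg_snd|exact: scaler_continuous].
move=> _ /real_pos_C[e e0 ->].
(* The product norm is a maximum, and the sum of the two moduli is at most twice that. *)
have e20 : 0 < e / 2 by rewrite divr_gt0.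
have [d d0 Hd] := H _ e20; apply/nbhsC2P; exists d => // -[h1 h2] /=.
rewrite !subr0 => h1d h2d.
rewrite [X in f X](_ : _ = (x.1 + h1, x.2 + h2)); last first.
  by case: x {H Hd} => x1 x2 /=; rewrite [x1 + _]addrC [x2 + _]addrC.
have N : (Num.max (normc h1) (normc h2))%:C <= `|(h1, h2) : (C * C)%type|.
  by rewrite normrC2.
apply: le_trans (ler_wpM2l _ N); last by rewrite ler0c ltW.
rewrite normrC -rmorphM lecR; apply: (le_trans (Hd _ _ h1d h2d)).
rewrite -mulrA ler_pM2l//.
have [] := leP (normc h1) (normc h2); lra.
Qed.

End Derivatives.

(** * Complex integrals, Goursat and Cauchy *)

Section ComplexIntegral.
Context d (T : measurableType d) (R : realType).
Variable mu : {measure set T -> \bar R}.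
Notation C := R[i].
Implicit Types (D : set T) (F G : T -> C).

Definition cintegrable D F :=
  mu.-integrable D (fun x => (Rec (F x))%:E) /\
  mu.-integrable D (fun x => (Imc (F x))%:E).

Definition cint D F : C :=
  (\int[mu]_(x in D) Rec (F x)) +i* (\int[mu]_(x in D) Imc (F x)).

Lemma cint_Re D F : Rec (cint D F) = \int[mu]_(x in D) Rec (F x).
Proof. by []. Qed.
Lemma cint_Im D F : Imc (cint D F) = \int[mu]_(x in D) Imc (F x).
Proof. by []. Qed.

Lemma eq_cint D F G : (forall x, D x -> F x = G x) -> cint D F = cint D G.
Proof.
by move=> FG; congr Complex; apply: eq_Rintegral => x /set_mem Dx; rewrite FG.
Qed.

Lemma eq_cintegrable D F G : measurable D ->
  (forall x, D x -> F x = G x) -> cintegrable D F -> cintegrable D G.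
Proof.
by move=> mD FG [H1 H2]; split; [apply: eq_integrable H1|apply: eq_integrable H2] => //
  x /set_mem Dx; rewrite FG.
Qed.

Lemma cintegrableD D F G : measurable D -> cintegrable D F ->
  cintegrable D G -> cintegrable D (fun x => F x + G x).
Proof.
move=> mD [F1 F2] [G1 G2]; split.
  by under eq_fun do rewrite ReD EFinD; exact: integrableD.
by under eq_fun do rewrite ImD EFinD; exact: integrableD.
Qed.

Lemma cintegrableZ D F (c : C) : measurable D -> cintegrable D F ->
  cintegrable D (fun x => c * F x).
Proof.
move=> mD [F1 F2]; split.
  under eq_fun do rewrite ReM EFinB !EFinM.
  by apply: integrableB => //; exact: integrableZl.
under eq_fun do rewrite ImM EFinD !EFinM.
by apply: integrableD => //; exact: integrableZl.
Qed.

Lemma cintegrableN D F : measurable D -> cintegrable D F ->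
  cintegrable D (fun x => - F x).
Proof.
move=> mD iF; under eq_fun do rewrite -mulN1r; exact: cintegrableZ.
Qed.

Lemma cintegrableB D F G : measurable D -> cintegrable D F ->
  cintegrable D G -> cintegrable D (fun x => F x - G x).
Proof. by move=> mD iF iG; apply: cintegrableD => //; exact: cintegrableN. Qed.

Lemma cintD D F G : measurable D -> cintegrable D F -> cintegrable D G ->
  cint D (fun x => F x + G x) = cint D F + cint D G.
Proof.
move=> mD [F1 F2] [G1 G2]; apply: eqC; rewrite ?ReImE !(cint_Re, cint_Im).
  by rewrite -RintegralD//; apply: eq_Rintegral => x _; rewrite ReD.
by rewrite -RintegralD//; apply: eq_Rintegral => x _; rewrite ImD.
Qed.

Lemma cintZ D F (c : C) : measurable D -> cintegrable D F ->
  cint D (fun x => c * F x) = c * cint D F.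
Proof.
move=> mD [F1 F2].
have E (r : R) g : mu.-integrable D (fun x => (g x)%:E) ->
  mu.-integrable D (fun x => (r * g x)%:E).
  by move=> ig; under eq_fun do rewrite EFinM; exact: integrableZl.
apply: eqC; rewrite ?ReImE !(cint_Re, cint_Im) -!RintegralZl//.
  by rewrite -RintegralB ?E//; apply: eq_Rintegral => x _; rewrite ReM.
by rewrite -RintegralD ?E//; apply: eq_Rintegral => x _; rewrite ImM.
Qed.

Lemma cintN D F : measurable D -> cintegrable D F ->
  cint D (fun x => - F x) = - cint D F.
Proof.
move=> mD iF; rewrite -mulN1r -cintZ//; apply: eq_cint => x _.
by rewrite mulN1r.
Qed.

Lemma cintB D F G : measurable D -> cintegrable D F -> cintegrable D G ->
  cint D (fun x => F x - G x) = cint D F - cint D G.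
Proof.
move=> mD iF iG; rewrite cintD//; last exact: cintegrableN.
by rewrite cintN.
Qed.

Lemma cintegrable0 D : measurable D -> cintegrable D (fun=> 0).
Proof. by move=> mD; split; exact: integrable0. Qed.

Lemma cint0 D : cint D (fun=> 0) = 0.
Proof. by apply: eqC; rewrite /= /Rintegral integral0. Qed.

Lemma cintegrable_sum D I (s : seq I) (F : I -> T -> C) : measurable D ->
  (forall i, cintegrable D (F i)) ->
  cintegrable D (fun x => \sum_(i <- s) F i x).
Proof.
move=> mD iF; elim: s => [|i s IH].
  by under eq_fun do rewrite big_nil; exact: cintegrable0.
by under eq_fun do rewrite big_cons; exact: cintegrableD.
Qed.

Lemma cint_sum D I (s : seq I) (F : I -> T -> C) : measurable D ->
  (forall i, cintegrable D (F i)) ->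
  cint D (fun x => \sum_(i <- s) F i x) = \sum_(i <- s) cint D (F i).
Proof.
move=> mD iF; elim: s => [|i s IH].
  by rewrite big_nil -[RHS](cint0 D); apply: eq_cint => x _; rewrite big_nil.
rewrite big_cons -IH -cintD//; last exact: cintegrable_sum.
by apply: eq_cint => x _; rewrite big_cons.
Qed.

Lemma cint_conj D F : measurable D -> cintegrable D F ->
  cint D (fun x => (F x)^*) = (cint D F)^*.
Proof.
move=> mD [F1 F2]; apply: eqC; rewrite ?ReImE !(cint_Re, cint_Im).
  by apply: eq_Rintegral => x _; rewrite ReJ.
rewrite -mulN1r -RintegralZl//; apply: eq_Rintegral => x _.
by rewrite ImJ mulN1r.
Qed.

Lemma cmeasurable_normc D F : measurable_fun D (fun x => Rec (F x)) ->
  measurable_fun D (fun x => Imc (F x)) ->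
  measurable_fun D (fun x => normc (F x)).
Proof.
move=> m1 m2; under eq_fun do rewrite normcE2.
apply: measurableT_comp.
  by apply: continuous_measurable_fun => x; exact: sqrt_continuous.
by apply: measurable_funD; exact: measurable_funX.
Qed.

Lemma cintegrable_normc D F : measurable D -> cintegrable D F ->
  mu.-integrable D (fun x => (normc (F x))%:E).
Proof.
move=> mD [F1 F2].
apply: (@le_integrable _ _ _ _ _ mD _ (fun x => `|Rec (F x)|%:E + `|Imc (F x)|%:E)%E).
- apply/measurable_EFinP/cmeasurable_normc; apply/measurable_EFinP.
    exact: measurable_int F1.
  exact: measurable_int F2.
- move=> x Dx; rewrite -EFinD !abse_EFin lee_fin.
  rewrite (ger0_norm (normc_ge0 _)).
  by rewrite (ger0_norm (addr_ge0 (normr_ge0 _) (normr_ge0 _))) normc_le_ReIm.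
apply: integrableD => //; exact: integrable_norm.
Qed.

Lemma le_cintegrable D F (g : T -> R) : measurable D ->
  measurable_fun D (fun x => Rec (F x)) ->
  measurable_fun D (fun x => Imc (F x)) ->
  mu.-integrable D (EFin \o g) ->
  (forall x, D x -> normc (F x) <= g x) -> cintegrable D F.
Proof.
move=> mD m1 m2 ig Fg; split.
  apply: le_integrable ig => //; first exact/measurable_EFinP.
  move=> x Dx; rewrite !abse_EFin lee_fin.
  by apply: le_trans (Re_le_normc _) (le_trans (Fg _ Dx) (ler_norm _)).
apply: le_integrable ig => //; first exact/measurable_EFinP.
move=> x Dx; rewrite !abse_EFin lee_fin.
by apply: le_trans (Im_le_normc _) (le_trans (Fg _ Dx) (ler_norm _)).
Qed.

(* Rotate the integral onto the positive real axis. *)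
Lemma cint_normc D F : measurable D -> cintegrable D F ->
  normc (cint D F) <= \int[mu]_(x in D) normc (F x).
Proof.
move=> mD iF; have [->|I0] := eqVneq (cint D F) 0.
  by rewrite normc0; apply: Rintegral_ge0 => x _; exact: normc_ge0.
have n0 : 0 < normc (cint D F) by rewrite normc_gt0.
rewrite -(@ler_pM2l _ (normc (cint D F)))// -expr2.
have -> : normc (cint D F) ^+ 2 = Rec (cint D (fun x => cj (cint D F) * F x)).
  by rewrite cintZ// mulrC mulcJ.
rewrite cint_Re -RintegralZl//; [|exact: cintegrable_normc].
apply: le_Rintegral => //; first by case: (cintegrableZ (cj (cint D F)) mD iF).
  exact: (integrableZl mD (normc (cint D F)) (cintegrable_normc mD iF)).
move=> x Dx; apply: le_trans (ler_norm _) _; apply: le_trans (Re_le_normc _) _.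
by rewrite normcM normc_conj.
Qed.

End ComplexIntegral.

(** * Complex integrals over real segments *)

Section IntervalIntegral.
Variable R : realType.
Notation C := R[i].
Notation leb := (@lebesgue_measure R).
Implicit Types (F G : R -> C) (a b c : R).

Definition rccont F (x : R) := forall e : R, 0 < e ->
  exists2 d : R, 0 < d & forall y, `|y - x| < d -> normc (F y - F x) < e.

Definition ci a b F : C := cint leb `[a, b] F.

Lemma rccont_Re F x : rccont F x -> {for x, continuous (fun y => Rec (F y))}.
Proof.
move=> H; apply/cvgrPdist_lt => e e0; have [d d0 Hd] := H e e0.
near=> y; rewrite distrC -ReN -ReD; apply: le_lt_trans (Re_le_normc _) _.
apply: Hd; near: y; apply/nbhs_ballP; exists d => //= y.
by rewrite /ball /= distrC.
Unshelve. all: by end_near. Qed.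

Lemma rccont_Im F x : rccont F x -> {for x, continuous (fun y => Imc (F y))}.
Proof.
move=> H; apply/cvgrPdist_lt => e e0; have [d d0 Hd] := H e e0.
near=> y; rewrite distrC -ImN -ImD; apply: le_lt_trans (Im_le_normc _) _.
apply: Hd; near: y; apply/nbhs_ballP; exists d => //= y.
by rewrite /ball /= distrC.
Unshelve. all: by end_near. Qed.

Lemma rccont_integrable a b F : (forall x, a <= x <= b -> rccont F x) ->
  cintegrable leb `[a, b] F.
Proof.
move=> H; split; apply: continuous_compact_integrable;
  try exact: segment_compact; apply: continuous_in_subspaceT => x /set_mem /=;
  rewrite in_itv /= => xab; [apply: rccont_Re|apply: rccont_Im]; exact: H.
Qed.

Lemma leb_itvcc a b : a <= b -> leb `[a, b] = (b - a)%:E.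
Proof.
move=> ab; rewrite lebesgue_measure_itv /= lte_fin EFinB.
by case: ltP => // ba; rewrite (le_anti (introT andP (conj ab ba))) -EFinB subrr.
Qed.

Lemma ci_norm a b F M : a <= b -> (forall x, a <= x <= b -> rccont F x) ->
  (forall x, a <= x <= b -> normc (F x) <= M) -> normc (ci a b F) <= M * (b - a).
Proof.
move=> ab cF FM; have iF := rccont_integrable cF.
apply: le_trans (cint_normc _ iF) _ => //.
have -> : M * (b - a) = \int[leb]_(x in `[a, b]) M.
  by rewrite Rintegral_cst//= leb_itvcc.
apply: le_Rintegral => //; first exact: cintegrable_normc.
  apply: continuous_compact_integrable; first exact: segment_compact.
by move=> ?; exact: cvg_cst.
Qed.

Lemma ci_cat a b c F : a <= c -> c <= b -> cintegrable leb `[a, b] F ->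
  ci a b F = ci a c F + ci c b F.
Proof.
move=> ac cb [i1 i2].
have H g : leb.-integrable `[a, b] (fun x => (g x)%:E) ->
    \int[leb]_(x in `[a, b]) g x =
    \int[leb]_(x in `[a, c]) g x + \int[leb]_(x in `[c, b]) g x.
  move=> ig; have := @Rintegral_itvB _ g (BLeft a) (BRight b) c ig.
  rewrite !bnd_simp => /(_ ac cb) E.
  rewrite -(@Rintegral_itv_obnd_cbnd _ c); last first.
    apply: integrableS ig => //; apply: subset_itv; rewrite bnd_simp//.
  by rewrite -E addrC subrK.
by apply: eqC; rewrite ?ReImE /= H.
Qed.

Lemma ci_cst a b (k : C) : a <= b -> ci a b (fun=> k) = k * (b - a)%:C.
Proof.
by move=> ab; apply: eqC; rewrite ?ReImE /= Rintegral_cst//= leb_itvcc//= mulr0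
  ?subr0 ?add0r.
Qed.

Lemma eq_ci a b F G : (forall x, a <= x <= b -> F x = G x) -> ci a b F = ci a b G.
Proof. by move=> FG; apply: eq_cint => x /=; rewrite in_itv /=; exact: FG. Qed.

Lemma rccontD F G x : rccont F x -> rccont G x -> rccont (fun x => F x + G x) x.
Proof.
move=> cF cG e e0; have e2 : 0 < e / 2 by rewrite divr_gt0.
have [d d0 Hd] := cF _ e2; have [d' d'0 Hd'] := cG _ e2.
exists (Num.min d d'); first by rewrite lt_min d0.
move=> y; rewrite lt_min => /andP[/Hd a1 /Hd' a2].
rewrite opprD addrACA; apply: le_lt_trans (normcD _ _) _.
by rewrite [e]splitr ltrD.
Qed.

Lemma rccontZ F x (k : C) : rccont F x -> rccont (fun x => k * F x) x.
Proof.
move=> cF e e0; have k0 : 0 < normc k + 1 by rewrite ltr_wpDl.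
have [d d0 Hd] := cF _ (divr_gt0 e0 k0); exists d => // y /Hd.
rewrite ltr_pdivlMr// => H; rewrite -mulrBr normcM mulrC.
by apply: le_lt_trans H; rewrite ler_wpM2l ?normc_ge0// lerDl.
Qed.

Lemma rccontN F x : rccont F x -> rccont (fun x => - F x) x.
Proof. by move=> cF e /cF[d d0 Hd]; exists d => // y /Hd; rewrite -opprD normcNE. Qed.

Lemma rccontB F G x : rccont F x -> rccont G x -> rccont (fun x => F x - G x) x.
Proof. by move=> cF cG; apply: rccontD => //; exact: rccontN. Qed.

Lemma rccont_cst (k : C) x : rccont (fun=> k) x.
Proof. by move=> e e0; exists 1 => // y _; rewrite subrr normc0. Qed.

Lemma rccont_sum I (s : seq I) (F : I -> R -> C) x : (forall i, rccont (F i) x) ->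
  rccont (fun t => \sum_(i <- s) F i t) x.
Proof.
move=> cF; elim: s => [|i s IH].
  by under eq_fun do rewrite big_nil; exact: rccont_cst.
by under eq_fun do rewrite big_cons; exact: rccontD.
Qed.

Lemma rccontM F G x : rccont F x -> rccont G x -> rccont (fun x => F x * G x) x.
Proof.
move=> cF cG e e0; pose K := normc (F x) + normc (G x) + 1.
have K0 : 0 < K by rewrite ltr_wpDl ?addr_ge0.
pose e' := Num.min 1 (e / (2 * K)).
have e'0 : 0 < e' by rewrite lt_min ltr01 divr_gt0// mulr_gt0.
have [d d0 Hd] := cF _ e'0; have [d' d'0 Hd'] := cG _ e'0.
exists (Num.min d d'); first by rewrite lt_min d0.
move=> y; rewrite lt_min => /andP[/Hd a1 /Hd' a2].
rewrite (_ : F y * G y - F x * G x =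
  F y * (G y - G x) + (F y - F x) * G x); last by ring.
apply: le_lt_trans (normcD _ _) _; rewrite !normcM.
have Fy : normc (F y) < normc (F x) + 1.
  have -> : F y = F x + (F y - F x) by rewrite addrC subrK.
  apply: le_lt_trans (normcD _ _) _; rewrite ltrD2l (lt_le_trans a1)//.
  by rewrite ge_min lexx.
apply: (@lt_le_trans _ _ (K * e' + K * e')).
  apply: ltr_leD.
    apply: (@le_lt_trans _ _ (K * normc (G y - G x))).
      rewrite ler_wpM2r// (le_trans (ltW Fy))// /K -addrA lerD2l.
      by rewrite ler_wpDl.
    by rewrite ltr_pM2l.
  rewrite mulrC ler_pM// ?ltW// /K.
  have := normc_ge0 (F x); lra.
rewrite -mulr2n -mulrnAr -[leRHS](divfK (lt0r_neq0 (mulr_gt0 (ltr0n R 2) K0))).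
rewrite [leRHS](_ : _ = K * (e / (2 * K) *+ 2)); last first.
  by rewrite mulrnAr mulr2n; ring.
have e'le : e' <= e / (2 * K) by rewrite ge_min lexx orbT.
by rewrite ler_pM2l// !mulr2n lerD.
Qed.

End IntervalIntegral.

(** * Goursat's theorem on rectangles *)

Section Goursat.
Variable R : realType.
Notation C := R[i].
Implicit Types (g : C -> C) (x y : R).

Definition ccont g (z : C) := forall e : R, 0 < e ->
  exists2 d : R, 0 < d & forall w : C, normc (w - z) < d -> normc (g w - g z) < e.

Lemma cderiv_ccont g z l : cderiv g z l -> ccont g z.
Proof.
move=> H e e0; have [d d0 Hd] := H 1 ltr01.
have k0 : 0 < normc l + 1 + 1 by rewrite !ltr_wpDl ?addr_ge0.
exists (Num.min d (e / (normc l + 1 + 1))); first by rewrite lt_min d0 divr_gt0.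
move=> w; rewrite lt_min ltr_pdivlMr// => /andP[/Hd].
rewrite [z + _]addrC subrK => A B; apply: le_lt_trans B.
have -> : g w - g z = (g w - g z - l * (w - z)) + l * (w - z) by rewrite subrK.
apply: le_trans (normcD _ _) _; apply: le_trans (lerD A (lexx _)) _.
rewrite normcM; have := normc_ge0 (w - z); nra.
Qed.

Lemma ccont_horizontal g x y : ccont g (x +i* y) -> rccont (fun t => g (t +i* y)) x.
Proof.
move=> H e /H[d d0 Hd]; exists d => // t td; apply: Hd.
by rewrite [X in normc X](_ : _ = (t - x)%:C) ?normc_real//; apply: eqC; rewrite ?ReImE //= subrr.
Qed.

Lemma ccont_vertical g x y : ccont g (x +i* y) -> rccont (fun t => g (x +i* t)) y.
Proof.
move=> H e /H[d d0 Hd]; exists d => // t td; apply: Hd.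
rewrite (_ : _ - _ = 0 +i* (t - y)); last by apply: eqC; rewrite ?ReImE //= subrr.
by rewrite normcE2 /= expr0n add0r sqrtr_sqr.
Qed.

Definition inrect (x1 x2 y1 y2 : R) (z : C) :=
  (x1 <= Rec z <= x2) && (y1 <= Imc z <= y2).

Lemma inrect_sub (x1 x2 y1 y2 u1 u2 v1 v2 : R) z :
  x1 <= u1 -> u2 <= x2 -> y1 <= v1 -> v2 <= y2 ->
  inrect u1 u2 v1 v2 z -> inrect x1 x2 y1 y2 z.
Proof.
move=> h1 h2 h3 h4 /andP[/andP[a b] /andP[c d]]; rewrite /inrect.
by rewrite (le_trans h1)// (le_trans h3)// (le_trans b)// (le_trans d).
Qed.

(** The counterclockwise boundary integral. Opposite sides share one integrand, so that cutting the
    rectangle amounts to splitting one integral and telescoping the other. *)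
Definition rectint g (x1 x2 y1 y2 : R) : C :=
  ci x1 x2 (fun x => g (x +i* y1) - g (x +i* y2)) +
  'i * ci y1 y2 (fun y => g (x2 +i* y) - g (x1 +i* y)).

Lemma rectint_cutx g x1 x2 c y1 y2 : x1 <= c <= x2 -> y1 <= y2 ->
  (forall z, inrect x1 x2 y1 y2 z -> ccont g z) ->
  rectint g x1 x2 y1 y2 = rectint g x1 c y1 y2 + rectint g c x2 y1 y2.
Proof.
move=> /andP[x1c cx2] y12 H; rewrite /rectint.
have x12 := le_trans x1c cx2.
rewrite (@ci_cat _ _ _ c)//; last first.
  apply: rccont_integrable => x xx; apply: rccontB; apply: ccont_horizontal;
    apply: H; by rewrite /inrect /= xx lexx y12.
rewrite addrACA -mulrDr; congr (_ + _ * _).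
have V x y : x1 <= x <= x2 -> y1 <= y <= y2 -> rccont (fun y => g (x +i* y)) y.
  by move=> xx yy; apply: ccont_vertical; apply: H; rewrite /inrect /= xx.
rewrite addrC /ci -cintD//.
- by apply: eq_cint => y _; rewrite addrA subrK.
- by apply: rccont_integrable => y yy; apply: rccontB; apply: V; rewrite ?lexx ?x12 ?cx2 ?x1c.
- by apply: rccont_integrable => y yy; apply: rccontB; apply: V; rewrite ?lexx ?x12 ?cx2 ?x1c.
Qed.

Lemma rectint_cuty g x1 x2 c y1 y2 : x1 <= x2 -> y1 <= c <= y2 ->
  (forall z, inrect x1 x2 y1 y2 z -> ccont g z) ->
  rectint g x1 x2 y1 y2 = rectint g x1 x2 y1 c + rectint g x1 x2 c y2.
Proof.
move=> x12 /andP[y1c cy2] H; rewrite /rectint.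
have y12 := le_trans y1c cy2.
rewrite (@ci_cat _ y1 _ c)//; last first.
  apply: rccont_integrable => x xx; apply: rccontB; apply: ccont_vertical;
    apply: H; by rewrite /inrect /= xx lexx x12.
rewrite addrACA -mulrDr; congr (_ + _ * _).
have V x y : x1 <= x <= x2 -> y1 <= y <= y2 -> rccont (fun x => g (x +i* y)) x.
  by move=> xx yy; apply: ccont_horizontal; apply: H; rewrite /inrect /= xx.
rewrite /ci -cintD//.
- by apply: eq_cint => y _; rewrite addrA subrK.
- by apply: rccont_integrable => y yy; apply: rccontB; apply: V; rewrite ?lexx ?y12 ?cy2 ?y1c.
- by apply: rccont_integrable => y yy; apply: rccontB; apply: V; rewrite ?lexx ?y12 ?cy2 ?y1c.
Qed.

(** An affine function integrates to 0 around the rectangle: between opposite sides [B * z] changes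
    by the constants [k] and [k'], whose contributions cancel. What is left is at most [2 M] on each
    pair of sides. *)
Lemma rectint_bound g x1 x2 y1 y2 (A B : C) M : x1 <= x2 -> y1 <= y2 ->
  (forall z, inrect x1 x2 y1 y2 z -> ccont g z) ->
  (forall z, inrect x1 x2 y1 y2 z -> normc (g z - A - B * z) <= M) ->
  normc (rectint g x1 x2 y1 y2) <= M *+ 2 * ((x2 - x1) + (y2 - y1)).
Proof.
move=> x12 y12 cg HM; pose r z := g z - A - B * z.
have cB z : ccont (fun z => B * z) z.
  move=> e e0; have k0 : 0 < normc B + 1 by rewrite ltr_wpDl.
  exists (e / (normc B + 1)); first by rewrite divr_gt0.
  move=> w; rewrite ltr_pdivlMr// => H; rewrite -mulrBr normcM.
  apply: le_lt_trans H; rewrite mulrC ler_wpM2l ?normc_ge0// lerDl//.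
have cr z : inrect x1 x2 y1 y2 z -> ccont r z.
  move=> zi e e0; have e2 : 0 < e / 2 by rewrite divr_gt0.
  have [d d0 Hd] := cg _ zi _ e2; have [d' d'0 Hd'] := cB z _ e2.
  exists (Num.min d d'); first by rewrite lt_min d0.
  move=> w; rewrite lt_min => /andP[/Hd a1 /Hd' a2].
  have -> : r w - r z = (g w - g z) - (B * w - B * z) by rewrite /r; ring.
  by apply: le_lt_trans (normcB _ _) _; rewrite [e]splitr ltrD.
have -> : rectint g x1 x2 y1 y2 = rectint r x1 x2 y1 y2.
  pose k : C := B * (0 +i* (y2 - y1)); pose k' : C := B * (x2 - x1)%:C.
  have E1 : ci x1 x2 (fun x => g (x +i* y1) - g (x +i* y2)) =
      ci x1 x2 (fun x => r (x +i* y1) - r (x +i* y2)) - k * (x2 - x1)%:C.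
    rewrite -ci_cst// /ci -cintB//.
    - apply: eq_cint => x _.
      have -> : k = B * (x +i* y2) - B * (x +i* y1).
        by rewrite /k -mulrBr; congr (_ * _); apply: eqC; rewrite ?ReImE /=; ring.
      by rewrite /r; ring.
    - by apply: rccont_integrable => x xx; apply: rccontB;
        apply: ccont_horizontal; apply: cr; rewrite /inrect /= xx lexx y12.
    - by apply: rccont_integrable => x xx; exact: rccont_cst.
  have E2 : ci y1 y2 (fun y => g (x2 +i* y) - g (x1 +i* y)) =
      ci y1 y2 (fun y => r (x2 +i* y) - r (x1 +i* y)) + k' * (y2 - y1)%:C.
    rewrite -ci_cst// /ci -cintD//.
    - apply: eq_cint => y _.
      have -> : k' = B * (x2 +i* y) - B * (x1 +i* y).
        by rewrite /k' -mulrBr; congr (_ * _); apply: eqC; rewrite ?ReImE /=; ring.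
      by rewrite /r; ring.
    - by apply: rccont_integrable => x xx; apply: rccontB;
        apply: ccont_vertical; apply: cr; rewrite /inrect /= xx lexx x12.
    - by apply: rccont_integrable => x xx; exact: rccont_cst.
  rewrite /rectint E1 E2 mulrDr addrACA -[RHS]addr0; congr (_ + _).
  rewrite /k /k' [0 +i* _](_ : _ = 'i * (y2 - y1)%:C); first by ring.
  by apply: eqC; rewrite ?ReImE /=; ring.
have bnd z w : inrect x1 x2 y1 y2 z -> inrect x1 x2 y1 y2 w ->
    normc (r z - r w) <= M *+ 2.
  by move=> /HM a /HM b; apply: le_trans (normcB _ _) _; rewrite mulr2n lerD.
apply: le_trans (normcD _ _) _; rewrite mulrDr; apply: lerD.
  apply: ci_norm => // x xx; last first.
    by apply: bnd; rewrite /inrect /= xx lexx y12.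
  by apply: rccontB; apply: ccont_horizontal; apply: cr; rewrite /inrect /= xx lexx y12.
rewrite normcM [normc 'i](_ : _ = 1) ?mul1r; last first.
  by rewrite normcE2 /= expr0n expr1n add0r sqrtr1.
apply: ci_norm => // x xx; last first.
  by apply: bnd; rewrite /inrect /= xx lexx x12.
by apply: rccontB; apply: ccont_vertical; apply: cr; rewrite /inrect /= xx lexx x12.
Qed.

Definition quarter (g : C -> C) (L H : R) (p q : (R * R)) :=
  [/\ p.1 <= q.1 <= p.1 + L / 2, p.2 <= q.2 <= p.2 + H / 2 &
    normc (rectint g p.1 (p.1 + L) p.2 (p.2 + H)) <=
    4 * normc (rectint g q.1 (q.1 + L / 2) q.2 (q.2 + H / 2))].

Lemma le_max4 (t u1 u2 u3 u4 : R) : t <= (u1 + u2) + (u3 + u4) ->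
  4 * u1 < t -> 4 * u2 < t -> 4 * u3 < t -> t <= 4 * u4.
Proof. by lra. Qed.

Lemma quarter_exists g L H p : 0 <= L -> 0 <= H ->
  (forall z, inrect p.1 (p.1 + L) p.2 (p.2 + H) z -> ccont g z) ->
  exists q, quarter g L H p q.
Proof.
case: p => a b /= L0 H0 cg.
have aL : a <= a + L / 2 <= a + L by lra.
have bH : b <= b + H / 2 <= b + H by lra.
have bHH : b <= b + H by lra.
pose N u v := normc (rectint g u (u + L / 2) v (v + H / 2)).
have E : rectint g a (a + L) b (b + H) =
  (rectint g a (a + L / 2) b (b + H / 2) +
   rectint g a (a + L / 2) (b + H / 2) (b + H / 2 + H / 2)) +
  (rectint g (a + L / 2) (a + L / 2 + L / 2) b (b + H / 2) +
   rectint g (a + L / 2) (a + L / 2 + L / 2) (b + H / 2) (b + H / 2 + H / 2)).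
  have e1 : a + L / 2 + L / 2 = a + L by rewrite -addrA -splitr.
  have e2 : b + H / 2 + H / 2 = b + H by rewrite -addrA -splitr.
  rewrite e1 e2 (@rectint_cutx _ _ _ (a + L / 2))//.
  rewrite (@rectint_cuty g a (a + L / 2) (b + H / 2) b (b + H)); first last.
  - by move=> z zi; apply: cg; apply: inrect_sub zi; lra.
  - by lra.
  - by lra.
  rewrite (@rectint_cuty g (a + L / 2) (a + L) (b + H / 2) b (b + H))//; first lra.
  by move=> z zi; apply: cg; apply: inrect_sub zi; lra.
have B : normc (rectint g a (a + L) b (b + H)) <=
    (N a b + N a (b + H / 2)) + (N (a + L / 2) b + N (a + L / 2) (b + H / 2)).
  rewrite E; apply: le_trans (normcD _ _) _.
  by apply: lerD; apply: normcD.
have h1 : 0 <= L / 2 by lra.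
have h2 : 0 <= H / 2 by lra.
rewrite /quarter /=.
have s1 : a <= a <= a + L / 2 by lra.
have s2 : a <= a + L / 2 <= a + L / 2 by lra.
have s3 : b <= b <= b + H / 2 by lra.
have s4 : b <= b + H / 2 <= b + H / 2 by lra.
have [M1|M1] := leP (normc (rectint g a (a + L) b (b + H))) (4 * N a b).
  by exists (a, b).
have [M2|M2] := leP (normc (rectint g a (a + L) b (b + H))) (4 * N a (b + H / 2)).
  by exists (a, b + H / 2).
have [M3|M3] := leP (normc (rectint g a (a + L) b (b + H))) (4 * N (a + L / 2) b).
  by exists (a + L / 2, b).
exists (a + L / 2, b + H / 2); split => //=.
exact: (le_max4 B M1 M2 M3).
Qed.

(** The supremum of the left ends lies in all the intervals. It is used once for each coordinate of
    the shrinking rectangles. *)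
Lemma nested_point (a : nat -> R) (L : R) :
  (forall n, a n <= a n.+1 <= a n + L / 2 ^+ n.+1) -> 0 <= L ->
  exists p, forall n, a n <= p <= a n + L / 2 ^+ n.
Proof.
move=> H L0.
have p2 n : 0 < 2 ^+ n :> R by rewrite exprn_gt0.
have S n : L / 2 ^+ n = L / 2 ^+ n.+1 + L / 2 ^+ n.+1.
  by rewrite exprS invfM mulrCA -mulrDl -[LHS]mul1r; congr (_ * _); lra.
have inc n k : a n <= a (n + k)%N <= a n + L / 2 ^+ n - L / 2 ^+ (n + k).
  elim: k => [|k IH]; first by rewrite addn0; lra.
  rewrite addnS; have := H (n + k)%N; have := S (n + k)%N; lra.
have p0 n : 0 <= L / 2 ^+ n by rewrite divr_ge0// ltW.
have ub m n : a m <= a n + L / 2 ^+ n.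
  have [/subnKC <-|/ltnW/subnKC <-] := leqP n m.
    by have := inc n (m - n)%N; have := p0 (n + (m - n))%N; lra.
  by have := inc m (n - m)%N; have := p0 (m + (n - m))%N; lra.
have hs : has_sup (range a).
  split; first by exists (a 0%N), 0%N.
  by exists (a 0%N + L / 2 ^+ 0) => _ [m _ <-]; exact: ub.
exists (sup (range a)) => n; apply/andP; split.
  by apply: ub_le_sup; [case: hs|exists n].
by apply: ge_sup; [case: hs|move=> _ [m _ <-]; exact: ub].
Qed.

Theorem goursat g x1 x2 y1 y2 : x1 <= x2 -> y1 <= y2 ->
  (forall z, inrect x1 x2 y1 y2 z -> exists l, cderiv g z l) ->
  rectint g x1 x2 y1 y2 = 0.
Proof.
move=> x12 y12 dg; pose L := x2 - x1; pose H := y2 - y1.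
have cg z : inrect x1 x2 y1 y2 z -> ccont g z.
  by move=> /dg[l /cderiv_ccont].
have L0 : 0 <= L by rewrite subr_ge0.
have H0 : 0 <= H by rewrite subr_ge0.
have p2 n : 0 < 2 ^+ n :> R by rewrite exprn_gt0.
pose St := (nat * (R * R))%type.
pose inv (s : St) := (x1 <= s.2.1) && (s.2.1 + L / 2 ^+ s.1 <= x2) &&
  ((y1 <= s.2.2) && (s.2.2 + H / 2 ^+ s.1 <= y2)).
pose I (s : St) := rectint g s.2.1 (s.2.1 + L / 2 ^+ s.1) s.2.2 (s.2.2 + H / 2 ^+ s.1).
(* Guarded by [inv s], so that every state has a successor, as dependent choice requires. *)
pose Rl (s t : St) := inv s -> [/\ t.1 = s.1.+1, inv t,
   s.2.1 <= t.2.1 <= s.2.1 + L / 2 ^+ s.1.+1,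
   s.2.2 <= t.2.2 <= s.2.2 + H / 2 ^+ s.1.+1 & normc (I s) <= 4 * normc (I t)].
have hv (x : R) n : x / 2 ^+ n / 2 = x / 2 ^+ n.+1.
  by rewrite exprSr invfM mulrA.
have [s|f [f0 fS]] := @dependent_choice St Rl _ (0%N, (x1, y1)).
  apply: cid.
  have [is_|nis] := boolP (inv s); last by exists s => is_; rewrite is_ in nis.
  have Ln : 0 <= L / 2 ^+ s.1 by rewrite divr_ge0// ltW.
  have Hn : 0 <= H / 2 ^+ s.1 by rewrite divr_ge0// ltW.
  have [|q [q1 q2 q3]] := @quarter_exists g (L / 2 ^+ s.1) (H / 2 ^+ s.1) s.2 Ln Hn.
    by move=> z zi; apply: cg; move: is_ => /andP[/andP[? ?] /andP[? ?]];
      apply: inrect_sub zi.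
  exists (s.1.+1, q) => _; split => //=; rewrite /I /= -?hv//.
  move: is_; rewrite /inv /= -!hv; lra.
have E n : (f n).1 = n /\ inv (f n).
  elim: n => [|n [IH1 IH2]].
    by rewrite f0 /inv /= expr0 !divr1 /L /H; split => //; lra.
  by have [-> ? _ _ _] := fS n IH2; rewrite IH1.
have Sn n := fS n (proj2 (E n)).
have [|p1 Hp1] := @nested_point (fun n => (f n).2.1) L _ L0.
  by move=> n; have [_ _ + _ _] := Sn n; rewrite (proj1 (E n)).
have [|p2' Hp2] := @nested_point (fun n => (f n).2.2) H _ H0.
  by move=> n; have [_ _ _ + _] := Sn n; rewrite (proj1 (E n)).
have In n : normc (I (f 0%N)) <= 4 ^+ n * normc (I (f n)).
  elim: n => [|n IH]; first by rewrite expr0 mul1r.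
  have [_ _ _ _ +] := Sn n; rewrite exprSr => K.
  by apply: le_trans IH _; rewrite -mulrA ler_pM2l// exprn_gt0.
have pin : inrect x1 x2 y1 y2 (p1 +i* p2').
  have := Hp1 0%N; have := Hp2 0%N; rewrite f0 /inrect /= expr0 !divr1 /L /H; lra.
have [l dl] := dg _ pin.
apply/eqP; rewrite -normc_eq0 eq_le normc_ge0 andbT.
have -> : rectint g x1 x2 y1 y2 = I (f 0%N).
  by rewrite f0 /I /= expr0 !divr1 /L /H; congr rectint; lra.
apply/ler_addgt0Pl => e e0; rewrite addr0.
(* With slope error [e / K] at the limit point, the n-th rectangle integral is at most
   [2 (e / K) (L + H)^2 / 4^n]. The summand 1 keeps [K] positive for a degenerate rectangle. *)
pose K := 2 * (L + H) * (L + H) + 1.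
have K0 : 0 < K by rewrite /K; nra.
have [d d0 Hd] := dl _ (divr_gt0 e0 K0).
have [n Hn] : exists n, (L + H) / 2 ^+ n < d.
  have k0 : 0 <= (L + H) / d := divr_ge0 (addr_ge0 L0 H0) (ltW d0).
  exists (Num.bound ((L + H) / d)); rewrite ltr_pdivrMr// -ltr_pdivrMl// mulrC.
  apply: lt_trans (archi_boundP k0) _.
  by rewrite -natrX ltr_nat ltn_expl.
apply: le_trans (In n) _.
pose w := (L + H) / 2 ^+ n.
have w0 : 0 <= w := divr_ge0 (addr_ge0 L0 H0) (ltW (p2 n)).
have := @rectint_bound g (f n).2.1 ((f n).2.1 + L / 2 ^+ n) (f n).2.2
  ((f n).2.2 + H / 2 ^+ n) (g (p1 +i* p2') - l * (p1 +i* p2')) l (e / K * w).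
have := proj2 (E n); rewrite /inv (proj1 (E n)) => iv.
have Ln : 0 <= L / 2 ^+ n by rewrite divr_ge0// ltW.
have Hn' : 0 <= H / 2 ^+ n by rewrite divr_ge0// ltW.
move=> /(_ ltac:(lra) ltac:(lra)) B.
have {}B : normc (I (f n)) <= (e / K * w) *+ 2 * w.
  rewrite /I (proj1 (E n)); apply: le_trans (B _ _) _.
  - by move=> z zi; apply: cg; move: iv => /andP[/andP[? ?] /andP[? ?]];
      apply: inrect_sub zi.
  - move=> z zi; have zp : normc (z - (p1 +i* p2')) <= w.
      apply: le_trans (normc_le_ReIm _) _; rewrite !ReImE /= [leRHS](mulrDl L H).
      move: zi (Hp1 n) (Hp2 n); rewrite /inrect => zi h1 h2.
      by apply: lerD; rewrite ler_norml; lra.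
    have := Hd _ (le_lt_trans zp Hn); rewrite [_ + (z - _)]addrC subrK.
    have -> : g z - (g (p1 +i* p2') - l * (p1 +i* p2')) - l * z =
      g z - g (p1 +i* p2') - l * (z - (p1 +i* p2')) by ring.
    move=> /le_trans; apply; rewrite ler_pM2l//; exact: divr_gt0.
  - rewrite le_eqVlt; apply/orP; left; apply/eqP; congr (_ * _).
    have aK (u v : R) : u + v - u = v by ring.
    by rewrite !aK; exact: (esym (mulrDl L H _)).
have {}B : normc (I (f n)) <= e / K * (2 * (L + H) * (L + H)) / 4 ^+ n.
  apply: le_trans B _; rewrite le_eqVlt; apply/orP; left; apply/eqP.
  have -> : 4 ^+ n = 2 ^+ n * 2 ^+ n :> R by rewrite -exprMn; congr (_ ^+ _); ring.
  by rewrite /w -mulr_natl; field; rewrite !lt0r_neq0// exprn_gt0.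
rewrite mulrC -ler_pdivlMr ?exprn_gt0//; apply: le_trans B _.
rewrite ler_wpM2r ?invr_ge0 ?exprn_ge0// mulrAC ler_pdivrMr//.
by rewrite ler_pM2l// /K; lra.
Qed.

End Goursat.

(** * The complex exponential *)

Section ComplexExponential.
Variable R : realType.
Notation C := R[i].

Lemma rderiv (f : R -> R) (x l : R) : is_derive x 1 f l -> forall e : R, 0 < e ->
  exists2 d : R, 0 < d & forall h, `|h| < d -> `|f (x + h) - f x - l * h| <= e * `|h|.
Proof.
move=> [df <-] e e0; have := derivable_nbhs df; move=> /eqaddoP/(_ e e0).
move=> /nbhs_ballP[d /= d0 Hd]; exists d => // h hd.
have := Hd h; rewrite /ball /= sub0r normrN => /(_ hd).
rewrite -![(_ + _ : _ -> _) _]/(_ + _) -![(- _ : _ -> _) _]/(- _) /cst /=.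
by rewrite /GRing.scale /= mulr1 opprD addrA [h + x]addrC [_ * h]mulrC.
Qed.

Lemma expiD (s t : R) : expi (s + t) = expi s * expi t.
Proof. by apply: eqC; rewrite ?ReImE /= ?cosD// sinD addrC [X in X + _]mulrC. Qed.

Lemma expi0 : expi (0 : R) = 1.
Proof. by rewrite /expi cos0 sin0. Qed.

Lemma expiD2pi (t : R) : expi (t + pi *+ 2) = expi t.
Proof. by rewrite /expi cosD2pi sinD2pi. Qed.

Lemma expiN (t : R) : expi (- t) = (expi t)^*.
Proof. by rewrite /expi cosN sinN. Qed.

Lemma normc_expi (t : R) : normc (expi t) = 1.
Proof. by rewrite normcE2 /= cos2Dsin2 sqrtr1. Qed.

Lemma expiX (t : R) n : expi t ^+ n = expi (t *+ n).
Proof.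
elim: n => [|n IH]; first by rewrite expr0 mulr0n expi0.
by rewrite exprS IH mulrS expiD.
Qed.

(** Serves as polar coordinates: it carries rectangles, where Goursat's theorem applies, onto
    annuli. *)
Definition cexp (w : C) : C := (expR (Rec w))%:C * expi (Imc w).

Lemma cexpD (w z : C) : cexp (w + z) = cexp w * cexp z.
Proof. by rewrite /cexp ReD ImD expRD expiD rmorphM /=; ring. Qed.

Lemma normc_cexp w : normc (cexp w) = expR (Rec w).
Proof. by rewrite normcM normc_expi normc_real mulr1 ger0_norm// expR_ge0. Qed.

Lemma cderiv_cexp0 : cderiv cexp 0 1.
Proof.
(* The four error terms below are at most [e'], [3 e'], [e'] and [4 e'] times the modulus of [h],
   whence the 9. Taking [e'] also as a bound for that modulus makes the quadratic terms linear. *)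
move=> e e0; have [e' [e'0 e'1 e'9]] : exists e', [/\ 0 < e', e' <= 1 & e' <= e / 9].
  exists (Num.min 1 (e / 9)).
  by rewrite lt_min ltr01 divr_gt0// !ge_min !lexx orbT.
have [d1 d10 H1] := rderiv (is_derive_expR 0) e'0.
have [d2 d20 H2] := rderiv (is_derive_cos 0) e'0.
have [d3 d30 H3] := rderiv (is_derive_sin 0) e'0.
exists (Num.min e' (Num.min d1 (Num.min d2 d3))).
  by rewrite !lt_min e'0 d10 d20.
move=> h; rewrite !lt_min => /and4P[h1 hd1 hd2 hd3].
have rh := Re_le_normc h; have ih := Im_le_normc h.
have {H1} := H1 _ (le_lt_trans rh hd1); rewrite add0r expR0 mul1r => H1.
have {H2} := H2 _ (le_lt_trans ih hd2); rewrite add0r cos0 sin0 oppr0 mul0r subr0 => H2.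
have {H3} := H3 _ (le_lt_trans ih hd3); rewrite add0r sin0 cos0 mul1r subr0 => H3.
rewrite add0r mul1r.
have -> : cexp 0 = 1 by rewrite /cexp /= expR0 expi0 mulr1.
set a := Rec h in rh H1 *; set b := Imc h in ih H2 H3 *.
set N := normc h in rh ih h1 hd1 hd2 hd3 *.
have N0 : 0 <= N by exact: normc_ge0.
have E3 : `|expR a - 1 - a| <= e' * N by apply: le_trans H1 _; rewrite ler_wpM2l// ltW.
have E2 : `|cos b - 1| <= e' * N by apply: le_trans H2 _; rewrite ler_wpM2l// ltW.
have E1 : `|sin b - b| <= e' * N by apply: le_trans H3 _; rewrite ler_wpM2l// ltW.
have X : `|expR a - 1| <= 2 * N.
  have -> : expR a - 1 = (expR a - 1 - a) + a by rewrite subrK.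
  by apply: le_trans (ler_normD _ _) _; rewrite mulr2n mulrDl mul1r lerD// (le_trans E3)// ler_piMl.
have SB : `|sin b| <= 2 * N.
  have -> : sin b = (sin b - b) + b by rewrite subrK.
  by apply: le_trans (ler_normD _ _) _; rewrite mulr2n mulrDl mul1r lerD// (le_trans E1)// ler_piMl.
have XB : `|(expR a - 1) * sin b| <= 4 * e' * N.
  rewrite normrM; apply: le_trans (ler_pM _ _ X SB) _ => //.
  have -> : 2 * N * (2 * N) = 4 * (N * N) by ring.
  by rewrite -mulrA ler_pM2l// ler_wpM2r// ltW.
have XC : `|expR a * (cos b - 1)| <= 3 * (e' * N).
  rewrite normrM; apply: ler_pM => //.
  have -> : expR a = (expR a - 1) + 1 by rewrite subrK.
  apply: le_trans (ler_normD _ _) _; rewrite normr1; move: X h1 e'1; clear; lra.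
apply: le_trans (normc_le_ReIm _) _; rewrite !ReImE /= -/a -/b.
rewrite (_ : _ - _ - a = (expR a - 1 - a) + expR a * (cos b - 1)); last by ring.
rewrite (_ : _ + _ - _ - b = (sin b - b) + (expR a - 1) * sin b); last by ring.
have := ler_normD (expR a - 1 - a) (expR a * (cos b - 1)).
have := ler_normD (sin b - b) ((expR a - 1) * sin b).
have EN : e' * N <= e / 9 * N by rewrite ler_wpM2r.
move: XB XC E1 E3 EN; clear; lra.
Qed.

Lemma cderiv_cexp w : cderiv cexp w (cexp w).
Proof.
move=> e e0; have w0 : 0 < normc (cexp w) by rewrite normc_cexp expR_gt0.
have [d d0 Hd] := cderiv_cexp0 (divr_gt0 e0 w0); exists d => // h /Hd.
have c0 : cexp 0 = 1 by rewrite /cexp /= expR0 expi0 mulr1.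
rewrite add0r mul1r c0 cexpD => H.
rewrite (_ : _ - _ = cexp w * (cexp h - 1 - h)); last by ring.
rewrite normcM mulrC -ler_pdivlMr//; apply: le_trans H _.
by rewrite mulrAC.
Qed.

Lemma differentiable_cexp w : differentiable cexp w.
Proof. by apply/diff_cderiv; exists (cexp w); exact: cderiv_cexp. Qed.

Lemma cexp_polar (rho t : R) : 0 < rho -> cexp (ln rho +i* t) = rho%:C * expi t.
Proof. by move=> r0; rewrite /cexp /= lnK. Qed.

End ComplexExponential.

Section Tube.
Variable R : realType.

(** Tube lemma: by compactness of the segment, local radii become one radius. It makes circle means
    continuous in the radius. *)
Lemma segment_tube (Q : R -> R -> Prop) (x0 a b : R) :
  (forall y, a <= y <= b -> exists2 d : R, 0 < d &
     forall x y', `|x - x0| < d -> `|y' - y| < d -> Q x y') ->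
  exists2 d : R, 0 < d & forall x, `|x - x0| < d -> forall y, a <= y <= b -> Q x y.
Proof.
move=> H; have /compact_near_coveringP K := @segment_compact R a b.
have := K _ (nbhs x0) Q _.
case.
  move=> y /=; rewrite in_itv /= => /H[d d0 Hd].
  exists (ball y d, ball x0 d); first by split; exact: nbhsx_ballx.
  by move=> [y' x] /= [B1 B2]; apply: Hd; rewrite distrC.
move=> d /= d0 Hd; exists d => // x xd y yab; apply: Hd => /=.
  by rewrite distrC.
by rewrite in_itv.
Qed.

End Tube.

(** * Circle means of holomorphic functions *)

Section CircleMean.
Variable R : realType.
Notation C := R[i].
Notation leb := (@lebesgue_measure R).
Implicit Types (f g : C -> C) (z : C) (r rho : R).

Definition cmean (F : R -> C) : C := ((pi *+ 2)^-1)%:C * ci 0 (pi *+ 2) F.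

Definition circ f rho := cmean (fun t => f (rho%:C * expi t)).

Lemma twopi_gt0 : 0 < pi *+ 2 :> R.
Proof. by rewrite pmulrn_lgt0// pi_gt0. Qed.

Lemma twopi_ge0 : 0 <= pi *+ 2 :> R.
Proof. exact/ltW/twopi_gt0. Qed.

Lemma rccont_polar f rho t : ccont f (rho%:C * expi t) ->
  rccont (fun t => f (rho%:C * expi t)) t.
Proof.
move=> H e /H[d d0 Hd].
have [d1 d10 H1] := cderiv_ccont (cderiv_cexp (0 +i* t)) (divr_gt0 d0 (ltr_wpDl (normr_ge0 rho) ltr01)).
exists d1 => // s sd; apply: Hd; rewrite -mulrBr normcM normc_real.
have := H1 (0 +i* s); rewrite (_ : _ - _ = 0 +i* (s - t)); last first.
  by apply: eqC; rewrite ?ReImE //= subrr.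
rewrite [normc (0 +i* _)]normcE2 /= expr0n add0r sqrtr_sqr => /(_ sd).
rewrite /cexp /= expR0 !mul1r ltr_pdivlMr ?ltr_wpDl// => A.
apply: le_lt_trans A; rewrite mulrC ler_wpM2l ?normc_ge0//.
by rewrite lerDl.
Qed.

Lemma cmean_norm F M : (forall t, rccont F t) ->
  (forall t, 0 <= t <= pi *+ 2 -> normc (F t) <= M) -> normc (cmean F) <= M.
Proof.
move=> cF FM; rewrite normcM normc_real ger0_norm ?invr_ge0 ?twopi_ge0//.
rewrite mulrC ler_pdivrMr ?twopi_gt0//.
have := @ci_norm R 0 (pi *+ 2) F M twopi_ge0; rewrite subr0.
exact.
Qed.

Lemma cmeanD F G : (forall t, rccont F t) -> (forall t, rccont G t) ->
  cmean (fun t => F t + G t) = cmean F + cmean G.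
Proof.
by move=> cF cG; rewrite /cmean /ci cintD ?mulrDr//; exact: rccont_integrable.
Qed.

Lemma cmeanZ F k : (forall t, rccont F t) ->
  cmean (fun t => k * F t) = k * cmean F.
Proof.
move=> cF; rewrite /cmean mulrCA; congr (_ * _).
by apply: cintZ => //; exact: rccont_integrable.
Qed.

Lemma cmeanB F G : (forall t, rccont F t) -> (forall t, rccont G t) ->
  cmean (fun t => F t - G t) = cmean F - cmean G.
Proof.
by move=> cF cG; rewrite /cmean /ci cintB ?mulrBr//; exact: rccont_integrable.
Qed.

Lemma cmean_cst k : cmean (fun=> k) = k.
Proof.
rewrite /cmean ci_cst ?twopi_ge0// subr0 mulrCA -rmorphM /= mulVf ?mulr1//.
by rewrite gt_eqF// twopi_gt0.
Qed.

Lemma cmean_conj F : (forall t, rccont F t) ->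
  cmean (fun t => (F t)^*) = (cmean F)^*.
Proof.
move=> cF; rewrite /cmean rmorphM /= /ci cint_conj//; last exact: rccont_integrable.
by congr (_ * _); rewrite oppr0.
Qed.

Lemma cmean_sum I (s : seq I) (F : I -> R -> C) : (forall i t, rccont (F i) t) ->
  cmean (fun t => \sum_(i <- s) F i t) = \sum_(i <- s) cmean (F i).
Proof.
move=> cF; rewrite /cmean /ci cint_sum//; first by rewrite mulr_sumr.
by move=> i; exact: rccont_integrable.
Qed.

Lemma eq_cmean F G : (forall t, F t = G t) -> cmean F = cmean G.
Proof. by move=> FG; rewrite /cmean; congr (_ * _); apply: eq_ci => t _. Qed.

Lemma differentiable_ccont f z : differentiable f z -> ccont f z.
Proof. by move=> /diff_cderiv[l /cderiv_ccont]. Qed.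

(** Under [cexp] the annulus is the image of a rectangle of height [2 pi]. The horizontal sides
    cancel by periodicity, and Goursat's theorem equates the vertical ones, which are the two circle
    means. *)
Lemma circ_annulus f r1 r2 : 0 < r1 -> r1 <= r2 ->
  (forall z, r1 <= normc z <= r2 -> differentiable f z) -> circ f r1 = circ f r2.
Proof.
move=> r10 r12 df; have r20 := lt_le_trans r10 r12.
have l12 : ln r1 <= ln r2 by rewrite ler_ln.
have cV rho : r1 <= rho <= r2 -> forall t, rccont (fun t => f (rho%:C * expi t)) t.
  move=> rr t; apply: rccont_polar; apply: differentiable_ccont; apply: df.
  by rewrite normcM normc_expi mulr1 normc_real ger0_norm//; lra.
have E0 : rectint (f \o @cexp R) (ln r1) (ln r2) 0 (pi *+ 2) = 0.
  apply: goursat => //; first exact: twopi_ge0.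
  move=> z /andP[/andP[a b] _]; apply/diff_cderiv/differentiable_comp.
    exact: differentiable_cexp.
  apply: df; rewrite normc_cexp -(lnK r10) -(lnK r20).
  by rewrite !ler_expR a b.
move: E0; rewrite /rectint [X in X + _ = _](_ : _ = 0); last first.
  rewrite /ci -[RHS](cint0 leb `[ln r1, ln r2]); apply: eq_cint => x _ /=.
  by rewrite /cexp /= -{1}[pi *+ 2]add0r expiD2pi expi0 subrr.
rewrite add0r => /eqP; rewrite mulf_eq0 => /orP[/eqP[] /eqP|/eqP].
  by rewrite oner_eq0.
rewrite /ci /= => E; rewrite /circ /cmean; congr (_ * _); apply/eqP.
rewrite eq_sym -subr_eq0 -cintB//.
- rewrite -[X in _ == X]E; apply/eqP; apply: eq_cint => t _ /=.
  by rewrite !cexp_polar.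
- by apply: rccont_integrable => t _; apply: cV; rewrite lexx andbT.
- by apply: rccont_integrable => t _; apply: cV; rewrite lexx.
Qed.

Lemma circ_cont f rho : (forall t, ccont f (rho%:C * expi t)) ->
  forall e : R, 0 < e -> exists2 d : R, 0 < d & forall r', `|r' - rho| < d ->
    (forall t, ccont f (r'%:C * expi t)) -> normc (circ f r' - circ f rho) <= e.
Proof.
move=> cf e e0.
have [y _|d d0 Hd] := @segment_tube R
    (fun r' t => normc (f (r'%:C * expi t) - f (rho%:C * expi t)) <= e) rho 0 (pi *+ 2).
  have e2 : 0 < e / 2 by rewrite divr_gt0.
  have [d d0 Hd] := cf y _ e2.
  have [d1 d10 H1] := rccont_polar (cf y) e2.
  have [d2 d20 H2] := @rccont_polar id rho y (fun e e0 => ex_intro2 _ _ e e0 (fun w H => H)) _ (divr_gt0 d0 (ltr0n R 2)).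
  exists (Num.min (d / 2) (Num.min d1 d2)); first by rewrite !lt_min divr_gt0// d10.
  move=> x y'; rewrite !lt_min => /andP[xd _] /and3P[_ /H1 A1 /H2 A2].
  rewrite (_ : _ - _ = (f (x%:C * expi y') - f (rho%:C * expi y)) -
    (f (rho%:C * expi y') - f (rho%:C * expi y))); last by ring.
  apply: le_trans (normcB _ _) _; rewrite [e]splitr; apply: lerD; last exact: ltW.
  apply/ltW/Hd; rewrite (_ : _ - _ = (x - rho)%:C * expi y' +
    (rho%:C * expi y' - rho%:C * expi y)); last by rewrite rmorphB /=; ring.
  apply: le_lt_trans (normcD _ _) _; rewrite [d]splitr.
  by rewrite ltrD// normcM normc_expi mulr1 normc_real.
exists d => // r' rd cr; rewrite /circ -cmeanB.
- rewrite /cmean normcM normc_real ger0_norm ?invr_ge0 ?twopi_ge0//.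
  rewrite mulrC ler_pdivrMr ?twopi_gt0//.
  have := @ci_norm R 0 (pi *+ 2) _ e twopi_ge0; rewrite subr0.
  apply=> t tt; last exact: Hd.
  by apply: rccontB; exact: rccont_polar.
- by move=> t; exact: rccont_polar.
- by move=> t; exact: rccont_polar.
Qed.

(** The mean value property with one exceptional point, where continuity is enough; this allows
    difference quotients in Cauchy's formula. The mean is constant on annuli that avoid [z0], and
    continuity in the radius bridges the radii 0 and [normc z0]. *)
Lemma circ_mean f r z0 : ccont f z0 ->
  (forall z, normc z < r -> z != z0 -> differentiable f z) ->
  forall rho, 0 <= rho < r -> circ f rho = f 0.
Proof.
move=> cf0 df.
have cf z : normc z < r -> ccont f z.
  by move=> zr; have [->//|zz] := eqVneq z z0; exact/differentiable_ccont/df.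
have ncirc rho t : 0 <= rho -> normc (rho%:C * expi t) = rho.
  by move=> r0; rewrite normcM normc_expi mulr1 normc_real ger0_norm.
have circ0 : circ f 0 = f 0.
  by rewrite -[RHS]cmean_cst; apply: eq_cmean => t; rewrite mul0r.
have close rho : 0 <= rho -> rho < r -> forall e : R, 0 < e ->
    exists2 d : R, 0 < d & forall r', 0 <= r' -> r' < r -> `|r' - rho| < d ->
      normc (circ f r' - circ f rho) <= e.
  move=> r0 rr e e0; have [|d d0 Hd] := @circ_cont f rho _ e e0.
    by move=> t; apply: cf; rewrite ncirc.
  exists d => // r' r'0 r'r r'd; apply: Hd => // t.
  by apply: cf; rewrite ncirc.
have sq a b : (forall e : R, 0 < e -> normc (a - b) <= e) -> a = b.
  move=> H; apply/eqP; rewrite -subr_eq0 -normc_eq0 eq_le normc_ge0 andbT.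
  by apply/ler_addgt0Pl => e e0; rewrite addr0 H.
have ann r1 r2 : 0 < r1 -> r1 <= r2 -> r2 < r ->
    (normc z0 < r1 \/ r2 < normc z0) -> circ f r1 = circ f r2.
  move=> r10 r12 r2r zz; apply: circ_annulus => // z /andP[z1 z2].
  apply: df; first exact: le_lt_trans r2r.
  by apply/eqP => E; move: zz; rewrite -E; case; rewrite ltNge ?z1 ?z2.
have step1 rho : 0 < rho -> rho < r -> z0 = 0 \/ rho < normc z0 ->
    circ f rho = circ f 0.
  move=> r0 rr zz; apply: sq => e e0.
  have [d d0 Hd] := close 0 (lexx _) (lt_trans r0 rr) _ e0.
  have m0 : 0 < Num.min rho (d / 2) by rewrite lt_min r0 divr_gt0.
  have m1 : Num.min rho (d / 2) <= rho by rewrite ge_min lexx.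
  have m2 : Num.min rho (d / 2) <= d / 2 by rewrite ge_min lexx orbT.
  rewrite -(ann _ _ m0 m1 rr).
    apply: Hd; [exact: ltW|exact: le_lt_trans rr|].
    by rewrite subr0 gtr0_norm//; move: m2 d0; clear; lra.
  by case: zz => [->|]; [left; rewrite normc0|right].
have step2 : 0 < normc z0 -> normc z0 < r -> circ f (normc z0) = circ f 0.
  move=> r0 rr; apply: sq => e e0.
  have [d d0 Hd] := close _ (ltW r0) rr _ e0.
  pose m := Num.min (normc z0 / 2) (d / 2).
  have m0 : 0 < m by rewrite lt_min !divr_gt0.
  have m1 : m <= normc z0 / 2 by rewrite ge_min lexx.
  have m2 : m <= d / 2 by rewrite ge_min lexx orbT.
  have h1 : 0 < normc z0 - m by move: m1 r0; clear; lra.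
  have h2 : normc z0 - m < normc z0 by move: m0; clear; lra.
  rewrite -(step1 _ h1 (lt_trans h2 rr) (or_intror h2)) distcC.
  apply: Hd; [exact: ltW|exact: lt_trans rr|].
  by rewrite addrAC subrr sub0r normrN gtr0_norm//; move: m2 d0; clear; lra.
move=> rho /andP[r0 rr]; rewrite -circ0.
have [->//|rho0] := eqVneq rho 0.
have {}r0 : 0 < rho by rewrite lt0r rho0.
have [z00|z00] := eqVneq z0 0; first by apply: step1 => //; left.
have nz0 : 0 < normc z0 by rewrite normc_gt0.
have [lt|gt|eq] := ltgtP rho (normc z0); first by apply: step1 => //; right.
  rewrite -(step2 nz0 (lt_trans gt rr)); apply: sq => e e0.
  have [d d0 Hd] := close _ (ltW nz0) (lt_trans gt rr) _ e0.
  pose m := Num.min (rho - normc z0) (d / 2).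
  have m0 : 0 < m by rewrite lt_min subr_gt0 gt divr_gt0.
  have m1 : m <= rho - normc z0 by rewrite ge_min lexx.
  have m2 : m <= d / 2 by rewrite ge_min lexx orbT.
  have h1 : normc z0 < normc z0 + m by rewrite ltrDl.
  have h2 : normc z0 + m <= rho by move: m1; clear; lra.
  rewrite -(ann _ _ (lt_trans nz0 h1) h2 rr (or_introl h1)).
  apply: Hd; [exact/ltW/(lt_trans nz0)|exact: le_lt_trans rr|].
  by rewrite addrAC subrr add0r gtr0_norm//; move: m2 d0; clear; lra.
by rewrite eq; apply: step2; rewrite -?eq.
Qed.

End CircleMean.

(** * Cauchy's formula with Taylor remainder *)

Section CauchyExpansion.
Variable R : realType.
Notation C := R[i].
Implicit Types (f g : C -> C) (z w : C) (r rho : R).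

Lemma differentiable_cst' (k z : C) : differentiable (fun=> k : C) z.
Proof. exact: differentiable_cst. Qed.

Lemma differentiable_idC z : differentiable (fun w : C => w) z.
Proof. by apply: ex_diff. Qed.

Lemma differentiable_cexpn f z n : differentiable f z ->
  differentiable (fun w => f w ^+ n) z.
Proof.
move=> df; elim: n => [|n IH].
  by under eq_fun do rewrite expr0; exact: differentiable_cst'.
by under eq_fun do rewrite exprS; exact: differentiableM.
Qed.

Lemma differentiable_cpow z n : differentiable (fun w : C => w ^+ n) z.
Proof. apply: differentiable_cexpn; exact: differentiable_idC. Qed.

Lemma normc_circle rho t : 0 <= rho -> normc (rho%:C * expi t) = rho.
Proof. by move=> r0; rewrite normcM normc_expi mulr1 normc_real ger0_norm. Qed.

Lemma rccont_bounded (F : R -> C) (a b : R) : a <= b ->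
  (forall t, a <= t <= b -> rccont F t) ->
  exists M, forall t, a <= t <= b -> normc (F t) <= M.
Proof.
move=> ab cF; have [|c _ Hc] := @EVT_max R (fun t => normc (F t)) _ _ ab.
  apply: continuous_in_subspaceT => t /set_mem /=; rewrite in_itv /= => tt.
  apply/cvgrPdist_lt => e e0; have [d d0 Hd] := cF _ tt _ e0.
  near=> y; rewrite distrC; apply: le_lt_trans (ler_distC_normc _ _) _.
  apply: Hd; near: y; apply/nbhs_ballP; exists d => //= y.
  by rewrite /ball /= distrC.
by exists (normc (F c)) => t tt; apply: Hc; rewrite in_itv.
Unshelve. all: by end_near. Qed.

Lemma ccontM f g z : ccont f z -> ccont g z -> ccont (fun w => f w * g w) z.
Proof.
move=> cf cg e e0; pose K := normc (f z) + normc (g z) + 1.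
have K0 : 0 < K by rewrite ltr_wpDl ?addr_ge0.
have [e' [e'0 e'1 e'K]] : exists e', [/\ 0 < e', e' <= 1 & K * e' <= e / 2].
  exists (Num.min 1 (e / (2 * K))); split; rewrite ?ge_min ?lexx//.
    by rewrite lt_min ltr01 divr_gt0// mulr_gt0.
  apply: le_trans (_ : K * (e / (2 * K)) <= _).
    by rewrite ler_pM2l// ge_min lexx orbT.
  have -> : K * (e / (2 * K)) = e / 2 by field; rewrite gt_eqF.
  exact: lexx.
have [d d0 Hd] := cf _ e'0; have [d' d'0 Hd'] := cg _ e'0.
exists (Num.min d d'); first by rewrite lt_min d0.
move=> y; rewrite lt_min => /andP[/Hd a1 /Hd' a2].
rewrite (_ : f y * g y - f z * g z =
  f y * (g y - g z) + (f y - f z) * g z); last by ring.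
apply: le_lt_trans (normcD _ _) _; rewrite !normcM.
have Fy : normc (f y) <= K.
  have -> : f y = f z + (f y - f z) by rewrite addrC subrK.
  apply: le_trans (normcD _ _) _; have := normc_ge0 (g z).
  by move: a1 e'1; rewrite /K; clear; lra.
have Gz : normc (g z) <= K.
  by have := normc_ge0 (f z); rewrite /K; clear; lra.
apply: (@le_lt_trans _ _ (K * normc (g y - g z) + K * normc (f y - f z))).
  by rewrite [X in _ + X <= _]mulrC lerD// ler_wpM2r.
rewrite -mulrDr; apply: lt_le_trans (_ : K * (e' + e') <= e).
  by rewrite ltr_pM2l// ltrD.
by rewrite mulrDr [e]splitr lerD.
Qed.

Lemma rccont_circ f rho : 0 <= rho -> (forall z, normc z = rho -> ccont f z) ->
  forall t, rccont (fun t => f (rho%:C * expi t)) t.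
Proof. by move=> r0 cf t; apply: rccont_polar; apply: cf; exact: normc_circle. Qed.

Definition ccoef f rho m := circ (fun z => f z / z ^+ m) rho.

Lemma circ_neg f r m rho : (forall z, normc z < r -> differentiable f z) ->
  0 <= rho < r -> circ (fun z => f z * z ^+ m.+1) rho = 0.
Proof.
move=> df rr.
have r0 : 0 < r by move: rr => /andP[]; exact: le_lt_trans.
have D z : normc z < r -> differentiable (fun z => f z * z ^+ m.+1) z.
  by move=> zr; apply: differentiableM; [exact: df|exact: differentiable_cpow].
have D0 : ccont (fun z => f z * z ^+ m.+1) 0.
  by apply: differentiable_ccont; apply: D; rewrite normc0.
rewrite (circ_mean D0 (fun z zr _ => D z zr) rr).
by rewrite exprS mul0r mulr0.
Qed.

Lemma ccoef_cst f r m r1 r2 : (forall z, normc z < r -> differentiable f z) ->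
  0 < r1 -> r1 <= r2 -> r2 < r -> ccoef f r1 m = ccoef f r2 m.
Proof.
move=> df r10 r12 r2r; apply: circ_annulus => // z /andP[z1 z2].
apply: differentiableM; first by apply: df; exact: le_lt_trans r2r.
apply: differentiableV; first exact: differentiable_cpow.
by rewrite expf_neq0// -normc_gt0 (lt_le_trans r10).
Qed.

(** On the circle of squared radius [c], the kernel with its pole inside the disc is the conjugate
    of a function of [w] that is holomorphic on the disc. *)
Lemma kernel_conj z w (c : C) : c^* = c -> w * w^* = c -> w != 0 -> w - z != 0 ->
  w / (w - z) = ((1 - z^* * w / c)^-1)^*.
Proof.
move=> cJ wJ w0 wz; have wJ0 : w^* != 0 by rewrite cj_eq0.
rewrite cjV rmorphB rmorph1 !rmorphM /= cjK cjV cJ -wJ.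
by field; rewrite w0 wJ0 wz.
Qed.

Lemma cauchy_kernel_mean z rho : normc z < rho ->
  circ (fun w => w / (w - z)) rho = 1.
Proof.
move=> zr; have r0 : 0 < rho by exact: le_lt_trans zr.
pose k (w : C) := (1 - z^* * w / (rho ^+ 2)%:C)^-1.
(* The function [k] is holomorphic for [|w| < rho^2 / |z|]. This radius lies strictly above [rho],
   not above that bound, and is meaningful for [z = 0] too. *)
pose r := rho ^+ 2 *+ 2 / (rho + normc z).
have s0 : 0 < rho + normc z by rewrite ltr_wpDr ?normc_ge0.
have q0 : 0 < rho ^+ 2 by rewrite exprn_gt0.
have rr : rho < r.
  by rewrite /r ltr_pdivlMr// expr2 -mulrnAr ltr_pM2l// mulr2n ltrD2l.
have kd w : normc w < r -> differentiable k w.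
  move=> wr; apply: differentiableV.
    apply: differentiableB; first exact: differentiable_cst'.
    apply: differentiableM; last exact: differentiable_cst'.
    apply: differentiableM; first exact: differentiable_cst'.
    exact: differentiable_idC.
  apply/eqP => /eqP; rewrite subr_eq0 => /eqP /(congr1 (fun z => normc z)).
  rewrite !normcM normcV normc_conj normc1 normc_real (gtr0_norm q0) => E.
  have : normc z * normc w / rho ^+ 2 < 1.
    rewrite ltr_pdivrMr// mul1r.
    have [->|z0] := eqVneq (normc z) 0; first by rewrite mul0r.
    have z0' : 0 < normc z by rewrite lt0r z0 normc_ge0.
    apply: lt_le_trans (_ : normc z * r <= _); first by rewrite ltr_pM2l.
    rewrite /r mulrA ler_pdivrMr// mulrnAr mulrC -mulrnAr ler_pM2l// mulr2n.
    by rewrite lerD2r ltW.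
  by rewrite -E ltxx.
have k0 : circ k rho = 1.
  rewrite (@circ_mean _ k r 0) ?ltW ?r0//; last by move=> w wr _; exact: kd.
  - by rewrite /k mulr0 mul0r subr0 invr1.
  - by apply/differentiable_ccont/kd; rewrite normc0 (lt_trans r0).
rewrite -[RHS]cj1 -k0 -cmean_conj; last first.
  by apply: rccont_circ; [exact: ltW|move=> w wr; apply/differentiable_ccont/kd; rewrite wr].
apply: eq_cmean => t; set w := rho%:C * expi t.
have wJ : w * w^* = (rho ^+ 2)%:C by rewrite mulcJ normc_circle// ltW.
have w0 : w != 0 by rewrite -normc_gt0 normc_circle// ltW.
have wz : w - z != 0.
  by apply/eqP => /eqP; rewrite subr_eq0 => /eqP E; move: zr; rewrite -E normc_circle ?ltxx// ltW.
by apply: kernel_conj => //; rewrite cj_real.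
Qed.

Lemma geom_kernel z w K : w != 0 -> w - z != 0 ->
  w / (w - z) = \sum_(m < K) z ^+ m / w ^+ m + (z / w) ^+ K * (w / (w - z)).
Proof.
move=> w0 wz; elim: K => [|K IH]; first by rewrite big_ord0 expr0 mul1r add0r.
rewrite big_ord_recr /= [LHS]IH -addrA; congr (_ + _).
rewrite exprSr -expr_div_n -mulrA -[X in _ = X + _]mulr1 -mulrDr; congr (_ * _).
by field; rewrite w0 wz.
Qed.

(** The function [(f w - f z) w / (w - z)] has mean equal to its value at 0, which is 0. Since the
    kernel has mean 1, [f z] is the mean of [f w] times the kernel, and the truncated geometric
    series of the kernel gives the Taylor polynomial and its remainder. *)
Theorem cauchy_expansion f r rho z M K :
  (forall w, normc w < r -> differentiable f w) -> rho < r -> normc z < rho ->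
  (forall t, 0 <= t <= pi *+ 2 -> normc (f (rho%:C * expi t)) <= M) ->
  normc (f z - \sum_(m < K) ccoef f rho m * z ^+ m) <=
    M * (normc z / rho) ^+ K * (rho / (rho - normc z)).
Proof.
move=> df rr zr fM; have r0 : 0 < rho by exact: le_lt_trans zr.
have r0' := ltW r0.
have zz : normc z < r by exact: lt_trans rr.
have [l dl] := proj1 (diff_cderiv f z) (df z zz).
(* At [w = z] the value is the limit of the quotient, and for [z = 0] it still vanishes at the
   centre. *)
pose h w := if w == z then l * z else (f w - f z) * w / (w - z).
have hz : ccont h z.
  have mz : ccont (fun w => if w == z then l else (f w - f z) / (w - z)) z.
    move=> e e0; have e20 : 0 < e / 2 by rewrite divr_gt0.
    have [d d0 Hd] := dl _ e20; exists d => // w wd; rewrite eqxx.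
    case: ifPn => [_|wz]; first by rewrite subrr normc0.
    have wz0 : w - z != 0 by rewrite subr_eq0.
    have n0 : 0 < normc (w - z) by rewrite normc_gt0.
    have -> : (f w - f z) / (w - z) - l = (f w - f z - l * (w - z)) / (w - z).
      by field.
    rewrite normcM normcV ltr_pdivrMr//; have := Hd _ wd; rewrite [z + _]addrC subrK.
    move=> /le_lt_trans; apply; rewrite ltr_pM2r//; move: e0; clear; lra.
  have := ccontM mz (differentiable_ccont (differentiable_idC z)).
  move=> H e /H[d d0 Hd]; exists d => // w /Hd; rewrite /h eqxx.
  case: ifPn => [/eqP ->//|wz].
  by have -> : (f w - f z) * w / (w - z) = (f w - f z) / (w - z) * w by rewrite mulrAC.
have dh w : normc w < r -> w != z -> differentiable h w.
  move=> wr wz; have dG : differentiable (fun w => (f w - f z) * w / (w - z)) w.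
    apply: differentiableM; first apply: differentiableM.
    - by apply: differentiableB; [exact: df|exact: differentiable_cst'].
    - exact: differentiable_idC.
    - apply: differentiableV; last by rewrite subr_eq0.
      by apply: differentiableB; [exact: differentiable_idC|exact: differentiable_cst'].
  move/diff_cderiv: dG => [k Hk]; apply/diff_cderiv; exists k => e e0.
  have [d d0 Hd] := Hk _ e0.
  have n0 : 0 < normc (w - z) by rewrite normc_gt0 subr_eq0.
  exists (Num.min d (normc (w - z))); first by rewrite lt_min d0.
  move=> t; rewrite lt_min => /andP[td tz]; rewrite /h (negPf wz).
  have /negPf -> : w + t != z; last exact: Hd.
  apply/eqP => E; move: tz; rewrite -E opprD addNKr normcNE ltxx//.
have h0 : circ h rho = 0.
  rewrite (@circ_mean _ h r z)// ?r0' ?rr//.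
  by rewrite /h; case: eqVneq => [<-|_]; rewrite ?mulr0 ?mul0r.
have cne t : rho%:C * expi t != 0 by rewrite -normc_gt0 normc_circle.
have cnz t : rho%:C * expi t - z != 0.
  rewrite subr_eq0; apply/eqP => E; move: zr; rewrite -E normc_circle ?ltxx//.
pose Q w := w / (w - z).
have cf w : normc w = rho -> ccont f w.
  by move=> wr; apply/differentiable_ccont/df; rewrite wr.
have dQ w : normc w = rho -> differentiable Q w.
  move=> wr; apply: differentiableM; first exact: differentiable_idC.
  apply: differentiableV.
    by apply: differentiableB; [exact: differentiable_idC|exact: differentiable_cst'].
  by rewrite subr_eq0; apply/eqP => E; move: zr; rewrite -E wr ltxx.
have cQ w : normc w = rho -> ccont Q w.
  by move=> wr; exact/differentiable_ccont/dQ.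
have cfQ w : normc w = rho -> ccont (fun w => f w * Q w) w.
  by move=> wr; apply: ccontM; [exact: cf|exact: cQ].
have E1 : circ (fun w => f w * Q w) rho = f z.
  have := cauchy_kernel_mean zr; rewrite -/Q => E.
  rewrite -[RHS]mulr1 -E -[X in _ * X]/(cmean _) -cmeanZ; last exact: rccont_circ.
  apply/eqP; rewrite -subr_eq0 -cmeanB.
  - rewrite -h0; apply/eqP/eq_cmean => t; rewrite /h /Q.
    have := cnz t; rewrite subr_eq0 => /negPf ->.
    by rewrite -[RHS]mulrA mulrBl.
  - exact: (rccont_circ r0' cfQ).
  - by move=> t; apply: rccontZ; exact: (rccont_circ r0' cQ).
have czK w : normc w = rho -> ccont (fun w => (z / w) ^+ K) w.
  move=> wr; apply/differentiable_ccont/differentiable_cexpn/differentiableM.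
    exact: differentiable_cst'.
  apply: differentiableV; first exact: differentiable_idC.
  by rewrite -normc_gt0 wr.
have cc m w : normc w = rho -> ccont (fun w => f w / w ^+ m) w.
  move=> wr; apply: ccontM; first exact: cf.
  apply/differentiable_ccont/differentiableV; first exact: differentiable_cpow.
  by rewrite expf_neq0// -normc_gt0 wr.
have ccr w : normc w = rho -> ccont (fun w => (f w * Q w) * (z / w) ^+ K) w.
  by move=> wr; apply: ccontM; [exact: cfQ|exact: czK].
have -> : f z - \sum_(m < K) ccoef f rho m * z ^+ m =
    circ (fun w => (f w * Q w) * (z / w) ^+ K) rho.
  apply/eqP; rewrite subr_eq -E1; apply/eqP.
  under [X in _ + X]eq_bigr => m _.
    rewrite mulrC -[X in _ * X]/(cmean _) -cmeanZ; last exact: (rccont_circ r0' (cc m)).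
    over.
  rewrite -cmean_sum; last first.
    by move=> m t; apply: rccontZ; exact: (rccont_circ r0' (cc m)).
  rewrite -cmeanD; last 2 first.
  - exact: (rccont_circ r0' ccr).
  - move=> t; apply: rccont_sum => m; apply: rccontZ.
    exact: (rccont_circ r0' (cc m)).
  apply: eq_cmean => t; rewrite {1}/Q (geom_kernel K (cne t) (cnz t)) mulrDr addrC.
  congr (_ + _); first by rewrite -[RHS]mulrA; congr (_ * _); rewrite mulrC.
  by rewrite mulr_sumr; apply: eq_bigr => m _; rewrite mulrCA.
rewrite -[X in _ <= X]mulrA; apply: cmean_norm; first exact: (rccont_circ r0' ccr).
move=> t tt; rewrite normcM normcX normcM normcM normcM !normcV normc_circle//.
rewrite -[leLHS]mulrA; apply: ler_pM; first exact: normc_ge0.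
- by rewrite mulr_ge0 ?exprn_ge0 ?divr_ge0 ?normc_ge0.
- exact: fM.
rewrite mulrC ler_wpM2l ?exprn_ge0 ?divr_ge0// ler_wpM2l//.
rewrite lef_pV2 ?posrE ?subr_gt0// ?normc_gt0//.
have := normcD (rho%:C * expi t - z) z; rewrite subrK normc_circle//; clear; lra.
Qed.

End CauchyExpansion.

(** * Cauchy estimates, maximum principle and disc automorphisms *)

Section CauchyConsequences.
Variable R : realType.
Notation C := R[i].
Notation leb := (@lebesgue_measure R).
Implicit Types (f g : C -> C) (z w a : C) (r rho M : R).

Lemma ccoef_bound f r rho m M : (forall w, normc w < r -> differentiable f w) ->
  0 < rho -> rho < r ->
  (forall t, 0 <= t <= pi *+ 2 -> normc (f (rho%:C * expi t)) <= M) ->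
  normc (ccoef f rho m) <= M / rho ^+ m.
Proof.
move=> df r0 rr fM; apply: cmean_norm.
  apply: (@rccont_circ _ (fun z => f z / z ^+ m) rho (ltW r0)).
  move=> z zr; apply: ccontM.
    by apply/differentiable_ccont/df; rewrite zr.
  apply/differentiable_ccont/differentiableV; first exact: differentiable_cpow.
  by rewrite expf_neq0// -normc_gt0 zr.
move=> t tt; rewrite normcM normcV normcX normc_circle ?(ltW r0)//.
by rewrite ler_pM2r ?invr_gt0 ?exprn_gt0//; exact: fM.
Qed.

Lemma ccoef0 f r rho : (forall w, normc w < r -> differentiable f w) ->
  0 < rho -> rho < r -> ccoef f rho 0 = f 0.
Proof.
move=> df r0 rr; have rr' : 0 <= rho < r by rewrite ltW.
have cf0 : ccont f 0 by apply/differentiable_ccont/df; rewrite normc0 (lt_trans r0).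
rewrite -(circ_mean cf0 (fun w wr _ => df w wr) rr').
by apply: eq_cmean => t; rewrite expr0 divr1.
Qed.

(** Cauchy's expansion of order 2 on the circle of radius [r / 2]: the squared radius contributes a
    factor 4, and [|z| <= r / 4] bounds the last factor by 2. *)
Lemma taylor2 f r M z : 0 < r -> (forall w, normc w < r -> differentiable f w) ->
  (forall w, normc w < r -> normc (f w) <= M) -> normc z <= r / 4 ->
  normc (f z - f 0 - ccoef f (r / 2) 1 * z) <= 8 * M / r ^+ 2 * normc z ^+ 2.
Proof.
move=> r0 df fM zr.
have h0 : 0 < r / 2 by rewrite divr_gt0.
have hr : r / 2 < r by move: r0; clear; lra.
have zr2 : normc z < r / 2 by move: r0 zr; clear; lra.
have B t : 0 <= t <= pi *+ 2 -> normc (f ((r / 2)%:C * expi t)) <= M.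
  by move=> _; apply: fM; rewrite normc_circle// ltW.
have M0 : 0 <= M by apply: le_trans (normc_ge0 _) (fM 0 _); rewrite normc0.
have := @cauchy_expansion R f r (r / 2) z M 2 df hr zr2 B.
rewrite !big_ord_recr big_ord0 /= add0r expr0 mulr1 expr1 (ccoef0 df)// opprD addrA.
move=> /le_trans; apply.
rewrite expr_div_n.
have q : (r / 2) / (r / 2 - normc z) <= 2.
  by rewrite ler_pdivrMr ?subr_gt0//; move: zr r0; clear; lra.
apply: le_trans (_ : M * (normc z ^+ 2 / (r / 2) ^+ 2) * 2 <= _).
  by rewrite ler_wpM2l// mulr_ge0 ?divr_ge0 ?exprn_ge0 ?normc_ge0// ltW.
rewrite le_eqVlt; apply/orP; left; apply/eqP; field.
by rewrite gt_eqF.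
Qed.

(** Turns truncation estimates valid for every degree into exact identities. *)
Lemma le_of_geometric (x q A : R) : 0 <= q < 1 ->
  (forall K : nat, x <= A * q ^+ K) -> x <= 0.
Proof.
move=> /andP[q0 q1] H; rewrite leNgt; apply/negP => x0.
have A0 : 0 < A by have := H 0%N; rewrite expr0 mulr1; exact: lt_le_trans.
have /cvgrPdist_lt/(_ _ (divr_gt0 x0 A0)) : (fun n => q ^+ n) @ \oo --> (0 : R).
  by apply: cvg_expr; rewrite ger0_norm.
move=> [N _ /(_ N (leqnn N))] /=; rewrite sub0r normrN ger0_norm ?exprn_ge0//.
by rewrite ltr_pdivlMr// mulrC => /(le_lt_trans (H N)); rewrite ltxx.
Qed.

Lemma cmean_normcE (F : R -> C) : (forall t, rccont F t) ->
  normc (cmean F) <= (pi *+ 2)^-1 * \int[leb]_(t in `[0, pi *+ 2]) normc (F t).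
Proof.
move=> cF; rewrite normcM normc_real ger0_norm ?invr_ge0 ?twopi_ge0//.
rewrite ler_wpM2l ?invr_ge0 ?twopi_ge0//; apply: cint_normc => //.
exact: rccont_integrable.
Qed.

Lemma conj_rccont (F : R -> C) t : rccont F t -> rccont (fun t => (F t)^*) t.
Proof.
move=> H e /H[d d0 Hd]; exists d => // y /Hd.
by rewrite -normc_conj rmorphB.
Qed.

Lemma inv_circle rho t : 0 < rho ->
  (rho%:C * expi t)^-1 = (rho ^- 2)%:C * (rho%:C * expi t)^*.
Proof.
move=> r0; set w := _ * _; have wJ : w * w^* = (rho ^+ 2)%:C.
  by rewrite mulcJ normc_circle// ltW.
have w0 : w != 0 by rewrite -normc_gt0 normc_circle// ltW.
apply: (mulfI w0); rewrite mulfV// mulrCA wJ -rmorphM /= mulVf//.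
by rewrite expf_neq0// gt_eqF.
Qed.

(** On a circle [1 / w] is a multiple of the conjugate of [w], so this is the conjugate of a mean of
    [f w] times a positive power of [w], which vanishes. *)
Lemma circ_conj_coef f r rho m : (forall w, normc w < r -> differentiable f w) ->
  0 < rho -> rho < r -> circ (fun w => (f w)^* / w ^+ m.+1) rho = 0.
Proof.
move=> df r0 rr; have rr' : 0 <= rho < r by rewrite ltW.
have cf w : normc w = rho -> ccont (fun w => f w * w ^+ m.+1) w.
  move=> wr; apply/differentiable_ccont/differentiableM; last exact: differentiable_cpow.
  by apply: df; rewrite wr.
have cF t := rccont_circ (ltW r0) cf t.
suff -> : circ (fun w => (f w)^* / w ^+ m.+1) rho =
    (rho ^- 2 ^+ m.+1)%:C * (circ (fun w => f w * w ^+ m.+1) rho)^*.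
  by rewrite (circ_neg m df rr') cj0 mulr0.
rewrite /circ -cmean_conj// -cmeanZ; last by move=> t; exact: conj_rccont.
apply: eq_cmean => t.
rewrite -exprVn inv_circle//; move: (_ * expi t) => w.
rewrite exprMn cjM cjX mulrCA; congr (_ * _).
by rewrite rmorphXn.
Qed.

(* All higher Taylor coefficients are bounded by the circle mean of
   Re f(0) - Re f, which vanishes. *)
Lemma re_max0 f r z : (forall w, normc w < r -> differentiable f w) ->
  (forall w, normc w < r -> Rec (f w) <= Rec (f 0)) -> normc z < r -> f z = f 0.
Proof.
move=> df fm zr.
pose rho := (normc z + r) / 2.
have zrho : normc z < rho by rewrite /rho; move: zr; clear; lra.
have rr : rho < r by rewrite /rho; move: zr; clear; lra.
have r0 : 0 < rho by apply: le_lt_trans zrho; exact: normc_ge0.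
have rr0 : 0 <= rho < r by rewrite ltW.
have cfw w : normc w < r -> ccont f w by move=> wr; exact/differentiable_ccont/df.
have cf w : normc w = rho -> ccont f w by move=> E; apply: cfw; rewrite E.
have cF t := rccont_circ (ltW r0) cf t.
pose F t := f (rho%:C * expi t).
pose k := f 0 + (f 0)^*.
pose v t : C := k - (F t + (F t)^*).
have cv t : rccont v t.
  apply: rccontB; first exact: rccont_cst.
  by apply: rccontD => //; exact: conj_rccont.
have vE t : v t = (2 * (Rec (f 0) - Rec (F t)))%:C.
  by apply: eqC; rewrite /v /k !ReImE /=; ring.
have v0 t : 0 <= 2 * (Rec (f 0) - Rec (F t)).
  rewrite mulr_ge0// subr_ge0; apply: fm; rewrite normc_circle// ltW//.
have nv t : normc (v t) = Rec (v t).
  by rewrite vE normc_real ger0_norm.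
have mF : cmean F = f 0.
  have cf0 : ccont f 0 by apply: cfw; rewrite normc0 (lt_trans r0).
  exact: (circ_mean cf0 (fun w wr _ => df w wr) rr0).
have mv : cmean v = 0.
  rewrite cmeanB; last 2 first.
  - by move=> t; exact: rccont_cst.
  - by move=> t; apply: rccontD => //; exact: conj_rccont.
  rewrite cmean_cst cmeanD//; last by move=> t; exact: conj_rccont.
  by rewrite cmean_conj// mF subrr.
have Iv : (pi *+ 2)^-1 * \int[leb]_(t in `[0, pi *+ 2]) Rec (v t) = 0.
  have := congr1 (fun z => Rec z) mv; rewrite /cmean ReM /= mul0r subr0.
  by [].
have cp m w : normc w = rho -> ccont (fun w => (w ^+ m)^-1) w.
  move=> wr; apply/differentiable_ccont/differentiableV; first exact: differentiable_cpow.
  by rewrite expf_neq0// -normc_gt0 wr.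
have cP m t := rccont_circ (ltW r0) (cp m) t.
have c0 m : ccoef f rho m.+1 = 0.
  have d1 : (forall w, normc w < r -> differentiable (fun=> 1 : C) w).
    by move=> w _; exact: differentiable_cst'.
  have E : cmean (fun t => v t * ((rho%:C * expi t) ^+ m.+1)^-1) = - ccoef f rho m.+1.
    have -> : cmean (fun t => v t * ((rho%:C * expi t) ^+ m.+1)^-1) =
      cmean (fun t => (k * ((rho%:C * expi t) ^+ m.+1)^-1 -
       F t / (rho%:C * expi t) ^+ m.+1) - (F t)^* / (rho%:C * expi t) ^+ m.+1).
      by apply: eq_cmean => t; rewrite /v; ring.
    have h1 t : rccont (fun t => k * ((rho%:C * expi t) ^+ m.+1)^-1) t.
      by apply: rccontZ.
    have h2 t : rccont (fun t => F t / (rho%:C * expi t) ^+ m.+1) t.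
      by apply: rccontM.
    have h3 t : rccont (fun t => (F t)^* / (rho%:C * expi t) ^+ m.+1) t.
      by apply: rccontM => //; exact: conj_rccont.
    have h12 t : rccont (fun t => k * ((rho%:C * expi t) ^+ m.+1)^-1 -
       F t / (rho%:C * expi t) ^+ m.+1) t by apply: rccontB.
    rewrite (cmeanB h12 h3) (cmeanB h1 h2) cmeanZ//.
    have -> : cmean (fun t => ((rho%:C * expi t) ^+ m.+1)^-1) = 0.
      rewrite -(circ_conj_coef m d1 r0 rr); apply: eq_cmean => t.
      by rewrite cj1 mul1r.
    rewrite [cmean (fun t => (F t)^* / _)](circ_conj_coef m df r0 rr).
    by rewrite mulr0 sub0r subr0.
  apply/eqP; rewrite -oppr_eq0 -E -normc_eq0 eq_le normc_ge0 andbT.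
  apply: le_trans (cmean_normcE _) _; first by move=> t; apply: rccontM.
  rewrite (_ : \int[leb]_(t in _) _ = rho ^- m.+1 * \int[leb]_(t in `[0, pi *+ 2]) Rec (v t)).
    by rewrite mulrCA Iv mulr0.
  have [i1 _] := rccont_integrable (fun t (_ : 0 <= t <= pi *+ 2) => cv t).
  rewrite -RintegralZl//; apply: eq_Rintegral => t _.
  by rewrite normcM normcV normcX normc_circle ?ltW// nv mulrC.
apply/eqP; rewrite -subr_eq0 -normc_eq0 eq_le normc_ge0 andbT.
have [M HM] := @rccont_bounded R F 0 (pi *+ 2) (@twopi_ge0 R) (fun t _ => cF t).
apply: (@le_of_geometric _ (normc z / rho) (M * (rho / (rho - normc z)) * (normc z / rho))).
  by rewrite divr_ge0 ?normc_ge0 ?(ltW r0)//= ltr_pdivrMr// mul1r.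
move=> K; have := @cauchy_expansion R f r rho z M K.+1 df rr zrho HM.
rewrite big_ord_recl /= (ccoef0 df)// expr0 mulr1 big1 ?addr0; last first.
  by move=> i _; rewrite /bump /= add1n c0 mul0r.
move/le_trans; apply; rewrite le_eqVlt; apply/orP; left; apply/eqP.
by rewrite exprS; ring.
Qed.

Definition mobius a z : C := (z + a) / (1 + a^* * z).

Lemma mobius_den a z : normc a < 1 -> normc z < 1 -> 1 + a^* * z != 0.
Proof.
move=> a1 z1; apply/eqP => /eqP; rewrite addr_eq0 => /eqP /(congr1 (fun z => normc z)).
rewrite normc1 normcNE normcM normc_conj => E.
have := normc_ge0 a; have := normc_ge0 z; nra.
Qed.

Lemma mobius_disk a z : normc a < 1 -> normc z < 1 -> normc (mobius a z) < 1.
Proof.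
move=> a1 z1; have d0 := mobius_den a1 z1.
have n0 : 0 < normc (1 + a^* * z) by rewrite normc_gt0.
rewrite normcM normcV ltr_pdivrMr// mul1r.
rewrite -(@ltr_pXn2r _ 2)// ?nnegrE ?normc_ge0// !sqr_normcE -subr_gt0.
have : 0 < (1 - normc a ^+ 2) * (1 - normc z ^+ 2).
  by rewrite mulr_gt0// subr_gt0 expr_lt1// normc_ge0.
rewrite !sqr_normcE; case: (a) => x y; case: (z) => u v; rewrite !ReImE /=.
by set A := (X in 0 < X -> _); set B := (X in _ -> 0 < X); suff -> : B = A by [];
  rewrite /A /B; ring.
Qed.

Lemma mobiusK a z : normc a < 1 -> normc z < 1 -> mobius a (mobius (- a) z) = z.
Proof.
move=> a1 z1; have Na1 : normc (- a) < 1 by rewrite normcNE.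
have d0 := mobius_den Na1 z1; have d1 := mobius_den a1 (mobius_disk Na1 z1).
move: d0 d1; rewrite /mobius rmorphN /= mulNr => d0 d1.
have dd : 1 - a^* * z + a^* * (z - a) != 0.
  move: d1; apply: contraNneq => E.
  have -> : 1 + a^* * ((z - a) / (1 - a^* * z)) =
    (1 - a^* * z + a^* * (z - a)) / (1 - a^* * z) by field.
  by rewrite E mul0r.
by field; rewrite d0 dd.
Qed.

Lemma differentiable_mobius a z : normc a < 1 -> normc z < 1 ->
  differentiable (mobius a) z.
Proof.
move=> a1 z1; apply: differentiableM.
  by apply: differentiableD; [exact: differentiable_idC|exact: differentiable_cst'].
apply: differentiableV; last exact: mobius_den.
apply: differentiableD; first exact: differentiable_cst'.
by apply: differentiableM; [exact: differentiable_cst'|exact: differentiable_idC].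
Qed.

Lemma mobius0 a : mobius a 0 = a.
Proof. by rewrite /mobius mulr0 addr0 add0r divr1. Qed.

(** A disc automorphism moves the maximum point [a] to the centre. *)
Lemma re_max f a z : (forall w, normc w < 1 -> differentiable f w) ->
  normc a < 1 -> (forall w, normc w < 1 -> Rec (f w) <= Rec (f a)) ->
  normc z < 1 -> f z = f a.
Proof.
move=> df a1 fm z1; have Na1 : normc (- a) < 1 by rewrite normcNE.
have := @re_max0 (f \o mobius a) 1 (mobius (- a) z).
rewrite /= mobiusK// mobius0; apply; last exact: mobius_disk.
  move=> w w1; apply: differentiable_comp; first exact: differentiable_mobius.
  by apply: df; exact: mobius_disk.
by move=> w w1; apply: fm; exact: mobius_disk.
Qed.

End CauchyConsequences.

(** * Differential calculus in the real plane *)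

Section PlaneCalculus.
Variable R : realType.
Notation C := R[i].
Implicit Types (g u v : R * R -> R) (p q e : R * R).

Lemma is_derive_line g p e (t : R) : derivable g (p + t *: e) e ->
  is_derive t 1 (fun s : R => g (p + s *: e)) ('D_e g (p + t *: e)).
Proof.
move=> dg.
have E : (fun h : R => h^-1 *: (((fun s : R => g (p + s *: e)) \o shift t) (h *: 1) - g (p + t *: e))) =
    (fun h : R => h^-1 *: ((g \o shift (p + t *: e)) (h *: e) - g (p + t *: e))).
  apply/funext => h /=; congr (_ *: (g _ - _)).
  by rewrite [h *: 1]mulr1 scalerDl addrCA.
by split; rewrite /derivable /derive E.
Qed.

Lemma line_MVT g p e (h : R) :
  (forall t, `|t| <= `|h| -> derivable g (p + t *: e) e) ->
  exists2 s, `|s| <= `|h| & g (p + h *: e) - g p = h * 'D_e g (p + s *: e).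
Proof.
move=> dg; pose f (s : R) := g (p + s *: e).
have df (t : R) : `|t| <= `|h| -> is_derive t 1 f ('D_e g (p + t *: e)).
  by move=> /dg; exact: is_derive_line.
have f0 : f 0 = g p by rewrite /f scale0r addr0.
have cf (t : R) : `|t| <= `|h| -> {for t, continuous f}.
  by move=> /df [d _]; apply/differentiable_continuous/derivable1_diffP.
have [h0|h0] := leP 0 h.
  have [x| |s] := @MVT_segment R f (fun t => 'D_e g (p + t *: e)) 0 h h0.
    rewrite in_itv /= => /andP[x0 xh]; apply: df.
    by rewrite !ger0_norm// ltW.
    apply: continuous_in_subspaceT => t /set_mem /=; rewrite in_itv /= => /andP[t0 th].
    by apply: cf; rewrite !ger0_norm.
  rewrite in_itv /= => /andP[s0 sh] E; exists s; first by rewrite !ger0_norm.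
  by rewrite -f0 -[g _]/(f h) E subr0 mulrC.
have [x| |s] := @MVT_segment R f (fun t => 'D_e g (p + t *: e)) h 0 (ltW h0).
  rewrite in_itv /= => /andP[x0 xh]; apply: df.
  by rewrite !ltr0_norm// lerN2 ltW.
  apply: continuous_in_subspaceT => t /set_mem /=; rewrite in_itv /= => /andP[t0 th].
  by apply: cf; rewrite ler0_norm// ltr0_norm// lerN2.
rewrite in_itv /= => /andP[s0 sh] E; exists s; first by rewrite ler0_norm// ltr0_norm// lerN2.
by rewrite -f0 -[g _]/(f h) -opprB E sub0r mulrN opprK mulrC.
Qed.

Definition e1 : R * R := (1, 0).
Definition e2 : R * R := (0, 1).

Definition inbox p (d : R) q := `|q.1 - p.1| < d /\ `|q.2 - p.2| < d.

Lemma continuous_atP g p : continuous_at p g -> forall e : R, 0 < e ->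
  exists2 d : R, 0 < d & forall q, inbox p d q -> `|g q - g p| < e.
Proof.
move=> /cvgrPdist_lt H e e0; have /nbhs_ballP[d /= d0 Hd] := H e e0.
exists d => // q [q1 q2]; rewrite distrC; apply: Hd.
by split; rewrite /ball /= distrC.
Qed.

Lemma line_e1 p (t : R) : p + t *: e1 = (p.1 + t, p.2).
Proof.
rewrite [LHS](_ : _ = (p.1 + t * 1, p.2 + t * 0)); last by case: p.
by rewrite mulr1 mulr0 addr0.
Qed.

Lemma line_e2 p (t : R) : p + t *: e2 = (p.1, p.2 + t).
Proof.
rewrite [LHS](_ : _ = (p.1 + t * 0, p.2 + t * 1)); last by case: p.
by rewrite mulr1 mulr0 addr0.
Qed.

Lemma C1_differentiable g p (r0 : R) : 0 < r0 ->
  (forall q, inbox p r0 q -> derivable g q e1 /\ derivable g q e2) ->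
  continuous_at p ('D_e1 g) -> continuous_at p ('D_e2 g) ->
  forall e : R, 0 < e -> exists2 d : R, 0 < d & forall h1 h2 : R, `|h1| < d -> `|h2| < d ->
    `|g (p.1 + h1, p.2 + h2) - g p - ('D_e1 g p * h1 + 'D_e2 g p * h2)| <=
      e * (`|h1| + `|h2|).
Proof.
move=> r00 dg c1 c2 e e0.
have [d1 d10 H1] := continuous_atP c1 e0; have [d2 d20 H2] := continuous_atP c2 e0.
exists (Num.min r0 (Num.min d1 d2)); first by rewrite !lt_min r00 d10.
move=> h1 h2; rewrite !lt_min => /and3P[a1 a2 a3] /and3P[b1 b2 b3].
have [|s1 s1h E1] := @line_MVT g (p.1, p.2 + h2) e1 h1.
  move=> t th; rewrite line_e1 /=; apply: (proj1 (dg _ _)).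
  by split; rewrite /= addrAC subrr add0r//; apply: le_lt_trans a1.
have [|s2 s2h E2] := @line_MVT g p e2 h2.
  move=> t th; rewrite line_e2 /=; apply: (proj2 (dg _ _)).
  by split; rewrite /= ?subrr ?normr0//addrAC subrr add0r; apply: le_lt_trans b1.
move: E1 E2; rewrite !line_e1 !line_e2 /= => E1 E2.
have -> : g (p.1 + h1, p.2 + h2) - g p - ('D_e1 g p * h1 + 'D_e2 g p * h2) =
   h1 * ('D_e1 g (p.1 + s1, p.2 + h2) - 'D_e1 g p) + h2 * ('D_e2 g (p.1, p.2 + s2) - 'D_e2 g p).
  rewrite !mulrBr -E1 -E2; ring.
apply: le_trans (ler_normD _ _) _; rewrite [leRHS]mulrDr !normrM ![e * _]mulrC.
apply: lerD; rewrite ler_wpM2l//; apply/ltW.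
- apply: H1; split; rewrite /= addrAC subrr add0r//; exact: le_lt_trans a2.
- by apply: H2; split; rewrite /= ?subrr ?normr0//addrAC subrr add0r; exact: le_lt_trans b3.
Qed.

(** Two mean value theorems, one in each direction, applied to the second difference of [g]. *)
Lemma clairaut_point g p (r0 : R) (x y : R) : 0 < x < r0 -> 0 < y < r0 ->
  (forall q, inbox p r0 q -> derivable g q e1 /\ derivable ('D_e1 g) q e2) ->
  exists2 q, inbox p r0 q /\ (`|q.1 - p.1| <= x /\ `|q.2 - p.2| <= y) &
   g (p.1 + x, p.2 + y) - g (p.1 + x, p.2) - g (p.1, p.2 + y) + g p =
     x * y * 'D_e2 ('D_e1 g) q.
Proof.
move=> /andP[x0 xr] /andP[y0 yr] dg.
pose k q := g (q.1, q.2 + y) - g q.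
have addE q : q + (0, y) = (q.1, q.2 + y).
  by case: q => a b; rewrite [LHS](_ : _ = (a + 0, b + y))// addr0.
have kE : k = (fun q => g (q + (0, y))) - g.
  by apply/funext => q; rewrite /k -addE.
have shE q (v : R * R) : (fun h : R => h^-1 *: (((fun q => g (q + (0, y))) \o shift q) (h *: v) - g (q + (0, y)))) =
    (fun h : R => h^-1 *: ((g \o shift (q + (0, y))) (h *: v) - g (q + (0, y)))).
  by apply/funext => h /=; rewrite addrA.
have sd q (v : R * R) : derivable g (q + (0, y)) v -> derivable (fun q => g (q + (0, y))) q v.
  by rewrite /derivable shE.
have sD q (v : R * R) : 'D_v (fun q => g (q + (0, y))) q = 'D_v g (q + (0, y)).
  by rewrite /derive shE.
have [|s sx E] := @line_MVT k p e1 x.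
  move=> t; rewrite (gtr0_norm x0) => tx; rewrite line_e1 kE; apply: derivableB.
    apply: sd; rewrite addE /=; apply: (proj1 (dg _ _)).
    split; rewrite /= addrAC subrr add0r; first exact: le_lt_trans xr.
    by rewrite gtr0_norm.
  apply: (proj1 (dg _ _)); split; rewrite /= ?subrr ?normr0 ?(lt_trans y0)//.
  by rewrite addrAC subrr add0r; exact: le_lt_trans xr.
rewrite (gtr0_norm x0) in sx.
have DK : 'D_e1 k (p + s *: e1) = 'D_e1 g (p + s *: e1 + (0, y)) - 'D_e1 g (p + s *: e1).
  rewrite kE deriveB ?sD// line_e1.
    apply: sd; rewrite addE /=; apply: (proj1 (dg _ _)).
    split; rewrite /= addrAC subrr add0r; first exact: le_lt_trans xr.
    by rewrite gtr0_norm.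
  apply: (proj1 (dg _ _)); split; rewrite /= ?subrr ?normr0 ?(lt_trans y0)//.
  by rewrite addrAC subrr add0r; exact: le_lt_trans xr.
move: E; rewrite DK !line_e1 addE /k /= => E.
have [|s' sy E'] := @line_MVT ('D_e1 g) (p.1 + s, p.2) e2 y.
  move=> t; rewrite (gtr0_norm y0) => ty; rewrite line_e2 /=; apply: (proj2 (dg _ _)).
  by split; rewrite /= addrAC subrr add0r; [exact: le_lt_trans xr|exact: le_lt_trans yr].
rewrite (gtr0_norm y0) in sy.
move: E'; rewrite !line_e2 /= => E'.
exists (p.1 + s, p.2 + s').
  by split; split; rewrite /= addrAC subrr add0r//; [exact: le_lt_trans xr|exact: le_lt_trans yr].
by rewrite -mulrA -E' -E; ring.
Qed.

Lemma dist_half (a b c e : R) : `|a - b| < e / 2 -> `|a - c| < e / 2 ->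
  `|b - c| <= e.
Proof. by rewrite !ltr_norml ler_norml; lra. Qed.

Lemma clairaut g p (r0 : R) : 0 < r0 ->
  (forall q, inbox p r0 q -> [/\ derivable g q e1, derivable g q e2,
     derivable ('D_e1 g) q e2 & derivable ('D_e2 g) q e1]) ->
  continuous_at p ('D_e2 ('D_e1 g)) -> continuous_at p ('D_e1 ('D_e2 g)) ->
  'D_e2 ('D_e1 g) p = 'D_e1 ('D_e2 g) p.
Proof.
move=> r00 dg c1 c2; apply/eqP; rewrite -subr_eq0 -normr_eq0 eq_le normr_ge0 andbT.
apply/ler_addgt0Pl => e e0; rewrite addr0.
have e20 : 0 < e / 2 by rewrite divr_gt0.
have [d1 d10 H1] := continuous_atP c1 e20; have [d2 d20 H2] := continuous_atP c2 e20.
pose x := Num.min (r0 / 2) (Num.min (d1 / 2) (d2 / 2)).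
have x0 : 0 < x by rewrite !lt_min !divr_gt0.
have xr : x < r0.
  by apply: (@le_lt_trans _ _ (r0 / 2)); [rewrite ge_min lexx|move: r00; clear; lra].
have xd1 : x < d1.
  by apply: (@le_lt_trans _ _ (d1 / 2)); [rewrite !ge_min lexx orbT|move: d10; clear; lra].
have xd2 : x < d2.
  by apply: (@le_lt_trans _ _ (d2 / 2)); [rewrite !ge_min lexx !orbT|move: d20; clear; lra].
clearbody x; have xx : 0 < x < r0 by rewrite x0.
have [q|q [_ [q1 q2]] E1] := @clairaut_point g p r0 x x xx xx.
  by move=> /dg[].
(* Exchanging the variables leaves the second difference unchanged but produces the other mixed
   derivative, so one lemma serves both orders. *)
pose g' q := g (q.2, q.1).
have sw (k : R * R -> R) (o v : R * R) : (fun h : R => h^-1 *: (((fun q => k (q.2, q.1)) \o shift o) (h *: v) - k (o.2, o.1))) =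
    (fun h : R => h^-1 *: ((k \o shift (o.2, o.1)) (h *: (v.2, v.1)) - k (o.2, o.1))).
  by [].
have D1 (k : R * R -> R) : 'D_e1 (fun q => k (q.2, q.1)) = (fun q => 'D_e2 k (q.2, q.1)).
  by apply/funext => s; rewrite /derive sw.
have D2 (k : R * R -> R) : 'D_e2 (fun q => k (q.2, q.1)) = (fun q => 'D_e1 k (q.2, q.1)).
  by apply/funext => s; rewrite /derive sw.
have dsw (k : R * R -> R) (o v : R * R) : derivable k (o.2, o.1) (v.2, v.1) ->
    derivable (fun q => k (q.2, q.1)) o v.
  by rewrite /derivable -sw.
have [q'|s [_ [/= s1 s2]] E2] := @clairaut_point g' (p.2, p.1) r0 x x xx xx.
  move=> [a b]; have [//|h1 h2 h3 h4] := dg (q'.2, q'.1).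
  split; first exact: (dsw g q' e1 h2).
  by rewrite D1; exact: (dsw ('D_e2 g) q' e2 h4).
have DD : 'D_e2 ('D_e1 g') s = 'D_e1 ('D_e2 g) (s.2, s.1).
  by rewrite (D1 g); exact: (congr1 (fun F => F s) (D2 ('D_e2 g))).
move: E2; rewrite DD /g' /= -surjective_pairing => E2.
have E12 : g (p.1 + x, p.2 + x) - g (p.1 + x, p.2) - g (p.1, p.2 + x) + g p =
    g (p.1 + x, p.2 + x) - g (p.1, p.2 + x) - g (p.1 + x, p.2) + g p.
  by move: (g _) (g _) (g _) (g _) => ? ? ? ?; ring.
have {}E2 := etrans (esym E1) (etrans E12 E2).
have xn0 : x != 0 by rewrite gt_eqF.
have xx0 := mulf_neq0 xn0 xn0.
have {}E2 := mulfI xx0 E2.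
have A : `|'D_e2 ('D_e1 g) q - 'D_e2 ('D_e1 g) p| < e / 2.
  by apply: H1; split; [exact: le_lt_trans xd1|exact: le_lt_trans xd1].
have B : `|'D_e1 ('D_e2 g) (s.2, s.1) - 'D_e1 ('D_e2 g) p| < e / 2.
  by apply: H2; split; [exact: le_lt_trans xd2|exact: le_lt_trans xd2].
rewrite E2 in A; exact: (dist_half A B).
Qed.

Definition rediff g p (a b : R) := forall e : R, 0 < e ->
  exists2 d : R, 0 < d & forall h1 h2 : R, `|h1| < d -> `|h2| < d ->
    `|g (p.1 + h1, p.2 + h2) - g p - (a * h1 + b * h2)| <= e * (`|h1| + `|h2|).

Lemma rediffN v p (a b : R) : rediff v p a (- b) ->
  rediff (fun q => - v q) p (- a) b.
Proof.
move=> H e /H[d d0 Hd]; exists d => // h1 h2 h1d h2d.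
apply: le_trans (Hd h1 h2 h1d h2d); rewrite -normrN.
by rewrite le_eqVlt; apply/orP; left; apply/eqP; congr (`|_|); ring.
Qed.

Lemma cauchy_riemann u v (z : C) (a b : R) :
  rediff u (Rec z, Imc z) a b -> rediff v (Rec z, Imc z) (- b) a ->
  cderiv (fun w => u (Rec w, Imc w) +i* v (Rec w, Imc w)) z (a -i* b).
Proof.
move=> du dv e e0; have e40 : 0 < e / 4 by rewrite divr_gt0.
have [d1 d10 H1] := du _ e40; have [d2 d20 H2] := dv _ e40.
exists (Num.min d1 d2); first by rewrite lt_min d10.
move=> h; rewrite lt_min => /andP[hd1 hd2].
have rh := Re_le_normc h; have ih := Im_le_normc h.
have {H1} := H1 _ _ (le_lt_trans rh hd1) (le_lt_trans ih hd1).
have {H2} := H2 _ _ (le_lt_trans rh hd2) (le_lt_trans ih hd2).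
rewrite /= => A B; apply: le_trans (normc_le_ReIm _) _; rewrite !ReImE /=.
have E : e / 4 * (`|Rec h| + `|Imc h|) <= e / 2 * normc h.
  apply: le_trans (_ : e / 4 * (normc h + normc h) <= _).
    by rewrite ler_pM2l// lerD.
  by rewrite le_eqVlt; apply/orP; left; apply/eqP; field.
rewrite (_ : e * normc h = e / 2 * normc h + e / 2 * normc h); last by field.
rewrite mulNr in A.
apply: lerD; [apply: le_trans (le_trans B E)|apply: le_trans (le_trans A E)].
  by rewrite le_eqVlt; apply/orP; left; apply/eqP; congr (`|_|); ring.
by rewrite le_eqVlt; apply/orP; left; apply/eqP; congr (`|_|); ring.
Qed.

End PlaneCalculus.

(** * Harmonic functions on the unit disc *)

Section Harmonic.
Variable R : realType.
Notation C := R[i].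
Notation D := (@unit_disk R).
Implicit Types (g u v : R * R -> R) (p q e : R * R).
Notation e1 := (@e1 R).
Notation e2 := (@e2 R).
Notation U := (@toC R @^-1` D).

(** Twice the Wirtinger derivative of [g] in [z]. For harmonic [g] it is holomorphic: its
    Cauchy-Riemann equations are Laplace's equation and the symmetry of the second derivatives. *)
Definition grad g (z : C) : C :=
  'D_e1 g (Rec z, Imc z) -i* 'D_e2 g (Rec z, Imc z).

Lemma in_unit_disk (z : C) : D z <-> normc z < 1.
Proof. by rewrite /unit_disk /= normrC ltcR. Qed.

Lemma unit_disk_box (z : C) : D z ->
  exists2 r0 : R, 0 < r0 & forall q, inbox (Rec z, Imc z) r0 q -> U q.
Proof.
move=> /in_unit_disk z1; exists ((1 - normc z) / 2).
  by rewrite divr_gt0// subr_gt0.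
move=> [a b] [/= h1 h2]; apply/in_unit_disk => /=.
have -> : a +i* b = z + ((a - Rec z) +i* (b - Imc z)).
  by apply: eqC; rewrite ?ReImE /=; ring.
apply: le_lt_trans (normcD _ _) _.
have := normc_le_ReIm ((a - Rec z) +i* (b - Imc z)); rewrite /=.
move: h1 h2; clear; lra.
Qed.

Lemma UE (z : C) : U (Rec z, Imc z) <-> D z.
Proof. by case: z. Qed.

Lemma C_k1_rediff g (z : C) : C_k 1 U g -> D z ->
  rediff g (Rec z, Imc z) ('D_e1 g (Rec z, Imc z)) ('D_e2 g (Rec z, Imc z)).
Proof.
move=> [_ dg] Dz e; have [r0 r00 rU] := unit_disk_box Dz.
have [dg1 [cg1 _]] := dg e1; have [dg2 [cg2 _]] := dg e2.
apply: (C1_differentiable r00).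
- by move=> q /rU Uq; split; [exact: dg1|exact: dg2].
- by apply: cg1; apply/UE.
- by apply: cg2; apply/UE.
Qed.

Lemma grad_holomorphic g : harmonic_real_on U g ->
  forall z, normc z < 1 -> differentiable (grad g) z.
Proof.
move=> [[cg dg] lg] z /in_unit_disk Dz.
have [r0 r00 rU] := unit_disk_box Dz.
have [dg1 Cg1] := dg e1; have [dg2 Cg2] := dg e2.
have Cg1' := Cg1; have Cg2' := Cg2.
case: Cg1' => cg1 dd1; case: Cg2' => cg2 dd2.
have [d11 [c11 _]] := dd1 e1; have [d12 [c12 _]] := dd1 e2.
have [d21 [c21 _]] := dd2 e1; have [d22 [c22 _]] := dd2 e2.
set p := (Rec z, Imc z); have Up : U p by apply/UE.
have sym : 'D_e2 ('D_e1 g) p = 'D_e1 ('D_e2 g) p.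
  apply: (clairaut r00); [|exact: c12|exact: c21].
  by move=> q /rU Uq; split; [exact: dg1|exact: dg2|exact: d12|exact: d21].
have lap : 'D_e2 ('D_e2 g) p = - 'D_e1 ('D_e1 g) p.
  have L : 'D_e1 ('D_e1 g) p + 'D_e2 ('D_e2 g) p = 0 := lg p Up.
  by apply/eqP; rewrite -addr_eq0 addrC L.
have R1 : rediff ('D_e1 g) p ('D_e1 ('D_e1 g) p) ('D_e2 ('D_e1 g) p) := C_k1_rediff Cg1 Dz.
have R2 : rediff ('D_e2 g) p ('D_e1 ('D_e2 g) p) ('D_e2 ('D_e2 g) p) := C_k1_rediff Cg2 Dz.
rewrite -sym lap in R2.
apply/diff_cderiv; exists ('D_e1 ('D_e1 g) p -i* 'D_e2 ('D_e1 g) p).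
exact: (cauchy_riemann R1 (rediffN R2)).
Qed.

Lemma derive_dir g (z w : C) : C_k 1 U g -> D z ->
  'D_(Rec w, Imc w) g (Rec z, Imc z) = Rec (grad g z * w).
Proof.
move=> Cg Dz; set p := (Rec z, Imc z); set d := (Rec w, Imc w).
have H := C_k1_rediff Cg Dz; rewrite -/p in H.
case: Cg => _ dg; have [dgd _] := dg d.
have dv : is_derive (0 : R) 1 (fun s : R => g (p + s *: d)) ('D_d g p).
  have := @is_derive_line _ g p d 0; rewrite scale0r addr0; apply.
  by apply: dgd; apply/UE.
apply/eqP; rewrite -subr_eq0 -normr_eq0 eq_le normr_ge0 andbT.
apply/ler_addgt0Pl => e e0; rewrite addr0.
have K0 : 0 < 1 + `|d.1| + `|d.2| by rewrite !ltr_wpDr.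
have eK : 0 < e / (1 + `|d.1| + `|d.2|) by rewrite divr_gt0.
have [r1 r10 H1] := rderiv dv eK; have [r2 r20 H2] := H _ eK.
pose h := Num.min (r1 / 2) (r2 / (1 + `|d.1| + `|d.2|)).
have h0 : 0 < h by rewrite lt_min !divr_gt0.
have hr1 : `|h| < r1.
  rewrite gtr0_norm//; apply: (@le_lt_trans _ _ (r1 / 2)); first by rewrite ge_min lexx.
  by move: r10; clear; lra.
have hK : h * (1 + `|d.1| + `|d.2|) <= r2 by rewrite -ler_pdivlMr// ge_min lexx orbT.
have n1 := normr_ge0 d.1; have n2 := normr_ge0 d.2.
have k1 : `|h * d.1| < r2 by rewrite normrM gtr0_norm//; nra.
have k2 : `|h * d.2| < r2 by rewrite normrM gtr0_norm//; nra.
have {H1} := H1 h hr1; have {H2} := H2 _ _ k1 k2.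
rewrite scale0r addr0 add0r !normrM (gtr0_norm h0).
have -> : p + h *: d = (p.1 + h * d.1, p.2 + h * d.2) by [].
set X := g _ - g p => A B.
rewrite -(@ler_pM2l _ h)// -{1}(gtr0_norm h0) -normrM.
have -> : h * ('D_d g p - Rec (grad g z * w)) =
  (X - ('D_e1 g p * (h * d.1) + 'D_e2 g p * (h * d.2))) - (X - 'D_d g p * h).
  by rewrite ReM /grad /= -/p; ring.
apply: le_trans (ler_normB _ _) _; apply: le_trans (lerD A B) _.
set k := 1 + `|d.1| + `|d.2| in K0 *.
rewrite (_ : _ + _ = e / k * (h * k)); last by rewrite /k; ring.
by rewrite mulrCA divfK// gt_eqF.
Qed.

Lemma is_derive_powsum (a : nat -> R) (K : nat) (t : R) :
  is_derive t 1 (fun s : R => \sum_(m < K) a m * s ^+ m.+1 / m.+1%:R)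
    (\sum_(m < K) a m * t ^+ m).
Proof.
elim: K => [|K IH].
  rewrite big_ord0 (_ : (fun _ => _) = cst 0); first exact: is_derive_cst.
  by apply/funext => s; rewrite big_ord0.
rewrite big_ord_recr /=.
have -> : (fun s : R => \sum_(m < K.+1) a m * s ^+ m.+1 / m.+1%:R) =
  (fun s : R => \sum_(m < K) a m * s ^+ m.+1 / m.+1%:R) + (a K / K.+1%:R) *: (fun s : R => s ^+ K.+1).
  apply/funext => s; rewrite big_ord_recr /=; congr (_ + _).
  by rewrite [RHS](_ : _ = (a K / K.+1%:R) * s ^+ K.+1)// mulrAC.
apply: is_deriveD; have dK : is_derive t 1 (fun s : R => s ^+ K.+1) (K.+1%:R * t ^+ K).
  split; first exact: exprn_derivable.
  by rewrite exp_derive /GRing.scale /= mulr1.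
apply: is_derive_eq.
by rewrite /GRing.scale /= mulrA divfK// pnatr_eq0.
Qed.

(** One coefficient sequence serves all radii. The bound at [w] is stated in terms of a larger
    modulus [normc z], so that it holds along the whole segment from 0 to [z] and survives the mean
    value theorem there. *)
Lemma unit_disk_expansion (G : C -> C) :
  (forall z, normc z < 1 -> differentiable G z) -> exists c : nat -> C,
  forall rho : R, 0 < rho < 1 -> exists M : R, forall (K : nat) (z w : C),
    normc z < rho -> normc w <= normc z ->
    normc (G w - \sum_(m < K) c m * w ^+ m) <=
      M * (normc z / rho) ^+ K / (rho - normc z).
Proof.
move=> dG.
have [c cE] : exists c : nat -> C, forall rho m, 0 < rho < 1 -> ccoef G rho m = c m.
  have h0 : 0 < 2^-1 :> R by rewrite invr_gt0.
  have h1 : 2^-1 < 1 :> R by rewrite invf_lt1// ltr1n.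
  exists (ccoef G 2^-1) => rho m /andP[r0 r1].
  have [l|/ltW l] := leP 2^-1 rho; first exact/esym/(ccoef_cst m dG h0 l r1).
  exact: (ccoef_cst m dG r0 l h1).
exists c => rho r01; have /andP[r0 r1] := r01.
have cf w : normc w = rho -> ccont G w.
  by move=> wr; apply/differentiable_ccont/dG; rewrite wr.
have [M0 HM] := @rccont_bounded R _ 0 (pi *+ 2) (@twopi_ge0 R)
  (fun t _ => rccont_circ (ltW r0) cf t).
have M00 : 0 <= M0.
  by apply: le_trans (normc_ge0 _) (HM 0 _); rewrite lexx twopi_ge0.
exists (M0 * rho) => K z w zr wz; have wr := le_lt_trans wz zr.
have := @cauchy_expansion R G 1 rho w M0 K dG r1 wr HM.
rewrite (eq_bigr (fun m : 'I_K => c m * w ^+ m)); last by move=> m _; rewrite cE.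
move=> /le_trans; apply.
have rw : 0 < rho - normc w by rewrite subr_gt0.
have rz : 0 < rho - normc z by rewrite subr_gt0.
rewrite (_ : M0 * rho * _ / _ = M0 * (normc z / rho) ^+ K * (rho / (rho - normc z))); last by ring.
apply: ler_pM.
- by rewrite mulr_ge0// exprn_ge0// divr_ge0 ?normc_ge0 ?(ltW r0).
- by rewrite divr_ge0 ?(ltW r0) ?(ltW rw).
- rewrite ler_wpM2l// lerXn2r ?nnegrE ?divr_ge0 ?normc_ge0 ?(ltW r0)//.
  by rewrite ler_wpM2r// invr_ge0 ltW.
- by rewrite ler_wpM2l ?(ltW r0)// lef_pV2 ?posrE// lerB.
Qed.

Lemma Re_powsum (c : nat -> C) (K : nat) (z : C) (t : R) :
  Rec ((\sum_(m < K) c m * (t%:C * z) ^+ m) * z) =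
  \sum_(m < K) Rec (c m * z ^+ m.+1) * t ^+ m.
Proof.
elim: K => [|K IH]; first by rewrite !big_ord0 mul0r.
rewrite !big_ord_recr /= mulrDl ReD IH; congr (_ + _).
rewrite exprMn -rmorphXn /= (_ : _ * z = (c K * z ^+ K.+1) * (t ^+ K)%:C).
  by rewrite [LHS]ReM /= mulr0 subr0.
by rewrite exprS; ring.
Qed.

Lemma Re_powsum1 (c : nat -> C) (K : nat) (z : C) :
  Rec (\sum_(m < K) c m * z ^+ m.+1 / m.+1%:R) =
  \sum_(m < K) Rec (c m * z ^+ m.+1) * 1 ^+ m.+1 / m.+1%:R.
Proof.
elim: K => [|K IH]; first by rewrite !big_ord0.
rewrite !big_ord_recr /= ReD IH; congr (_ + _).
rewrite expr1n mulr1 -(rmorph_nat (real_complex R)) -fmorphV.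
by rewrite [LHS]ReM /= mulr0 subr0.
Qed.

(** Along the segment from 0 to [z], the derivative of [g] is the real part of [grad g] times [z].
    The mean value theorem applied to [g] minus the primitive of the Taylor polynomial of [grad g]
    transfers the remainder bound to [g]. *)
Lemma harmonic_real_expansion g : harmonic_real_on U g -> exists c : nat -> C,
  forall rho : R, 0 < rho < 1 -> exists M : R, forall (K : nat) (z : C), normc z < rho ->
    normc (grad g z - \sum_(m < K) c m * z ^+ m) <=
      M * (normc z / rho) ^+ K / (rho - normc z) /\
    `|g (Rec z, Imc z) - g (0, 0) - Rec (\sum_(m < K) c m * z ^+ m.+1 / m.+1%:R)| <=
      M * (normc z / rho) ^+ K / (rho - normc z).
Proof.
move=> hg; have [c Hc] := unit_disk_expansion (grad_holomorphic hg).
exists c => rho r01; have [M HM] := Hc _ r01; exists M => K z zr.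
have /andP[r0 r1] := r01.
have B w : normc w <= normc z -> normc (grad g w - \sum_(m < K) c m * w ^+ m) <=
    M * (normc z / rho) ^+ K / (rho - normc z) by exact: HM.
split; first exact: B.
pose a m := Rec (c m * z ^+ m.+1).
pose d := (Rec z, Imc z).
pose F (t : R) := g (0 + t *: d) - \sum_(m < K) a m * t ^+ m.+1 / m.+1%:R.
have zt (t : R) : 0 <= t <= 1 -> normc (t%:C * z) <= normc z.
  move=> /andP[t0 t1]; rewrite normcM normc_real ger0_norm//.
  by rewrite ler_piMl ?normc_ge0.
have tE (t : R) : 0 + t *: d = (Rec (t%:C * z), Imc (t%:C * z)).
  rewrite add0r [LHS](_ : _ = (t * Rec z, t * Imc z))//; congr pair.
    by rewrite ReM /= mul0r subr0.
  by rewrite ImM /= mul0r addr0.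
have Dt (t : R) : 0 <= t <= 1 -> D (t%:C * z).
  by move=> /zt h; apply/in_unit_disk; apply: le_lt_trans h (lt_trans zr r1).
have C1 : C_k 1 U g.
  by case: hg => -[cg dg] _; split => // v; have [? [? _]] := dg v; split; [|split].
have dF (t : R) : 0 <= t <= 1 ->
    is_derive t 1 F (Rec ((grad g (t%:C * z) - \sum_(m < K) c m * (t%:C * z) ^+ m) * z)).
  move=> t01; have := is_derive_powsum a K t.
  have dl : is_derive t 1 (fun s : R => g (0 + s *: d)) ('D_d g (0 + t *: d)).
    apply: is_derive_line; rewrite tE; case: C1 => _ /(_ d)[+ _]; apply.
    by apply/UE; exact: Dt.
  move=> dp; apply: (is_derive_eq (is_deriveB dl dp)).
  by rewrite tE (derive_dir _ C1 (Dt _ t01)) mulrBl ReD ReN Re_powsum.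
have [x| |s] := @MVT_segment R F (fun t => Rec ((grad g (t%:C * z) -
    \sum_(m < K) c m * (t%:C * z) ^+ m) * z)) 0 1 ler01.
- by rewrite in_itv /= => /andP[x0 x1]; apply: dF; rewrite !ltW.
- apply: continuous_in_subspaceT => t /set_mem /=; rewrite in_itv /= => t01.
  by have [dd _] := dF t t01; apply/differentiable_continuous/derivable1_diffP.
rewrite in_itv /= subr0 mulr1 => s01.
have F0 : F 0 = g (0, 0).
  rewrite /F scale0r addr0 big1 ?subr0// => m _.
  by rewrite exprS mul0r mulr0 mul0r.
have F1 : F 1 = g (Rec z, Imc z) - Rec (\sum_(m < K) c m * z ^+ m.+1 / m.+1%:R).
  by rewrite /F scale1r add0r Re_powsum1.
rewrite F0 F1 => E; rewrite addrAC E.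
apply: le_trans (Re_le_normc _) _; rewrite normcM.
apply: le_trans (B _ (zt _ s01)); rewrite ler_piMr ?normc_ge0//.
exact: ltW (lt_trans zr r1).
Qed.

Lemma grad_eq (u v : R * R -> R) (cu cv : nat -> C) :
  (forall rho : R, 0 < rho < 1 -> exists M : R, forall (K : nat) (z : C), normc z < rho ->
    normc (grad u z - \sum_(m < K) cu m * z ^+ m) <=
      M * (normc z / rho) ^+ K / (rho - normc z)) ->
  (forall rho : R, 0 < rho < 1 -> exists M : R, forall (K : nat) (z : C), normc z < rho ->
    normc (grad v z - \sum_(m < K) cv m * z ^+ m) <=
      M * (normc z / rho) ^+ K / (rho - normc z)) ->
  (forall m, cu m = 'i * cv m) -> forall z, normc z < 1 -> grad u z = 'i * grad v z.
Proof.
move=> Hu Hv cuv z z1; pose rho := (normc z + 1) / 2.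
have zr : normc z < rho by rewrite /rho; move: z1; clear; lra.
have r1 : rho < 1 by rewrite /rho; move: z1; clear; lra.
have r0 : 0 < rho := le_lt_trans (normc_ge0 z) zr.
have r01 : 0 < rho < 1 by rewrite r0.
have [Mu HMu] := Hu _ r01; have [Mv HMv] := Hv _ r01.
apply/eqP; rewrite -subr_eq0 -normc_eq0 eq_le normc_ge0 andbT.
have ni : normc ('i : C) = 1 by rewrite normcE2 /= expr0n expr1n add0r sqrtr1.
apply: (@le_of_geometric _ _ (normc z / rho) ((Mu + Mv) / (rho - normc z))).
  by rewrite divr_ge0 ?normc_ge0 ?(ltW r0)//= ltr_pdivrMr// mul1r.
move=> K; have A := HMu K z zr; have B := HMv K z zr.
set Su := \sum_(m < K) _ in A; set Sv := \sum_(m < K) _ in B.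
have S : Su = 'i * Sv.
  by rewrite /Su /Sv mulr_sumr; apply: eq_bigr => m _; rewrite cuv mulrA.
rewrite (_ : _ - _ = (grad u z - Su) - 'i * (grad v z - Sv)); last by rewrite S; ring.
apply: le_trans (normcB _ _) _; rewrite normcM ni mul1r.
apply: le_trans (lerD A B) _; rewrite le_eqVlt; apply/orP; left; apply/eqP.
by move: (rho - normc z) ((_ / _) ^+ K) => d q; ring.
Qed.

(** [a k] and [b k] belong to the power [k.+1], the constant term being split off as [Phi 0]. If all
    [b k] vanish, then the gradients satisfy [grad u = i grad v], which are the Cauchy-Riemann
    equations for [Phi = u + i v]. *)
Lemma harmonic_expansion (Phi : C -> C) : harmonic_on D Phi ->
  exists a b : nat -> C,
  (forall rho : R, 0 < rho < 1 -> exists M : R, forall (K : nat) (z : C), normc z < rho ->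
     normc (Phi z - Phi 0 - \sum_(k < K) (a k * z ^+ k.+1 + b k * z^* ^+ k.+1)) <=
       M * (normc z / rho) ^+ K / (rho - normc z)) /\
  ((forall k, b k = 0) -> holomorphic_on D Phi).
Proof.
move=> [hu hv].
set u := fun p : R * R => Rec (Phi (toC p)) in hu.
set v := fun p : R * R => Imc (Phi (toC p)) in hv.
have [cu Hu] := harmonic_real_expansion hu; have [cv Hv] := harmonic_real_expansion hv.
have toCK (z : C) : toC (Rec z, Imc z) = z by case: z.
(* The factor 2 comes from writing a real part as half the sum of a number and its conjugate, and
   [k.+1] from integrating [grad]. *)
pose a k := (cu k + 'i * cv k) / (2 * k.+1%:R).
pose b k := ((cu k)^* + 'i * (cv k)^*) / (2 * k.+1%:R).
have nz (k : nat) : (2 * k.+1%:R : C) != 0 by rewrite mulf_neq0// pnatr_eq0.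
have nz1 (k : nat) : (k.+1%:R : C) != 0 by rewrite pnatr_eq0.
have two : (2 : C) != 0 by rewrite pnatr_eq0.
have T (z : C) K : \sum_(k < K) (a k * z ^+ k.+1 + b k * z^* ^+ k.+1) =
    (Rec (\sum_(m < K) cu m * z ^+ m.+1 / m.+1%:R))%:C +
    'i * (Rec (\sum_(m < K) cv m * z ^+ m.+1 / m.+1%:R))%:C.
  elim: K => [|K IH]; first by rewrite !big_ord0 !rmorph0 mulr0 addr0.
  rewrite !big_ord_recr /= IH !ReD !rmorphD /=.
  have RE (w : C) : (Rec w)%:C = (w + w^*) / 2.
    by apply: (mulIf two); rewrite divfK//; apply: eqC; rewrite ?ReImE /=; ring.
  rewrite (RE (cu K * _ / _)) (RE (cv K * _ / _)) !cjM !cjV !cjX.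
  have -> : (K.+1%:R : C)^* = K.+1%:R by rewrite -(rmorph_nat (real_complex R)) cj_real.
  rewrite /a /b; move: (_%:C) (_%:C) => s1 s2.
  move: (nz1 K); move: (K.+1%:R : C) (z ^+ K.+1) (z^* ^+ K.+1) => n x y n0.
  by field; rewrite n0.
exists a, b; split=> [rho r01|b0].
  have [Mu HMu] := Hu _ r01; have [Mv HMv] := Hv _ r01; exists (Mu + Mv) => K z zr.
  have [_ A] := HMu K z zr; have [_ B] := HMv K z zr.
  move: A B; rewrite /u /v toCK (_ : toC (0, 0) = 0)// => A B.
  rewrite T; move: (Rec (\sum_(m < K) _)) (Rec (\sum_(m < K) _)) A B => Y X A B.
  rewrite (_ : _ - _ = (Rec (Phi z) - Rec (Phi 0) - X) +i* (Imc (Phi z) - Imc (Phi 0) - Y)).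
    apply: le_trans (normc_le_ReIm _) _; apply: le_trans (lerD A B) _;
    rewrite le_eqVlt; apply/orP; left; apply/eqP.
    by move: (rho - normc z) ((_ / _) ^+ K) => d q; ring.
  by apply: eqC; rewrite !ReImE /=; ring.
move=> z Dz; have z1 := proj1 (in_unit_disk z) Dz.
have cuv m : cu m = 'i * cv m.
  have := b0 m; rewrite /b => /eqP; rewrite mulf_eq0 invr_eq0 (negPf (nz m)) orbF => /eqP E.
  have := congr1 (@cj R) E; rewrite cjD cjM !cjK cj0.
  have -> : ('i : C)^* = - 'i by apply: eqC; rewrite /= ?oppr0.
  by rewrite mulNr => /eqP; rewrite subr_eq0 => /eqP.
have G := @grad_eq u v cu cv
  (fun rho r01 => let: ex_intro M HM := Hu rho r01 in ex_intro _ M (fun K z zr => proj1 (HM K z zr)))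
  (fun rho r01 => let: ex_intro M HM := Hv rho r01 in ex_intro _ M (fun K z zr => proj1 (HM K z zr)))
  cuv z z1.
have C1 (g : R * R -> R) : harmonic_real_on U g -> C_k 1 U g.
  by case=> -[cg dg] _; split => // e; have [? [? _]] := dg e; split; [|split].
have du := C_k1_rediff (C1 _ hu) Dz; have dv := C_k1_rediff (C1 _ hv) Dz.
move: (congr1 (fun z => Rec z) G) (congr1 (fun z => Imc z) G).
rewrite ReM ImM /grad /= => E1 E2.
apply/diff_cderiv; eexists.
have -> : Phi = fun w => u (Rec w, Imc w) +i* v (Rec w, Imc w).
  by apply/funext => w; rewrite /u /v toCK; case: (Phi w).
apply: (cauchy_riemann du).
move: dv E1 E2; move: ('D_e1 v _) ('D_e2 v _) ('D_e1 u _) ('D_e2 u _) => v1 v2 u1 u2.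
move=> dv E1 E2; have <- : v2 = u1 by rewrite E1; ring.
by have <- : v1 = - u2 by rewrite E2; ring.
Qed.

End Harmonic.

(** * Injectivity of the Gram weights *)

Section KernelInjectivity.
Variable R : realType.
Implicit Types (c e : nat -> R).

(** The sum on the right is the integral over [0, 1] of [t ^ y] times the power sum. The integral is
    replaced by the increment of a primitive, estimated with the mean value theorem; [de]
    contributes [de / y.+1]. *)
Lemma powsum_shift_ge0 c n y (de : R) :
  (forall t : R, 0 <= t <= 1 -> - de <= \sum_(k < n) c k * t ^+ k) ->
  - (de / y.+1%:R) <= \sum_(k < n) c k / (y.+1 + k)%:R.
Proof.
(* The coefficients of [t ^ y] times the power sum. *)
move=> H; pose a m := if (m < y)%N then 0 else c (m - y)%N.
pose F (t : R) := \sum_(m < y + n) a m * t ^+ m.+1 / m.+1%:R.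
have aE : forall (G : nat -> R), \sum_(m < y + n) a m * G m = \sum_(k < n) c k * G (y + k)%N.
  move=> G; rewrite big_split_ord /= big1 ?add0r => [|i _]; last first.
    by rewrite /a ltn_ord mul0r.
  by apply: eq_bigr => i _; rewrite /a ltnNge leq_addr /= addKn.
pose G (t : R) := F t + (de / y.+1%:R) * t ^+ y.+1.
have dG (t : R) : is_derive t 1 G (\sum_(m < y + n) a m * t ^+ m + de * t ^+ y).
  have dK : is_derive t 1 (fun s : R => s ^+ y.+1) (y.+1%:R * t ^+ y).
    by split; [exact: exprn_derivable|rewrite exp_derive /GRing.scale /= mulr1].
  have -> : G = F + (de / y.+1%:R) *: (fun s : R => s ^+ y.+1) by apply/funext.
  apply: (is_derive_eq (is_deriveD (is_derive_powsum a (y + n) t) (is_deriveZ _ dK))).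
  by rewrite /GRing.scale /= mulrA divfK// pnatr_eq0.
have G0 : G 0 = 0.
  rewrite /G /F big1 => [|i _]; last by rewrite expr0n mulr0 mul0r.
  by rewrite expr0n mulr0 addr0.
have G1 : G 1 = \sum_(k < n) c k / (y.+1 + k)%:R + de / y.+1%:R.
  rewrite /G expr1n mulr1 /F; congr (_ + _).
  rewrite -(aE (fun m => (m.+1)%:R^-1)); apply: eq_bigr => i _.
  by rewrite expr1n mulr1.
suff : G 0 <= G 1 by rewrite G0 G1 -lerBlDr sub0r.
have cG : {within `[0, 1], continuous G}.
  apply: derivable_within_continuous => t _; exact: (@ex_derive _ _ _ _ _ _ _ (dG t)).
have [|t] := @MVT_segment R G (fun t => \sum_(m < y + n) a m * t ^+ m + de * t ^+ y) 0 1 ler01.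
  exact: cG.
rewrite in_itv /= => t01; rewrite subr0 mulr1 -subr_ge0 => ->.
rewrite (aE (fun m => t ^+ m)) (_ : _ + _ = t ^+ y * (\sum_(k < n) c k * t ^+ k + de)).
  apply: mulr_ge0; first by apply: exprn_ge0; case/andP: t01.
  by have := H _ t01; clear; lra.
rewrite mulrDr mulr_sumr; congr (_ + _); last by rewrite mulrC.
by apply: eq_bigr => i _; rewrite exprD mulrCA.
Qed.

Definition ramp_sum c x := \sum_(k < x) c k * (x - k)%:R.

Lemma ramp_sumS c x : ramp_sum c x.+1 = ramp_sum c x + \sum_(k < x.+1) c k.
Proof.
rewrite /ramp_sum 2!big_ord_recr /= subSnn mulr1 addrA -big_split /=; congr (_ + _).
by apply: eq_bigr => i _; rewrite subSn ?(ltnW (ltn_ord i))// mulrSr; ring.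
Qed.

(* Abel summation twice: the generating function of the ramp sums is
   [s / (1 - s) ^ 2] times that of [c]. *)
Lemma ramp_sum_gen c (s : R) N :
  (1 - s) ^+ 2 * (\sum_(x < N) ramp_sum c x * s ^+ x) +
  s ^+ N * ((1 - s) * ramp_sum c N + s * \sum_(k < N) c k) =
  s * \sum_(k < N) c k * s ^+ k.
Proof.
elim: N => [|N IH].
  by rewrite /ramp_sum !big_ord0; ring.
rewrite ramp_sumS !big_ord_recr /= (exprS s N); move: IH.
move: (\sum_(x < N) _) (ramp_sum c N) (\sum_(k < N) c k) (\sum_(k < N) c k * _) (s ^+ N) (c N).
move=> u v w p q h E; rewrite (mulrDr s p) -E; ring.
Qed.

(** Here [de n] bounds the truncation error of a series that is nonnegative on [0, 1] and vanishes
    at [t0]. By the last hypothesis the ramp sums are positive multiples of its moments, hence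
    nonnegative. For [t0 > 0] the generating function at [t0] is then a vanishing sum of nonnegative
    terms, so all ramp sums are 0, and the [c k] are their second differences. *)
Lemma ramp_sum_eq0 c (d : nat) (de : nat -> R) (t0 B : R) :
  (forall n (t : R), 0 <= t <= 1 -> - de n <= \sum_(k < n) c k * t ^+ k) ->
  de @ \oo --> (0 : R) -> 0 <= t0 < 1 ->
  (forall n, \sum_(k < n) c k * t0 ^+ k <= de n) ->
  (forall n, `|\sum_(k < n) c k| <= B) ->
  (forall x, (0 < x)%N -> (fun n => \sum_(k < n) c k / (x + d + k)%:R) @ \oo -->
     (ramp_sum c x / (x%:R * (x + d)%:R))) ->
  forall k, c k = 0.
Proof.
move=> pos de0 /andP[t00 t01] max PB lim.
have S_ge0 x : 0 <= ramp_sum c x.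
  case: x => [|x]; first by rewrite /ramp_sum big_ord0.
  have cS := lim x.+1 isT.
  have : 0 <= ramp_sum c x.+1 / (x.+1%:R * (x.+1 + d)%:R).
    have cD : (fun n => - (de n / (x + d).+1%:R)) @ \oo --> (0 : R).
      by rewrite -oppr0; apply: cvgN; rewrite -(mul0r (x + d).+1%:R^-1); exact: cvgMl.
    apply: (ler_cvg_to cD cS).
    by apply: nearW => n; exact: (@powsum_shift_ge0 c n (x + d) (de n) (pos n)).
  by rewrite pmulr_lge0// invr_gt0 mulr_gt0 ?ltr0n.
suff S0 x : ramp_sum c x = 0.
  have P0 x : \sum_(k < x.+1) c k = 0.
    by have := ramp_sumS c x; rewrite !S0 add0r => <-.
  case=> [|k]; first by have := P0 0%N; rewrite big_ord1.
  by have := P0 k.+1; rewrite big_ord_recr /= P0 add0r.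
(* At [t0 = 0] the factor [s] of the generating function vanishes. Instead [c 0 = 0] makes the first
   moment [mu d] vanish, and the moments are nonnegative and nonincreasing. *)
case: (ltrgtP t0 0) t00 => // t0E _; last first.
  have c0 : c 0%N = 0.
    have dn n : `|c 0%N| <= de n.+1.
      have E (m : nat) : \sum_(k < m.+1) c k * 0 ^+ k = c 0%N :> R.
        rewrite big_ord_recl expr0 mulr1 big1 ?addr0// => i _.
        by rewrite expr0n mulr0.
      have := max n.+1; have := pos n.+1 0; rewrite t0E E lexx ler01 => /(_ isT).
      by rewrite ler_norml => -> ->.
    apply/eqP; rewrite -normr_le0.
    have cS : (fun n => de n.+1) @ \oo --> (0 : R) by rewrite (cvg_shiftS de).
    by apply: (ler_cvg_to (cvg_cst _) cS); exact: nearW.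
  pose mu y := if (y < d)%N then 0 else ramp_sum c (y.+1 - d) / ((y.+1 - d)%:R * y.+1%:R).
  have lmu y : (d <= y)%N ->
    (fun n => \sum_(k < n) c k / (y.+1 + k)%:R) @ \oo --> mu y.
    move=> dy; have := lim (y.+1 - d)%N; rewrite subn_gt0 ltnS dy => /(_ isT).
    by rewrite subnK ?(leq_trans dy)// /mu ltnNge dy.
  (* [mu y] is the integral of [t ^ y] against the nonnegative sum of the series. *)
  have mu_dec y : (d <= y)%N -> mu y.+1 <= mu y.
    (* [c' g] lists the coefficients of [1 - t] times the power sum of [g]; integrated against
       [t ^ y] it yields the difference of two consecutive moments. *)
    move=> dy; pose c' (g : nat -> R) k := g k - (if k is k'.+1 then g k' else 0).
    have E g n (t : R) : \sum_(k < n.+1) c' g k * t ^+ k =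
        (1 - t) * \sum_(k < n) g k * t ^+ k + g n * t ^+ n.
      elim: n => [|n IH]; first by rewrite big_ord1 big_ord0 /c' /=; ring.
      rewrite big_ord_recr /= IH (big_ord_recr n) /= /c' (exprS t n).
      by move: (\sum_(k < n) _) (g n) (t ^+ n) (g n.+1) => p q r s'; ring.
    have E2 g n : \sum_(k < n.+1) c' g k / (y.+1 + k)%:R =
        \sum_(k < n) g k / (y.+1 + k)%:R - \sum_(k < n) g k / (y.+2 + k)%:R +
        g n / (y.+1 + n)%:R.
      elim: n => [|n IH]; first by rewrite big_ord1 !big_ord0 /c' /=; ring.
      rewrite big_ord_recr /= IH (big_ord_recr n) /= (big_ord_recr n) /= /c' !addSn !addnS.
      by move: (\sum_(k < n) _) (\sum_(k < n) _) => p q; ring.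
    have cl : (fun n => \sum_(k < n) c k / (y.+1 + k)%:R - \sum_(k < n) c k / (y.+2 + k)%:R)
        @ \oo --> mu y - mu y.+1 by exact: cvgB (lmu _ dy) (lmu _ (leqW dy)).
    rewrite -subr_ge0.
    have cD : (fun n => - (de n / y.+1%:R)) @ \oo --> (0 : R).
      by rewrite -oppr0; apply: cvgN; rewrite -(mul0r y.+1%:R^-1); exact: cvgMl.
    apply: (ler_cvg_to cD cl); apply: nearW => n.
    (* Cutting [c] at [n] removes the boundary terms with [g n]. *)
    pose g k := if (k < n)%N then c k else 0.
    have gE (G : nat -> R) : \sum_(k < n) g k * G k = \sum_(k < n) c k * G k.
      by apply: eq_bigr => i _; rewrite /g ltn_ord.
    have gn : g n = 0 by rewrite /g ltnn.
    have := @powsum_shift_ge0 (c' g) n.+1 y (de n).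
    rewrite E2 gn mul0r addr0 (gE (fun k => (y.+1 + k)%:R^-1)) (gE (fun k => (y.+2 + k)%:R^-1)).
    apply => t t01'; rewrite E gn mul0r addr0 (gE (fun k => t ^+ k)).
    have de_ge0 : 0 <= de n.
      by have := pos n 0; rewrite lexx ler01 => /(_ isT); have := max n; rewrite t0E; clear; lra.
    have p1 := pos n t t01'; move: p1 t01' de_ge0; clear.
    move: (\sum_(k < n) _) (de n) => p q pq /andP[t0 t1] q0.
    have : (1 - t) * - q <= (1 - t) * p by apply: ler_wpM2l => //; lra.
    have : 0 <= t * q by exact: mulr_ge0.
    lra.
  have mu0 y : (d <= y)%N -> mu y = 0.
    move=> dy; apply/eqP; rewrite eq_le {2}/mu ltnNge dy /= divr_ge0 ?mulr_ge0// andbT.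
    rewrite -(subnK dy); elim: (y - d)%N => [|n IH].
      by rewrite add0n /mu ltnn subSnn /ramp_sum big_ord1 c0 mul0r mul0r.
    by rewrite addSn; apply: le_trans IH; apply: mu_dec; exact: leq_addl.
  case: x => [|x]; first by rewrite /ramp_sum big_ord0.
  have := mu0 (x + d)%N (leq_addl _ _); rewrite /mu ltnNge leq_addl /=.
  by rewrite -addSn addnK => /eqP; rewrite mulf_eq0 invr_eq0 mulf_eq0 !pnatr_eq0 /= orbF => /eqP.
have t0p := t0E.
apply/eqP; rewrite eq_le S_ge0 andbT.
have k0 : 0 < (1 - t0) ^+ 2 * t0 ^+ x by rewrite mulr_gt0 ?exprn_gt0 ?subr_gt0.
rewrite -(pmulr_rle0 _ k0).
have cD : (fun n => t0 * de n + t0 * (t0 ^+ n * B)) @ \oo --> (0 : R).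
  rewrite -[X in _ --> X](_ : t0 * 0 + t0 * (0 * B) = 0); last by ring.
  apply: cvgD; first exact: cvgMr.
  by apply: cvgMr; apply: cvgMl; apply: cvg_expr; rewrite ger0_norm// ltW.
apply: (ler_cvg_to (cvg_cst _) cD); near=> n.
have xn : (x < n)%N by near: n; exists x.+1.
have := ramp_sum_gen c t0 n; have := max n; have := PB n; have := S_ge0 n.
have : ramp_sum c x * t0 ^+ x <= \sum_(x < n) ramp_sum c x * t0 ^+ x.
  rewrite (bigD1 (Ordinal xn)) //= lerDl; apply: sumr_ge0 => i _.
  by rewrite mulr_ge0// exprn_ge0// ltW.
have : 0 <= t0 ^+ n by rewrite exprn_ge0// ltW.
move: (\sum_(x < n) _) (ramp_sum c n) (ramp_sum c x) (\sum_(k < n) c k) (\sum_(k < n) c k * _) (t0 ^+ n) (t0 ^+ x) (de n).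
move=> U Sn Sx Pn En tn tx D tn0 SU Sn0 PnB EnD G.
rewrite -mulrA (mulrC tx).
have q2 : 0 <= (1 - t0) ^+ 2 by exact: sqr_ge0.
apply: (le_trans (ler_wpM2l q2 SU)).
have a1 : 0 <= tn * ((1 - t0) * Sn) by rewrite !mulr_ge0// subr_ge0 ltW.
have a2 : t0 * En <= t0 * D by rewrite ler_pM2l.
have a3 : - (t0 * (tn * B)) <= t0 * (tn * Pn).
  rewrite -mulrN ler_pM2l// -mulrN; apply: ler_wpM2l => //.
  by move: PnB; rewrite ler_norml => /andP[].
move: G a1 a2 a3; rewrite mulrDr (mulrCA tn t0).
move: ((1 - t0) ^+ 2 * U) (tn * _) (t0 * En) (t0 * D) (t0 * (tn * B)) (t0 * (tn * Pn)).
clear; move=> a b c d e f; lra.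
Unshelve. all: by end_near. Qed.

(* [x y / (y + k)] minus the Gram coefficient [min k x (min k x + d) / (k + y)]
   is the ramp [(x - k)^+], where [y = x + d]. *)
Lemma gram_ramp (x d k : nat) : (0 < x)%N ->
  1 / (x + d + k)%:R = ((minn k x * (minn k x + d))%:R / (k + x + d)%:R +
  (x - k)%:R) / (x%:R * (x + d)%:R) :> R.
Proof.
move=> x0; have y0 : (x + d)%:R != 0 :> R by rewrite pnatr_eq0 addn_eq0 negb_and -lt0n x0.
have k0 : (x + d + k)%:R != 0 :> R by rewrite pnatr_eq0 !addn_eq0 !negb_and -lt0n x0.
have x0' : x%:R != 0 :> R by rewrite pnatr_eq0 -lt0n.
rewrite (_ : (k + x + d = x + d + k)%N); last by rewrite -addnA addnC.
move: y0 k0; rewrite !(natrD, natrM) => y0 k0.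
have [kx|xk] := leqP k x.
  by rewrite natrB//; field; rewrite x0' y0 k0.
rewrite (eqP (ltnW xk : x - k == 0)%N); field; rewrite x0' y0 k0 //.
Qed.

(** The previous lemma is applied to the coefficients [c] of [M - E] or of [E - min E]. Only the
    constant term differs from a multiple of [e], and at [k = 0] the weight is 0, so the limits of
    the weighted sums remain 0. From [c = 0] and [e 0 = 0] follows [M = 0], hence [e = 0]. *)
Lemma gram_injective e (d : nat) : e 0%N = 0 ->
  (exists B : R, forall n, \sum_(k < n) `|e k| <= B) ->
  (forall x, (0 < x)%N -> (fun n => \sum_(k < n)
     e k * ((minn k x * (minn k x + d))%:R / (k + x + d)%:R)) @ \oo --> (0 : R)) ->
  forall k, e k = 0.
Proof.
move=> e00 [B eB] lim.
(* The tail of the series of the [|e k|], which bounds the truncation error uniformly in [t]. *)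
have [de [de0 tail]] : exists de : nat -> R, de @ \oo --> (0 : R) /\
  forall n m (t : R), 0 <= t <= 1 -> (n <= m)%N ->
    `|\sum_(k < m) e k * t ^+ k - \sum_(k < n) e k * t ^+ k| <= de n.
  pose a n := \sum_(k < n) `|e k|.
  have a_nd : nondecreasing_seq a.
    by apply/nondecreasing_seqP => n; rewrite /a big_ord_recr /= lerDl.
  have a_cvg : cvgn a.
    by apply: nondecreasing_is_cvgn => //; exists B => _ [n _ <-]; exact: eB.
  exists (fun n => limn a - a n); split.
    by rewrite -(subrr (limn a)); apply: cvgB => //; exact: cvg_cst.
  move=> n m t /andP[t0 t1] nm; apply: (@le_trans _ _ (a m - a n)); last first.
    by rewrite lerD2r; exact: nondecreasing_cvgn_le.
  rewrite -(subnKC nm) /a !big_split_ord /= addrAC subrr add0r addrAC subrr add0r.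
  apply: le_trans (ler_norm_sum _ _ _) _; apply: ler_sum => i _.
  rewrite normrM -[leRHS]mulr1; apply: ler_wpM2l => //.
  by rewrite ger0_norm ?exprn_ge0// exprn_ile1.
have E_ex (t : R) : exists E : R, 0 <= t <= 1 -> (fun n => \sum_(k < n) e k * t ^+ k) @ \oo --> E.
  case: (boolP (0 <= t <= 1)) => [t01|_]; last by exists 0.
  exists (limn (series (fun k => e k * t ^+ k))) => _.
  have -> : (fun n => \sum_(k < n) e k * t ^+ k) = series (fun k => e k * t ^+ k).
    by apply/funext => n; rewrite /series /= big_mkord.
  apply: normed_cvg; apply: nondecreasing_is_cvgn.
    by apply: nondecreasing_series => n _ _; exact: normr_ge0.
  exists B => _ [n _ <-]; suff : \sum_(0 <= k < n) `|e k * t ^+ k| <= B by [].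
  rewrite big_mkord; apply: le_trans (eB n).
  apply: ler_sum => i _; case/andP: t01 => t0 t1.
  rewrite normrM -[leRHS]mulr1; apply: ler_wpM2l => //.
  by rewrite ger0_norm ?exprn_ge0// exprn_ile1.
have [E EE] := choice E_ex.
have E_de n (t : R) : 0 <= t <= 1 -> `|E t - \sum_(k < n) e k * t ^+ k| <= de n.
  move=> t01.
  have c1 : (fun m => `|\sum_(k < m) e k * t ^+ k - \sum_(k < n) e k * t ^+ k|) @ \oo -->
     `|E t - \sum_(k < n) e k * t ^+ k|.
    by apply: cvg_norm; apply: cvgB; [exact: EE|exact: cvg_cst].
  apply: (ler_cvg_to c1 (cvg_cst (de n))); near=> m; apply: tail => //.
  by near: m; exists n.
have poly_cont n (t : R) : {for t, continuous (fun s : R => \sum_(k < n) e k * s ^+ k)}.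
  elim: n => [|n IH].
    rewrite (_ : (fun _ => _) = cst 0); first exact: cvg_cst.
    by apply/funext => s; rewrite big_ord0.
  rewrite (_ : (fun _ => _) = fun s => (\sum_(k < n) e k * s ^+ k) + e n * s ^+ n); last first.
    by apply/funext => s; rewrite big_ord_recr.
  by apply: continuousD => //; apply: cvgMr; exact: exprn_continuous.
have aux (a b c c1 f g : R) : `|c - c1| <= g / 3 -> `|a - c| <= f -> `|b - c1| <= f ->
    f <= g / 3 -> `|a - b| <= g.
  by rewrite !ler_norml; lra.
have E_cont : {within `[0, 1], continuous E}.
  apply/subspace_continuousP => t; rewrite /= in_itv /= => t01.
  apply/cvgrPdist_le => ep ep0.
  have e3 : 0 < ep / 3 by rewrite divr_gt0.
  have [n _ /(_ n (leqnn n)) /= den] : \forall n \near \oo, `|0 - de n| <= ep / 3.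
    by move/cvgrPdist_le : de0; apply.
  have den' : de n <= ep / 3.
    by apply: le_trans den; rewrite sub0r normrN; exact: ler_norm.
  have P : \forall s \near t, `|(\sum_(k < n) e k * t ^+ k) - (\sum_(k < n) e k * s ^+ k)| <= ep / 3.
    by have /cvgrPdist_le := poly_cont n t; apply.
  rewrite near_withinE; near=> s; rewrite /= in_itv /= => s01.
  have P1 : `|(\sum_(k < n) e k * t ^+ k) - (\sum_(k < n) e k * s ^+ k)| <= ep / 3.
    by near: s; exact: P.
  have h1 := E_de n _ t01; have h2 := E_de n _ s01.
  exact: (aux _ _ _ _ _ _ P1 h1 h2 den').
(* The sign [(-1) ^+ s] treats a maximum and a minimum of [E] together. *)
have key (s : bool) (t0 : R) : 0 <= t0 < 1 ->
   (forall t : R, 0 <= t <= 1 -> (-1) ^+ s * E t <= (-1) ^+ s * E t0) -> forall k, e k = 0.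
  move=> t01 tmax; pose M : R := (-1) ^+ s * E t0.
  pose c (k : nat) : R := M *+ (k == 0%N) - (-1) ^+ s * e k.
  have cE n (G : nat -> R) : \sum_(k < n.+1) c k * G k = M * G 0%N - (-1) ^+ s * \sum_(k < n.+1) e k * G k.
    have -> : M * G 0%N = \sum_(k < n.+1) M *+ (k == 0%N :> nat) * G k.
      by rewrite big_ord_recl /= mulr1n big1 ?addr0// => i _; rewrite mulr0n mul0r.
    by rewrite mulr_sumr -sumrB; apply: eq_bigr => i _; rewrite /c; ring.
  have de_ge0 n : 0 <= de n.
    by apply: le_trans (tail n n 0 _ (leqnn n)); rewrite ?lexx ?ler01.
  have close n (t : R) : 0 <= t <= 1 ->
      `|(-1) ^+ s * E t - (-1) ^+ s * \sum_(k < n) e k * t ^+ k| <= de n.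
    by move=> tI; rewrite -mulrBr normrMsign; exact: E_de.
  have c0 : forall k, c k = 0.
    apply: (@ramp_sum_eq0 c d de t0 (`|M| + B)) => //.
    - case=> [|n] t tI; first by rewrite big_ord0 oppr_le0.
      rewrite (cE n (fun k => t ^+ k)) expr0 mulr1.
      have := close n.+1 t tI; have := tmax t tI; rewrite -/M.
      move: ((-1) ^+ s * E t) ((-1) ^+ s * _) => u v; rewrite ler_norml; clear; lra.
    - case=> [|n]; first by rewrite big_ord0.
      rewrite (cE n (fun k => t0 ^+ k)) expr0 mulr1.
      have t01' : 0 <= t0 <= 1 by case/andP: t01 => -> /ltW.
      have := close n.+1 t0 t01'; rewrite -/M.
      by move: ((-1) ^+ s * _) => v; rewrite ler_norml => /andP[].
    - case=> [|n].
        by rewrite big_ord0 normr0 addr_ge0//; apply: le_trans (eB 0%N); rewrite big_ord0.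
      have := cE n (fun=> 1); under eq_bigr do rewrite mulr1.
      under [in RHS]eq_bigr do rewrite mulr1.
      rewrite mulr1 => ->; apply: (le_trans (ler_normB _ _)); rewrite lerD2l normrMsign.
      exact: le_trans (ler_norm_sum _ _ _) (eB _).
    - move=> x x0; pose xy : R := x%:R * (x + d)%:R.
      have rampE : ramp_sum c x = M * x%:R - (-1) ^+ s * ramp_sum e x.
        by case: x x0 xy => // x _ _; rewrite /ramp_sum (cE x (fun k => (x.+1 - k)%:R)) subn0.
      rewrite -cvg_shiftS.
      have L1 : (fun n => \sum_(k < n) e k / (x + d + k)%:R) @ \oo --> ramp_sum e x / xy.
        have L2 : (fun n => \sum_(k < n) e k * (x - k)%:R) @ \oo --> ramp_sum e x.
          apply: cvg_near_cst; near=> n; have xn : (x <= n)%N by near: n; exists x.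
          rewrite -(subnKC xn) big_split_ord /= [X in _ + X]big1 ?addr0// => i _.
          by rewrite (eqP (leq_addr _ _ : x - (x + i) == 0)%N) mulr0.
        have L3 : (fun n => (\sum_(k < n) e k * ((minn k x * (minn k x + d))%:R / (k + x + d)%:R) +
            \sum_(k < n) e k * (x - k)%:R) / xy) @ \oo --> (0 + ramp_sum e x) / xy.
          by apply: cvgMl; apply: cvgD; [exact: lim|exact: L2].
        rewrite add0r in L3; rewrite (_ : (fun n => _) = (fun n => (\sum_(k < n) e k *
          ((minn k x * (minn k x + d))%:R / (k + x + d)%:R) + \sum_(k < n) e k * (x - k)%:R) / xy))//.
        apply/funext => n; rewrite -big_split /= mulr_suml; apply: eq_bigr => i _.
        by rewrite -[in LHS](mul1r (x + d + i)%:R^-1) (gram_ramp d i x0) -/xy; ring.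
      have -> : ramp_sum c x / xy = M * (x + d + 0)%:R^-1 - (-1) ^+ s * (ramp_sum e x / xy).
        have x1 : x%:R != 0 :> R by rewrite pnatr_eq0 -lt0n.
        rewrite rampE addn0 mulrBl; congr (_ - _); last by rewrite -mulrA.
        by rewrite /xy invfM mulrA mulfK.
      rewrite (_ : (fun n => _) = (fun n => M * (x + d + 0)%:R^-1 -
        (-1) ^+ s * \sum_(k < n.+1) e k / (x + d + k)%:R)); last first.
        by apply/funext => n; rewrite (cE n (fun k => (x + d + k)%:R^-1)).
      apply: cvgB; first exact: cvg_cst.
      by apply: cvgMr; rewrite (cvg_shiftS (fun n => \sum_(k < n) e k / (x + d + k)%:R)).
  have M0 : M = 0 by have := c0 0%N; rewrite /c e00 mulr0 subr0.
  move=> k; have := c0 k; rewrite /c M0 mul0rn sub0r => /eqP.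
  by rewrite oppr_eq0 mulf_eq0 signr_eq0 /= => /eqP.
have [t1 t1in max1] := EVT_max (@ler01 R) E_cont.
have [t2 t2in min2] := EVT_min (@ler01 R) E_cont.
rewrite !in_itv /= in t1in t2in.
have [t1lt|t1ge] := ltP t1 1.
  apply: (key false t1); first by case/andP: t1in => -> _.
  by move=> t t01; rewrite !mul1r; apply: max1; rewrite in_itv.
have [t2lt|t2ge] := ltP t2 1.
  apply: (key true t2); first by case/andP: t2in => -> _.
  by move=> t t01; rewrite !mulN1r lerN2; apply: min2; rewrite in_itv.
(* If both extremal points are 1, then [E] is constant and 0 is a maximum point as well. *)
have t11 : t1 = 1 by apply/eqP; rewrite eq_le t1ge andbT; case/andP: t1in.
have t21 : t2 = 1 by apply/eqP; rewrite eq_le t2ge andbT; case/andP: t2in.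
have E1 (t : R) : 0 <= t <= 1 -> E t = E 1.
  move=> tI; apply/eqP; rewrite eq_le.
  have := max1 t; have := min2 t; rewrite in_itv /= tI t11 t21 => -> // -> //.
apply: (key false 0); first by rewrite lexx ltr01.
by move=> t t01; rewrite !E1 ?lexx ?ler01.
Unshelve. all: by end_near. Qed.
End KernelInjectivity.

(** * Measure-preserving maps *)

Section MeasurePreserving.
Local Open Scope ereal_scope.
Context d1 d2 (T1 : measurableType d1) (T2 : measurableType d2) (R : realType).
Variables (m1 : {measure set T1 -> \bar R}) (m2 : {measure set T2 -> \bar R}).

Definition mpres (phi : T1 -> T2) := measurable_fun setT phi /\
  forall A, measurable A -> m2 A = m1 (phi @^-1` A).

Lemma mpres_ge0_integral phi D (f : T2 -> \bar R) : mpres phi -> measurable D ->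
  measurable_fun D f -> (forall y, D y -> 0 <= f y) ->
  \int[m2]_(y in D) f y = \int[m1]_(x in phi @^-1` D) f (phi x).
Proof.
move=> [mphi mE] mD mf f0.
pose mx := isMeasurableFun.Build _ _ _ _ _ mphi.
pose ph : {mfun _ >-> _} := HB.pack phi mx.
rewrite -(@ge0_integral_pushforward _ _ _ _ _ phi mphi m1 D f)//; last first.
  by move=> y /set_mem; exact: f0.
by apply: (@eq_measure_integral _ _ _ _ (pushforward m1 ph) m2) => A mA _; exact: mE.
Qed.

Lemma mpres_measurable_fun phi D d (T3 : measurableType d) (f : T2 -> T3) :
  mpres phi -> measurable D -> measurable_fun D f ->
  measurable_fun (phi @^-1` D) (f \o phi).
Proof.
move=> mp mD mf; apply: (measurable_comp mD) => //; first exact: image_preimage_subset.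
by apply: measurable_funTS; case: mp.
Qed.

Lemma mpres_integral phi D (f : T2 -> \bar R) : mpres phi -> measurable D ->
  measurable_fun D f ->
  \int[m2]_(y in D) f y = \int[m1]_(x in phi @^-1` D) f (phi x).
Proof.
move=> mp mD mf; rewrite integralE [RHS]integralE; congr (_ - _).
  rewrite (@mpres_ge0_integral phi D f^\+ mp mD (measurable_funepos mf) (fun y _ => funepos_ge0 f y)).
  by apply: eq_integral => x _; rewrite -[RHS]/((f \o phi)^\+ x) [in RHS]funepos_comp.
rewrite (@mpres_ge0_integral phi D f^\- mp mD (measurable_funeneg mf) (fun y _ => funeneg_ge0 f y)).
by apply: eq_integral => x _; rewrite -[RHS]/((f \o phi)^\- x) [in RHS]funeneg_comp.
Qed.

Lemma mpres_cint phi D (F : T2 -> R[i]) : mpres phi -> measurable D ->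
  cintegrable m2 D F -> cint m2 D F = cint m1 (phi @^-1` D) (F \o phi).
Proof.
move=> mp mD [F1 F2]; rewrite /cint /Rintegral.
rewrite (@mpres_integral phi D (fun y => (Rec (F y))%:E))//; last by case/integrableP: F1.
by rewrite (@mpres_integral phi D (fun y => (Imc (F y))%:E))//; last by case/integrableP: F2.
Qed.

Lemma mpres_intro phi : measurable_fun setT phi ->
  (forall f : T2 -> \bar R, measurable_fun setT f -> (forall y, 0 <= f y) ->
    \int[m2]_y f y = \int[m1]_x f (phi x)) -> mpres phi.
Proof.
move=> mphi H; split => // A mA.
have mpA : measurable (phi @^-1` A) by rewrite -(setTI (_ @^-1` _)); exact: mphi.
have <- : \int[m2]_y (\1_A y)%:E = m2 A by rewrite integral_indic// setIT.
have <- : \int[m1]_x (\1_(phi @^-1` A) x)%:E = m1 (phi @^-1` A) by rewrite integral_indic// setIT.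
apply: (H (fun y => (\1_A y)%:E)); last by move=> y; rewrite lee_fin.
by apply/measurable_EFinP; exact: measurable_indic.
Qed.

End MeasurePreserving.

(** * Plane Lebesgue measure under shears, rotations and scalings *)

Section PlaneMeasure.
Local Open Scope ereal_scope.
Variable R : realType.
Notation T := (measurableTypeR R).
Notation leb := (@lebesgue_measure R).
Notation l2 := (leb \x leb).

(** The rescaled image measure agrees with Lebesgue measure on half-open intervals, and that
    characterises Lebesgue measure. *)
Lemma leb_affine (c b : R) (f : T -> \bar R) : (0 < c)%R -> measurable_fun setT f ->
  (forall y, 0 <= f y) -> \int[leb]_x f x = c%:E * \int[leb]_x f (c * x + b)%R.
Proof.
move=> c0 mf f0; pose phi (x : T) : T := (c * x + b)%R.
have mphi : measurable_fun setT phi.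
  by apply: measurable_funD => //; apply: measurable_funM.
pose mx := isMeasurableFun.Build _ _ _ _ _ mphi.
pose ph : {mfun _ >-> _} := HB.pack phi mx.
have cge0 : (0 <= c)%R := ltW c0.
pose cn : {nonneg R} := NngNum cge0.
rewrite (@eq_measure_integral _ _ _ _ (mscale cn (pushforward leb ph)) leb f) => [|A mA _]; last first.
  apply: lebesgue_measure_unique => // _ [[a b'] _ <-] /=.
  rewrite /mscale /= /pushforward.
  have -> : phi @^-1` `]a, b']%classic = `]((a - b) / c)%R, ((b' - b) / c)%R]%classic.
    apply/seteqP; split => x /=; rewrite !in_itv /= /phi.
      by rewrite ltr_pdivrMr// ler_pdivlMr// mulrC ltrBlDr lerBrDr.
    by rewrite ltr_pdivrMr// ler_pdivlMr// (mulrC x) ltrBlDr lerBrDr.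
  rewrite !lebesgue_measure_itv /= !lte_fin ltr_pM2r ?invr_gt0// ltrD2r.
  case: ifP => _; last by rewrite mule0.
  by rewrite -!EFinD -EFinM; congr (_%:E); field; rewrite gt_eqF.
rewrite ge0_integral_mscale//; congr (_ * _).
by rewrite (@ge0_integral_pushforward _ _ _ _ _ phi mphi leb setT f).
Qed.

Lemma l2_swap : mpres l2 l2 (fun p : T * T => (p.2, p.1)).
Proof.
have ms : measurable_fun setT (fun p : T * T => (p.2, p.1)).
  exact: measurable_swap.
apply: mpres_intro => // f mf f0.
rewrite (fubini_tonelli1 f)// (fubini_tonelli2 (fun p : T * T => f (p.2, p.1)))//.
exact: (measurableT_comp mf ms).
Qed.

(* The maps [(x, y) |-> (x, a x + c y + b)] multiply areas by [c]. *)
Lemma l2_shear (a b c : R) (f : T * T -> \bar R) : (0 < c)%R -> measurable_fun setT f ->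
  (forall y, 0 <= f y) ->
  \int[l2]_p f p = c%:E * \int[l2]_p f (p.1, (c * p.2 + (a * p.1 + b))%R).
Proof.
move=> c0 mf f0.
have ms : measurable_fun setT (fun p : T * T => (p.1, (c * p.2 + (a * p.1 + b))%R) : T * T).
  apply/measurable_fun_pairP; split; first exact: measurable_fst.
  apply: measurable_funD; first exact: measurable_funM.
  by apply: measurable_funD => //; exact: measurable_funM.
have mfs := measurableT_comp mf ms.
rewrite (fubini_tonelli1 f)// (fubini_tonelli1 _ mfs)//=.
rewrite -ge0_integralZl//; last 3 first.
- by apply: measurable_fun_fubini_tonelli_F => // y; exact: f0.
- by move=> x _; apply: integral_ge0 => y _; exact: f0.
- by rewrite lee_fin ltW.
apply: eq_integral => x _; rewrite /fubini_F /= (@leb_affine c (a * x + b))//.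
exact: measurableT_comp mf (measurable_pair1 x).
Qed.


Lemma l2_shear_mpres (a b : R) :
  mpres l2 l2 (fun p : T * T => (p.1, (p.2 + (a * p.1 + b))%R) : T * T).
Proof.
apply: mpres_intro.
  apply/measurable_fun_pairP; split; first exact: measurable_fst.
  apply: measurable_funD => //.
  by apply: measurable_funD => //; exact: measurable_funM.
move=> f mf f0; rewrite (@l2_shear a b 1)// mul1e.
by apply: eq_integral => x _; rewrite mul1r.
Qed.

Lemma mpres_comp d1 d2 d3 (T1 : measurableType d1) (T2 : measurableType d2)
    (T3 : measurableType d3) (m1 : {measure set T1 -> \bar R})
    (m2 : {measure set T2 -> \bar R}) (m3 : {measure set T3 -> \bar R}) phi psi :
  mpres m1 m2 phi -> mpres m2 m3 psi -> mpres m1 m3 (psi \o phi).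
Proof.
move=> [mphi E1] [mpsi E2]; split; first exact: measurableT_comp.
by move=> A mA; rewrite E2// E1// -(setTI (_ @^-1` _)); exact: mpsi.
Qed.

Lemma eq_mpres d1 d2 (T1 : measurableType d1) (T2 : measurableType d2)
    (m1 : {measure set T1 -> \bar R})
    (m2 : {measure set T2 -> \bar R}) phi psi :
  (forall x, phi x = psi x) -> mpres m1 m2 phi -> mpres m1 m2 psi.
Proof. by move=> /funext ->. Qed.

Lemma l2_shear_mpres1 (a b : R) :
  mpres l2 l2 (fun p : T * T => ((p.1 + (a * p.2 + b))%R, p.2) : T * T).
Proof.
exact: (mpres_comp (mpres_comp l2_swap (l2_shear_mpres a b)) l2_swap).
Qed.

Lemma l2_translation (a : R * R) :
  mpres l2 l2 (fun p : T * T => ((p.1 + a.1)%R, (p.2 + a.2)%R) : T * T).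
Proof.
apply: (eq_mpres _ (mpres_comp (l2_shear_mpres1 0 a.1) (l2_shear_mpres 0 a.2))) => p /=.
by rewrite !mul0r !add0r.
Qed.

Definition rot (u : R[i]) (p : T * T) : T * T :=
  ((Rec u * p.1 - Imc u * p.2)%R, (Rec u * p.2 + Imc u * p.1)%R).

Lemma toC_rot u p : toC (rot u p) = (u * toC p)%R.
Proof. by case: u => a b; case: p => x y. Qed.

(* A rotation other than [-1] is a product of three shears; [-1] is the square
   of the rotation by [i]. *)
Lemma l2_rotation u : normc u = 1%R -> mpres l2 l2 (rot u).
Proof.
move=> u1.
have three v : normc v = 1%R -> Rec v != (-1)%R -> mpres l2 l2 (rot v).
  case: v => p q /(congr1 (fun x => x ^+ 2)%R); rewrite sqr_normcE expr1n /= => pq p1.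
  have p10 : (1 + p != 0)%R by rewrite addrC -(opprK 1%R) subr_eq0.
  pose t := (q / (1 + p))%R.
  have tE : (t * (1 + p) = q)%R by rewrite /t divfK.
  have tq : (t * q = 1 - p)%R.
    by rewrite /t mulrAC -expr2 (_ : q ^+ 2 = (1 - p) * (1 + p))%R ?mulfK//;
       move: pq; clear; lra.
  apply: (eq_mpres _ (mpres_comp (mpres_comp (l2_shear_mpres1 (- t) 0)
    (l2_shear_mpres q 0)) (l2_shear_mpres1 (- t) 0))) => -[x y] /=.
  rewrite /rot /= !addr0; congr pair.
    transitivity ((1 - t * q) * x - (2 - t * q) * t * y)%R; first by ring.
    rewrite tq; congr (_ - _)%R; first by congr (_ * _)%R; ring.
    by congr (_ * _)%R; rewrite -tE; ring.
  transitivity ((1 - t * q) * y + q * x)%R; first by ring.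
  by rewrite tq; congr (_ + _)%R; congr (_ * _)%R; ring.
have [um1|] := eqVneq (Rec u) (-1)%R; last exact: three.
have ui : mpres l2 l2 (rot 'i%C).
  apply: three; first by rewrite normcE2 /= expr0n expr1n add0r sqrtr1.
  by rewrite /= eq_sym oppr_eq0 oner_eq0.
have im0 : Imc u = 0%R.
  have := congr1 (fun x => x ^+ 2)%R u1; rewrite sqr_normcE expr1n um1 sqrrN expr1n.
  by rewrite -[RHS]addr0 => /addrI /eqP; rewrite sqrf_eq0 => /eqP.
apply: (eq_mpres _ (mpres_comp ui ui)) => -[x y].
by rewrite /rot /= um1 im0; congr pair; ring.
Qed.

(** One coordinate is stretched at a time by a shear with [a = b = 0]; the exchange of coordinates
    comes in between, and each stretch contributes a factor [c]. *)
Lemma l2_scale (c : R) (f : T * T -> \bar R) : (0 < c)%R -> measurable_fun setT f ->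
  (forall y, 0 <= f y) ->
  \int[l2]_p f p = (c ^+ 2)%:E * \int[l2]_p f ((c * p.1)%R, (c * p.2)%R).
Proof.
move=> c0 mf f0; rewrite (@l2_shear 0 0 c)//.
set g := fun p : T * T => _ : \bar R.
have mg : measurable_fun setT g.
  apply: (measurableT_comp mf); apply/measurable_fun_pairP; split; first exact: measurable_fst.
  apply: measurable_funD; first exact: measurable_funM.
  by apply: measurable_funD => //; exact: measurable_funM.
have g0 p : 0 <= g p by exact: f0.
have msw : measurable_fun setT (fun p : T * T => (p.2, p.1)) by exact: measurable_swap.
pose h (p : T * T) := g (p.2, p.1); have mh : measurable_fun setT h by exact: (measurableT_comp mg msw).
have -> : \int[l2]_p g p = \int[l2]_p h p.
  exact: (@mpres_ge0_integral _ _ _ _ _ _ _ _ setT g l2_swap).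
pose k (p : T * T) := f ((c * p.1)%R, (c * p.2)%R).
have mk : measurable_fun setT k.
  apply: (measurableT_comp mf); apply/measurable_fun_pairP.
  by split; apply: measurable_funM.
have -> : \int[l2]_p f ((c * p.1)%R, (c * p.2)%R) = \int[l2]_p k (p.2, p.1).
  change (\int[l2]_p k p = \int[l2]_p k (p.2, p.1)).
  by apply: (@mpres_ge0_integral _ _ _ _ _ _ _ _ setT k l2_swap) => // y _; exact: f0.
rewrite (@l2_shear 0 0 c h)// => [|y]; last exact: g0.
rewrite muleA -EFinM -expr2; congr (_ * _).
by apply: eq_integral => p _; rewrite /h /g /k /= !mul0r !addr0.
Qed.

End PlaneMeasure.

(** * Measurability through countable bases *)

Section CountableBase.
Variable R : realType.

(** Second countability expressed with measurable sets: [N p e] plays the part of the ball of radius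
    [e]. In this form the property passes to products and makes open sets measurable for the product
    sigma-algebra. *)
Definition cbase d (T : measurableType d) (N : T -> R -> set T) :=
  exists B : nat -> set T, (forall i, measurable (B i)) /\
    forall p e, 0 < e -> exists i, B i p /\ B i `<=` N p e.

Lemma cbase_open d (T : measurableType d) (N : T -> R -> set T) A : cbase N ->
  (forall p, A p -> exists2 e : R, 0 < e & N p e `<=` A) -> measurable A.
Proof.
move=> [B [mB BN]] oA.
have -> : A = \bigcup_(i in [set i | B i `<=` A]) B i.
  apply/seteqP; split => [p Ap|p [i /= iA]]; last exact: iA.
  have [e e0 eA] := oA p Ap; have [i [Bp Bs]] := BN p e e0.
  by exists i => //=; exact: subset_trans eA.
rewrite bigcup_mkcond; apply: bigcupT_measurable => i.
by case: ifP => _ //; exact: measurable0.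
Qed.

Lemma cbase_measurable_fun d (T : measurableType d) (N : T -> R -> set T) A (f : T -> R) :
  cbase N -> (forall p, A p -> exists2 e : R, 0 < e & N p e `<=` A) ->
  (forall p d1 d2, d1 <= d2 -> N p d1 `<=` N p d2) ->
  (forall p, A p -> forall e : R, 0 < e -> exists2 de : R, 0 < de &
     forall q, N p de q -> `|f q - f p| < e) ->
  measurable_fun A f.
Proof.
move=> bN oA mono cf.
have mA := cbase_open bN oA.
apply: (measurability _ (RGenOInfty.measurableE R)) => // _ [_ [a ->] <-].
apply: (cbase_open bN) => p [Ap]; rewrite /= in_itv /= andbT => fa.
have [e1 e10 s1] := oA p Ap.
have [|e2 e20 s2] := cf p Ap (f p - a); first by rewrite subr_gt0.
exists (Num.min e1 e2); first by rewrite lt_min e10.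
move=> q Nq; split; first by apply: s1; apply: mono Nq; rewrite ge_min lexx.
rewrite /= in_itv /= andbT.
have /s2 : N p e2 q by apply: mono Nq; rewrite ge_min lexx orbT.
by rewrite ltr_norml => /andP[+ _]; rewrite opprB ltrBDr subrK.
Qed.

Lemma cbase_prod d1 d2 (T1 : measurableType d1) (T2 : measurableType d2)
    (N1 : T1 -> R -> set T1) (N2 : T2 -> R -> set T2) : cbase N1 -> cbase N2 ->
  cbase (fun (p : T1 * T2) e => N1 p.1 e `*` N2 p.2 e).
Proof.
move=> [B1 [mB1 H1]] [B2 [mB2 H2]].
pose B n := if unpickle n is Some (i, j) then B1 i `*` B2 j else set0.
exists B; split=> [n|p e e0].
  by rewrite /B; case: unpickle => [[i j]|]; [exact: measurableX|exact: measurable0].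
have [i [i1 i2]] := H1 p.1 e e0; have [j [j1 j2]] := H2 p.2 e e0.
exists (pickle (i, j)); rewrite /B pickleK; split; first by split.
by move=> q [/= q1 q2]; split; [exact: i2|exact: j2].
Qed.

Notation T := (measurableTypeR R).

Lemma cbase_R : cbase (fun (p : T) e => [set q | `|(q : R) - p| < e]).
Proof.
pose B n : set T := if unpickle n is Some (q, k) then
  `](ratr q : R) - k.+1%:R^-1, ratr q + k.+1%:R^-1[%classic else set0.
exists B; split=> [n|p e e0].
  by rewrite /B; case: unpickle => [[i j]|]; [exact: measurable_itv|exact: measurable0].
have [k ke] : exists k, (k.+1%:R^-1 : R) < e / 2.
  have e20 : 0 < e / 2 by rewrite divr_gt0.
  have [k _ /(_ k (leqnn k))] := near_infty_natSinv_lt (PosNum e20).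
  by exists k.
have k0 : 0 < (k.+1%:R^-1 : R) by rewrite invr_gt0.
have /rat_in_itvoo[q] : (p : R) - k.+1%:R^-1 < p + k.+1%:R^-1.
  by move: k0; move: (k.+1%:R^-1) => x; clear; lra.
rewrite in_itv /= => /andP[q1 q2].
exists (pickle (q, k)); rewrite /B pickleK; move: k0 ke q1 q2.
move: (k.+1%:R^-1) (ratr q) => x y x0 xe q1 q2; split.
  by rewrite /= in_itv /=; apply/andP; split; move: q1 q2; clear; lra.
move=> z /=; rewrite in_itv /= => /andP[z1 z2].
by rewrite ltr_norml; apply/andP; split; move: z1 z2 q1 q2 xe; clear; lra.
Qed.

Definition near2 (p : T * T) (e : R) : set (T * T) :=
  [set q : T | `|(q : R) - p.1| < e] `*` [set q : T | `|(q : R) - p.2| < e].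

Definition near4 (p : T * T * (T * T)) (e : R) : set (T * T * (T * T)) :=
  near2 p.1 e `*` near2 p.2 e.

Lemma cbase2 : cbase near2. Proof. exact: cbase_prod cbase_R cbase_R. Qed.
Lemma cbase4 : cbase near4. Proof. exact: cbase_prod cbase2 cbase2. Qed.

Lemma near2_le p d1 d2 : d1 <= d2 -> near2 p d1 `<=` near2 p d2.
Proof. by move=> d12 q [/= q1 q2]; split => /=; exact: lt_le_trans d12. Qed.

Lemma near4_le p d1 d2 : d1 <= d2 -> near4 p d1 `<=` near4 p d2.
Proof. by move=> d12 q [/= q1 q2]; split => /=; exact: near2_le d12 _ _. Qed.

Lemma near2_normc (p q : T * T) (e : R) : near2 p (e / 2) q -> normc (toC q - toC p) < e.
Proof.
case: p => a b; case: q => c d [/= q1 q2].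
apply: le_lt_trans (normc_le_ReIm _) _; rewrite /=.
by move: q1 q2; move: (`|_ - a|) (`|_ - b|) => x y; clear; lra.
Qed.

End CountableBase.

(** * Open sets and continuous functions of one and two complex variables *)

Section ComplexSets.
Variable R : realType.
Notation C := R[i].
Notation T := (measurableTypeR R).
Notation Y := (T * T * (T * T))%type.

Definition copen (A : set C) := forall z, A z -> exists2 e : R, 0 < e &
  forall w, normc (w - z) < e -> A w.

Definition copen2 (A : set (C * C)) := forall x, A x -> exists2 e : R, 0 < e &
  forall y, normc (y.1 - x.1) < e -> normc (y.2 - x.2) < e -> A y.

Definition ccont2 (F : C * C -> C) x := forall e : R, 0 < e -> exists2 d : R, 0 < d &
  forall y, normc (y.1 - x.1) < d -> normc (y.2 - x.2) < d -> normc (F y - F x) < e.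

(** Unlike [toC2], which reads left-nested coordinates, this views the four real dimensions as a
    product of two planes, so that Tonelli's theorem slices along the complex variables. *)
Definition toCC (p : Y) : C * C := (toC p.1, toC p.2).

Lemma copen_near2 A (p : T * T) : copen A -> A (toC p) ->
  exists2 e : R, 0 < e & near2 p e `<=` @toC R @^-1` A.
Proof.
move=> oA /oA[e e0 H]; exists (e / 2); first by rewrite divr_gt0.
by move=> q /near2_normc /H.
Qed.

Lemma copen_near4 A (p : Y) : copen2 A -> A (toCC p) ->
  exists2 e : R, 0 < e & near4 p e `<=` toCC @^-1` A.
Proof.
move=> oA /oA[e e0 H]; exists (e / 2); first by rewrite divr_gt0.
by move=> q [/near2_normc q1 /near2_normc q2]; exact: H.
Qed.

Lemma copen_measurable A : copen A -> measurable (@toC R @^-1` A : set (T * T)).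
Proof. by move=> oA; apply: (cbase_open (cbase2 R)) => p; exact: copen_near2. Qed.

Lemma copen2_measurable A : copen2 A -> measurable (toCC @^-1` A).
Proof. by move=> oA; apply: (cbase_open (cbase4 R)) => p; exact: copen_near4. Qed.

Definition cmeasurable d (S : measurableType d) (D : set S) (F : S -> C) :=
  measurable_fun D (fun x => Rec (F x)) /\ measurable_fun D (fun x => Imc (F x)).

Lemma ccont_cmeasurable A (F : C -> C) : copen A -> (forall z, A z -> ccont F z) ->
  cmeasurable (@toC R @^-1` A : set (T * T)) (fun p => F (toC p)).
Proof.
move=> oA cF; split; (apply: (cbase_measurable_fun (cbase2 R)) => [p|p d1 d2|p Ap e e0];
  [exact: copen_near2|exact: near2_le|]);
  have [d d0 H] := cF _ Ap e e0; exists (d / 2); rewrite ?divr_gt0// => q /near2_normc/H;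
  apply: le_lt_trans.
- by apply: le_trans (Re_le_normc _); rewrite !ReImE.
- by apply: le_trans (Im_le_normc _); rewrite !ReImE.
Qed.

Lemma ccont2_cmeasurable A (F : C * C -> C) : copen2 A -> (forall z, A z -> ccont2 F z) ->
  cmeasurable (toCC @^-1` A) (fun p => F (toCC p)).
Proof.
move=> oA cF; split; (apply: (cbase_measurable_fun (cbase4 R)) => [p|p d1 d2|p Ap e e0];
  [exact: copen_near4|exact: near4_le|]);
  have [d d0 H] := cF _ Ap e e0; exists (d / 2); rewrite ?divr_gt0//;
  move=> q [/near2_normc h1 /near2_normc h2]; have := H (toCC q) h1 h2;
  apply: le_lt_trans.
- by apply: le_trans (Re_le_normc _); rewrite !ReImE.
- by apply: le_trans (Im_le_normc _); rewrite !ReImE.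
Qed.

End ComplexSets.

Section BoundedIntegrands.
Context d (S : measurableType d) (R : realType).
Variable mu : {measure set S -> \bar R}.
Notation C := R[i].
Implicit Types (D : set S) (F : S -> C).

Lemma finite_cst_integrable D (M : R) : measurable D -> (mu D < +oo)%E ->
  mu.-integrable D (fun=> M%:E).
Proof.
move=> mD muD; apply/integrableP; split; first exact: measurable_cst.
by rewrite integral_cst// lte_mul_pinfty.
Qed.

Lemma bounded_integrable D (f : S -> R) (M : R) : measurable D -> (mu D < +oo)%E ->
  measurable_fun D f -> (forall x, D x -> `|f x| <= M) ->
  mu.-integrable D (fun x => (f x)%:E).
Proof.
move=> mD muD mf fM; apply: (@le_integrable _ _ _ mu D mD _ (fun=> M%:E)).
- exact/measurable_EFinP.
- by move=> x Dx; rewrite !abse_EFin lee_fin (le_trans (fM x Dx))// ler_norm.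
- exact: finite_cst_integrable.
Qed.

Lemma bounded_cintegrable D F (M : R) : measurable D -> (mu D < +oo)%E ->
  cmeasurable D F -> (forall x, D x -> normc (F x) <= M) -> cintegrable mu D F.
Proof.
move=> mD muD [m1 m2] FM; split; apply: (@bounded_integrable _ _ M) => // x Dx.
  exact: le_trans (Re_le_normc _) (FM x Dx).
exact: le_trans (Im_le_normc _) (FM x Dx).
Qed.

Lemma cint_bounded D F (M : R) : measurable D -> (mu D < +oo)%E ->
  cintegrable mu D F -> (forall x, D x -> normc (F x) <= M) ->
  normc (cint mu D F) <= M * fine (mu D).
Proof.
move=> mD muD iF FM; apply: le_trans (cint_normc mD iF) _.
rewrite -Rintegral_cst//; apply: le_Rintegral => //; first exact: cintegrable_normc.
exact: finite_cst_integrable.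
Qed.

End BoundedIntegrands.

(** * Monomials and their moments on discs *)

Section Discs.
Variable R : realType.
Notation C := R[i].
Notation T := (measurableTypeR R).
Notation leb := (@lebesgue_measure R).
Notation l2 := (leb \x leb)%E.

Definition disc (r : R) : set (T * T) := @toC R @^-1` [set z | normc z < r].

Lemma copen_disc (a : C) (r : R) : copen [set z | normc (z - a) < r].
Proof.
move=> z /= zr; exists (r - normc (z - a)); first by rewrite subr_gt0.
move=> w wz /=; rewrite (_ : w - a = (w - z) + (z - a)); last by ring.
by apply: le_lt_trans (normcD _ _) _; rewrite -ltrBrDr.
Qed.

Lemma copen_disc0 (r : R) : copen [set z : C | normc z < r].
Proof.
move=> z zr; have h0 : [set w : C | normc (w - 0) < r] z by rewrite /= subr0.
have [e e0 H] := @copen_disc 0 r z h0.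
by exists e => // w /H; rewrite /= subr0.
Qed.

Lemma measurable_disc r : measurable (disc r).
Proof. by apply: copen_measurable; exact: copen_disc0. Qed.

Lemma l2_box (a b c d : R) : a <= b -> c <= d ->
  l2 (`[a, b]%classic `*` `[c, d]%classic) = ((b - a) * (d - c))%:E.
Proof. by move=> ab cd; rewrite product_measure1E//= !leb_itvcc. Qed.

Lemma l2_disc_fin r : (l2 (disc r) < +oo)%E.
Proof.
apply: (@le_lt_trans _ _ (l2 (`[- `|r|, `|r|]%classic `*` `[- `|r|, `|r|]%classic))).
  apply: le_measure; rewrite ?inE; [exact: measurable_disc|exact: measurableX|].
  move=> [x y] /=; rewrite /disc /= => h; split => /=; rewrite in_itv /= -ler_norml.
    apply: le_trans (Re_le_normc (x +i* y)) _.
    exact: le_trans (ltW h) (ler_norm _).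
  apply: le_trans (Im_le_normc (x +i* y)) _.
  exact: le_trans (ltW h) (ler_norm _).
by rewrite l2_box ?ltry// ge0_cp.
Qed.

Lemma l2_disc_gt0 r : 0 < r -> 0 < fine (l2 (disc r)).
Proof.
move=> r0; apply: (@lt_le_trans _ _ (fine (l2 (`[0, r / 4]%classic `*` `[0, r / 4]%classic)))).
  by rewrite l2_box ?divr_ge0 ?(ltW r0)// subr0 /= mulr_gt0 ?divr_gt0.
apply: fine_le.
- by rewrite l2_box ?divr_ge0 ?(ltW r0).
- by rewrite ge0_fin_numE ?l2_disc_fin.
apply: le_measure; rewrite ?inE; [exact: measurableX|exact: measurable_disc|].
move=> [x y] [/=]; rewrite !in_itv /= /disc /= => /andP[x0 xr] /andP[y0 yr].
apply: le_lt_trans (normc_le_ReIm _) _; rewrite /= !ger0_norm//.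
by move: xr yr r0; clear; lra.
Qed.

Lemma rot_disc u r : normc u = 1 -> rot u @^-1` disc r = disc r.
Proof.
move=> u1; apply/seteqP; split => p;
by rewrite /disc /preimage /mkset toC_rot normcM u1 mul1r.
Qed.

Lemma cint_rot u r (F : T * T -> C) : normc u = 1 -> cintegrable l2 (disc r) F ->
  cint l2 (disc r) F = cint l2 (disc r) (F \o rot u).
Proof.
move=> u1 iF; rewrite (mpres_cint (l2_rotation u1))//; last exact: measurable_disc.
by rewrite rot_disc.
Qed.

Lemma ccont_cpow n z : ccont (fun w : C => w ^+ n) z.
Proof. by apply: differentiable_ccont; exact: differentiable_cpow. Qed.

Lemma ccont_conj (f : C -> C) z : ccont f z -> ccont (fun w => (f w)^*) z.
Proof. by move=> cf e /cf[d d0 H]; exists d => // w /H; rewrite -cjB normc_conj. Qed.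

Lemma ccont_monomial a b z : ccont (fun w : C => w ^+ a * w^* ^+ b) z.
Proof.
apply: ccontM; first exact: ccont_cpow.
rewrite (_ : (fun w : C => w^* ^+ b) = (fun w => (w ^+ b)^*)).
  by apply: ccont_conj; exact: ccont_cpow.
by apply/funext => w; rewrite cjX.
Qed.

Lemma disc_cintegrable r (F : C -> C) M : (forall z, normc z < r -> ccont F z) ->
  (forall z, normc z < r -> normc (F z) <= M) ->
  cintegrable l2 (disc r) (fun p => F (toC p)).
Proof.
move=> cF FM; apply: (@bounded_cintegrable _ _ _ _ _ _ M) => //.
- exact: measurable_disc.
- exact: l2_disc_fin.
- by apply: ccont_cmeasurable => //; exact: copen_disc0.
- by move=> p; exact: FM.
Qed.

Lemma normc_monomial a b (z : C) : normc (z ^+ a * z^* ^+ b) = normc z ^+ (a + b).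
Proof. by rewrite normcM !normcX normc_conj exprD. Qed.

Lemma monomial_cintegrable r a b :
  cintegrable l2 (disc r) (fun p => toC p ^+ a * (toC p)^* ^+ b).
Proof.
apply: (@disc_cintegrable r (fun z => z ^+ a * z^* ^+ b) (r ^+ (a + b))) => z zr.
  exact: ccont_monomial.
have r0 := le_lt_trans (normc_ge0 z) zr.
by rewrite normc_monomial lerXn2r// ?nnegrE ?normc_ge0// ltW.
Qed.

Lemma expi_pi_neq1 n : (0 < n)%N -> expi (pi / n%:R : R) ^+ n != 1.
Proof.
move=> n0; rewrite expiX -(mulr_natr (pi / n%:R)) divfK ?pnatr_eq0 -?lt0n//.
rewrite /expi cospi sinpi; apply/eqP => /(congr1 (@complex.Re R)) /=.
by move=> h; have := ltr01 (R := R); rewrite -h; lra.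
Qed.

(** The integral is invariant under rotations, while a rotation by [pi / |a - b|] multiplies the
    integrand by -1. *)
Lemma monomial_orthogonal r a b : a != b ->
  cint l2 (disc r) (fun p => toC p ^+ a * (toC p)^* ^+ b) = 0.
Proof.
move=> ab; set I := cint _ _ _.
have [u u1 uab] : exists2 u : C, normc u = 1 & u ^+ a * u^* ^+ b != 1.
  have uu (t : R) : expi t * (expi t)^* = 1 by rewrite mulcJ normc_expi expr1n.
  have [lab|lba|/eqP] := ltngtP a b; last by rewrite (negPf ab).
  - exists (expi (- (pi / (b - a)%:R))); first exact: normc_expi.
    rewrite expiN cjK -(subnKC (ltnW lab)) exprD mulrA (mulrC _ (_ ^+ a)) -exprMn uu expr1n mul1r.
    by rewrite subnKC ?(ltnW lab)// expi_pi_neq1// subn_gt0.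
  - exists (expi (pi / (a - b)%:R)); first exact: normc_expi.
    rewrite -{2}(subnKC (ltnW lba)) exprD mulrAC -exprMn uu expr1n mul1r.
    by rewrite expi_pi_neq1// subn_gt0.
have : I = (u ^+ a * u^* ^+ b) * I.
  rewrite {1}/I (cint_rot u1); last exact: monomial_cintegrable.
  rewrite -cintZ; [|exact: measurable_disc|exact: monomial_cintegrable].
  apply: eq_cint => p _; rewrite /comp toC_rot cjM !exprMn; ring.
move/eqP; rewrite -{1}(mul1r I) -subr_eq0 -mulrBl mulf_eq0 subr_eq0 eq_sym (negPf uab) /=.
by move/eqP.
Qed.

Definition moment r a : R := \int[l2]_(p in disc r) (normc (toC p) ^+ (a + a)).

Lemma cint_moment r a :
  cint l2 (disc r) (fun p => toC p ^+ a * (toC p)^* ^+ a) = (moment r a)%:C.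
Proof.
have E (p : T * T) : toC p ^+ a * (toC p)^* ^+ a = (normc (toC p) ^+ (a + a))%:C.
  by rewrite -exprMn mulcJ -rmorphXn -exprM mul2n -addnn.
apply: eqC; rewrite ?cint_Re ?cint_Im /=; first by apply: eq_Rintegral => p _; rewrite E.
transitivity (\int[l2]_(p in disc r) (0 : R)); first by apply: eq_Rintegral => p _; rewrite E.
by rewrite Rintegral_cst ?mul0r//; exact: measurable_disc.
Qed.


Lemma moment_integrable r a :
  l2.-integrable (disc r) (fun p => (normc (toC p) ^+ (a + a))%:E).
Proof.
have := cintegrable_normc (measurable_disc r) (monomial_cintegrable r a a).
by under eq_fun do rewrite normc_monomial.
Qed.

Lemma moment_ge0 r a : 0 <= moment r a.
Proof. by apply: Rintegral_ge0 => p _; rewrite exprn_ge0// normc_ge0. Qed.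

Lemma moment0 r : moment r 0 = fine (l2 (disc r)).
Proof.
transitivity (\int[l2]_(p in disc r) (1 : R)); first by apply: eq_Rintegral => p _; rewrite expr0.
by rewrite Rintegral_cst ?mul1r//; exact: measurable_disc.
Qed.

Lemma moment_scale r a : 0 < r -> moment r a = r ^+ (a + a).+2 * moment 1 a.
Proof.
move=> r0; pose g (p : T * T) : \bar R := (normc (toC p) ^+ (a + a))%:E.
have mg : measurable_fun setT g.
  apply/measurable_EFinP; apply: measurable_funX; apply: cmeasurable_normc.
    by rewrite (_ : (fun p : T * T => _) = fst)//; apply/funext => -[].
  by rewrite (_ : (fun p : T * T => _) = snd)//; apply/funext => -[].
have g0 p : (0 <= g p)%E by rewrite lee_fin exprn_ge0// normc_ge0.
have mgd s : measurable_fun setT (g \_ (disc s)).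
  by apply/(measurable_restrictT _ (measurable_disc s)); exact: measurable_funTS.
have mom s : (\int[l2]_p (g \_ (disc s)) p = (moment s a)%:E)%E.
  rewrite -integral_mkcond /moment /Rintegral fineK//.
  by apply: integrable_fin_num; [exact: measurable_disc|exact: moment_integrable].
apply: EFin_inj; rewrite EFinM -!mom (@l2_scale R r _ r0 (mgd r)); last first.
  by move=> p; rewrite /patch; case: ifP.
have E (p : T * T) : ((g \_ (disc r)) ((r * p.1)%R : T, (r * p.2)%R : T) =
    (r ^+ (a + a))%:E * (g \_ (disc 1)) p)%E.
  case: p => x y /=; have nE : normc (toC (r * x : T, r * y : T)) = r * normc (toC (x : T, y : T)).
    rewrite (_ : toC _ = r%:C * toC (x : T, y : T)).
      by rewrite normcM normc_real ger0_norm// ltW.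
    by apply: eqC; rewrite /= ?mul0r ?subr0 ?addr0.
  rewrite /patch (_ : ((_, _) \in disc r) = ((x : T, y : T) \in disc 1)).
    by case: ifP => _; rewrite ?mule0// /g nE exprMn EFinM.
  have L v : (r * v < r) = (v < 1) by rewrite -{2}(mulr1 r) ltr_pM2l.
  by apply/idP/idP => /set_mem h; apply/mem_set; move: h; rewrite /disc /preimage /mkset nE L.
have rr : 0 <= r ^+ (a + a) by rewrite exprn_ge0// ltW.
have -> : (\int[l2]_p (g \_ (disc r)) ((r * p.1)%R : T, (r * p.2)%R : T) =
    (r ^+ (a + a))%:E * \int[l2]_p (g \_ (disc 1)) p)%E.
  rewrite -ge0_integralZl//; first by apply: eq_integral => p _; exact: E.
  by move=> p _; rewrite /patch; case: ifP.
by rewrite muleA -EFinM -exprD.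
Qed.

Lemma moment_sub r s a : 0 <= r -> r <= s ->
  r ^+ (a + a) * (moment s 0 - moment r 0) <= moment s a - moment r a <=
  s ^+ (a + a) * (moment s 0 - moment r 0).
Proof.
move=> r0 rs; pose A := disc s `\` disc r.
have mA : measurable A by apply: measurableD; exact: measurable_disc.
have sE : disc s = disc r `|` A.
  by rewrite /A setDE setUIr setUv setIT; apply/esym/setUidPr => p /= h; exact: lt_le_trans rs.
have dis : [disjoint disc r & A] by apply/disj_setPS => p [h1 [_ h2]].
have E b : moment s b - moment r b = \int[l2]_(p in A) (normc (toC p) ^+ (b + b)).
  rewrite /moment {1}sE Rintegral_setU//; [|exact: measurable_disc|by rewrite -sE; exact: moment_integrable].
  by rewrite addrAC subrr add0r.
have iA b : l2.-integrable A (fun p => (normc (toC p) ^+ (b + b))%:E).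
  by apply: integrableS (moment_integrable s b) => //; [exact: measurable_disc|exact: subDsetl].
have Z c : c * \int[l2]_(p in A) (normc (toC p) ^+ (0 + 0)) =
    \int[l2]_(p in A) (c * normc (toC p) ^+ (0 + 0)) by rewrite RintegralZl//; exact: iA.
rewrite !E !Z; apply/andP; split; apply: le_Rintegral => //.
- exact: (integrableZl mA (r ^+ (a + a)) (iA 0%N)).
- exact: iA.
- move=> p [_ /negP]; rewrite -leNgt => h; rewrite expr0 mulr1.
  by rewrite lerXn2r// nnegrE normc_ge0.
- exact: iA.
- exact: (integrableZl mA (s ^+ (a + a)) (iA 0%N)).
- move=> p [h _]; rewrite expr0 mulr1.
  have s0 := le_trans r0 rs.
  by rewrite lerXn2r ?nnegrE ?normc_ge0//; exact: ltW h.
Qed.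

(** What polar coordinates would give, relative to the area [moment r 0]; the area itself cancels in
    all later quotients and is never computed. *)
Lemma momentE r a : 0 < r -> moment r a = r ^+ (a + a) / a.+1%:R * moment r 0.
Proof.
move=> r0; rewrite (moment_scale a r0) (moment_scale 0 r0).
suff -> : moment 1 a = a.+1%:R^-1 * moment 1 0 by rewrite !exprS expr0; ring.
have c0 := moment_ge0 1 0; have ca := moment_ge0 1 a.
set C0 := moment 1 0 in c0 *; set Ca := moment 1 a in ca *.
(* Dividing [moment_sub] between radii [x] and [1] by [1 - x ^ 2] and letting
   [x] tend to [1] squeezes [(a + 1) Ca] to [C0]. *)
pose S x := \sum_(i < a.+1) (x ^+ 2) ^+ i : R.
have sq (x : R) : 0 < x < 1 -> x ^+ (a + a) * C0 <= Ca * S x <= C0.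
  move=> /andP[x0 x1]; have := moment_sub a (ltW x0) (ltW x1).
  rewrite (moment_scale a x0) (moment_scale 0 x0) -/C0 -/Ca expr1n mul1r.
  have x21 : 0 < 1 - x ^+ 2 by rewrite subr_gt0 exprn_ilt1// ltW.
  have -> : Ca - x ^+ (a + a).+2 * Ca = (1 - x ^+ 2) * (Ca * S x).
    have := subrX1 (x ^+ 2) a.+1; rewrite -exprM mul2n -addnn addSn addnS -/(S x) => E.
    have {}E : 1 - x ^+ (a + a).+2 = (1 - x ^+ 2) * S x.
      by move: E; move: (x ^+ (a + a).+2) (x ^+ 2) (S x) => u v w h; rewrite -(opprB u) h; ring.
    by rewrite -{1}(mul1r Ca) -mulrBl E; ring.
  have -> : C0 - x ^+ 2 * C0 = (1 - x ^+ 2) * C0 by ring.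
  by rewrite mulrCA !ler_pM2l.
have cS : (fun x : R => S x) @ (1 : R)^'- --> (a.+1%:R : R).
  apply: cvg_at_left_filter; rewrite /S.
  have E : \sum_(i < a.+1) (1 : R) = a.+1%:R by rewrite sumr_const card_ord.
  rewrite -E; elim: a.+1 => [|n IH].
    rewrite big_ord0 (_ : (fun _ => _) = cst 0); first exact: cvg_cst.
    by apply/funext => x; rewrite big_ord0.
  rewrite big_ord_recr /= (_ : (fun _ => _) = (fun x : R => \sum_(i < n) (x ^+ 2) ^+ i + x ^+ (2 * n))).
    by apply: cvgD => //; rewrite -[X in _ --> X](expr1n R (2 * n)); exact: exprn_continuous.
  by apply/funext => x; rewrite big_ord_recr /= -exprM.
have cX : (fun x : R => x ^+ (a + a) * C0) @ (1 : R)^'- --> C0.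
  apply: cvg_at_left_filter; rewrite -[X in _ --> X](_ : 1 ^+ (a + a) * C0 = _).
    by apply: cvgMl; exact: exprn_continuous.
  by rewrite expr1n mul1r.
have cR : (fun x : R => Ca * S x) @ (1 : R)^'- --> (Ca * a.+1%:R : R) by exact: cvgMr.
have near1 : \forall x \near (1 : R)^'-, 0 < x < 1.
  near=> x; apply/andP; split; last by near: x; exact: nbhs_left_lt.
  by near: x; apply: nbhs_left_gt; exact: ltr01.
have : Ca * a.+1%:R = C0.
  apply/eqP; rewrite eq_le; apply/andP; split.
    by apply: (ler_cvg_to cR (cvg_cst C0)); apply: filterS near1 => x /sq /andP[].
  by apply: (ler_cvg_to cX cR); apply: filterS near1 => x /sq /andP[].
by move=> <-; rewrite mulrCA mulVf ?mulr1// pnatr_eq0.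
Unshelve. all: by end_near. Qed.

End Discs.

(** * Residuals of the monomials on a disc *)

Section DiscKernels.
Variable R : realType.
Notation C := R[i].
Notation T := (measurableTypeR R).
Notation leb := (@lebesgue_measure R).
Notation l2 := (leb \x leb)%E.

Lemma circle_bound (f : C -> C) (r rho : R) : (forall w, normc w < r -> differentiable f w) ->
  0 < rho -> rho < r -> exists M : R,
  forall t, 0 <= t <= pi *+ 2 -> normc (f (rho%:C * expi t)) <= M.
Proof.
move=> df rho0 rhor; apply: rccont_bounded; first exact: twopi_ge0.
move=> t _; apply: rccont_circ; first exact: ltW.
by move=> z zr; apply: differentiable_ccont; apply: df; rewrite zr.
Qed.

Lemma disc_bounded (f : C -> C) (r rho : R) : (forall w, normc w < r -> differentiable f w) ->
  0 < rho -> rho < r -> exists M : R, forall z, normc z < rho -> normc (f z) <= M.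
Proof.
move=> df rho0 rhor; have [s [rs sr]] : exists s : R, rho < s /\ s < r.
  by exists ((rho + r) / 2); split; move: rhor; clear; lra.
have s0 : 0 < s := lt_trans rho0 rs.
have [M fM] := circle_bound df s0 sr.
have M0 : 0 <= M.
  by apply: le_trans (normc_ge0 _) (fM 0 _); rewrite lexx twopi_ge0.
exists (M * (s / (s - rho))) => z zr; have zs := lt_trans zr rs.
have := cauchy_expansion 0 df sr zs fM; rewrite big_ord0 subr0 expr0 mulr1 => h.
apply: le_trans h _; apply: ler_wpM2l => //; rewrite ler_pM2l// lef_pV2 ?posrE ?subr_gt0//.
by move: zr; clear; lra.
Qed.

Lemma disc_integrable_conj (f : C -> C) (r rho : R) a b :
  (forall w, normc w < r -> differentiable f w) -> 0 < rho -> rho < r ->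
  cintegrable l2 (disc rho) (fun p => toC p ^+ b * (toC p)^* ^+ a * (f (toC p))^*).
Proof.
move=> df rho0 rhor; have [M fM] := disc_bounded df rho0 rhor.
apply: (@disc_cintegrable _ rho (fun z => z ^+ b * z^* ^+ a * (f z)^*) (rho ^+ (b + a) * M)).
  move=> z zr; apply: ccontM; first exact: ccont_monomial.
  by apply: ccont_conj; apply: differentiable_ccont; apply: df; exact: lt_trans rhor.
move=> z zr; rewrite normcM normc_conj ler_pM ?normc_ge0 ?fM//.
by rewrite normc_monomial lerXn2r// ?nnegrE ?normc_ge0// ?(ltW rho0)// ltW.
Qed.

(** Termwise integration of the Taylor series: by orthogonality only the coefficient of index
    [b - a] contributes. The expansion is taken on a circle of radius [s] between [rho] and [r],
    which makes the truncation error geometric on the smaller disc. *)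
Lemma disc_coefficients (f : C -> C) (r rho : R) :
  (forall w, normc w < r -> differentiable f w) -> 0 < rho -> rho < r ->
  exists2 c : nat -> C, c 0%N = f 0 & forall a b,
    cint l2 (disc rho) (fun p => toC p ^+ b * (toC p)^* ^+ a * (f (toC p))^*) =
    if (a <= b)%N then (c (b - a)%N)^* * (moment rho b)%:C else 0.
Proof.
move=> df rho0 rhor; have [s [rs sr]] : exists s : R, rho < s /\ s < r.
  by exists ((rho + r) / 2); split; move: rhor; clear; lra.
have s0 : 0 < s := lt_trans rho0 rs.
have [M fM] := circle_bound df s0 sr.
have M0 : 0 <= M.
  by apply: le_trans (normc_ge0 _) (fM 0 _); rewrite lexx twopi_ge0.
have srho : 0 < s - rho by rewrite subr_gt0.
have [c [B [c0 expn]]] : exists (c : nat -> C) (B : R), c 0%N = f 0 /\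
    forall K z, normc z < rho -> normc (f z - \sum_(m < K) c m * z ^+ m) <= B * (rho / s) ^+ K.
  exists (ccoef f s), (M * (s / (s - rho))); split; first exact: ccoef0 df s0 sr.
  move=> K z zr; have zs := lt_trans zr rs.
  apply: le_trans (cauchy_expansion K df sr zs fM) _.
  rewrite -mulrA -[leRHS]mulrA; apply: ler_wpM2l => //; rewrite [leRHS]mulrC.
  have zs0 : 0 < s - normc z by rewrite subr_gt0.
  apply: ler_pM.
  - by rewrite exprn_ge0// divr_ge0 ?normc_ge0// ltW.
  - by rewrite divr_ge0 ?(ltW s0) ?(ltW zs0).
  - by rewrite lerXn2r ?nnegrE ?divr_ge0 ?normc_ge0 ?(ltW s0) ?(ltW rho0)// ler_pM2r ?invr_gt0// ltW.
  - by rewrite ler_pM2l// lef_pV2 ?posrE//; move: zr; clear; lra.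
exists c => // a b; set V := (if _ then _ else _).
pose S K (z : C) := \sum_(m < K) c m * z ^+ m.
pose mon := fun z : C => z ^+ b * z^* ^+ a.
have mD := measurable_disc rho.
have monle z : normc z < rho -> normc (mon z) <= rho ^+ (b + a).
  by move=> zr; rewrite normc_monomial lerXn2r// ?nnegrE ?normc_ge0// ?(ltW rho0)// ltW.
have i1 : cintegrable l2 (disc rho) (fun p => mon (toC p) * (f (toC p))^*).
  exact: disc_integrable_conj df rho0 rhor.
have monS K z : mon z * (S K z)^* = \sum_(m < K) (c m)^* * (z ^+ b * z^* ^+ (a + m)).
  rewrite /S /mon rmorph_sum mulr_sumr; apply: eq_bigr => m _ /=.
  rewrite -/(cj _) cjM cjX exprD.
  by move: (c m)^* (z^* ^+ m) (z^* ^+ a) (z ^+ b) => u v w x; ring.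
have iS K : cintegrable l2 (disc rho) (fun p => mon (toC p) * (S K (toC p))^*).
  under eq_fun do rewrite monS.
  apply: cintegrable_sum => // m; apply: cintegrableZ => //; exact: monomial_cintegrable.
have SV K : (b < K)%N -> cint l2 (disc rho) (fun p => mon (toC p) * (S K (toC p))^*) = V.
  move=> bK; under eq_cint do rewrite monS.
  rewrite cint_sum//; last by move=> m; apply: cintegrableZ => //; exact: monomial_cintegrable.
  transitivity (\sum_(m < K) (c m)^* * (if (a + m == b)%N then (moment rho b)%:C else 0)).
    apply: eq_bigr => m _; rewrite cintZ//; last exact: monomial_cintegrable.
    congr (_ * _); case: eqP => [->|/eqP h]; first exact: cint_moment.
    by rewrite monomial_orthogonal// eq_sym.
  rewrite /V; case: ifP => ab; last first.
    by rewrite big1// => m _; case: eqP => [h|_]; rewrite ?mulr0//; move: ab; rewrite -h leq_addr.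
  have bK' : (b - a < K)%N by apply: leq_ltn_trans bK; exact: leq_subr.
  rewrite (bigD1 (Ordinal bK')) //= subnKC// eqxx big1 ?addr0// => m mb.
  case: eqP => [h|_]; rewrite ?mulr0//; case/negP: mb; apply/eqP/val_inj => /=.
  by rewrite -h addKn.
have key K : (b < K)%N -> normc (cint l2 (disc rho) (fun p => mon (toC p) * (f (toC p))^*) - V) <=
   rho ^+ (b + a) * B * fine (l2 (disc rho)) * (rho / s) ^+ K.
  move=> bK; rewrite -(SV K bK) -cintB//.
  apply: le_trans (cint_bounded (M := rho ^+ (b + a) * (B * (rho / s) ^+ K)) mD (l2_disc_fin rho) _ _) _.
  - exact: cintegrableB.
  - move=> p zr; rewrite -mulrBr -cjB normcM normc_conj.
    by rewrite ler_pM ?normc_ge0 ?monle ?expn.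
  - by rewrite le_eqVlt; apply/orP; left; apply/eqP; move: (fine _) => u; ring.
apply/eqP; rewrite -subr_eq0 -normc_eq0 eq_le normc_ge0 andbT.
apply: (@le_of_geometric _ _ (rho / s) (rho ^+ (b + a) * B * fine (l2 (disc rho)) * (rho / s) ^+ b.+1)).
  by rewrite divr_ge0 ?(ltW rho0) ?(ltW s0)//= ltr_pdivrMr ?mul1r.
by move=> K; rewrite -mulrA -exprD; apply: key; rewrite addSn ltnS leq_addr.
Qed.

(** The quotient of [moment r m] by [moment r (m - k)]: with this factor, [z ^+ (m - k)] is the
    projection of the monomial. For [k > m] the monomial is already orthogonal to the holomorphic
    functions. *)
Definition gam (r : R) (k m : nat) : R :=
  if (k <= m)%N then r ^+ (k + k) * (m - k).+1%:R / m.+1%:R else 0.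

(* [conj z ^ k z ^ m] minus its projection onto the holomorphic functions on the
   disc of radius [r]. *)
Definition antihol (r : R) k m (z : C) : C := z ^+ m * z^* ^+ k - (gam r k m)%:C * z ^+ (m - k).

Lemma gam_moment r k m : 0 < r -> (k <= m)%N -> gam r k m * moment r (m - k) = moment r m.
Proof.
move=> r0 km; rewrite /gam km; have := subnKC km; move: (m - k)%N => j <-.
rewrite (momentE _ r0) [RHS](momentE _ r0) addnACA (exprD r (k + k)).
have x0 : j.+1%:R != 0 :> R by rewrite pnatr_eq0.
move: x0; move: (moment r 0) (r ^+ (k + k)) (r ^+ (j + j)) (j.+1%:R : R) ((k + j).+1%:R^-1 : R).
by move=> u v w x y x0; field.
Qed.

Lemma antihol_orthogonal (f : C -> C) (r rho : R) k m :
  (forall w, normc w < r -> differentiable f w) -> 0 < rho -> rho < r ->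
  cint l2 (disc rho) (fun p => antihol rho k m (toC p) * (f (toC p))^*) = 0.
Proof.
move=> df rho0 rhor; have [c c0 H] := disc_coefficients df rho0 rhor.
have mD := measurable_disc rho.
have ib a b : cintegrable l2 (disc rho) (fun p => toC p ^+ b * (toC p)^* ^+ a * (f (toC p))^*).
  exact: disc_integrable_conj df rho0 rhor.
transitivity (cint l2 (disc rho) (fun p => toC p ^+ m * (toC p)^* ^+ k * (f (toC p))^*) -
  (gam rho k m)%:C * cint l2 (disc rho) (fun p => toC p ^+ (m - k) * (toC p)^* ^+ 0 * (f (toC p))^*)).
  rewrite -cintZ// -cintB//; last exact: cintegrableZ.
  by apply: eq_cint => p _; rewrite /antihol expr0; ring.
rewrite !H leq0n subn0; case: ifP => km; last by rewrite /gam km mul0r subr0.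
by rewrite mulrCA -rmorphM gam_moment// subrr.
Qed.


Lemma disc_mean (f : C -> C) (r rho : R) :
  (forall w, normc w < r -> differentiable f w) -> 0 < rho -> rho < r ->
  cint l2 (disc rho) (fun p => (f (toC p))^*) = (f 0)^* * (moment rho 0)%:C.
Proof.
move=> df rho0 rhor; have [c c0 H] := disc_coefficients df rho0 rhor.
rewrite -c0 -[RHS](H 0%N 0%N); apply: eq_cint => p _.
by rewrite !expr0 !mul1r.
Qed.

(** The first residual is orthogonal to the holomorphic part of the second one, so only the pure
    monomial of the second factor counts. *)
Lemma antihol_innerE (r : R) k m l n : 0 < r ->
  cint l2 (disc r) (fun p => antihol r k m (toC p) * (antihol r l n (toC p))^*) =
  cint l2 (disc r) (fun p => toC p ^+ (m + l) * (toC p)^* ^+ (k + n)) -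
  (gam r k m)%:C * cint l2 (disc r) (fun p => toC p ^+ (m - k + l) * (toC p)^* ^+ n).
Proof.
move=> r0; have mD := measurable_disc r.
have df w : normc w < r + 1 -> differentiable (fun z : C => z ^+ (n - l)) w.
  by move=> _; exact: differentiable_cpow.
have orth := antihol_orthogonal k m df r0 (ltr_pwDr ltr01 (lexx r)).
have im a b := monomial_cintegrable r a b.
have ia : cintegrable l2 (disc r) (fun p => antihol r k m (toC p) * (toC p ^+ (n - l))^*).
  have E (p : T * T) : antihol r k m (toC p) * (toC p ^+ (n - l))^* =
      toC p ^+ m * (toC p)^* ^+ (k + (n - l)) - (gam r k m)%:C * (toC p ^+ (m - k) * (toC p)^* ^+ (n - l)).
    by rewrite /antihol cjX exprD; ring.
  under eq_fun do rewrite E; apply: cintegrableB; [exact: mD|exact: im|].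
  by apply: cintegrableZ; [exact: mD|exact: im].
have E (p : T * T) : antihol r k m (toC p) * (antihol r l n (toC p))^* =
    (toC p ^+ (m + l) * (toC p)^* ^+ (k + n) -
     (gam r k m)%:C * (toC p ^+ (m - k + l) * (toC p)^* ^+ n)) -
    (gam r l n)%:C * (antihol r k m (toC p) * (toC p ^+ (n - l))^*).
  rewrite {2}/antihol cjB !cjM !cjX cjK cj_real mulrBr; congr (_ - _).
    by rewrite /antihol !exprD; ring.
  by ring.
under eq_cint do rewrite E.
rewrite cintB//; last 2 first.
- by apply: cintegrableB; [exact: mD|exact: im|apply: cintegrableZ; [exact: mD|exact: im]].
- exact: cintegrableZ.
rewrite (cintZ _ mD ia) orth mulr0 subr0.
rewrite (cintB mD (im _ _)); last by apply: cintegrableZ; [exact: mD|exact: im].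
by rewrite (cintZ _ mD (im _ _)).
Qed.

Lemma antihol_inner0 (r : R) k m l n : 0 < r -> (k + n != l + m)%N ->
  cint l2 (disc r) (fun p => antihol r k m (toC p) * (antihol r l n (toC p))^*) = 0.
Proof.
move=> r0 kn; rewrite antihol_innerE// monomial_orthogonal ?sub0r; last by rewrite eq_sym (addnC m).
have [km|mk] := leqP k m; last by rewrite /gam leqNgt mk mul0r oppr0.
rewrite monomial_orthogonal ?mulr0 ?oppr0//; apply: contra kn => /eqP <-.
by rewrite addnA subnKC// addnC.
Qed.

(** The inner product is the moment of the full monomial minus that of its projection. These are the
    two terms into which [gram_ramp] splits the weight, and its truncated difference covers [k > m],
    where there is no projection. *)
Lemma antihol_inner (r : R) k m d : 0 < r ->
  cint l2 (disc r) (fun p => antihol r k m (toC p) * (antihol r (k + d) (m + d) (toC p))^*) =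
  (r ^+ (k + m + d + (k + m + d)) * ((minn k m.+1 * (minn k m.+1 + d))%:R / (k + m.+1 + d)%:R /
    (m.+1%:R * (m.+1 + d)%:R)) * moment r 0)%:C.
Proof.
move=> r0; rewrite antihol_innerE//.
rewrite (_ : (m + (k + d) = k + (m + d))%N); last by rewrite addnCA.
rewrite cint_moment (momentE (k + (m + d)) r0) addnA.
have G := @gram_ramp R m.+1 d k isT.
set Q := _ / (k + m.+1 + d)%:R / _ in G *.
have {}G : Q = 1 / (m.+1 + d + k)%:R - (m.+1 - k)%:R / (m.+1%:R * (m.+1 + d)%:R).
  by rewrite G mulrDl -/Q addrK.
rewrite G (_ : (m.+1 + d + k = (k + (m + d)).+1)%N); last by rewrite addnC addSn addnS.
have eE : (k + (m + d) + k + (m + d) = k + m + d + (k + m + d))%N by rewrite !addnA.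
have [km|mk] := leqP k m; last first.
  rewrite /gam leqNgt mk mul0r subr0 (eqP (mk : m.+1 - k == 0)%N) mul0r subr0 eE.
  by rewrite mul1r.
rewrite (_ : (m - k + (k + d) = m + d)%N); last by rewrite addnA subnK.
rewrite cint_moment (momentE (m + d) r0) /gam km -rmorphM -rmorphB subSn// eE; congr (_%:C).
rewrite (_ : (k + m + d + (k + m + d) = (k + k) + (m + d + (m + d)))%N); last first.
  by rewrite -(addnA k) addnACA.
rewrite exprD; have x0 : m.+1%:R != 0 :> R by rewrite pnatr_eq0.
have y0 : (m.+1 + d)%:R != 0 :> R by rewrite pnatr_eq0.
rewrite -addSn; move: x0 y0; move: (moment r 0) (r ^+ (k + k)) (r ^+ (m + d + (m + d))) (m.+1%:R : R)
  ((m.+1 + d)%:R : R) ((k + (m + d)).+1%:R^-1 : R) ((m - k).+1%:R : R).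
by move=> u v w x y z t x0 y0; field; rewrite x0 y0.
Qed.

End DiscKernels.

(** * Square integrable functions and the Bergman projection *)

Section RectangleFubini.
Context d1 d2 (T1 : measurableType d1) (T2 : measurableType d2) (R : realType).
Variables (m1 : {sigma_finite_measure set T1 -> \bar R})
  (m2 : {sigma_finite_measure set T2 -> \bar R}).
Local Open Scope ereal_scope.
Implicit Types (A : set T1) (B : set T2).

Lemma patch_rect A B (g : T1 * T2 -> \bar R) z w :
  (g \_ (A `*` B)) (z, w) = if w \in B then ((fun z => g (z, w)) \_ A) z else 0.
Proof. by rewrite /patch in_setX /=; case: (z \in A); case: (w \in B). Qed.

Lemma tonelli_rect A B (g : T1 * T2 -> \bar R) : measurable A -> measurable B ->
  measurable_fun (A `*` B) g -> (forall p, (A `*` B) p -> 0 <= g p) ->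
  \int[m1 \x m2]_(p in A `*` B) g p = \int[m2]_(w in B) \int[m1]_(z in A) g (z, w) /\
  measurable_fun B (fun w => \int[m1]_(z in A) g (z, w)).
Proof.
move=> mA mB mg g0; have mAB : measurable (A `*` B) by exact: measurableX.
have mr : measurable_fun setT (g \_ (A `*` B)) by apply/(measurable_restrictT _ mAB).
have r0 p : 0 <= (g \_ (A `*` B)) p.
  by rewrite /patch; case: ifP => // /set_mem; exact: g0.
have E w : fubini_G m1 (g \_ (A `*` B)) w = ((fun w => \int[m1]_(z in A) g (z, w)) \_ B) w.
  rewrite /fubini_G; under eq_integral do rewrite patch_rect.
  rewrite [RHS]/patch; case: ifP => _; first by rewrite -integral_mkcond.
  by rewrite integral0.
have mG : measurable_fun setT (fubini_G m1 (g \_ (A `*` B))).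
  by apply: measurable_fun_fubini_tonelli_G.
split.
  rewrite [LHS]integral_mkcond [RHS]integral_mkcond (fubini_tonelli2 (g \_ (A `*` B))) //.
  by apply: eq_integral => w _; exact: E.
apply/(measurable_restrictT _ mB); apply: eq_measurable_fun mG => w _; exact: E.
Qed.

Lemma fubini_rect0 A B (g : T1 * T2 -> \bar R) : measurable A -> measurable B ->
  (m1 \x m2).-integrable (A `*` B) g ->
  (forall w, B w -> \int[m1]_(z in A) g (z, w) = 0) ->
  \int[m1 \x m2]_(p in A `*` B) g p = 0.
Proof.
move=> mA mB ig g0; have mAB : measurable (A `*` B) by exact: measurableX.
rewrite integral_mkcond -integral21_prod_meas1; last by rewrite -integrable_mkcond.
rewrite integral0_eq// => w _; rewrite /fubini_G; under eq_integral do rewrite patch_rect.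
have [wB|wB] := boolP (w \in B); last by rewrite integral0.
by rewrite -integral_mkcond g0//; exact: set_mem.
Qed.

Lemma cint_rect0 A B (F : T1 * T2 -> R[i]) : measurable A -> measurable B ->
  cintegrable (m1 \x m2) (A `*` B) F ->
  (forall w, B w -> cintegrable m1 A (fun z => F (z, w))) ->
  (forall w, B w -> cint m1 A (fun z => F (z, w)) = 0%R) ->
  cint (m1 \x m2) (A `*` B) F = 0%R.
Proof.
move=> mA mB [F1 F2] iF F0.
have fin h : m1.-integrable A (fun z => (h z)%:E) ->
  (\int[m1]_(z in A) h z)%R = 0%R -> \int[m1]_(z in A) (h z)%:E = 0.
  move=> ih h0; rewrite -[LHS]fineK; last exact: integrable_fin_num.
  by congr (_%:E).
apply: eqC; rewrite ?cint_Re ?cint_Im /Rintegral.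
  rewrite (fubini_rect0 mA mB F1)// => w Bw; apply: fin; first by case: (iF w Bw).
  by have := F0 w Bw => /(congr1 (@complex.Re R)).
rewrite (fubini_rect0 mA mB F2)// => w Bw; apply: fin; first by case: (iF w Bw).
by have := F0 w Bw => /(congr1 (@complex.Im R)).
Qed.

End RectangleFubini.

(** The choice [t = I / a] gives the squared inequality whenever [a] is nonzero; if [a = 0] the
    roles of [a] and [b] are exchanged by [t] and its inverse. *)
Lemma le_geometric_mean (R : rcfType) (I a b : R) : 0 <= I -> 0 <= a -> 0 <= b ->
  (forall t, 0 < t -> I <= (t * a + t^-1 * b) / 2) -> I <= Num.sqrt a * Num.sqrt b.
Proof.
move=> I0 a0 b0 key; rewrite -sqrtrM// -(ger0_norm I0) -sqrtr_sqr ler_sqrt ?mulr_ge0//.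
have sq_le (A B : R) : 0 <= B -> (forall t, 0 < t -> I <= (t * A + t^-1 * B) / 2) ->
   0 < A -> I ^+ 2 <= A * B.
  move=> B0 K Apos; have [->|In0] := eqVneq I 0.
    by rewrite expr0n /= mulr_ge0// ltW.
  have Ip : 0 < I by rewrite lt0r In0.
  have := K (I / A) (divr_gt0 Ip Apos); rewrite divfK ?gt_eqF// invf_div => h.
  have h2 : I <= A / I * B by move: h; move: (A / I * B) => u; clear; lra.
  rewrite expr2; apply: le_trans (ler_wpM2l I0 h2) _.
  by rewrite mulrA (mulrC I) divfK ?gt_eqF.
have [a00|an0] := eqVneq a 0; last by apply: sq_le => //; rewrite lt0r an0.
have [b00|bn0] := eqVneq b 0.
  have := key 1 ltr01; rewrite a00 b00 !mulr0 addr0 mul0r => h.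
  by rewrite (_ : I = 0) ?expr0n//; apply/eqP; rewrite eq_le h.
rewrite mulrC; apply: sq_le => //; last by rewrite lt0r bn0.
by move=> t t0; have := key t^-1; rewrite invr_gt0 invrK addrC; exact.
Qed.

Section SquareIntegrable.
Context d (S : measurableType d) (R : realType).
Variable mu : {measure set S -> \bar R}.
Notation C := R[i].
Implicit Types (D : set S) (F G H : S -> C).

Definition sqm D F : \bar R := (\int[mu]_(x in D) (normc (F x) ^+ 2)%:E)%E.
Definition L2m D F := cmeasurable D F /\ (sqm D F < +oo)%E.
Definition nrm2 D F : R := fine (sqm D F).
Definition ip D F G : C := cint mu D (fun x => F x * (G x)^*).

Lemma cmeasurableM D F G : cmeasurable D F -> cmeasurable D G ->
  cmeasurable D (fun x => F x * G x).
Proof.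
move=> [F1 F2] [G1 G2]; split.
  by under eq_fun do rewrite ReM; apply: measurable_funB; exact: measurable_funM.
by under eq_fun do rewrite ImM; apply: measurable_funD; exact: measurable_funM.
Qed.

Lemma cmeasurable_conj D F : cmeasurable D F -> cmeasurable D (fun x => (F x)^*).
Proof.
move=> [F1 F2]; split; first by under eq_fun do rewrite ReJ.
by under eq_fun do rewrite ImJ; exact: measurableT_comp.
Qed.

Lemma cmeasurableD D F G : cmeasurable D F -> cmeasurable D G ->
  cmeasurable D (fun x => F x + G x).
Proof.
move=> [F1 F2] [G1 G2]; split.
  by under eq_fun do rewrite ReD; exact: measurable_funD.
by under eq_fun do rewrite ImD; exact: measurable_funD.
Qed.

Lemma cmeasurable_cst D (c : C) : cmeasurable D (fun=> c).
Proof. by split; exact: measurable_cst. Qed.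

Lemma cmeasurable_sqr D F : cmeasurable D F ->
  measurable_fun D (fun x => (normc (F x) ^+ 2)%:E).
Proof.
move=> [F1 F2]; apply/measurable_EFinP; apply: measurable_funX.
exact: cmeasurable_normc.
Qed.

Lemma sqm_ge0 D F : (0 <= sqm D F)%E.
Proof. by apply: integral_ge0 => x _; rewrite lee_fin sqr_ge0. Qed.

Lemma nrm2_ge0 D F : 0 <= nrm2 D F.
Proof. by rewrite /nrm2 fine_ge0// sqm_ge0. Qed.

Lemma L2_sqm D F : L2m D F -> sqm D F = (nrm2 D F)%:E.
Proof. by move=> [_ h]; rewrite /nrm2 fineK// ge0_fin_numE// sqm_ge0. Qed.

Lemma L2_integrable D F : L2m D F -> mu.-integrable D (fun x => (normc (F x) ^+ 2)%:E).
Proof.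
move=> [mF h]; apply/integrableP; split; first exact: cmeasurable_sqr.
apply: le_lt_trans h; rewrite /sqm le_eqVlt; apply/orP; left; apply/eqP.
by apply: eq_integral => x _; rewrite abse_EFin ger0_norm// sqr_ge0.
Qed.

Lemma le_sqm D F G : cmeasurable D F -> cmeasurable D G -> measurable D ->
  (forall x, D x -> normc (F x) <= normc (G x)) -> (sqm D F <= sqm D G)%E.
Proof.
move=> mF mG mD FG; apply: ge0_le_integral => //.
- by move=> x _; rewrite lee_fin sqr_ge0.
- exact: cmeasurable_sqr.
- exact: cmeasurable_sqr.
by move=> x Dx; rewrite lee_fin lerXn2r ?nnegrE ?normc_ge0// FG.
Qed.

Lemma L2Z D F (c : C) : measurable D -> L2m D F -> L2m D (fun x => c * F x) /\
  nrm2 D (fun x => c * F x) = normc c ^+ 2 * nrm2 D F.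
Proof.
move=> mD LF; have [mF h] := LF.
have E : sqm D (fun x => c * F x) = ((normc c ^+ 2)%:E * sqm D F)%E.
  rewrite /sqm -ge0_integralZl//; last 3 first.
  - exact: cmeasurable_sqr.
  - by move=> x _; rewrite lee_fin sqr_ge0.
  - by rewrite lee_fin sqr_ge0.
  by apply: eq_integral => x _; rewrite normcM exprMn EFinM.
split; last by rewrite /nrm2 E (L2_sqm LF) -EFinM.
split; first by apply: cmeasurableM => //; exact: cmeasurable_cst.
by rewrite E (L2_sqm LF) -EFinM ltry.
Qed.

Lemma normcD_sqr (z w : C) : normc (z + w) ^+ 2 <= 2 * normc z ^+ 2 + 2 * normc w ^+ 2.
Proof.
have h := normcD z w; have : normc (z + w) ^+ 2 <= (normc z + normc w) ^+ 2.
  by rewrite lerXn2r ?nnegrE ?addr_ge0 ?normc_ge0.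
have := sqr_ge0 (normc z - normc w); move: (normc z) (normc w) (normc (z + w) ^+ 2).
by clear; move=> x y t; rewrite !expr2; lra.
Qed.

Lemma L2D D F G : measurable D -> L2m D F -> L2m D G -> L2m D (fun x => F x + G x).
Proof.
move=> mD LF LG; split; first by apply: cmeasurableD; [case: LF|case: LG].
have [mF hF] := LF; have [mG hG] := LG.
apply: (@le_lt_trans _ _ (\int[mu]_(x in D) (2%:E * (normc (F x) ^+ 2)%:E + 2%:E * (normc (G x) ^+ 2)%:E))%E).
  apply: ge0_le_integral => //.
  - by move=> x _; rewrite lee_fin sqr_ge0.
  - by apply: cmeasurable_sqr; exact: cmeasurableD.
  - by apply: emeasurable_funD; apply: measurable_funeM; exact: cmeasurable_sqr.
  - by move=> x _; rewrite -!EFinM -EFinD lee_fin normcD_sqr.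
rewrite ge0_integralD//; last 4 first.
- by move=> x _; rewrite -EFinM lee_fin mulr_ge0 ?sqr_ge0.
- by apply: measurable_funeM; exact: cmeasurable_sqr.
- by move=> x _; rewrite -EFinM lee_fin mulr_ge0 ?sqr_ge0.
- by apply: measurable_funeM; exact: cmeasurable_sqr.
rewrite !ge0_integralZl//; try exact: cmeasurable_sqr; try by move=> x _; rewrite lee_fin sqr_ge0.
by rewrite -/(sqm D F) -/(sqm D G) (L2_sqm LF) (L2_sqm LG) -!EFinM -EFinD ltry.
Qed.

Lemma L2B D F G : measurable D -> L2m D F -> L2m D G -> L2m D (fun x => F x - G x).
Proof.
move=> mD LF LG; apply: L2D => //; have [+ _] := L2Z (-1) mD LG.
by under eq_fun do rewrite mulN1r.
Qed.

Lemma L2_product D F G : measurable D -> L2m D F -> L2m D G ->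
  cintegrable mu D (fun x => F x * (G x)^*).
Proof.
move=> mD LF LG; have [mF hF] := LF; have [mG hG] := LG.
have [m1 m2] : cmeasurable D (fun x => F x * (G x)^*).
  by apply: cmeasurableM => //; exact: cmeasurable_conj.
apply: (@le_cintegrable _ _ _ mu D _ (fun x => normc (F x) ^+ 2 + normc (G x) ^+ 2)) => //.
  rewrite (_ : EFin \o _ = (fun x => (normc (F x) ^+ 2)%:E + (normc (G x) ^+ 2)%:E)%E)//.
  by apply: integrableD => //; exact: L2_integrable.
move=> x _; rewrite normcM normc_conj; have := sqr_ge0 (normc (F x) - normc (G x)).
have := mulr_ge0 (normc_ge0 (F x)) (normc_ge0 (G x)).
by move: (normc (F x)) (normc (G x)); clear => a b; rewrite !expr2; lra.
Qed.

Lemma eq_ip D F F' G G' : (forall x, D x -> F x = F' x) -> (forall x, D x -> G x = G' x) ->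
  ip D F G = ip D F' G'.
Proof. by move=> FF GG; apply: eq_cint => x Dx; rewrite FF// GG. Qed.

Lemma ipDl D F G H : measurable D -> L2m D F -> L2m D G -> L2m D H ->
  ip D (fun x => F x + G x) H = ip D F H + ip D G H.
Proof.
move=> mD LF LG LH; rewrite /ip -cintD//; [|exact: L2_product|exact: L2_product].
by apply: eq_cint => x _; rewrite mulrDl.
Qed.

Lemma ipZl D F G (c : C) : measurable D -> L2m D F -> L2m D G ->
  ip D (fun x => c * F x) G = c * ip D F G.
Proof.
move=> mD LF LG; rewrite /ip -cintZ//; last exact: L2_product.
by apply: eq_cint => x _; rewrite mulrA.
Qed.

Lemma ipBl D F G H : measurable D -> L2m D F -> L2m D G -> L2m D H ->
  ip D (fun x => F x - G x) H = ip D F H - ip D G H.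
Proof.
move=> mD LF LG LH; rewrite /ip -cintB//; [|exact: L2_product|exact: L2_product].
by apply: eq_cint => x _; rewrite mulrBl.
Qed.

Lemma ip_conj D F G : measurable D -> L2m D F -> L2m D G -> ip D G F = (ip D F G)^*.
Proof.
move=> mD LF LG; rewrite /ip -cint_conj//; last exact: L2_product.
by apply: eq_cint => x _; rewrite cjM cjK mulrC.
Qed.

Lemma ipBr D F G H : measurable D -> L2m D F -> L2m D G -> L2m D H ->
  ip D H (fun x => F x - G x) = ip D H F - ip D H G.
Proof.
move=> mD LF LG LH; rewrite ip_conj//; last exact: L2B.
by rewrite ipBl// cjB -!ip_conj.
Qed.

Lemma ip_self D F : L2m D F -> ip D F F = (nrm2 D F)%:C.
Proof.
move=> LF; apply: eqC; rewrite /ip ?cint_Re ?cint_Im /=.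
  by apply: (congr1 fine); apply: eq_integral => x _; rewrite mulcJ.
transitivity (\int[mu]_(x in D) (0 : R)); first by apply: eq_Rintegral => x _; rewrite mulcJ.
by rewrite /Rintegral integral0.
Qed.

Lemma cauchy_schwarz D F G : measurable D -> L2m D F -> L2m D G ->
  normc (ip D F G) <= Num.sqrt (nrm2 D F) * Num.sqrt (nrm2 D G).
Proof.
move=> mD LF LG; apply: le_trans (cint_normc mD (L2_product mD LF LG)) _.
set I := \int[mu]_(x in D) _.
have iP := cintegrable_normc mD (L2_product mD LF LG).
have key (t : R) : 0 < t -> I <= (t * nrm2 D F + t^-1 * nrm2 D G) / 2.
  move=> t0; have iF := L2_integrable LF; have iG := L2_integrable LG.
  rewrite [leRHS](_ : _ = \int[mu]_(x in D) (t / 2 * normc (F x) ^+ 2 + t^-1 / 2 * normc (G x) ^+ 2)).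
    apply: le_Rintegral => //.
      rewrite (_ : EFin \o _ = (fun x => ((t / 2)%:E * (normc (F x) ^+ 2)%:E +
        (t^-1 / 2)%:E * (normc (G x) ^+ 2)%:E)%E)); last by apply/funext.
      by apply: integrableD => //; exact: integrableZl.
    move=> x _; rewrite normcM normc_conj.
    move: (normc (F x)) (normc (G x)) => a b.
    have : 0 <= t^-1 * (t * a - b) ^+ 2 by rewrite mulr_ge0 ?sqr_ge0 ?invr_ge0 ?ltW.
    have -> : t^-1 * (t * a - b) ^+ 2 = t * a ^+ 2 + t^-1 * b ^+ 2 - 2 * (a * b).
      by field; rewrite gt_eqF.
    rewrite (_ : t / 2 * a ^+ 2 + t^-1 / 2 * b ^+ 2 = (t * a ^+ 2 + t^-1 * b ^+ 2) / 2); last by ring.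
    by move: (a * b) (t * a ^+ 2) (t^-1 * b ^+ 2) => u v w; clear; lra.
  have ZI c h : mu.-integrable D (fun x => (h x)%:E) -> mu.-integrable D (EFin \o (fun x => c * h x)).
    by move=> ih; rewrite (_ : EFin \o _ = (fun x => (c%:E * (h x)%:E)%E))//; exact: integrableZl.
  rewrite RintegralD//; [|exact: ZI|exact: ZI].
  rewrite !RintegralZl//.
  have nE H : nrm2 D H = \int[mu]_(x in D) normc (H x) ^+ 2 by [].
  by rewrite -!nE; ring.
have I0 : 0 <= I by apply: Rintegral_ge0 => x _; exact: normc_ge0.
have a0 := nrm2_ge0 D F; have b0 := nrm2_ge0 D G.
exact: le_geometric_mean.
Qed.

End SquareIntegrable.

(** * Geometry of the L2 seminorm *)

Section SeminormGeometry.
Context d (S : measurableType d) (R : realType).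
Variables (mu : {measure set S -> \bar R}) (D : set S).
Hypothesis mD : measurable D.
Notation C := R[i].
Notation L2 := (L2m mu D).
Notation nn := (nrm2 mu D).
Notation inn := (ip mu D).
Implicit Types (F G H : S -> C).

Lemma ipDr F G H : L2 F -> L2 G -> L2 H ->
  inn H (fun x => F x + G x) = inn H F + inn H G.
Proof.
move=> LF LG LH; rewrite ip_conj//; last exact: L2D.
by rewrite ipDl// cjD -!ip_conj.
Qed.

Lemma ipZr F G (c : C) : L2 F -> L2 G -> inn F (fun x => c * G x) = c^* * inn F G.
Proof.
move=> LF LG; rewrite ip_conj//; last by case: (L2Z c mD LG).
by rewrite ipZl// cjM -ip_conj.
Qed.

Lemma nrm2D F G : L2 F -> L2 G ->
  nn (fun x => F x + G x) = nn F + 2 * Rec (inn F G) + nn G.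
Proof.
move=> LF LG; have LFG := L2D mD LF LG.
have : Rec (inn (fun x => F x + G x) (fun x => F x + G x)) = nn (fun x => F x + G x).
  by rewrite ip_self.
move=> <-; rewrite ipDl// !ipDr// !ip_self// (ip_conj mD LF LG) !ReImE /=.
by ring.
Qed.

Lemma nrm2BZ F G (c : C) : L2 F -> L2 G ->
  nn (fun x => F x - c * G x) = nn F - 2 * Rec (c^* * inn F G) + normc c ^+ 2 * nn G.
Proof.
move=> LF LG; have [LcG nG] := L2Z (- c) mD LG.
rewrite (_ : (fun x => F x - c * G x) = (fun x => F x + (- c) * G x)); last first.
  by apply/funext => x; rewrite mulNr.
rewrite nrm2D// nG normcNE ipZr// rmorphN mulNr ReN /=.
by rewrite -/(cj c); ring.
Qed.

Lemma nrm2_parallelogram F G : L2 F -> L2 G ->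
  nn (fun x => F x - G x) = 2 * nn F + 2 * nn G - nn (fun x => F x + G x).
Proof.
move=> LF LG; have h := nrm2BZ 1 LF LG.
rewrite cj1 mul1r normc1 expr1n mul1r in h.
have {}h : nn (fun x => F x - G x) = nn F - 2 * Rec (inn F G) + nn G.
  by rewrite -h; congr nn; apply/funext => x; rewrite mul1r.
by rewrite h nrm2D//; ring.
Qed.

Lemma nrm_triangle F G : L2 F -> L2 G ->
  Num.sqrt (nn (fun x => F x + G x)) <= Num.sqrt (nn F) + Num.sqrt (nn G).
Proof.
move=> LF LG; have cs := le_trans (ler_norm _) (le_trans (Re_le_normc _) (cauchy_schwarz mD LF LG)).
have f0 := nrm2_ge0 mu D F; have g0 := nrm2_ge0 mu D G.
rewrite -[leRHS]ger0_norm ?addr_ge0 ?sqrtr_ge0// -sqrtr_sqr ler_sqrt ?sqr_ge0//.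
rewrite nrm2D// sqrrD !sqr_sqrtr// -mulr_natl.
by move: cs; move: (Rec _) (_ * _) => u v; lra.
Qed.

Lemma nrm2_le F G M : 0 <= M -> cmeasurable D F -> L2 G ->
  (forall x, D x -> normc (F x) <= M * normc (G x)) -> L2 F /\ nn F <= M ^+ 2 * nn G.
Proof.
move=> M0 mF LG FG; have [LMG nMG] := L2Z M%:C mD LG.
have h : (sqm mu D F <= sqm mu D (fun x => (M%:C * G x)%R))%E.
  apply: le_sqm => //; first by case: LMG.
  by move=> x Dx; rewrite normcM normc_real ger0_norm// FG.
have LF : L2 F by split => //; apply: le_lt_trans h _; case: LMG.
split => //; move: h; rewrite (L2_sqm LF) (L2_sqm LMG) lee_fin nMG normc_real.
by rewrite real_normK ?num_real.
Qed.

(** Against the competitor [c = t * inn F G] the gain is linear in [t] and the loss quadratic;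
    [t = 1 / nn G] already forces the pairing to vanish. *)
Lemma orthogonal_of_minimal F G : L2 F -> L2 G ->
  (forall c : C, nn F <= nn (fun x => F x - c * G x)) -> inn F G = 0.
Proof.
move=> LF LG H; apply/eqP; rewrite -normc_eq0; set n := normc _.
have n0 : 0 <= n by exact: normc_ge0.
have g0 := nrm2_ge0 mu D G.
have key (t : R) : 0 < t -> 2 * n ^+ 2 <= t * (n ^+ 2 * nn G).
  move=> t0; have := H (t%:C * inn F G); rewrite nrm2BZ//.
  rewrite cjM cj_real -mulrA (mulrC _ (inn F G)) mulcJ -/n -rmorphM /= normcM normc_real.
  rewrite (ger0_norm (ltW t0)) -/n exprMn => h.
  have {}h : t * (2 * n ^+ 2) <= t * (t * (n ^+ 2 * nn G)) by rewrite expr2 in h; move: h; lra.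
  by move: h; rewrite ler_pM2l.
rewrite -sqrf_eq0 eq_le sqr_ge0 andbT.
have [g00|gn0] := eqVneq (nn G) 0; first by have := key 1 ltr01; rewrite g00 !mulr0; lra.
have gp : 0 < nn G by rewrite lt0r gn0.
have := key (nn G)^-1; rewrite invr_gt0 => /(_ gp); rewrite (mulrC (nn G)^-1) mulfK//.
by move: (n ^+ 2) => u; lra.
Qed.

End SeminormGeometry.

Section ProductMeasurePreserving.
Local Open Scope ereal_scope.
Context d1 d2 (T1 : measurableType d1) (T2 : measurableType d2) (R : realType).
Variables (m1 : {sigma_finite_measure set T1 -> \bar R})
  (m2 : {sigma_finite_measure set T2 -> \bar R}).

Lemma mpres_prod phi psi : mpres m1 m1 phi -> mpres m2 m2 psi ->
  mpres (m1 \x m2) (m1 \x m2) (fun p => (phi p.1, psi p.2)).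
Proof.
move=> mphi mpsi; have [p1 _] := mphi; have [p2 _] := mpsi.
have mp : measurable_fun setT (fun p : T1 * T2 => (phi p.1, psi p.2)).
  apply/measurable_fun_pairP; split; first exact: (measurableT_comp p1 measurable_fst).
  exact: (measurableT_comp p2 measurable_snd).
apply: mpres_intro => // f mf f0.
have mfp := measurableT_comp mf mp.
rewrite (fubini_tonelli1 f)// (fubini_tonelli1 (fun p => f (phi p.1, psi p.2)))//.
rewrite (@mpres_ge0_integral _ _ _ _ _ m1 m1 phi setT (fubini_F m2 f))//; last 2 first.
- exact: measurable_fun_fubini_tonelli_F.
- by move=> x _; apply: integral_ge0 => y _; exact: f0.
apply: eq_integral => x _; rewrite /fubini_F /=.
rewrite (@mpres_ge0_integral _ _ _ _ _ m2 m2 psi setT (fun y => f (phi x, y)))//.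
exact: measurableT_comp mf (measurable_pair1 (phi x)).
Qed.

End ProductMeasurePreserving.

Section SigmaFiniteProduct.
Local Open Scope ereal_scope.
Context d1 d2 (T1 : measurableType d1) (T2 : measurableType d2) (R : realType).
Variables (m1 : {sigma_finite_measure set T1 -> \bar R})
  (m2 : {sigma_finite_measure set T2 -> \bar R}).

Lemma sigma_finite_prod : sigma_finite setT (m1 \x m2).
Proof.
have /sigma_finiteP[F [TF ndF Foo]] := sigma_finiteT m1.
have /sigma_finiteP[G [TG ndG Goo]] := sigma_finiteT m2.
exists (fun n => F n `*` G n).
  rewrite -setXTT TF TG predeqE => -[x y]; split; last by move=> [n _ []/= ? ?]; split; exists n.
  move=> [/= [n _ Fnx] [k _ Gky]]; exists (maxn n k) => //; split.
    by move: x Fnx; exact/subsetPset/ndF/leq_maxl.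
  by move: y Gky; exact/subsetPset/ndG/leq_maxr.
move=> k; have [? ?] := Foo k; have [? ?] := Goo k.
by split; [exact: measurableX|rewrite product_measure1E// lte_mul_pinfty// ge0_fin_numE].
Qed.

End SigmaFiniteProduct.


(** A name for the plane measure, so that it can carry the sigma-finite structure needed to form
    products with it and to apply Tonelli's theorem. *)
Definition lebesgue2 (R : realType) := (@lebesgue_measure R \x @lebesgue_measure R)%E.
HB.instance Definition _ (R : realType) := Measure.on (@lebesgue2 R).
HB.instance Definition _ (R : realType) :=
  Measure_isSigmaFinite.Build _ _ _ (@lebesgue2 R)
    (sigma_finite_prod (@lebesgue_measure R) (@lebesgue_measure R)).

(** * Bounds for point evaluations *)

Section PointEvaluation.
Variable R : realType.
Notation C := R[i].
Notation T := (measurableTypeR R).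
Notation leb := (@lebesgue_measure R).
Notation l2 := (leb \x leb)%E.
Notation m4 := (@lebesgue2 R \x @lebesgue2 R)%E.

(** The mean value property over the disc and Cauchy-Schwarz against the constant 1. The extended
    real form lets Tonelli's theorem integrate it over the second variable. *)
Lemma disc_point_bound (g : C -> C) (r rho : R) : (forall w, normc w < r -> differentiable g w) ->
  0 < rho -> rho < r ->
  ((normc (g 0) ^+ 2 * moment rho 0)%:E <= sqm l2 (disc rho) (fun p => g (toC p)))%E.
Proof.
move=> dg rho0 rhor; have mD := measurable_disc rho.
have m0 : 0 < moment rho 0 by rewrite moment0 l2_disc_gt0.
have [M gM] := disc_bounded dg rho0 rhor.
have Lc : L2m l2 (disc rho) (fun=> 1 : C).
  split; first exact: cmeasurable_cst.
  rewrite /sqm (eq_integral (fun=> 1%E)) => [|p _]; last by rewrite normc1 expr1n.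
  by rewrite integral_cst// mul1e; exact: l2_disc_fin.
have mg : cmeasurable (disc rho) (fun p : T * T => g (toC p)).
  apply: ccont_cmeasurable; first exact: copen_disc0.
  by move=> z zr; apply: differentiable_ccont; apply: dg; exact: lt_trans rhor.
have M0 : 0 <= M by apply: le_trans (normc_ge0 _) (gM 0 _); rewrite normc0.
have [Lg _] : L2m l2 (disc rho) (fun p => g (toC p)) /\
    nrm2 l2 (disc rho) (fun p => g (toC p)) <= M ^+ 2 * nrm2 l2 (disc rho) (fun=> 1 : C).
  by apply: nrm2_le => // p zr; rewrite normc1 mulr1; exact: gM.
rewrite (L2_sqm Lg) lee_fin.
have n1 : nrm2 l2 (disc rho) (fun=> 1 : C) = moment rho 0.
  rewrite moment0 /nrm2 /sqm (eq_integral (fun=> 1%E)) => [|p _]; last by rewrite normc1 expr1n.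
  by rewrite integral_cst// mul1e.
have := cauchy_schwarz mD Lc Lg; rewrite n1.
have -> : ip l2 (disc rho) (fun=> 1) (fun p => g (toC p)) = (g 0)^* * (moment rho 0)%:C.
  by rewrite -(disc_mean dg rho0 rhor); apply: eq_cint => p _; rewrite mul1r.
rewrite normcM normc_conj normc_real ger0_norm ?(ltW m0)//.
have := nrm2_ge0 l2 (disc rho) (fun p : T * T => g (toC p)); have := normc_ge0 (g 0).
move: (normc (g 0)) (nrm2 _ _ _) (moment rho 0) m0 => a N m m0 a0 N0 h.
have : (a * m) ^+ 2 <= (Num.sqrt m * Num.sqrt N) ^+ 2.
  by rewrite lerXn2r ?nnegrE ?mulr_ge0 ?sqrtr_ge0// ltW.
rewrite exprMn exprMn !sqr_sqrtr ?(ltW m0)// (expr2 m) mulrA (mulrC _ m) ler_pM2l//.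
Qed.

Lemma line_cderiv (f : C * C -> C) (x k : C * C) t l1 l2 :
  cderiv2 f (x.1 + t * k.1, x.2 + t * k.2) l1 l2 ->
  cderiv (fun s => f (x.1 + s * k.1, x.2 + s * k.2)) t (l1 * k.1 + l2 * k.2).
Proof.
move=> df e e0; pose K := normc k.1 + normc k.2 + 1.
have K0 : 0 < K by rewrite ltr_wpDl ?addr_ge0 ?normc_ge0.
have [d d0 H] := df (e / K) (divr_gt0 e0 K0).
exists (d / K); first exact: divr_gt0.
move=> h; rewrite ltr_pdivlMr// => hd.
have k1 : normc (h * k.1) < d.
  rewrite normcM; apply: le_lt_trans hd; apply: ler_wpM2l; first exact: normc_ge0.
  by rewrite /K -addrA lerDl addr_ge0 ?normc_ge0.
have k2 : normc (h * k.2) < d.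
  rewrite normcM; apply: le_lt_trans hd; apply: ler_wpM2l; first exact: normc_ge0.
  by rewrite /K addrAC lerDr addr_ge0 ?normc_ge0.
have := H _ _ k1 k2; rewrite /= -!addrA -!mulrDl => h'.
rewrite (_ : _ * h = l1 * (h * k.1) + l2 * (h * k.2)); last by ring.
apply: le_trans h' _; rewrite !normcM -mulrDr mulrA mulrAC -mulrA.
rewrite [leLHS](_ : _ = e * normc h * ((normc k.1 + normc k.2) / K)); last by ring.
apply: ler_piMr; first by rewrite mulr_ge0 ?normc_ge0 ?(ltW e0).
by rewrite ler_pdivrMr// mul1r lerDl.
Qed.

Lemma line_differentiable (f : C * C -> C) (x k : C * C) (t : C) :
  differentiable f (x.1 + t * k.1, x.2 + t * k.2) ->
  differentiable (fun s : C => f (x.1 + s * k.1, x.2 + s * k.2)) t.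
Proof.
move=> /diff_cderiv2[l1 [l2 h]]; apply/diff_cderiv.
by exists (l1 * k.1 + l2 * k.2); exact: line_cderiv.
Qed.

Lemma cderiv2_ccont2 (f : C * C -> C) x l1 l2 : cderiv2 f x l1 l2 -> ccont2 f x.
Proof.
move=> df e e0; have [d d0 H] := df 1 ltr01.
pose K := normc l1 + normc l2 + 2.
have K0 : 0 < K by rewrite ltr_wpDl ?addr_ge0 ?normc_ge0.
exists (Num.min d (e / (K + K))).
  by rewrite lt_min d0 divr_gt0 ?(addr_gt0 K0 K0).
move=> y; rewrite !lt_min => /andP[y1 e1] /andP[y2 e2].
have := H _ _ y1 y2; rewrite mul1r => h.
have yE : (x.1 + (y.1 - x.1), x.2 + (y.2 - x.2)) = y.
  by case: (y) => a b /=; congr pair; ring.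
rewrite yE in h; rewrite -(subrK (l1 * (y.1 - x.1) + l2 * (y.2 - x.2)) (f y - f x)).
apply: le_lt_trans (normcD _ _) _; apply: le_lt_trans (lerD h (normcD _ _)) _.
rewrite !normcM; move: (normc_ge0 (y.1 - x.1)) (normc_ge0 (y.2 - x.2)).
move: e1 e2; rewrite !ltr_pdivlMr ?(addr_gt0 K0 K0)//.
move: (normc (y.1 - x.1)) (normc (y.2 - x.2)) => u v h1 h2 u0 v0.
have i1 : (1 + normc l1) * u <= K * u.
  by apply: ler_wpM2r => //; rewrite /K; have := normc_ge0 l2; clear; lra.
have i2 : (1 + normc l2) * v <= K * v.
  by apply: ler_wpM2r => //; rewrite /K; have := normc_ge0 l1; clear; lra.
move: h1 h2 i1 i2; rewrite !mulrDr !mulrDl !mul1r !(mulrC u) !(mulrC v).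
by move: (K * u) (K * v) (normc l1 * u) (normc l2 * v); clear; move=> a b c d; lra.
Qed.

Lemma differentiable_ccont2 (f : C * C -> C) x : differentiable f x -> ccont2 f x.
Proof. by move=> /diff_cderiv2[l1 [l2]]; exact: cderiv2_ccont2. Qed.

Lemma m4_translation (x : C * C) : mpres m4 m4 (fun p : T * T * (T * T) =>
  (((p.1.1 + Rec x.1) : T, (p.1.2 + Imc x.1) : T),
   ((p.2.1 + Rec x.2) : T, (p.2.2 + Imc x.2) : T))).
Proof.
exact: (@mpres_prod _ _ _ _ R (@lebesgue2 R) (@lebesgue2 R) _ _
  (l2_translation (Rec x.1, Imc x.1)) (l2_translation (Rec x.2, Imc x.2))).
Qed.

Lemma slice1_differentiable (f : C * C -> C) (a b : C) (r : R) :
  (forall z, normc z < r -> differentiable f (a + z, b)) ->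
  forall z, normc z < r -> differentiable (fun z => f (a + z, b)) z.
Proof.
move=> df z zr; have := @line_differentiable f (a, b) (1, 0) z.
rewrite /= mulr1 mulr0 addr0 => /(_ (df z zr)).
by rewrite (_ : (fun s => _) = (fun z => f (a + z, b)))//; apply/funext => s; rewrite mulr1 mulr0 addr0.
Qed.

Lemma slice2_differentiable (f : C * C -> C) (a b : C) (r : R) :
  (forall z, normc z < r -> differentiable f (a, b + z)) ->
  forall z, normc z < r -> differentiable (fun z => f (a, b + z)) z.
Proof.
move=> df z zr; have := @line_differentiable f (a, b) (0, 1) z.
rewrite /= mulr1 mulr0 addr0 => /(_ (df z zr)).
by rewrite (_ : (fun s => _) = (fun z => f (a, b + z)))//; apply/funext => s; rewrite mulr1 mulr0 addr0.
Qed.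

Definition mom2 (rho : R) : R := moment rho 0 ^+ 2.

Lemma mom2_gt0 rho : 0 < rho -> 0 < mom2 rho.
Proof. by move=> r0; rewrite exprn_gt0// moment0 l2_disc_gt0. Qed.

(** After translating [x] to the origin, the one-variable bound is applied on every slice in the
    first variable and then to the centre line in the second. *)
Lemma polydisc_point_bound (E : set (C * C)) (f : C * C -> C) x (r rho : R) :
  copen2 E -> 0 < rho -> rho < r ->
  (forall y, normc (y.1 - x.1) < r -> normc (y.2 - x.2) < r -> E y) ->
  (forall y, E y -> differentiable f y) ->
  ((normc (f x) ^+ 2 * mom2 rho)%:E <= sqm m4 (@toCC R @^-1` E) (fun p => f (toCC p)))%E.
Proof.
move=> oE rho0 rhor rE df.
pose tau (p : T * T * (T * T)) := (((p.1.1 + Rec x.1) : T, (p.1.2 + Imc x.1) : T),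
   ((p.2.1 + Rec x.2) : T, (p.2.2 + Imc x.2) : T)).
have tauE p : toCC (tau p) = (x.1 + toC p.1, x.2 + toC p.2).
  case: p => -[a b] [c d]; rewrite /toCC /tau /=.
  by congr pair; apply: eqC; rewrite ReImE /= addrC.
pose B := [set y : C * C | normc (y.1 - x.1) < rho /\ normc (y.2 - x.2) < rho].
have oB : copen2 B.
  move=> y [y1 y2]; have [e1 e10 h1] := @copen_disc _ x.1 rho y.1 y1.
  have [e2 e20 h2] := @copen_disc _ x.2 rho y.2 y2.
  exists (Num.min e1 e2) => [|w]; first by rewrite lt_min e10.
  by rewrite !lt_min => /andP[w1 _] /andP[_ w2]; split; [exact: h1|exact: h2].
have mB := copen2_measurable oB; have mE := copen2_measurable oE.
have BE : @toCC R @^-1` B `<=` @toCC R @^-1` E.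
  by move=> p [h1 h2]; apply: rE; exact: lt_trans rhor.
have mf : cmeasurable (@toCC R @^-1` E) (fun p => f (toCC p)).
  by apply: ccont2_cmeasurable => // y /df; exact: differentiable_ccont2.
have mfB : cmeasurable (@toCC R @^-1` B) (fun p => f (toCC p)).
  by case: mf => m1 m2; split; [exact: measurable_funS m1|exact: measurable_funS m2].
apply: (@le_trans _ _ (sqm m4 (@toCC R @^-1` B) (fun p => f (toCC p)))); last first.
  apply: ge0_subset_integral => //; first exact: cmeasurable_sqr.
  by move=> p _; rewrite lee_fin sqr_ge0.
have msq := cmeasurable_sqr mfB.
rewrite /sqm (mpres_ge0_integral (m4_translation x))//; last first.
  by move=> p _; rewrite lee_fin sqr_ge0.
have mgt := mpres_measurable_fun (m4_translation x) mB msq; move: mgt.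
have -> : (fun p : T * T * (T * T) => (((p.1.1 + Rec x.1) : T, (p.1.2 + Imc x.1) : T),
   ((p.2.1 + Rec x.2) : T, (p.2.2 + Imc x.2) : T))) @^-1` (@toCC R @^-1` B) =
   disc rho `*` disc rho.
  by apply/seteqP; split => p /=; rewrite /B -/(tau p) tauE /= !(addrC x.1) !(addrC x.2) !addrK.
pose g (p : T * T * (T * T)) : \bar R := (normc (f (x.1 + toC p.1, x.2 + toC p.2)) ^+ 2)%:E.
move=> mgt; have mg : measurable_fun (disc rho `*` disc rho) g.
  by apply: eq_measurable_fun mgt => p _; rewrite /g /= -/(tau p) tauE.
rewrite (_ : \int[_]_(_ in _) _ = \int[m4]_(p in disc rho `*` disc rho) g p)%E; last first.
  by apply: eq_integral => p _; rewrite -/(tau p) tauE.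
have md := measurable_disc rho.
have [-> mG] := @tonelli_rect _ _ _ _ R (@lebesgue2 R) (@lebesgue2 R) _ _ g md md mg
  (fun p _ => ltac:(by rewrite lee_fin sqr_ge0)).
have m0 : 0 <= moment rho 0 by exact: moment_ge0.
have sl1 w : normc w < rho -> forall z, normc z < r -> differentiable (fun z => f (x.1 + z, x.2 + w)) z.
  move=> wr; apply: slice1_differentiable => z zr; apply: df; apply: rE => /=.
    by rewrite addrC addKr.
  by rewrite addrC addKr; exact: lt_trans rhor.
have sl2 z : normc z < r -> differentiable (fun z => f (x.1 + 0, x.2 + z)) z.
  apply: slice2_differentiable => {}z zr; apply: df; apply: rE => /=.
    by rewrite addr0 subrr normc0 (lt_trans rho0).
  by rewrite addrC addKr.
pose h (w : T * T) : \bar R := (normc (f (x.1 + 0, x.2 + toC w)) ^+ 2)%:E.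
have mh : measurable_fun (disc rho) h.
  apply: (@cmeasurable_sqr _ _ _ (disc rho) (fun w => f (x.1 + 0, x.2 + toC w))).
  apply: (@ccont_cmeasurable _ _ (fun w => f (x.1 + 0, x.2 + w))); first exact: copen_disc0.
  by move=> z zr; apply: differentiable_ccont; apply: sl2; exact: lt_trans rhor.
apply: (@le_trans _ _ (\int[l2]_(w in disc rho) ((moment rho 0)%:E * h w))%E); last first.
  apply: ge0_le_integral => //.
  - by move=> w _; rewrite /h -EFinM lee_fin mulr_ge0 ?sqr_ge0.
  - exact: measurable_funeM.
  - move=> w wr; rewrite /h -EFinM mulrC.
    exact: (disc_point_bound (sl1 (toC w) wr) rho0 rhor).
rewrite ge0_integralZl//; last by move=> w _; rewrite lee_fin sqr_ge0.
rewrite /mom2 expr2 mulrA mulrC EFinM; apply: lee_pmul => //.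
  by rewrite lee_fin mulr_ge0 ?sqr_ge0.
have xE : (x.1 + 0, x.2 + 0) = x by case: (x) => a b; rewrite !addr0.
by rewrite -expr2 -{1}xE; exact: (disc_point_bound sl2 rho0 rhor).
Qed.

End PointEvaluation.

(** * Second-order Taylor bounds in one and two variables *)

Section TaylorEstimates.
Variable R : realType.
Notation C := R[i].

(** [taylor2] has a circle mean as its linear coefficient. It equals the derivative [L], because two
    first-order expansions at 0 are compared at a small real point [t]. *)
Lemma taylor2_deriv (g : C -> C) (r M : R) L : 0 < r ->
  (forall w, normc w < r -> differentiable g w) -> (forall w, normc w < r -> normc (g w) <= M) ->
  cderiv g 0 L -> normc L <= 2 * M / r /\ forall z, normc z <= r / 4 ->
  normc (g z - g 0 - L * z) <= 8 * M / r ^+ 2 * normc z ^+ 2.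
Proof.
move=> r0 dg gM dL; have T z := @taylor2 _ g r M z r0 dg gM.
have r20 : 0 < r / 2 by rewrite divr_gt0.
have r2r : r / 2 < r by move: r0; clear; lra.
have M0 : 0 <= M by apply: le_trans (normc_ge0 _) (gM 0 _); rewrite normc0.
have cb := @ccoef_bound _ g r (r / 2) 1 M dg r20 r2r.
have {}cb : normc (ccoef g (r / 2) 1) <= 2 * M / r.
  rewrite (_ : 2 * M / r = M / (r / 2) ^+ 1); last by rewrite expr1; field; rewrite gt_eqF.
  by apply: cb => t _; apply: gM; rewrite normc_circle// ltW.
move: (ccoef g (r / 2) 1) T cb => c T cb.
suff -> : L = c by split.
apply/eqP; rewrite -subr_eq0 -normc_eq0 eq_le normc_ge0 andbT.
rewrite leNgt; apply/negP => n0.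
pose K := 8 * M / r ^+ 2.
have K0 : 0 <= K by apply: divr_ge0; [exact: mulr_ge0|exact: sqr_ge0].
have n40 : 0 < normc (L - c) / 4 by rewrite divr_gt0.
have [d d0 H] := dL _ n40.
pose t := Num.min (Num.min (d / 2) (r / 4)) (normc (L - c) / (4 * (K + 1))).
have K10 : 0 < 4 * (K + 1) by rewrite mulr_gt0 ?ltr_wpDl.
have t0 : 0 < t by rewrite !lt_min !divr_gt0.
have td : t < d.
  apply: (@le_lt_trans _ _ (d / 2)); first by rewrite !ge_min lexx.
  by move: d0; clear; lra.
have tr : t <= r / 4 by rewrite !ge_min lexx orbT.
have tK : t * (4 * (K + 1)) <= normc (L - c).
  by rewrite -ler_pdivlMr// !ge_min lexx orbT.
have nt : normc t%:C = t by rewrite normc_real ger0_norm// ltW.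
have h1 := T t%:C; rewrite nt in h1; have {}h1 := h1 tr.
have h2 := H t%:C; rewrite nt add0r in h2; have {}h2 := h2 td.
have : normc (L - c) * t <= normc (L - c) / 4 * t + K * t ^+ 2.
  rewrite -{1}nt -normcM.
  rewrite (_ : (L - c) * t%:C = (g t%:C - g 0 - c * t%:C) - (g t%:C - g 0 - L * t%:C)); last by ring.
  by apply: le_trans (normcB _ _) _; rewrite addrC lerD.
rewrite expr2 mulrA -mulrDl ler_pM2r//.
have : 0 <= t * K by rewrite mulr_ge0// ltW.
move: tK n0 t0; rewrite !mulrDr (mulrC K) (mulrCA t); move: (normc (L - c)) (t * K) => u v.
by clear; rewrite mulr1; lra.
Qed.

Lemma taylor2d (f : C * C -> C) x (r M : R) l1 l2 : 0 < r ->
  (forall y, normc (y.1 - x.1) < r -> normc (y.2 - x.2) < r -> differentiable f y) ->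
  (forall y, normc (y.1 - x.1) < r -> normc (y.2 - x.2) < r -> normc (f y) <= M) ->
  cderiv2 f x l1 l2 ->
  [/\ normc l1 <= 2 * M / r, normc l2 <= 2 * M / r &
   forall h1 h2, normc h1 + normc h2 <= r / 4 ->
   normc (f (x.1 + h1, x.2 + h2) - f x - (l1 * h1 + l2 * h2)) <=
     8 * M / r ^+ 2 * (normc h1 + normc h2) ^+ 2].
Proof.
move=> r0 df fM dl.
have L (k : C * C) : normc k.1 <= 1 -> normc k.2 <= 1 ->
    normc (l1 * k.1 + l2 * k.2) <= 2 * M / r /\ forall z, normc z <= r / 4 ->
    normc (f (x.1 + z * k.1, x.2 + z * k.2) - f x - (l1 * k.1 + l2 * k.2) * z) <=
    8 * M / r ^+ 2 * normc z ^+ 2.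
  move=> k1 k2; pose g z := f (x.1 + z * k.1, x.2 + z * k.2).
  have xE : (x.1 + 0 * k.1, x.2 + 0 * k.2) = x by case: (x) => a b; rewrite !mul0r !addr0.
  have g0 : g 0 = f x by rewrite /g xE.
  have in1 w (c : C) : normc c <= 1 -> normc w < r -> normc (w * c) < r.
    by move=> c1; apply: le_lt_trans; rewrite normcM ler_piMr ?normc_ge0.
  have := @taylor2_deriv g r M (l1 * k.1 + l2 * k.2) r0; rewrite g0; apply.
  - move=> w wr; apply: line_differentiable; apply: df => /=.
      by rewrite addrC addKr; exact: in1.
    by rewrite addrC addKr; exact: in1.
  - move=> w wr; apply: fM => /=.
      by rewrite addrC addKr; exact: in1.
    by rewrite addrC addKr; exact: in1.
  - by apply: line_cderiv; rewrite xE.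
split.
- by have := L (1, 0); rewrite /= normc0 normc1 lexx ler01 => /(_ isT isT)[]; rewrite mulr1 mulr0 addr0.
- by have := L (0, 1); rewrite /= normc0 normc1 lexx ler01 => /(_ isT isT)[]; rewrite mulr1 mulr0 add0r.
(* The one-variable estimate on the complex line in direction [(h1, h2) / s], evaluated at the point
   [s]. *)
move=> h1 h2; pose s := normc h1 + normc h2.
have s0 : 0 <= s by rewrite addr_ge0 ?normc_ge0.
rewrite -/s => sr; have [s00|sn0] := eqVneq s 0.
  have /andP[] : (normc h1 == 0) && (normc h2 == 0) by rewrite -paddr_eq0 ?normc_ge0// -/s s00.
  rewrite !normc_eq0 => /eqP -> /eqP ->; rewrite s00 expr0n mulr0 !mulr0 !addr0.
  by case: (x) => a b; rewrite /= subrr subr0 normc0.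
have sp : 0 < s by rewrite lt0r sn0.
have sC : s%:C != 0 by rewrite -normc_eq0 normc_real normr_eq0.
have ns : normc s%:C = s by rewrite normc_real ger0_norm.
have [||_ +] := L (h1 / s%:C, h2 / s%:C).
- by rewrite /= normcM normcV ns ler_pdivrMr// mul1r lerDl normc_ge0.
- by rewrite /= normcM normcV ns ler_pdivrMr// mul1r lerDr normc_ge0.
move=> /(_ s%:C); rewrite ns => /(_ sr) /=.
rewrite !(mulrCA s%:C) !divff// !mulr1.
rewrite (_ : (_ + _) * s%:C = l1 * h1 + l2 * h2)//.
by field.
Qed.

End TaylorEstimates.

(** * Locally uniform limits of holomorphic functions *)

Section LocallyUniformLimits.
Variable R : realType.
Notation C := R[i].

Lemma real_cauchy_limit (u : nat -> R) :
  (forall e : R, 0 < e -> exists N, forall m n, (N <= m)%N -> (N <= n)%N -> `|u m - u n| <= e) ->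
  exists l, forall e : R, 0 < e -> exists N, forall n, (N <= n)%N -> `|u n - l| <= e.
Proof.
move=> H; have : cvgn u.
  apply: cauchy_cvg; apply: cauchy_exP => e e0.
  have e20 : 0 < e / 2 by rewrite divr_gt0.
  have [N HN] := H _ e20; exists (u N); exists N => // n Nn.
  rewrite /= /ball /=; apply: le_lt_trans (HN N n (leqnn N) Nn) _.
  by move: e0; clear; lra.
move=> cu; exists (limn u) => e e0.
have /cvgrPdist_le/(_ e e0)[N _ HN] := cu.
by exists N => n Nn; rewrite distrC; exact: HN.
Qed.

Lemma complex_cauchy_limit (u : nat -> C) :
  (forall e : R, 0 < e -> exists N, forall m n, (N <= m)%N -> (N <= n)%N -> normc (u m - u n) <= e) ->
  exists l, forall e : R, 0 < e -> exists N, forall n, (N <= n)%N -> normc (u n - l) <= e.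
Proof.
move=> H; have [a aE] : exists l, forall e : R, 0 < e -> exists N, forall n, (N <= n)%N -> `|Rec (u n) - l| <= e.
  apply: real_cauchy_limit => e e0; have [N HN] := H e e0; exists N => m n Nm Nn.
  by apply: le_trans (HN m n Nm Nn); apply: le_trans (Re_le_normc _); rewrite !ReImE.
have [b bE] : exists l, forall e : R, 0 < e -> exists N, forall n, (N <= n)%N -> `|Imc (u n) - l| <= e.
  apply: real_cauchy_limit => e e0; have [N HN] := H e e0; exists N => m n Nm Nn.
  by apply: le_trans (HN m n Nm Nn); apply: le_trans (Im_le_normc _); rewrite !ReImE.
exists (a +i* b) => e e0; have e20 : 0 < e / 2 by rewrite divr_gt0.
have [N1 H1] := aE _ e20; have [N2 H2] := bE _ e20.
exists (maxn N1 N2) => n; rewrite geq_max => /andP[n1 n2].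
apply: le_trans (normc_le_ReIm _) _; rewrite !ReImE /=.
have := lerD (H1 n n1) (H2 n n2); move: (`|_ - a|) (`|_ - b|) => v w; clear; lra.
Qed.

(** Cauchy's estimates applied to [f n - f m] show that the derivatives at [x] form Cauchy
    sequences. The quadratic remainder bound depends only on [M] and [r], so it passes to the
    limit. *)
Lemma uniform_limit_differentiable (f : nat -> C * C -> C) (g : C * C -> C) x (r M : R) : 0 < r ->
  (forall n y, normc (y.1 - x.1) < r -> normc (y.2 - x.2) < r -> differentiable (f n) y) ->
  (forall n y, normc (y.1 - x.1) < r -> normc (y.2 - x.2) < r -> normc (f n y) <= M) ->
  (forall e : R, 0 < e -> exists N, forall n y, (N <= n)%N ->
    normc (y.1 - x.1) < r -> normc (y.2 - x.2) < r -> normc (f n y - g y) <= e) ->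
  differentiable g x.
Proof.
move=> r0 df fM lim.
have x0 : normc (x.1 - x.1) < r by rewrite subrr normc0.
have x1 : normc (x.2 - x.2) < r by rewrite subrr normc0.
have dfx n : exists l : C * C, cderiv2 (f n) x l.1 l.2.
  by have /diff_cderiv2[l1 [l2 h]] := df n x x0 x1; exists (l1, l2).
have [l lE] := choice dfx.
have ln n m (e : R) : (forall y, normc (y.1 - x.1) < r -> normc (y.2 - x.2) < r -> normc (f n y - f m y) <= e) ->
   normc ((l n).1 - (l m).1) <= 2 * e / r /\ normc ((l n).2 - (l m).2) <= 2 * e / r.
  move=> H; have dB : forall y, normc (y.1 - x.1) < r -> normc (y.2 - x.2) < r ->
      differentiable (fun y => f n y - f m y) y.
    by move=> y y1 y2; apply: differentiableB; exact: df.
  have dL : cderiv2 (fun y => f n y - f m y) x ((l n).1 - (l m).1) ((l n).2 - (l m).2).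
    move=> e' e0'; have e20 : 0 < e' / 2 by rewrite divr_gt0.
    have [d1 d10 H1] := lE n _ e20; have [d2 d20 H2] := lE m _ e20.
    exists (Num.min d1 d2) => [|h1 h2]; first by rewrite lt_min d10.
    rewrite !lt_min => /andP[a1 a2] /andP[b1 b2].
    have := lerD (H1 _ _ a1 b1) (H2 _ _ a2 b2); rewrite -mulrDl.
    rewrite (_ : e' / 2 + e' / 2 = e'); last by clear; lra.
    apply: le_trans; apply: le_trans (normcB _ _).
    by rewrite le_eqVlt; apply/orP; left; apply/eqP; congr (normc _); ring.
  by have [] := taylor2d r0 dB H dL.
have close n m (e : R) : (forall y, normc (y.1 - x.1) < r -> normc (y.2 - x.2) < r -> normc (f n y - g y) <= e) ->
    (forall y, normc (y.1 - x.1) < r -> normc (y.2 - x.2) < r -> normc (f m y - g y) <= e) ->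
    forall y, normc (y.1 - x.1) < r -> normc (y.2 - x.2) < r -> normc (f n y - f m y) <= 2 * e.
  move=> H1 H2 y y1 y2; rewrite (_ : f n y - f m y = (f n y - g y) - (f m y - g y)); last by ring.
  apply: le_trans (normcB _ _) _; have := lerD (H1 y y1 y2) (H2 y y1 y2).
  by move: (normc _) (normc _) => v w; clear; lra.
have cau (e : R) : 0 < e -> exists N, forall m n, (N <= m)%N -> (N <= n)%N ->
   normc ((l m).1 - (l n).1) <= e /\ normc ((l m).2 - (l n).2) <= e.
  move=> e0; have e1 : 0 < e * r / 4 by rewrite divr_gt0 ?mulr_gt0.
  have [N HN] := lim _ e1; exists N => m n Nm Nn.
  have := ln m n _ (close m n _ (fun y => HN m y Nm) (fun y => HN n y Nn)).
  by rewrite (_ : 2 * (2 * (e * r / 4)) / r = e)//; field; rewrite gt_eqF.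
have [l1 L1] := @complex_cauchy_limit (fun n => (l n).1) (fun e e0 =>
  let: ex_intro N HN := cau e e0 in ex_intro _ N (fun m n a b => (HN m n a b).1)).
have [l2 L2] := @complex_cauchy_limit (fun n => (l n).2) (fun e e0 =>
  let: ex_intro N HN := cau e e0 in ex_intro _ N (fun m n a b => (HN m n a b).2)).
pose K := 8 * M / r ^+ 2.
have M0 : 0 <= M by apply: le_trans (normc_ge0 _) (fM 0%N x x0 x1).
have K0 : 0 <= K by apply: divr_ge0; [exact: mulr_ge0|exact: sqr_ge0].
apply/diff_cderiv2; exists l1, l2 => e e0.
have K20 : 0 < 2 * (K + 1) by rewrite mulr_gt0 ?ltr_wpDl.
exists (Num.min (r / 8) (e / (2 * (K + 1)))); first by rewrite lt_min !divr_gt0.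
move=> h1 h2; rewrite !lt_min => /andP[a1 b1] /andP[a2 b2].
pose s := normc h1 + normc h2; have s0 : 0 <= s by rewrite addr_ge0 ?normc_ge0.
have sr : s <= r / 4 by rewrite /s; move: a1 a2; clear; lra.
have sK : s * (K + 1) <= e.
  have aux (u v w c : R) : u * (2 * w) < c -> v * (2 * w) < c -> (u + v) * w <= c.
    by clear; lra.
  by move: b1 b2; rewrite !ltr_pdivlMr//; exact: aux.
apply: (@le_trans _ _ (K * s ^+ 2)); last first.
  rewrite -/s expr2 mulrA ler_wpM2r//; move: sK; rewrite mulrDr mulr1 (mulrC K).
  by move: (s * K) s0 => u; clear; lra.
apply/ler_addgt0Pr => eta eta0.
(* Two differences of function values and the two linear terms, the latter weighted by [normc h1]
   and [normc h2], together cost [2 + s] such units. *)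
have q0 : 0 < eta / (2 + s) by rewrite divr_gt0 ?ltr_wpDr.
have [N1 H1] := lim _ q0; have [N2 H2] := L1 _ q0; have [N3 H3] := L2 _ q0.
pose n := maxn N1 (maxn N2 N3).
have n1 : (N1 <= n)%N by exact: leq_maxl.
have n2 : (N2 <= n)%N by rewrite (leq_trans (leq_maxl N2 N3))// leq_maxr.
have n3 : (N3 <= n)%N by rewrite (leq_trans (leq_maxr N2 N3))// leq_maxr.
have y1 : normc (x.1 + h1 - x.1) < r by rewrite addrC addKr; move: a1 r0; clear; lra.
have y2 : normc (x.2 + h2 - x.2) < r by rewrite addrC addKr; move: a2 r0; clear; lra.
have [_ _ /(_ h1 h2 sr)] := taylor2d r0 (df n) (fM n) (lE n).
rewrite -/s -/K => T.
have c1 := H1 n (x.1 + h1, x.2 + h2) n1 y1 y2; have c2 := H1 n x n1 x0 x1.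
have c3 := ler_pM (normc_ge0 _) (normc_ge0 h1) (H2 n n2) (lexx _).
have c4 := ler_pM (normc_ge0 _) (normc_ge0 h2) (H3 n n3) (lexx _).
rewrite -!normcM in c3 c4.
move: T c1 c2 c3 c4; move: (f n (x.1 + h1, x.2 + h2)) (f n x) (g (x.1 + h1, x.2 + h2)) (g x) => A B A' B'.
move=> T c1 c2 c3 c4.
rewrite (_ : A' - B' - _ = (A - B - ((l n).1 * h1 + (l n).2 * h2)) - (A - A') + (B - B') +
  (((l n).1 - l1) * h1 + ((l n).2 - l2) * h2)); last by ring.
apply: le_trans (normcD _ _) _; apply: le_trans (lerD (normcD _ _) (normcD _ _)) _.
apply: le_trans (lerD (lerD (normcB _ _) (lexx _)) (lexx _)) _.
have etaE : eta = eta / (2 + s) * 2 + eta / (2 + s) * normc h1 + eta / (2 + s) * normc h2.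
  have z0 : 2 + s != 0 by rewrite gt_eqF// ltr_wpDr.
  transitivity (eta / (2 + s) * (2 + s)); first by rewrite divfK.
  by rewrite {2}/s; ring.
have aux (t1 t2 t3 t4 t5 k q p1 p2 : R) : t1 <= k -> t2 <= q -> t3 <= q -> t4 <= p1 -> t5 <= p2 ->
    t1 + t2 + t3 + (t4 + t5) <= k + (q * 2 + p1 + p2) by clear; lra.
by rewrite etaE; exact: aux.
Qed.

End LocallyUniformLimits.

Section FatouL2.
Context d (S : measurableType d) (R : realType).
Variables (mu : {measure set S -> \bar R}) (D : set S).
Hypothesis mD : measurable D.
Notation C := R[i].

Lemma sqm_limit (F : nat -> S -> C) (G : S -> C) (c : \bar R) :
  (forall n, cmeasurable D (F n)) -> (forall n, (sqm mu D (F n) <= c)%E) ->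
  (forall x, D x -> forall e : R, 0 < e -> exists N, forall n, (N <= n)%N -> normc (F n x - G x) <= e) ->
  (sqm mu D G <= c)%E.
Proof.
move=> mF Fc FG.
have lim x : D x -> limn_einf (fun n => (normc (F n x) ^+ 2)%:E) = (normc (G x) ^+ 2)%:E.
  move=> Dx; have cv : (fun n => normc (F n x)) @ \oo --> normc (G x).
    apply/cvgrPdist_le => e e0; have [N HN] := FG x Dx e e0.
    exists N => // n /= Nn; rewrite distrC; apply: le_trans (HN n Nn).
    exact: ler_distC_normc.
  have cv2 : (fun n => (normc (F n x) ^+ 2)%:E) @ \oo --> (normc (G x) ^+ 2)%:E.
    apply: cvg_EFin; first exact: nearW.
    by rewrite expr2; under eq_fun do rewrite /= expr2; exact: cvgM.
  by have [-> _] := cvg_limn_einf_sup cv2.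
rewrite /sqm -(eq_integral _ _ (fun x => lim x \o set_mem (A := D) (u := x))).
apply: le_trans (fatou mu mD (fun n => cmeasurable_sqr (mF n)) _) _.
  by move=> n x _; rewrite lee_fin sqr_ge0.
rewrite limn_einf_lim; apply: lime_le; first exact: is_cvg_einfs.
apply: nearW => n; apply: le_trans (Fc n); apply: ereal_inf_lbound.
by exists n => /=.
Qed.

Lemma cmeasurableB (F G : S -> C) : cmeasurable D F -> cmeasurable D G ->
  cmeasurable D (fun x => F x - G x).
Proof.
move=> [a1 a2] [b1 b2]; split.
  by under eq_fun do rewrite ReD ReN; exact: measurable_funB.
by under eq_fun do rewrite ImD ImN; exact: measurable_funB.
Qed.

Lemma nrm2D_le (F G : S -> C) : L2m mu D F -> L2m mu D G ->
  nrm2 mu D (fun x => F x + G x) <= 2 * nrm2 mu D F + 2 * nrm2 mu D G.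
Proof.
move=> LF LG; have := nrm2_parallelogram mD LF LG.
by have := nrm2_ge0 mu D (fun x => F x - G x); lra.
Qed.

End FatouL2.

Lemma half_lt (R : realType) (e : R) : 0 < e -> e / 2 < e. Proof. lra. Qed.
Lemma quarter_lt_half (R : realType) (e : R) : 0 < e -> e / 4 < e / 2. Proof. lra. Qed.
Lemma halves_lt (R : realType) (a b c e : R) : c <= a + b -> a < e / 2 -> b < e / 2 -> c < e.
Proof. lra. Qed.
Lemma le_of_sqr (R : realType) (t c : R) : 0 <= t -> t ^+ 2 <= c -> t <= c + 1.
Proof. by move=> t0 h; have := sqr_ge0 (t - 1); rewrite sqrrB1; lra. Qed.


(** * Completeness of the Bergman space and existence of projections *)

Section BergmanProjection.
Variables (R : realType) (E : set (R[i] * R[i])).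
Notation C := R[i].
Notation T := (measurableTypeR R).
Notation m4 := (@lebesgue2 R \x @lebesgue2 R)%E.
Notation D := (@toCC R @^-1` E).
Hypothesis oE : copen2 E.
Implicit Types (F G f g h k : C * C -> C).

Definition LL F := L2m m4 D (fun p => F (toCC p)).
Definition nn F := nrm2 m4 D (fun p => F (toCC p)).
Definition inn F G := ip m4 D (fun p => F (toCC p)) (fun p => G (toCC p)).
Definition AA f := LL f /\ forall x, E x -> differentiable f x.

Let mD : measurable D. Proof. exact: copen2_measurable. Qed.

Lemma AA0 : AA (fun=> 0).
Proof.
split; last by move=> x _; exact: differentiable_cst.
split; first exact: cmeasurable_cst.
rewrite /sqm (eq_integral (fun=> 0%E)) ?integral0 ?ltry// => p _.
by rewrite normc0 expr0n.
Qed.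

Lemma AAD f g : AA f -> AA g -> AA (fun x => f x + g x).
Proof.
move=> [Lf df] [Lg dg]; split; first exact: (L2D mD Lf Lg).
by move=> x Ex; apply: differentiableD; [exact: df|exact: dg].
Qed.

Lemma differentiable_Zc f x (c : C) : differentiable f x -> differentiable (fun y => c * f y) x.
Proof.
move=> /diff_cderiv2[l1 [l2 h]]; apply/diff_cderiv2; exists (c * l1), (c * l2) => e e0.
have c0 : 0 < normc c + 1 by rewrite ltr_wpDl ?normc_ge0.
have [d d0 H] := h _ (divr_gt0 e0 c0); exists d => // h1 h2 a1 a2.
rewrite (_ : _ - _ - _ = c * (f (x.1 + h1, x.2 + h2) - f x - (l1 * h1 + l2 * h2))); last by ring.
rewrite normcM; apply: le_trans (ler_wpM2l (normc_ge0 c) (H h1 h2 a1 a2)) _.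
rewrite mulrA ler_wpM2r ?addr_ge0 ?normc_ge0//.
by rewrite mulrCA ler_piMr ?(ltW e0)// ler_pdivrMr// mul1r lerDl.
Qed.

Lemma AAZ f (c : C) : AA f -> AA (fun x => c * f x).
Proof.
move=> [Lf df]; split; first by case: (L2Z c mD Lf).
by move=> x Ex; apply: differentiable_Zc; exact: df.
Qed.

Lemma AAB f g : AA f -> AA g -> AA (fun x => f x - g x).
Proof.
move=> Af Ag; have := AAD Af (AAZ (-1) Ag).
by rewrite (_ : (fun x => f x + -1 * g x) = (fun x => f x - g x))//; apply/funext => x; rewrite mulN1r.
Qed.

(** One radius and one constant serve all members of the space and all points near [x], so that
    convergence in norm becomes locally uniform. *)
Lemma local_point_bound x : E x -> exists (r K : R), [/\ 0 < r, 0 < K,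
  (forall y, normc (y.1 - x.1) < r -> normc (y.2 - x.2) < r -> E y) &
  forall f, AA f -> forall y, normc (y.1 - x.1) < r -> normc (y.2 - x.2) < r ->
    normc (f y) ^+ 2 * K <= nn f].
Proof.
move=> Ex; have [e e0 He] := oE Ex.
have e20 : 0 < e / 2 by rewrite divr_gt0.
have e40 : 0 < e / 4 by rewrite divr_gt0.
exists (e / 2), (mom2 (e / 4)); split => //; first exact: mom2_gt0.
  by move=> y y1 y2; apply: He; apply: lt_trans (half_lt e0).
move=> f [Lf df] y y1 y2.
have tri (a b c : C) : normc (b - a) < e / 2 -> normc (c - b) < e / 2 -> normc (c - a) < e.
  move=> h1 h2; rewrite (_ : c - a = (c - b) + (b - a)); last by ring.
  exact: halves_lt (normcD _ _) h2 h1.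
have := @polydisc_point_bound R E f y (e / 2) (e / 4) oE e40.
rewrite (L2_sqm Lf) lee_fin; apply => //; first exact: quarter_lt_half.
by move=> z z1 z2; apply: He; [exact: tri z1|exact: tri z2].
Qed.

(** The local point bound makes the sequence locally uniformly Cauchy, which yields a holomorphic
    pointwise limit; Fatou's lemma then turns the pointwise limit into a limit in norm. *)
Lemma AA_complete (f : nat -> C * C -> C) : (forall n, AA (f n)) ->
  (forall e : R, 0 < e -> exists N, forall m n, (N <= m)%N -> (N <= n)%N -> nn (fun x => f m x - f n x) <= e) ->
  exists2 g, AA g & forall e : R, 0 < e -> exists N, forall n, (N <= n)%N -> nn (fun x => f n x - g x) <= e.
Proof.
move=> Af cau.
have loc x : E x -> exists2 r : R, 0 < r & (forall y, normc (y.1 - x.1) < r -> normc (y.2 - x.2) < r -> E y) /\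
   forall e : R, 0 < e -> exists N, forall m n, (N <= m)%N -> (N <= n)%N ->
     forall y, normc (y.1 - x.1) < r -> normc (y.2 - x.2) < r -> normc (f m y - f n y) <= e.
  move=> Ex; have [r [K [r0 K0 rE H]]] := local_point_bound Ex; exists r => //; split => // e e0.
  have [N HN] := cau (e ^+ 2 * K) (mulr_gt0 (exprn_gt0 _ e0) K0).
  exists N => m n Nm Nn y y1 y2.
  have := le_trans (H _ (AAB (Af m) (Af n)) y y1 y2) (HN m n Nm Nn).
  by rewrite ler_pM2r// ler_pXn2r// ?nnegrE ?normc_ge0// ltW.
have gex x : exists v, E x -> forall e : R, 0 < e -> exists N, forall n, (N <= n)%N -> normc (f n x - v) <= e.
  have [Ex|nEx] := pselect (E x); last by exists 0.
  have [r r0 [_ H]] := loc x Ex.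
  have [v Hv] : exists v, forall e : R, 0 < e -> exists N, forall n, (N <= n)%N -> normc (f n x - v) <= e.
    apply: complex_cauchy_limit => e e0; have [N HN] := H e e0; exists N => m n Nm Nn.
    by apply: HN => //; rewrite subrr normc0.
  by exists v.
have [g gE] := choice gex.
have dg x : E x -> differentiable g x.
  move=> Ex; have [r [K [r0 K0 rE PB]]] := local_point_bound Ex.
  have [r' r'0 [_ H]] := loc x Ex.
  pose s := Num.min r r'; have s0 : 0 < s by rewrite lt_min r0.
  have sr t : t < s -> t < r by rewrite lt_min => /andP[].
  have sr' t : t < s -> t < r' by rewrite lt_min => /andP[].
  have [N0 HN0] := cau 1 ltr01.
  pose B := 2 * 1 + 2 * nn (f N0).
  have fB n : (N0 <= n)%N -> nn (f n) <= B.
    move=> Nn; have := nrm2D_le mD (AAB (Af n) (Af N0)).1 (Af N0).1.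
    have -> : nrm2 m4 D (fun p => f n (toCC p) - f N0 (toCC p) + f N0 (toCC p)) = nn (f n).
      by congr nrm2; apply/funext => p; rewrite subrK.
    by move/le_trans; apply; rewrite lerD2r ler_pM2l//; exact: HN0.
  (* The shift by [N0] gives all terms the common norm bound [B]; the bound [B / K + 1] on values
     comes from [t <= t ^ 2 + 1]. *)
  apply: (@uniform_limit_differentiable R (fun n => f (n + N0)%N) g x s (B / K + 1) s0).
  - by move=> n y y1 y2; case: (Af (n + N0)%N) => _; apply; apply: rE; exact: sr.
  - move=> n y y1 y2; apply: le_of_sqr; first exact: normc_ge0.
    rewrite ler_pdivlMr//; apply: le_trans (fB _ (leq_addl n N0)).
    by apply: PB; [exact: Af|exact: sr|exact: sr].
  move=> e e0; have [N HN] := H e e0; exists N => n y Nn y1 y2.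
  have Ey : E y by apply: rE; exact: sr.
  apply/ler_addgt0Pr => eta eta0; have [N' HN'] := gE y Ey eta eta0.
  pose m := maxn N N'.
  rewrite (_ : f (n + N0)%N y - g y = (f (n + N0)%N y - f m y) + (f m y - g y)); last by ring.
  apply: le_trans (normcD _ _) _; apply: lerD; last by apply: HN'; exact: leq_maxr.
  by apply: HN; [rewrite (leq_trans Nn)// leq_addr|exact: leq_maxl|exact: sr'|exact: sr'].
have mg : cmeasurable D (fun p => g (toCC p)).
  by apply: ccont2_cmeasurable => // x Ex; apply: differentiable_ccont2; exact: dg.
have mB n : cmeasurable D (fun p => f n (toCC p) - g (toCC p)).
  by apply: cmeasurableB => //; case: ((Af n).1).
have key (e : R) : 0 < e -> exists N, forall n, (N <= n)%N ->
    (sqm m4 D (fun p => f n (toCC p) - g (toCC p))%R <= e%:E)%E.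
  move=> e0; have [N HN] := cau e e0; exists N => n Nn.
  apply: (@sqm_limit _ _ _ _ D mD (fun m p => f n (toCC p) - f (m + N)%N (toCC p))).
  - by move=> m; case: (AAB (Af n) (Af (m + N)%N)) => -[].
  - move=> m; have LB := (AAB (Af n) (Af (m + N)%N)).1; rewrite (L2_sqm LB) lee_fin.
    by apply: HN => //; exact: leq_addl.
  move=> p Dp eta eta0; have [N' HN'] := gE (toCC p) Dp eta eta0.
  exists N' => m Nm; rewrite opprD addrACA subrr add0r opprK addrC distcC.
  by apply: HN'; rewrite (leq_trans Nm)// leq_addr.
have LB (e : R) : 0 < e -> exists N, forall n, (N <= n)%N -> LL (fun x => f n x - g x) /\
    nn (fun x => f n x - g x) <= e.
  move=> e0; have [N HN] := key e e0; exists N => n Nn.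
  have L : LL (fun x => f n x - g x).
    by split; [exact: mB|apply: le_lt_trans (HN n Nn) _; exact: ltry].
  by split => //; have := HN n Nn; rewrite (L2_sqm L) lee_fin.
exists g; last by move=> e /LB[N HN]; exists N => n /HN[].
split=> //; have [N /(_ N (leqnn N))[L _]] := LB 1 ltr01.
have := L2B mD (Af N).1 L; rewrite (_ : (fun p => _ - _) = (fun p => g (toCC p)))//.
by apply/funext => p; rewrite opprB addrC subrK.
Qed.

(** A minimising sequence for the distance to the space is Cauchy by the parallelogram law, its
    limit attains the distance, and minimality gives orthogonality. *)
Lemma bergman_projection_exists F : LL F ->
  exists2 h, AA h & forall k, AA k -> inn (fun z => F z - h z) k = 0.
Proof.
move=> LF.
pose dist g := nn (fun z => F z - g z).
pose V := [set x : R | exists2 g, AA g & x = dist g].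
have V0 : V !=set0 by exists (dist (fun=> 0)), (fun=> 0) => //; exact: AA0.
have lbV : lbound V 0 by move=> _ [g _ ->]; exact: nrm2_ge0.
have hiV : has_inf V by split => //; exists 0.
pose d := inf V.
have dge g : AA g -> d <= dist g by move=> Ag; apply: ge_inf; [exists 0|exists g].
have near_inf n : exists g, AA g /\ dist g <= d + n.+1%:R^-1.
  have n0 : 0 < (n.+1%:R^-1 : R) by rewrite invr_gt0.
  have [_ [g Ag ->] h] := inf_adherent n0 hiV.
  by exists g; split => //; exact: ltW.
have [f fP] := choice near_inf.
have Af n : AA (f n) by case: (fP n).
have LFB g : AA g -> LL (fun z => F z - g z) by move=> [Lg _]; exact: (L2B mD LF Lg).
have par m n : nn (fun x => f m x - f n x) <= 2 * m.+1%:R^-1 + 2 * n.+1%:R^-1.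
  have := nrm2_parallelogram mD (LFB _ (Af n)) (LFB _ (Af m)).
  have -> : nrm2 m4 D (fun p => F (toCC p) - f n (toCC p) - (F (toCC p) - f m (toCC p))) =
      nn (fun x => f m x - f n x).
    by congr nrm2; apply/funext => p; ring.
  have Ah : AA (fun x => 2^-1 * (f n x + f m x)) by apply: AAZ; exact: AAD.
  have := (L2Z 2 mD (LFB _ Ah)).2.
  have -> : nrm2 m4 D (fun p => 2 * (F (toCC p) - 2^-1 * (f n (toCC p) + f m (toCC p)))) =
      nrm2 m4 D (fun p => F (toCC p) - f n (toCC p) + (F (toCC p) - f m (toCC p))).
    by congr nrm2; apply/funext => p; field.
  move=> -> ->; rewrite normc_nat; have := dge _ Ah; have := (fP n).2; have := (fP m).2.
  rewrite -/(nn (fun x => F x - f n x)) -/(nn (fun x => F x - f m x)).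
  rewrite -/(nn (fun x => F x - 2^-1 * (f n x + f m x))) /dist.
  move: (nn _) (nn _) (nn _) (m.+1%:R^-1) (n.+1%:R^-1) => a b c u v.
  lra.
have inv_small (e : R) : 0 < e -> exists N, forall n, (N <= n)%N -> (n.+1%:R^-1 : R) <= e.
  move=> e0; have [k _ Hk] := near_infty_natSinv_lt (PosNum e0).
  by exists k => n kn; apply: ltW; exact: (Hk n kn).
have [|h Ah fh] := AA_complete Af.
  move=> e e0; have e40 : 0 < e / 4 by rewrite divr_gt0.
  have [N HN] := inv_small _ e40; exists N => m n Nm Nn.
  apply: le_trans (par m n) _; have := HN m Nm; have := HN n Nn.
  by move: (m.+1%:R^-1) (n.+1%:R^-1) => u v; lra.
exists h => // k Ak.
have d0 : 0 <= d by apply: lb_le_inf.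
have min_h : dist h <= d.
  apply/ler_addgt0Pr => eps eps0.
  (* Squaring the triangle inequality gives at most [d + eta + 2 sqrt(d + 1) eta + eta ^ 2], and
     [eta <= 1] makes this [d + c eta] or less. *)
  pose c := 2 + 2 * Num.sqrt (d + 1); have c0 : 0 < c by rewrite ltr_wpDr ?mulr_ge0 ?sqrtr_ge0.
  pose eta := Num.min 1 (eps / c).
  have eta0 : 0 < eta by rewrite lt_min ltr01 divr_gt0.
  have eta1 : eta <= 1 by rewrite ge_min lexx.
  have etac : eta * c <= eps by rewrite -ler_pdivlMr// ge_min lexx orbT.
  have [N1 H1] := inv_small _ eta0; have [N2 H2] := fh _ (exprn_gt0 2 eta0).
  pose n := maxn N1 N2.
  have A1 : dist (f n) <= d + eta.
    by apply: le_trans (fP n).2 _; rewrite lerD2l; apply: H1; exact: leq_maxl.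
  have B1 : nn (fun x => f n x - h x) <= eta ^+ 2 by apply: H2; exact: leq_maxr.
  have tri := nrm_triangle mD (LFB _ (Af n)) (AAB (Af n) Ah).1.
  have tE : nrm2 m4 D (fun p => F (toCC p) - f n (toCC p) + (f n (toCC p) - h (toCC p))) = dist h.
    by congr nrm2; apply/funext => p; ring.
  rewrite tE -/(nn (fun x => F x - f n x)) -/(nn (fun x => f n x - h x)) -/(dist (f n)) in tri.
  have sB : Num.sqrt (nn (fun x => f n x - h x)) <= eta.
    by rewrite -[leRHS](ger0_norm (ltW eta0)) -sqrtr_sqr ler_sqrt ?sqr_ge0.
  have A0 : 0 <= dist (f n) by exact: nrm2_ge0.
  have h0 : 0 <= dist h by exact: nrm2_ge0.
  have sA : Num.sqrt (dist (f n)) <= Num.sqrt (d + 1).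
    rewrite ler_sqrt ?addr_ge0//; apply: le_trans A1 _; by rewrite lerD2l.
  have : Num.sqrt (dist h) ^+ 2 <= (Num.sqrt (dist (f n)) + eta) ^+ 2.
    rewrite lerXn2r ?nnegrE ?addr_ge0 ?sqrtr_ge0 ?(ltW eta0)//.
    by apply: le_trans tri _; rewrite lerD2l.
  rewrite sqr_sqrtr// sqrrD sqr_sqrtr// => hh.
  have e2 : eta ^+ 2 <= eta by rewrite expr2 ler_piMr ?(ltW eta0).
  have e3 : Num.sqrt (dist (f n)) * eta <= Num.sqrt (d + 1) * eta by rewrite ler_wpM2r ?(ltW eta0).
  move: hh e2 e3 A1 etac; rewrite /c mulrDr mulrCA (mulrC eta (Num.sqrt _)) -mulr_natl.
  move: (dist h) (dist (f n)) (eta ^+ 2) (Num.sqrt (d + 1) * eta) (Num.sqrt (dist (f n)) * eta).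
  by move=> u v w y z; lra.
apply: (orthogonal_of_minimal mD (LFB _ Ah) Ak.1) => c.
apply: le_trans min_h _; have := dge _ (AAD Ah (AAZ c Ak)).
rewrite /dist [X in _ <= X](_ : _ = nrm2 m4 D (fun p => F (toCC p) - h (toCC p) - c * k (toCC p)))//.
by congr nrm2; apply/funext => p; ring.
Qed.

End BergmanProjection.

(** * Concentration on a face *)

Section Splitting.
Context d (S : measurableType d) (R : realType).
Variable mu : {measure set S -> \bar R}.
Notation C := R[i].
Implicit Types (D : set S) (F G H : S -> C).

Lemma vanishing_integral D (A : nat -> set S) (f : S -> R) : measurable D ->
  (forall i, measurable (A i)) -> (forall i, A i `<=` D) ->
  (forall x, D x -> exists N, forall i, (N <= i)%N -> ~ A i x) ->
  mu.-integrable D (fun x => (f x)%:E) -> (forall x, D x -> 0 <= f x) ->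
  (fun i => \int[mu]_(x in A i) f x) @ \oo --> (0 : R).
Proof.
move=> mD mA AD Ax fi f0.
have mf : measurable_fun D f by apply/measurable_EFinP; case/integrableP: fi.
pose h i x := f x * \1_(A i) x : R.
have mh i : measurable_fun D (EFin \o h i).
  by apply/measurable_EFinP; apply: measurable_funM => //; exact: measurable_indic.
have hE i : \int[mu]_(x in A i) f x = \int[mu]_(x in D) h i x.
  rewrite -{1}(setIidr (AD i)) Rintegral_mkcondr; apply: eq_Rintegral => x _.
  by rewrite /h /patch indicE; case: (x \in A i); rewrite ?mulr1 ?mulr0.
have hlim x : D x -> (fun i => (h i x)%:E) @ \oo --> (0%R)%:E.
  move=> Dx; apply: cvg_near_cst; have [N HN] := Ax x Dx; exists N => // i /= Ni.
  by rewrite /h indicE memNset ?mulr0//; exact: HN.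
have hb i x : D x -> (`|(h i x)%:E| <= (f x)%:E)%E.
  move=> Dx; rewrite abse_EFin lee_fin /h normrM ger0_norm ?f0//.
  by rewrite indicE; case: (_ \in _); rewrite ?normr1 ?mulr1// normr0 mulr0 f0.
have C0 := @dominated_cvg _ _ _ mu D mD (fun i x => (h i x)%:E) (fun=> 0%E)
  (fun x => (f x)%:E) mh hlim (fun x _ => isT) fi hb.
under eq_fun do rewrite hE.
move: C0; rewrite integral0 => C0.
by move/fine_cvgP : C0 => [_].
Qed.

Lemma cint_setU A B F : measurable A -> measurable B -> [disjoint A & B] ->
  cintegrable mu (A `|` B) F -> cint mu (A `|` B) F = cint mu A F + cint mu B F.
Proof.
move=> mA mB AB [F1 F2]; apply: eqC; rewrite ?ReImE !(cint_Re, cint_Im).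
  exact: Rintegral_setU.
exact: Rintegral_setU.
Qed.

Lemma cmeasurableS A D F : measurable D -> A `<=` D -> cmeasurable D F -> cmeasurable A F.
Proof. by move=> mD AD [m1 m2]; split; [exact: measurable_funS m1|exact: measurable_funS m2]. Qed.

Lemma L2_sub A D F : measurable A -> measurable D -> A `<=` D -> L2m mu D F ->
  L2m mu A F /\ nrm2 mu A F <= nrm2 mu D F.
Proof.
move=> mA mD AD LF; have [mF hF] := LF.
have h : (sqm mu A F <= sqm mu D F)%E.
  apply: ge0_subset_integral => //; first exact: cmeasurable_sqr.
  by move=> x _; rewrite lee_fin sqr_ge0.
have LA : L2m mu A F by split; [exact: cmeasurableS mF|exact: le_lt_trans hF].
by split => //; move: h; rewrite (L2_sqm LA) (L2_sqm LF) lee_fin.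
Qed.

Lemma nrm2_setU A B F : measurable A -> measurable B -> [disjoint A & B] ->
  L2m mu (A `|` B) F -> nrm2 mu (A `|` B) F = nrm2 mu A F + nrm2 mu B F.
Proof.
move=> mA mB AB LF; have mAB : measurable (A `|` B) by exact: measurableU.
have [LA _] := L2_sub mA mAB (@subsetUl _ A B) LF.
have [LB _] := L2_sub mB mAB (@subsetUr _ A B) LF.
have [mF _] := LF; apply: EFin_inj; rewrite EFinD -(L2_sqm LF) -(L2_sqm LA) -(L2_sqm LB).
apply: ge0_integral_setU => //; first exact: cmeasurable_sqr.
by move=> x _; rewrite lee_fin sqr_ge0.
Qed.

Lemma ip_setU A B F G : measurable A -> measurable B -> [disjoint A & B] ->
  L2m mu (A `|` B) F -> L2m mu (A `|` B) G -> ip mu (A `|` B) F G = ip mu A F G + ip mu B F G.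
Proof.
move=> mA mB AB LF LG; apply: cint_setU => //.
by apply: L2_product => //; exact: measurableU.
Qed.

Lemma ip_bound D F G (a b : R) : measurable D -> L2m mu D F -> L2m mu D G ->
  0 <= a -> 0 <= b -> nrm2 mu D F <= a ^+ 2 -> nrm2 mu D G <= b ^+ 2 -> normc (ip mu D F G) <= a * b.
Proof.
move=> mD LF LG a0 b0 Fa Gb; apply: le_trans (cauchy_schwarz mD LF LG) _.
have sq x (c : R) : 0 <= c -> x <= c ^+ 2 -> Num.sqrt x <= c.
  by move=> c0 xc; rewrite -[leRHS](ger0_norm c0) -sqrtr_sqr ler_sqrt// sqr_ge0.
by apply: ler_pM; rewrite ?sqrtr_ge0 ?sq.
Qed.

(* The projection residuals [H], [H'] are replaced by the explicit residuals [v],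
   [v'] on the part [D0] of the domain that carries almost all the mass. *)
Lemma residual_comparison D0 D1 (A : (S -> C) -> Prop) F F' pu pv Q Q' v v' (M eta : R) :
  measurable D0 -> measurable D1 -> [disjoint D0 & D1] ->
  (forall f, A f -> L2m mu (D0 `|` D1) f) ->
  (forall f g, A f -> A g -> A (fun x => f x - g x)) ->
  L2m mu (D0 `|` D1) F -> L2m mu (D0 `|` D1) F' -> A pu -> A pv -> A Q -> A Q' ->
  (forall k, A k -> ip mu (D0 `|` D1) (fun x => F x - pu x) k = 0) ->
  L2m mu D0 v -> L2m mu D0 v' -> (forall k, A k -> ip mu D0 k v' = 0) ->
  0 <= M -> 0 <= eta ->
  nrm2 mu (D0 `|` D1) F <= M ^+ 2 -> nrm2 mu D0 v' <= M ^+ 2 ->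
  nrm2 mu D0 (fun x => (F x - Q x) - v x) <= eta ^+ 2 ->
  nrm2 mu D0 (fun x => (F' x - Q' x) - v' x) <= eta ^+ 2 ->
  nrm2 mu D1 (fun x => F' x - Q' x) <= eta ^+ 2 ->
  normc (ip mu (D0 `|` D1) (fun x => F x - pu x) (fun x => F' x - pv x) - ip mu D0 v v') <=
    3 * (M * eta).
Proof.
move=> m0 m1 dis AL AB LF LF' Apu Apv AQ AQ' Hort Lv Lv' vort M0 eta0 FM vM h1 h2 h3.
set D := D0 `|` D1 in AL LF LF' Hort FM *.
have mD : measurable D by exact: measurableU.
have sub0 : D0 `<=` D by exact: subsetUl.
have sub1 : D1 `<=` D by exact: subsetUr.
have LB f g : L2m mu D f -> L2m mu D g -> L2m mu D (fun x => f x - g x) by exact: L2B.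
pose H x := F x - pu x; pose H' x := F' x - pv x.
pose V x := F x - Q x; pose V' x := F' x - Q' x.
have LH : L2m mu D H by apply: LB => //; exact: AL.
have LV : L2m mu D V by apply: LB => //; exact: AL.
have LV' : L2m mu D V' by apply: LB => //; exact: AL.
have LH' : L2m mu D H' by apply: LB => //; exact: AL.
have [LH0 nH0] := L2_sub m0 mD sub0 LH; have [LH1 nH1] := L2_sub m1 mD sub1 LH.
have [LV0 _] := L2_sub m0 mD sub0 LV; have [LV'0 _] := L2_sub m0 mD sub0 LV'.
have [LV'1 _] := L2_sub m1 mD sub1 LV'.
(* [H] is orthogonal to [pu], so its squared norm is its pairing with [F]. *)
have nH : nrm2 mu D H <= M ^+ 2.
  have E : ip mu D H H = ip mu D H F.
    rewrite -[RHS]subr0 -(Hort _ Apu) -/H -ipBr//; last exact: AL.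
  have := cauchy_schwarz mD LH LF; rewrite -E ip_self// normc_real ger0_norm ?nrm2_ge0//.
  have a0 := nrm2_ge0 mu D H; have b0 := nrm2_ge0 mu D F.
  rewrite -{1}(sqr_sqrtr a0) expr2.
  have [s0|n0] := eqVneq (Num.sqrt (nrm2 mu D H)) 0.
    by move=> _; rewrite -(sqr_sqrtr a0) s0 expr0n sqr_ge0.
  rewrite ler_pM2l; last by rewrite lt0r n0 sqrtr_ge0.
  by rewrite ler_sqrt// => h; exact: le_trans h FM.
(* [H'] and [V'] differ by a member of [A], to which [H] is orthogonal on the whole domain. *)
have e1 : ip mu D H H' = ip mu D H V'.
  rewrite -[LHS]addr0 -(Hort _ (AB _ _ Apv AQ')) -/H -ipDr//; last by apply: AL; exact: AB.
  by apply: eq_ip => // x _; rewrite /H' /V'; ring.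
have e2 : ip mu D H V' = ip mu D0 H V' + ip mu D1 H V' by exact: ip_setU.
have e3 : ip mu D0 H V' = ip mu D0 H v' + ip mu D0 H (fun x => V' x - v' x).
  by rewrite -ipDr//; [apply: eq_ip => // x _; rewrite addrC subrK|exact: L2B].
(* Orthogonality of [H] holds on [D] and not on [D0], but there [v'] is orthogonal to [A]; this
   allows [H] to be replaced by [V]. *)
have e4 : ip mu D0 H v' = ip mu D0 v v' + ip mu D0 (fun x => V x - v x) v'.
  have AQu := AB _ _ Apu AQ; have LQu := (L2_sub m0 mD sub0 (AL _ AQu)).1.
  rewrite -[LHS]addr0 -(vort _ AQu) -!ipDl//; last exact: L2B.
  by apply: eq_ip => // x _; rewrite /H /V; ring.
rewrite e1 e2 e3 e4 -/H.
rewrite (_ : _ - ip mu D0 v v' = ip mu D0 (fun x => V x - v x) v' + ip mu D0 H (fun x => V' x - v' x)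
  + ip mu D1 H V'); last by ring.
apply: le_trans (normcD _ _) _; apply: le_trans (lerD (normcD _ _) (lexx _)) _.
rewrite (_ : 3 * (M * eta) = eta * M + M * eta + M * eta); last by ring.
apply: lerD; first apply: lerD.
- by apply: ip_bound => //; exact: L2B.
- by apply: ip_bound => //; [exact: L2B|exact: le_trans nH].
- by apply: ip_bound => //; exact: le_trans nH.
Qed.

End Splitting.

(** * Powers of a peak function near a face *)

Section Concentration.
Variable R : realType.
Notation C := R[i].
Notation T := (measurableTypeR R).
Notation Y := (T * T * (T * T))%type.
Notation m4 := (@lebesgue2 R \x @lebesgue2 R)%E.

Definition bidisc (r s : R) : set (C * C) := [set x | normc x.1 < r /\ normc x.2 < s].

(* [E] has the horizontal disc of radius [r] at height [w0] as a face. *)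
Definition face (E : set (C * C)) (r : R) (w0 : C) :=
  [/\ copen2 E, 0 < r, w0 != 0 & bidisc r (normc w0) `<=` E] /\
  (exists B : R, forall x, E x -> normc x.1 <= B /\ normc x.2 < normc w0) /\
  (forall eta : R, 0 < eta -> exists2 de : R, 0 < de &
     forall x, E x -> normc (x.2 - w0) < de -> normc x.1 < r + eta).

Lemma copen2_ball (a b : C) (r s : R) :
  copen2 [set x | normc (x.1 - a) < r /\ normc (x.2 - b) < s].
Proof.
move=> y [y1 y2]; have [e1 e10 h1] := @copen_disc _ a r y.1 y1.
have [e2 e20 h2] := @copen_disc _ b s y.2 y2.
exists (Num.min e1 e2) => [|w]; first by rewrite lt_min e10.
by rewrite !lt_min => /andP[w1 _] /andP[_ w2]; split; [exact: h1|exact: h2].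
Qed.

Lemma bidiscE r s : bidisc r s = [set x | normc (x.1 - 0) < r /\ normc (x.2 - 0) < s].
Proof. by apply/seteqP; split => x; rewrite /bidisc /= !subr0. Qed.

Lemma copen2_bidisc r s : copen2 (bidisc r s).
Proof. by rewrite bidiscE; exact: copen2_ball. Qed.

Lemma bidisc_prod r s : @toCC R @^-1` bidisc r s = disc r `*` disc s.
Proof. by []. Qed.

Lemma m4_bidisc r s : m4 (@toCC R @^-1` bidisc r s) = (lebesgue2 (disc r) * lebesgue2 (disc s))%E.
Proof. by rewrite bidisc_prod product_measure1E//; exact: measurable_disc. Qed.

Lemma lebesgue2_disc r : lebesgue2 (@disc R r) = (moment r 0)%:E.
Proof. by rewrite moment0 fineK// ge0_fin_numE//; exact: l2_disc_fin. Qed.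

Lemma m4_bidisc_fin r s : (m4 (@toCC R @^-1` bidisc r s) < +oo)%E.
Proof. by rewrite m4_bidisc !lebesgue2_disc -EFinM ltry. Qed.

(** On [|w| < |w0|] the modulus of [w + w0] stays below [2 |w0|] and comes close to it only near
    [w0]. *)
Definition peak (w0 : C) j (x : C * C) : C := (x.2 + w0) ^+ j.

Lemma peak_ccont2 w0 j x : ccont2 (peak w0 j) x.
Proof.
have h : differentiable (fun w : C => (w + w0) ^+ j) x.2.
  apply: differentiable_cexpn; apply: differentiableD; first exact: differentiable_idC.
  exact: differentiable_cst'.
move=> e e0; have [d d0 H] := differentiable_ccont h e0.
by exists d => // y _ /H.
Qed.

Section Face.
Variables (E : set (C * C)) (r : R) (w0 : C).
Hypothesis fE : face E r w0.
Notation s := (normc w0).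
Notation D := (@toCC R @^-1` E).
Notation D0 := (@toCC R @^-1` bidisc r s).
Let mass A j := nrm2 m4 A (fun p => peak w0 j (toCC p)).

Lemma face_facts : [/\ measurable D, measurable D0, D0 `<=` D, 0 < r & 0 < s].
Proof.
have [[oE r0 w00 sub] _] := fE; split => //.
- exact: copen2_measurable.
- by apply: copen2_measurable; exact: copen2_bidisc.
- by move=> p /sub.
- by rewrite normc_gt0.
Qed.

Lemma face_finite : (m4 D < +oo)%E.
Proof.
have [mD mD0 _ r0 s0] := face_facts; have [_ [[B HB] _]] := fE.
apply: le_lt_trans (m4_bidisc_fin (B + 1) s); apply: le_measure; rewrite ?inE //.
  by apply: copen2_measurable; exact: copen2_bidisc.
by move=> p /HB[h1 h2]; split => //; apply: le_lt_trans h1 _; rewrite ltrDl.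
Qed.

Lemma peak_le x j : E x -> normc (peak w0 j x) <= (s + s) ^+ j.
Proof.
have [_ [[B HB] _]] := fE; move=> /HB[_ h].
rewrite normcX lerXn2r ?nnegrE ?normc_ge0 ?addr_ge0 ?normc_ge0//.
by apply: le_trans (normcD _ _) _; rewrite lerD2r ltW.
Qed.

Lemma bounded_L2 (A : set Y) (F : Y -> C) (M : R) : measurable A -> A `<=` D -> cmeasurable A F ->
  (forall p, A p -> normc (F p) <= M) -> L2m m4 A F /\ nrm2 m4 A F <= M ^+ 2 * fine (m4 A).
Proof.
move=> mA AD mF FM; have [mD _ _ _ _] := face_facts.
have muA : (m4 A < +oo)%E by apply: le_lt_trans face_finite; apply: le_measure; rewrite ?inE.
have h : (sqm m4 A F <= (M ^+ 2 * fine (m4 A))%:E)%E.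
  rewrite EFinM fineK ?ge0_fin_numE// -integral_cst//; apply: ge0_le_integral => //.
  - by move=> p _; rewrite lee_fin sqr_ge0.
  - exact: cmeasurable_sqr.
  - move=> p Ap; rewrite lee_fin lerXn2r ?nnegrE ?normc_ge0 ?FM//.
    exact: le_trans (normc_ge0 _) (FM p Ap).
have LF : L2m m4 A F by split => //; apply: le_lt_trans h _; exact: ltry.
by split => //; move: h; rewrite (L2_sqm LF) lee_fin.
Qed.

Lemma peak_L2 j : L2m m4 D (fun p => peak w0 j (toCC p)).
Proof.
have [mD _ _ _ _] := face_facts; have [[oE _ _ _] _] := fE.
apply: (bounded_L2 (M := (s + s) ^+ j) mD _ _ _).1 => //.
  by apply: ccont2_cmeasurable => // x _; exact: peak_ccont2.
by move=> p; exact: peak_le.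
Qed.

(* [w + w0] is almost as large as [2 w0] on a small open set [G] near [w0]. *)
Lemma peak_lower (t : R) : 0 < t < 1 -> exists2 c : R, 0 < c &
  forall j, c * (2 * t * s) ^+ (j + j) <= mass D0 j.
Proof.
move=> /andP[t0 t1]; have [mD mD0 sub r0 s0] := face_facts.
pose G := [set x : C * C | normc (x.1 - 0) < r /\ normc (x.2 - t%:C * w0) < (1 - t) * s].
have oG : copen2 G by exact: copen2_ball.
have mG := copen2_measurable oG.
have nt : normc (t%:C * w0) = t * s by rewrite normcM normc_real ger0_norm// ltW.
have rho0 : 0 < (1 - t) * s by rewrite mulr_gt0// subr_gt0.
have GD0 : @toCC R @^-1` G `<=` D0.
  move=> p [h1 h2]; split; first by move: h1; rewrite subr0.
  rewrite -(subrK (t%:C * w0) (toCC p).2); apply: le_lt_trans (normcD _ _) _.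
  by rewrite nt; move: h2; rewrite mulrBl mul1r; lra.
have Gpos : 0 < fine (m4 (@toCC R @^-1` G)).
  pose tau (p : T * T) := ((p.1 + Rec (t%:C * w0)) : T, (p.2 + Imc (t%:C * w0)) : T).
  pose B : set (T * T) := @toC R @^-1` [set w | normc (w - t%:C * w0) < (1 - t) * s].
  have mB : measurable B by apply: copen_measurable; exact: copen_disc.
  have -> : @toCC R @^-1` G = disc r `*` B by apply/seteqP; split => p; rewrite /G /= subr0.
  rewrite product_measure1E//; last exact: measurable_disc.
  have [_ tauE] := l2_translation (Rec (t%:C * w0), Imc (t%:C * w0)).
  have LB : lebesgue2 B = lebesgue2 (disc ((1 - t) * s)).
    rewrite [LHS](tauE B mB); congr (lebesgue2 _); apply/seteqP; split => p;
    rewrite /B /disc /preimage /mkset (_ : toC _ - _ = toC p)//;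
    by case: (p) => a b; apply: eqC; rewrite ?ReD ?ImD ?ReN ?ImN /= addrK.
  have -> : (lebesgue2 (disc r) * lebesgue2 B)%E = (moment r 0 * moment ((1 - t) * s) 0)%:E.
    by rewrite EFinM -!lebesgue2_disc -LB.
  by rewrite /= mulr_gt0// moment0 l2_disc_gt0.
exists (fine (m4 (@toCC R @^-1` G))) => // j.
have LG := L2_sub mG mD (subset_trans GD0 sub) (peak_L2 j).
have LD0 := L2_sub mD0 mD sub (peak_L2 j).
have [_ +] := L2_sub mG mD0 GD0 LD0.1; apply: le_trans.
have muG : (m4 (@toCC R @^-1` G) < +oo)%E.
  by apply: le_lt_trans face_finite; apply: le_measure; rewrite ?inE//; exact: subset_trans sub.
rewrite -lee_fin -(L2_sqm LG.1) mulrC EFinM fineK ?ge0_fin_numE// -integral_cst//.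
apply: ge0_le_integral => //.
- by move=> p _; rewrite lee_fin exprn_ge0// !mulr_ge0 ?ltW.
- by apply: cmeasurable_sqr; case: LG.1.
move=> p [_ h]; rewrite lee_fin normcX -exprM muln2 -addnn lerXn2r ?nnegrE ?normc_ge0 ?mulr_ge0 ?(ltW t0) ?(ltW s0)//.
have E1 : normc ((1 + t)%:C * w0) = (1 + t) * s.
  by rewrite normcM normc_real ger0_norm// addr_ge0// ltW.
have : normc ((1 + t)%:C * w0) <= normc ((toCC p).2 + w0) + normc ((toCC p).2 - t%:C * w0).
  rewrite (_ : (1 + t)%:C * w0 = ((toCC p).2 + w0) - ((toCC p).2 - t%:C * w0)); first exact: normcB.
  by rewrite rmorphD /=; ring.
by rewrite E1; move: h; lra.
Qed.

Lemma peak_pos j : 0 < mass D0 j.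
Proof.
have [|c c0 H] := @peak_lower 2^-1; first by rewrite invr_gt0 invf_lt1 ?ltr1n// ltr0n.
apply: lt_le_trans (H j); rewrite mulr_gt0// exprn_gt0// mulfV// mul1r.
by have [] := face_facts.
Qed.

(** At distance at least [de] from [w0] the parallelogram identity bounds [|w + w0|] by some
    [h < 2 s]. On the bidisc the mass is at least of order [(2 t s) ^ (2 j)] for every [t < 1], and
    a [t] with [h < 2 t s] gives a geometric quotient. *)
Lemma far_mass (de e : R) : 0 < de -> 0 < e -> exists J, forall j, (J <= j)%N ->
  mass (D `&` [set p | de <= normc ((toCC p).2 - w0)]) j <= e * mass D0 j.
Proof.
move=> de0 e0; have [mD mD0 sub r0 s0] := face_facts.
set Far := D `&` _.
have mFar : measurable Far.
  have -> : Far = D `\` (@toCC R @^-1` [set x | normc (x.1 - 0) < normc (x.1 - 0) + 1 /\ normc (x.2 - w0) < de]).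
    apply/seteqP; split => p [h1 h2]; split => //.
      by move=> [_ h]; move: h2; rewrite /= leNgt h.
    by rewrite /= leNgt; apply/negP => h; apply: h2; split => //; rewrite ltrDl.
  apply: measurableD => //; apply: copen2_measurable => y [_ y2].
  have [e2 e20 h2] := @copen_disc _ w0 de y.2 y2.
  by exists e2 => // w _ h; split; [rewrite ltrDl|exact: h2].
(* The maximum with 0 covers a distance [de] so large that no point is far. *)
pose h := Num.sqrt (Num.max 0 (4 * s ^+ 2 - de ^+ 2)).
have h0 : 0 <= h by exact: sqrtr_ge0.
have hFar p : Far p -> normc ((toCC p).2 + w0) <= h.
  move=> [Ep /= dep]; have [_ [[B HB] _]] := fE; have [_ ws] := HB _ Ep.
  have par : normc ((toCC p).2 + w0) ^+ 2 + normc ((toCC p).2 - w0) ^+ 2 =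
      2 * normc (toCC p).2 ^+ 2 + 2 * s ^+ 2.
    by rewrite !sqr_normcE !ReImE; move: (Rec _) (Imc _) => u v; ring.
  rewrite -[leLHS](ger0_norm (normc_ge0 _)) -sqrtr_sqr ler_sqrt; last by rewrite le_max lexx.
  have h1 : normc (toCC p).2 ^+ 2 <= s ^+ 2 by rewrite lerXn2r ?nnegrE ?normc_ge0// ltW.
  have h2 : de ^+ 2 <= normc ((toCC p).2 - w0) ^+ 2 by rewrite lerXn2r ?nnegrE ?normc_ge0// ltW.
  rewrite le_max; apply/orP; right; move: par h1 h2.
  by move: (normc _ ^+ 2) (normc _ ^+ 2) (normc _ ^+ 2) (s ^+ 2) (de ^+ 2) => a b c d f; lra.
have h2s : h < 2 * s.
  have s20 : 0 <= 2 * s by rewrite mulr_ge0// ltW.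
  rewrite -[ltRHS](ger0_norm s20) -sqrtr_sqr ltr_sqrt ?exprn_gt0 ?mulr_gt0//.
  rewrite gt_max exprn_gt0 ?mulr_gt0//= exprMn.
  by rewrite (_ : 2 ^+ 2 = 4); [rewrite gtrBl exprn_gt0|rewrite -natrX].
have s2 : 0 < 2 * s by rewrite mulr_gt0.
(* Midway between [h / (2 s)] and 1. *)
pose t := (1 + h / (2 * s)) / 2.
have hs1 : h / (2 * s) < 1 by rewrite ltr_pdivrMr// mul1r.
have hs0 : 0 <= h / (2 * s) by rewrite divr_ge0// ltW.
have t01 : 0 < t < 1 by rewrite /t; apply/andP; split; move: hs1 hs0; lra.
have ht : h < 2 * t * s.
  by rewrite mulrAC -ltr_pdivrMl// mulrC /t; move: hs1; lra.
have [c c0 Hc] := peak_lower t01.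
have ts0 : 0 < 2 * t * s := le_lt_trans h0 ht.
pose q := (h / (2 * t * s)) ^+ 2.
have q01 : 0 <= q < 1.
  rewrite sqr_ge0 /= expr_lt1// ?divr_ge0 ?(ltW ts0)//.
  by rewrite ltr_pdivrMr// mul1r.
pose mu := fine (m4 D).
have mu0 : 0 <= mu by exact: fine_ge0.
have LFar j : mass Far j <= (h ^+ j) ^+ 2 * mu.
  have [LF hh] : L2m m4 Far (fun p => peak w0 j (toCC p)) /\
      mass Far j <= (h ^+ j) ^+ 2 * fine (m4 Far).
    apply: bounded_L2 => //; first exact: subIsetl.
      by apply: cmeasurableS (peak_L2 j).1 => //; exact: subIsetl.
    by move=> p Fp; rewrite normcX lerXn2r ?nnegrE ?normc_ge0// hFar.
  apply: le_trans hh _; apply: ler_wpM2l; first exact: sqr_ge0.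
  have le1 : (m4 Far <= m4 D)%E by apply: le_measure; rewrite ?inE//; exact: subIsetl.
  have f2 : m4 D \is a fin_num by rewrite ge0_fin_numE; [exact: face_finite|exact: measure_ge0].
  have f1 : m4 Far \is a fin_num.
    rewrite ge0_fin_numE; last exact: measure_ge0.
    apply: le_lt_trans le1 _.
    exact: face_finite.
  by apply: fine_le; [exact: f1|exact: f2|exact: le1].
have : (fun j => q ^+ j * (mu / c)) @ \oo --> (0 : R).
  rewrite -(mul0r (mu / c)); apply: cvgMl; apply: cvg_expr.
  by case/andP: q01 => a b; rewrite ger0_norm.
move/cvgrPdist_le => /(_ e e0)[J _ HJ]; exists J => j Jj.
have := HJ j Jj; rewrite /= sub0r normrN ger0_norm; last first.
  by rewrite mulr_ge0 ?divr_ge0 ?(ltW c0)// exprn_ge0//; case/andP: q01.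
move=> hq; apply: le_trans (LFar j) _.
have m0 : 0 <= mass D0 j by exact: nrm2_ge0.
apply: le_trans (ler_wpM2r m0 hq).
have -> : (h ^+ j) ^+ 2 * mu = q ^+ j * (mu / c) * (c * (2 * t * s) ^+ (j + j)).
  have -> : q ^+ j = (h ^+ j / (2 * t * s) ^+ j) ^+ 2 by rewrite /q -exprM mulnC exprM expr_div_n.
  have T0 : (2 * t * s) ^+ j != 0 by rewrite gt_eqF// exprn_gt0.
  rewrite exprD; move: T0; move: (h ^+ j) ((2 * t * s) ^+ j) => u v v0.
  by field; rewrite v0 gt_eqF.
apply: ler_wpM2l; last exact: Hc.
by rewrite mulr_ge0 ?divr_ge0 ?(ltW c0)// exprn_ge0//; case/andP: q01.
Qed.

Lemma rect_mass (A : set (T * T)) j : measurable A ->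
  sqm m4 (A `*` disc s) (fun p => peak w0 j (toCC p)) =
  (lebesgue2 A * sqm (@lebesgue2 R) (disc s) (fun w => ((toC w + w0) ^+ j)%R))%E.
Proof.
move=> mA; have md := @measurable_disc R s.
have mpk : cmeasurable setT (fun p : Y => peak w0 j (toCC p)).
  by apply: (@ccont2_cmeasurable _ setT (peak w0 j)) => [x _|x _]; [exists 1|exact: peak_ccont2].
have mg := cmeasurableS measurableT (@subsetT _ (A `*` disc s)) mpk.
have [] := @tonelli_rect _ _ _ _ R (@lebesgue2 R) (@lebesgue2 R) A (disc s)
  (fun p => (normc (peak w0 j (toCC p)) ^+ 2)%:E) mA md (cmeasurable_sqr mg)
  (fun p _ => ltac:(by rewrite lee_fin sqr_ge0)).
rewrite /sqm => -> _; rewrite muleC -ge0_integralZr//.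
- by apply: eq_integral => w _; rewrite -[RHS](integral_cst (@lebesgue2 R) mA).
- apply: (@cmeasurable_sqr _ _ _ (disc s) (fun w => (toC w + w0) ^+ j)).
  apply: (@ccont_cmeasurable _ _ (fun w => (w + w0) ^+ j)); first exact: copen_disc0.
  move=> z _; apply: differentiable_ccont; apply: differentiable_cexpn.
  by apply: differentiableD; [exact: differentiable_idC|exact: differentiable_cst'].
- by move=> w _; rewrite lee_fin sqr_ge0.
Qed.

(** A point of [E] outside the bidisc is either far from height [w0], where [far_mass] applies, or
    lies over a thin annulus around the disc of radius [r]. On products with the disc of radius [s]
    the mass is proportional to the area of the first factor. *)
Lemma outside_mass (e : R) : 0 < e -> exists J, forall j, (J <= j)%N ->
  mass (D `\` D0) j <= e * mass D0 j.
Proof.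
move=> e0; have [mD mD0 sub r0 s0] := face_facts.
have e20 : 0 < e / 2 by rewrite divr_gt0.
(* The annulus has relative area [(2 r eta + eta ^ 2) / r ^ 2], at most [3 eta / r] and hence at
   most [e / 2]. *)
pose eta := Num.min r (e * r / 6).
have eta0 : 0 < eta by rewrite lt_min r0 divr_gt0 ?mulr_gt0.
have [_ [[B HB] fib]] := fE; have [de de0 Hde] := fib eta eta0.
have [J HJ] := far_mass de0 e20; exists J => j Jj.
pose Far := D `&` [set p | de <= normc ((toCC p).2 - w0)].
pose An := disc (r + eta) `\` disc r.
have mAn : measurable An by apply: measurableD; exact: measurable_disc.
have finAn : (lebesgue2 An < +oo)%E.
  apply: le_lt_trans (l2_disc_fin (r + eta)); apply: le_measure; rewrite ?inE//.
    exact: measurable_disc.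
  exact: subDsetl.
have annulus : fine (lebesgue2 An) <= e / 2 * moment r 0.
  have sub1 : @disc R r `<=` disc (r + eta) by move=> p /= h; apply: lt_trans h _; rewrite ltrDl.
  have : lebesgue2 (disc r `|` An) = (lebesgue2 (disc r) + lebesgue2 An)%E.
    by rewrite measureU ?setDIK//; exact: measurable_disc.
  rewrite setDUK// !lebesgue2_disc -{1}(fineK (x := lebesgue2 An)) ?ge0_fin_numE// -EFinD.
  move=> hE; have h := EFin_inj hE.
  rewrite (moment_scale 0 (addr_gt0 r0 eta0)) (moment_scale 0 r0) in h; rewrite (moment_scale 0 r0).
  have M0 : 0 <= moment (1 : R) 0 by exact: moment_ge0.
  have e1 : eta <= r by rewrite ge_min lexx.
  have e2 : eta <= e * r / 6 by rewrite ge_min lexx orbT.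
  have -> : fine (lebesgue2 An) = ((r + eta) ^+ 2 - r ^+ 2) * moment 1 0.
    by rewrite mulrBl h; ring.
  rewrite mulrA; apply: ler_wpM2r => //.
  have p1 : eta * eta <= eta * r by rewrite ler_pM2l.
  have p2 : eta * r <= e * r / 6 * r by rewrite ler_pM2r.
  rewrite (_ : (r + eta) ^+ 2 - r ^+ 2 = 2 * (eta * r) + eta * eta); last by ring.
  rewrite (_ : e / 2 * r ^+ 2 = 3 * (e * r / 6 * r)); last by field.
  by move: p1 p2; move: (eta * r) (eta * eta) (e * r / 6 * r) => u v w; lra.
have LD := peak_L2 j; have [LD0 _] := L2_sub mD0 mD sub LD.
pose A1 := An `*` disc s.
have mA1 : measurable A1 by apply: measurableX => //; exact: measurable_disc.
have [h1 LA1] : nrm2 m4 A1 (fun p => peak w0 j (toCC p)) <= e / 2 * mass D0 j /\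
    L2m m4 A1 (fun p => peak w0 j (toCC p)).
  have E1 := rect_mass j mAn; have E0 := rect_mass j (@measurable_disc R r).
  have m0 : 0 < moment r 0 by rewrite moment0 l2_disc_gt0.
  move: E1 E0; set I := sqm _ (disc s) _ => E1 E0.
  have I0 : (0 <= I)%E by exact: sqm_ge0.
  have Ifin : I \is a fin_num.
    rewrite ge0_fin_numE// ltNge leye_eq; apply/negP => /eqP Ioo.
    have [_] := LD0; rewrite [sqm _ _ _]E0 lebesgue2_disc Ioo mulry gtr0_sg// mul1e.
    by rewrite ltxx.
  have mu0 : 0 <= fine (lebesgue2 An) by exact: fine_ge0.
  rewrite -(fineK Ifin) -(fineK (x := lebesgue2 An)) ?ge0_fin_numE// -EFinM in E1.
  rewrite -(fineK Ifin) lebesgue2_disc -EFinM in E0.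
  split.
    rewrite /nrm2 E1 /mass /nrm2 bidisc_prod E0 /= mulrA ler_wpM2r// fine_ge0//.
  split; last by rewrite E1 ltry.
  apply: (cmeasurableS measurableT (@subsetT _ A1)).
  by apply: (@ccont2_cmeasurable _ setT (peak w0 j)) => [x _|x _]; [exists 1|exact: peak_ccont2].
pose X := D `\` D0; have mX : measurable X by exact: measurableD.
pose U : set Y := @toCC R @^-1` [set x | normc (x.1 - 0) < normc (x.1 - 0) + 1 /\ normc (x.2 - w0) < de].
have mU : measurable U.
  apply: copen2_measurable => y [_ y2].
  have [e2 e20' h2] := @copen_disc _ w0 de y.2 y2.
  by exists e2 => // w _ h; split; [rewrite ltrDl|exact: h2].
have UE p : U p <-> normc ((toCC p).2 - w0) < de.
  by split=> [[]//|h]; split => //; rewrite ltrDl.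
have mFar : measurable Far.
  have -> : Far = D `\` U.
    apply/seteqP; split => p [a1 a2]; split => //.
      by move/UE; rewrite ltNge; move: a2 => /= ->.
    by rewrite /= leNgt; apply/negP => h; apply: a2; exact/UE.
  exact: measurableD.
have LX := L2_sub mX mD (@subDsetl _ D D0) LD.
have XE : X = (X `\` U) `|` (X `&` U) by rewrite setUC setUIDK.
have mXU : measurable (X `\` U) by exact: measurableD.
have mXI : measurable (X `&` U) by exact: measurableI.
have dis : [disjoint X `\` U & X `&` U] by apply/disj_setPS => p [[_ h2] [_ h3]].
have LX' := LX.1; rewrite XE in LX'.
rewrite /mass -/X XE nrm2_setU//.
have b1 : nrm2 m4 (X `\` U) (fun p => peak w0 j (toCC p)) <= e / 2 * mass D0 j.
  apply: le_trans (HJ j Jj).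
  have LF := L2_sub mFar mD (@subIsetl _ _ _) LD.
  apply: (L2_sub mXU mFar _ LF.1).2 => p [[Dp _] nU]; split => //=.
  by rewrite leNgt; apply/negP => h; apply: nU; exact/UE.
have b2 : nrm2 m4 (X `&` U) (fun p => peak w0 j (toCC p)) <= e / 2 * mass D0 j.
  apply: le_trans h1; apply: (L2_sub mXI mA1 _ LA1).2 => p [[Dp nD0] /UE Up].
  have [_ ws] := HB _ Dp; split; last exact: ws.
  split; first exact: (Hde (toCC p) Dp Up).
  by move=> zr; apply: nD0; split.
by rewrite (splitr e) mulrDl; exact: lerD b1 b2.
Qed.

End Face.
End Concentration.

(** * Expansions of harmonic functions *)

Section Parseval.
Variable R : realType.
Notation C := R[i].

Lemma expi_ccont (t : R) n : rccont (fun t => expi t ^+ n) t.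
Proof.
have := @rccont_polar R (fun z => z ^+ n) 1 t.
rewrite (_ : (fun t => _) = (fun t => expi t ^+ n)); last by apply/funext => x; rewrite mul1r.
by apply; apply: differentiable_ccont; exact: differentiable_cpow.
Qed.

Lemma expi_mean i j : cmean (fun t : R => expi t ^+ i * (expi t ^+ j)^*) = (i == j)%:R.
Proof.
have pw k : cmean (fun t : R => expi t ^+ k) = (k == 0%N)%:R.
  rewrite -(expr0n C k) -(@circ_mean R (fun z => z ^+ k) 2 0 _ _ 1); first last.
  - by rewrite ler01 ltr1n.
  - by move=> z _ _; exact: differentiable_cpow.
  - by apply: differentiable_ccont; exact: differentiable_cpow.
  by apply: eq_cmean => t; rewrite mul1r.
have uu (t : R) k : expi t ^+ k * (expi t ^+ k)^* = 1.
  by rewrite mulcJ normcX normc_expi !expr1n.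
have [ij|ji] := leqP i j.
  transitivity (cmean (fun t : R => (expi t ^+ (j - i))^*)).
    by apply: eq_cmean => t; rewrite -{1}(subnKC ij) exprD cjM mulrA uu mul1r.
  rewrite cmean_conj ?pw; last by move=> t; exact: expi_ccont.
  by rewrite subn_eq0 [in RHS]eqn_leq ij /=; case: (j <= i)%N; rewrite ?cj1 ?cj0.
transitivity (cmean (fun t : R => expi t ^+ (i - j))).
  by apply: eq_cmean => t; rewrite -{1}(subnKC (ltnW ji)) exprD mulrAC uu mul1r.
by rewrite pw subn_eq0 leqNgt ji gtn_eqF.
Qed.

Lemma poly_circle_bound (c : nat -> C) L (M : R) :
  (forall u, normc u = 1 -> normc (\sum_(i < L) c i * u ^+ i) <= M) ->
  \sum_(i < L) normc (c i) ^+ 2 <= M ^+ 2.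
Proof.
move=> H.
have M0 : 0 <= M by apply: le_trans (H 1 _); rewrite ?normc_ge0 ?normc1.
pose p (t : R) := \sum_(i < L) c i * expi t ^+ i.
have ct (i : 'I_L) t : rccont (fun t => c i * expi t ^+ i) t.
  by apply: rccontM; [exact: rccont_cst|exact: expi_ccont].
have cp t : rccont p t by apply: rccont_sum => i; exact: ct.
have E : cmean (fun t => p t * (p t)^*) = (\sum_(i < L) normc (c i) ^+ 2)%:C.
  transitivity (cmean (fun t => \sum_(i < L) \sum_(j < L)
      (c i * (c j)^*) * (expi t ^+ i * (expi t ^+ j)^*))).
    apply: eq_cmean => t; rewrite /p mulr_suml; apply: eq_bigr => i _.
    by rewrite (rmorph_sum (@cj R)) mulr_sumr; apply: eq_bigr => j _; rewrite /= cjM; ring.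
  have cij i j (t : R) : rccont (fun t : R => expi t ^+ i * (expi t ^+ j)^*) t.
    by apply: rccontM; [exact: expi_ccont|apply: conj_rccont; exact: expi_ccont].
  rewrite cmean_sum => [|i t]; last first.
    by apply: rccont_sum => j; apply: rccontM; [exact: rccont_cst|exact: cij].
  rewrite rmorph_sum; apply: eq_bigr => i _.
  rewrite cmean_sum => [|j t]; last by apply: rccontM; [exact: rccont_cst|exact: cij].
  rewrite (bigD1 i)//= big1 => [|j ji].
    by rewrite addr0 cmeanZ// expi_mean eqxx mulr1 mulcJ.
  have ij : (i == j :> nat) = false by apply/eqP => h; move/eqP: ji; apply; apply: val_inj; exact: esym.
  by rewrite cmeanZ// expi_mean ij mulr0.
have : normc (cmean (fun t => p t * (p t)^*)) <= M ^+ 2.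
  apply: cmean_norm => [t|t _]; first by apply: rccontM; [exact: cp|apply: conj_rccont; exact: cp].
  rewrite normcM normc_conj -expr2 lerXn2r ?nnegrE ?normc_ge0//.
  by apply: H; exact: normc_expi.
by rewrite E normc_real ger0_norm// sumr_ge0// => i _; exact: sqr_ge0.
Qed.

End Parseval.

Lemma cvg_sum_ord (R : realType) (f : nat -> nat -> R) (l : nat -> R) K :
  (forall k, (fun n => f n k) @ \oo --> l k) ->
  (fun n => \sum_(k < K) f n k) @ \oo --> \sum_(k < K) l k.
Proof.
move=> fl; elim: K => [|K IH].
  by rewrite big_ord0; under eq_fun do rewrite big_ord0; exact: cvg_cst.
by rewrite big_ord_recr; under eq_fun do rewrite big_ord_recr; exact: cvgD.
Qed.

Lemma cvg_pow (R : realType) (f : nat -> R) (l : R) m :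
  f @ \oo --> l -> (fun n => f n ^+ m) @ \oo --> l ^+ m.
Proof.
move=> fl; elim: m => [|m IH]; first by rewrite expr0; under eq_fun do rewrite expr0; exact: cvg_cst.
by rewrite exprS; under eq_fun do rewrite exprS; exact: cvgM.
Qed.

(** * Truncated expansions and square summability *)

Section Truncation.
Variable R : realType.
Notation C := R[i].
Variables (Phi : C -> C) (a b : nat -> C).
Hypothesis expansion : forall rho : R, 0 < rho < 1 -> exists M : R, forall K z, normc z < rho ->
  normc (Phi z - Phi 0 - \sum_(k < K) (a k * z ^+ k.+1 + b k * z^* ^+ k.+1)) <=
  M * (normc z / rho) ^+ K / (rho - normc z).

(** The expansion of the dilate [Phi (t u)]: for fixed [t < 1] it converges uniformly on the closed
    disc, which the expansion of [Phi] itself need not do. *)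
Definition trunc (t : R) K (u : C) : C :=
  Phi 0 + \sum_(k < K) ((a k * t%:C ^+ k.+1) * u ^+ k.+1 + (b k * t%:C ^+ k.+1) * u^* ^+ k.+1).

Lemma trunc_approx (t e : R) : 0 < t < 1 -> 0 < e -> exists K0, forall K, (K0 <= K)%N ->
  forall u, normc u <= 1 -> normc (Phi (t%:C * u) - trunc t K u) <= e.
Proof.
move=> /andP[t0 t1] e0; pose rho := (1 + t) / 2.
have rt : t < rho by rewrite /rho; lra.
have r1 : rho < 1 by rewrite /rho; lra.
have r0 : 0 < rho := lt_trans t0 rt.
have [|M HM] := expansion (rho := rho); first by rewrite r0 r1.
pose N := `|M| / (rho - t).
have rt0 : 0 < rho - t by rewrite subr_gt0.
have q0 : 0 <= t / rho by rewrite divr_ge0 ?(ltW t0) ?(ltW r0).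
have q1 : t / rho < 1 by rewrite ltr_pdivrMr// mul1r.
have : (fun K => (t / rho) ^+ K * N) @ \oo --> (0 : R).
  by rewrite -(mul0r N); apply: cvgMl; apply: cvg_expr; rewrite ger0_norm.
move/cvgrPdist_le => /(_ e e0)[K0 _ HK]; exists K0 => K KK u u1.
have := HK K KK; rewrite /= sub0r normrN ger0_norm; last first.
  by rewrite mulr_ge0 ?exprn_ge0// divr_ge0// ltW.
apply: le_trans.
have zt : normc (t%:C * u) <= t by rewrite normcM normc_real ger0_norm ?(ltW t0)// ger_pMr.
have zr : normc (t%:C * u) < rho := le_lt_trans zt rt.
have E : Phi (t%:C * u) - trunc t K u = Phi (t%:C * u) - Phi 0 -
    \sum_(k < K) (a k * (t%:C * u) ^+ k.+1 + b k * (t%:C * u)^* ^+ k.+1).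
  rewrite /trunc opprD addrA; congr (_ - _); apply: eq_bigr => k _.
  by rewrite cjM cj_real !exprMn !mulrA.
rewrite E; apply: le_trans (HM K _ zr) _.
have z0 := normc_ge0 (t%:C * u).
have zr0 : 0 < rho - normc (t%:C * u) by rewrite subr_gt0.
have h1 : (normc (t%:C * u) / rho) ^+ K <= (t / rho) ^+ K.
  apply: lerXn2r; rewrite ?nnegrE//; first exact: divr_ge0 (normc_ge0 _) (ltW r0).
  by rewrite ler_pM2r// invr_gt0.
have h0 : 0 <= (normc (t%:C * u) / rho) ^+ K by rewrite exprn_ge0// divr_ge0// ltW.
apply: (@le_trans _ _ (`|M| * (normc (t%:C * u) / rho) ^+ K / (rho - normc (t%:C * u)))).
  by rewrite ler_pM2r ?invr_gt0//; apply: ler_wpM2r => //; exact: ler_norm.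
rewrite /N mulrCA -mulrA mulrA -mulrA; apply: ler_wpM2l => //.
apply: ler_pM => //; first by rewrite invr_ge0 ltW.
by rewrite lef_pV2 ?posrE// lerD2l lerN2.
Qed.

(** On the unit circle conjugation is inversion, so [u ^ N] times the truncation is a polynomial of
    degree at most [2 N], bounded by [M + 1] when the truncation is within 1 of [Phi (t u)].
    Parseval bounds the damped sum of squares, and [t] tends to 1. *)
Lemma square_summable (M : R) : (forall u, normc u < 1 -> normc (Phi u) <= M) ->
  forall K, \sum_(k < K) normc (b k) ^+ 2 <= (M + 1) ^+ 2.
Proof.
move=> PhiM K.
have M0 : 0 <= M by apply: le_trans (PhiM 0 _); rewrite ?normc_ge0 ?normc0.
have partial (t : R) : 0 < t < 1 -> \sum_(k < K) normc (b k) ^+ 2 * (t ^+ k.+1) ^+ 2 <= (M + 1) ^+ 2.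
  move=> t01; have /andP[t0 t1] := t01.
  have [K0 HK] := trunc_approx t01 ltr01; pose N := maxn K K0.
  have HN := HK N (leq_maxr _ _).
  (* The coefficient of [u ^ i] after the multiplication by [u ^ N]: the conjugate powers come first
     in reverse order, then the constant at index [N], then the [a k]. *)
  pose c i : C := if (i < N)%N then b (N - i.+1)%N * t%:C ^+ (N - i) else
    if i == N then Phi 0 else a (i - N.+1)%N * t%:C ^+ (i - N).
  have B : forall u, normc u = 1 -> normc (\sum_(i < N + N.+1) c i * u ^+ i) <= M + 1.
    move=> u u1.
    have uu k : u^* ^+ k * u ^+ k = 1 by rewrite mulrC -exprMn mulcJ u1 !expr1n.
    have -> : \sum_(i < N + N.+1) c i * u ^+ i = u ^+ N * trunc t N u.
      rewrite big_split_ord /= big_ord_recl /= addn0 /c ltnn eqxx /trunc mulrDr mulr_sumr.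
      rewrite (eq_bigr (fun i : 'I_N => b (N - i.+1)%N * t%:C ^+ (N - i) * u ^+ i)) => [|i _]; last first.
        by rewrite ltn_ord.
      rewrite (reindex_inj rev_ord_inj) /= addrCA [Phi 0 * _]mulrC; congr (_ + _).
      rewrite -big_split; apply: eq_bigr => i _ /=.
      have iN := ltn_ord i.
      have e1 : (N - (N - i.+1) = i.+1)%N by lia.
      have e2 : (N - (N - i.+1).+1 = i)%N by lia.
      have e3 : (N + bump 0 i = N + i.+1)%N by rewrite /bump leq0n add1n.
      have e4 : (N + i.+1 < N)%N = false by lia.
      have e5 : (N + i.+1 == N)%N = false by lia.
      have e6 : (N + i.+1 - N.+1 = i)%N by lia.
      rewrite e1 e2 e3 e4 e5 e6 addKn exprD.
      have -> : u ^+ (N - i.+1) = u ^+ N * u^* ^+ i.+1.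
        rewrite (_ : u ^+ N = u ^+ (N - i.+1) * u ^+ i.+1); last by rewrite -exprD subnK.
        by rewrite -mulrA [u ^+ i.+1 * _]mulrC uu mulr1.
      ring.
    rewrite normcM normcX u1 expr1n mul1r.
    have tu : normc (t%:C * u) < 1 by rewrite normcM u1 mulr1 normc_real gtr0_norm.
    rewrite -(subrK (Phi (t%:C * u)) (trunc t N u)); apply: le_trans (normcD _ _) _.
    by rewrite addrC; apply: lerD; [exact: PhiM|rewrite distcC; apply: HN; rewrite u1].
  have := poly_circle_bound B; apply: le_trans.
  rewrite big_split_ord /=.
  apply: (@le_trans _ _ (\sum_(i < N) normc (c i) ^+ 2)); last first.
    by rewrite lerDl; apply: sumr_ge0 => i _; exact: sqr_ge0.
  rewrite [leRHS](reindex_inj rev_ord_inj) /=.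
  have -> : \sum_(i < N) normc (c (N - i.+1)%N) ^+ 2 = \sum_(i < N) normc (b i) ^+ 2 * (t ^+ i.+1) ^+ 2.
    apply: eq_bigr => i _; have iN := ltn_ord i.
    rewrite /c ltn_subrL (leq_ltn_trans _ iN)//= subKn// subnS subKn//=.
    by rewrite normcM normcX normc_real gtr0_norm// exprMn.
  rewrite -!(big_mkord xpredT (fun i => normc (b i) ^+ 2 * (t ^+ i.+1) ^+ 2)) /=.
  rewrite [leRHS](big_cat_nat (n := K))//=; last exact: leq_maxl.
  rewrite lerDl.
  by apply: sumr_ge0 => i _; rewrite mulr_ge0 ?sqr_ge0.
pose t n : R := 1 - n.+2%:R^-1.
have t01 n : 0 < t n < 1.
  by rewrite /t subr_gt0 invf_lt1 ?ltr1n// gtrBl invr_gt0 ltr0n.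
have t1 : t @ \oo --> (1 : R).
  rewrite -[X in _ --> X](subr0 (1 : R)); apply: cvgB; first exact: cvg_cst.
  by rewrite (cvg_shiftS (@harmonic R)); exact: cvg_harmonic.
have L : (fun n => \sum_(k < K) normc (b k) ^+ 2 * (t n ^+ k.+1) ^+ 2) @ \oo -->
    \sum_(k < K) normc (b k) ^+ 2.
  apply: (cvg_sum_ord (f := fun n k => normc (b k) ^+ 2 * (t n ^+ k.+1) ^+ 2)
    (l := fun k => normc (b k) ^+ 2)) => k.
  rewrite -[X in _ --> X]mulr1; apply: cvgMr.
  have -> : (1 : R) = (1 ^+ k.+1) ^+ 2 by rewrite !expr1n.
  by apply: cvg_pow; apply: cvg_pow.
by apply: (ler_cvg_to L (@cvg_cst _ _ _ _ _)); apply: nearW => n; exact: partial.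
Qed.

End Truncation.

(** * Continuous functions bounded on bounded sets *)

Section Tame.
Variable R : realType.
Notation C := R[i].
Notation T := (measurableTypeR R).
Implicit Types f g : C -> C.

(** Closed under the algebra that builds residuals, and enough for measurability and integrability
    over bounded sets. *)
Definition tame f := (forall z, ccont f z) /\
  (forall B : R, exists2 M : R, 0 <= M & forall z, normc z <= B -> normc (f z) <= M).

Lemma ccontD f g z : ccont f z -> ccont g z -> ccont (fun w => f w + g w) z.
Proof.
move=> cf cg e e0; have e20 : 0 < e / 2 by rewrite divr_gt0.
have [d1 d10 h1] := cf _ e20; have [d2 d20 h2] := cg _ e20.
exists (Num.min d1 d2) => [|w]; first by rewrite lt_min d10.
rewrite lt_min => /andP[/h1 w1 /h2 w2].
by apply: (halves_lt _ w1 w2); rewrite opprD addrACA; exact: normcD.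
Qed.

Lemma tame_cst (c : C) : tame (fun=> c).
Proof.
split=> [z e e0|B]; first by exists 1 => // w _; rewrite subrr normc0.
by exists (normc c); rewrite ?normc_ge0.
Qed.

Lemma tameD f g : tame f -> tame g -> tame (fun z => f z + g z).
Proof.
move=> [cf bf] [cg bg]; split=> [z|B]; first exact: ccontD.
have [M1 M10 h1] := bf B; have [M2 M20 h2] := bg B.
exists (M1 + M2) => [|z zB]; first exact: addr_ge0.
by apply: le_trans (normcD _ _) _; rewrite lerD ?h1 ?h2.
Qed.

Lemma tameM f g : tame f -> tame g -> tame (fun z => f z * g z).
Proof.
move=> [cf bf] [cg bg]; split=> [z|B]; first exact: ccontM.
have [M1 M10 h1] := bf B; have [M2 M20 h2] := bg B.
exists (M1 * M2) => [|z zB]; first exact: mulr_ge0.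
by rewrite normcM ler_pM ?normc_ge0 ?h1 ?h2.
Qed.

Lemma tame_conj f : tame f -> tame (fun z => (f z)^*).
Proof.
move=> [cf bf]; split=> [z|B]; first exact: ccont_conj.
by have [M M0 h] := bf B; exists M => // z zB; rewrite normc_conj h.
Qed.

Lemma tame_pow n : tame (fun z => z ^+ n).
Proof.
split=> [z|B]; first exact: ccont_cpow.
exists (`|B| ^+ n) => [|z zB]; first by rewrite exprn_ge0.
rewrite normcX lerXn2r ?nnegrE ?normc_ge0//; apply: le_trans zB _; exact: ler_norm.
Qed.

Lemma tame_sum I (s : seq I) (F : I -> C -> C) : (forall i, tame (F i)) ->
  tame (fun z => \sum_(i <- s) F i z).
Proof.
move=> tF; elim: s => [|i s IH].
  by under eq_fun do rewrite big_nil; exact: tame_cst.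
by under eq_fun do rewrite big_cons; exact: tameD.
Qed.

Lemma tameZ (c : C) f : tame f -> tame (fun z => c * f z).
Proof. by move=> tf; apply: tameM => //; exact: tame_cst. Qed.

Lemma tame_cpow n : tame (fun z => z^* ^+ n).
Proof. by under eq_fun do rewrite -cjX; apply: tame_conj; exact: tame_pow. Qed.

Lemma tame_antihol r k m : tame (antihol r k m).
Proof.
rewrite (_ : antihol r k m = fun z => z ^+ m * z^* ^+ k + - (gam r k m)%:C * z ^+ (m - k)).
  apply: tameD; first by apply: tameM; [exact: tame_pow|exact: tame_cpow].
  by apply: tameZ; exact: tame_pow.
by apply/funext => z; rewrite /antihol mulNr.
Qed.

Lemma tame_cmeasurable1 f (A : set (T * T)) : tame f -> cmeasurable A (fun p => f (toC p)).
Proof.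
move=> [cf _]; apply: (cmeasurableS measurableT (@subsetT _ A)).
by apply: (@ccont_cmeasurable _ setT f) => // z _; exists 1.
Qed.

Lemma tame_cmeasurable f (A : set (T * T * (T * T))) : tame f ->
  cmeasurable A (fun p => f (toC p.1)).
Proof.
move=> [cf _]; apply: (cmeasurableS measurableT (@subsetT _ A)).
apply: (@ccont2_cmeasurable _ setT (fun x => f x.1)) => [x _|x _]; first by exists 1.
by move=> e /(cf x.1)[d d0 H]; exists d => // y h _; exact: H.
Qed.

Lemma tame_cintegrable f (r : R) : tame f -> cintegrable (@lebesgue2 R) (disc r) (fun p => f (toC p)).
Proof.
move=> tf; have [M M0 HM] := tf.2 r; apply: (@bounded_cintegrable _ _ _ _ _ _ M).
- exact: measurable_disc.
- exact: l2_disc_fin.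
- exact: tame_cmeasurable1.
- by move=> p /ltW; exact: HM.
Qed.

End Tame.

(** * Test functions concentrating on the face *)

Section TestFunctions.
Variable R : realType.
Notation C := R[i].
Notation T := (measurableTypeR R).
Notation Y := (T * T * (T * T))%type.
Notation m4 := (@lebesgue2 R \x @lebesgue2 R)%E.
Variables (E : set (C * C)) (r : R) (w0 : C).
Hypothesis fE : face E r w0.
Notation s := (normc w0).
Notation D := (@toCC R @^-1` E).
Notation D0 := (@toCC R @^-1` bidisc r s).
Notation Far de := (D `&` [set p | de <= normc ((toCC p).2 - w0)]).

Definition lift2 (p : C -> C) (x : Y) : C := p (toC x.2).

(* Normalised functions of the second variable whose mass tends to the face; the norms
   are squared. *)
Definition concentrating (p : nat -> C -> C) :=
  [/\ forall j w, differentiable (p j) w,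
    forall j, L2m m4 D (lift2 (p j)) /\ nrm2 m4 D (lift2 (p j)) <= 2,
    forall j, nrm2 m4 D0 (lift2 (p j)) = 1,
    forall de e : R, 0 < de -> 0 < e -> exists J, forall j, (J <= j)%N ->
      nrm2 m4 (Far de) (lift2 (p j)) <= e &
    forall e : R, 0 < e -> exists J, forall j, (J <= j)%N ->
      nrm2 m4 (D `\` D0) (lift2 (p j)) <= e].

Lemma measurable_far de : measurable (Far de).
Proof.
have [mD _ _ _ _] := face_facts fE.
have -> : Far de = D `\` (@toCC R @^-1` [set x | normc (x.1 - 0) < normc (x.1 - 0) + 1 /\ normc (x.2 - w0) < de]).
  apply/seteqP; split => p [h1 h2]; split => //.
    by move=> [_ h]; move: h2; rewrite /= leNgt h.
  by rewrite /= leNgt; apply/negP => h; apply: h2; split => //; rewrite ltrDl.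
apply: measurableD => //; apply: copen2_measurable => y [_ y2].
have [e2 e20 h2] := @copen_disc _ w0 de y.2 y2.
by exists e2 => // w _ h; split; [rewrite ltrDl|exact: h2].
Qed.

Lemma concentrating_sequence : exists p, concentrating p.
Proof.
have [mD mD0 sub r0 s0] := face_facts fE.
(* From the exponent [J0] on, the mass outside the bidisc is at most the mass inside, which gives
   the bound 2 for every [j]. *)
have [J0 HJ0] := outside_mass fE ltr01.
pose m j := nrm2 m4 D0 (lift2 (fun w => (w + w0) ^+ (j + J0))).
have m0 j : 0 < m j by exact: (peak_pos fE).
pose c j := (Num.sqrt (m j))^-1.
pose p j (w : C) := (c j)%:C * (w + w0) ^+ (j + J0).
have L j : L2m m4 D (lift2 (fun w => (w + w0) ^+ (j + J0))) by exact: (peak_L2 fE).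
have N A j : measurable A -> A `<=` D -> L2m m4 A (lift2 (p j)) /\
    nrm2 m4 A (lift2 (p j)) = (m j)^-1 * nrm2 m4 A (lift2 (fun w => (w + w0) ^+ (j + J0))).
  move=> mA AD; have LA := (L2_sub mA mD AD (L j)).1.
  have [h1 h2] := L2Z (c j)%:C mA LA; split; first exact: h1.
  rewrite [LHS]h2 normc_real ger0_norm ?invr_ge0 ?sqrtr_ge0//.
  by rewrite /c exprVn sqr_sqrtr// ltW.
have N0 j : nrm2 m4 D0 (lift2 (p j)) = 1 by rewrite (N _ _ mD0 sub).2 mulVf// gt_eqF.
have scale A j e : measurable A -> A `<=` D ->
    nrm2 m4 A (lift2 (fun w => (w + w0) ^+ (j + J0))) <= e * m j -> nrm2 m4 A (lift2 (p j)) <= e.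
  by move=> mA AD h; rewrite (N _ _ mA AD).2 ler_pdivrMl ?m0// mulrC.
have mX : measurable (D `\` D0) by exact: measurableD.
exists p; split => //.
- move=> j w; have h : differentiable (fun w : C => (w + w0) ^+ (j + J0)) w.
    apply: differentiable_cexpn; apply: differentiableD; first exact: differentiable_idC.
    exact: differentiable_cst'.
  by apply: differentiableM; [exact: differentiable_cst'|exact: h].
- move=> j; have [LD nD] := N D j mD (@subset_refl _ _); split => //.
  have -> : D = D0 `|` (D `\` D0) by rewrite setDUK.
  rewrite nrm2_setU//; last by rewrite setDUK.
    rewrite N0 -[X in _ <= X]/(1 + 1) lerD2l; apply: scale; [exact: mX|exact: subDsetl|].
    by apply: HJ0; rewrite leq_addl.
  by apply/disj_setPS => x [h1 [_ h2]].
- move=> de e de0 e0; have [J HJ] := far_mass fE de0 e0; exists J => j Jj.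
  apply: scale; [exact: measurable_far|exact: subIsetl|].
  by apply: HJ; rewrite (leq_trans Jj)// leq_addr.
- move=> e e0; have [J HJ] := outside_mass fE e0; exists J => j Jj.
  apply: scale; [exact: mX|exact: subDsetl|].
  by apply: HJ; rewrite (leq_trans Jj)// leq_addr.
Qed.

Variable p : nat -> C -> C.
Hypothesis cp : concentrating p.
Let P j := lift2 (p j).

Lemma multiplier (A : set Y) (G : Y -> C) (M : R) j : measurable A -> A `<=` D -> 0 <= M ->
  cmeasurable A G -> (forall x, A x -> normc (G x) <= M) ->
  L2m m4 A (fun x => G x * P j x) /\ nrm2 m4 A (fun x => G x * P j x) <= M ^+ 2 * nrm2 m4 A (P j).
Proof.
move=> mA AD M0 mG GM; have [mD _ _ _ _] := face_facts fE; have [_ Lp _ _ _] := cp.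
have LA := (L2_sub mA mD AD (Lp j).1).1.
apply: nrm2_le => //; first by apply: cmeasurableM => //; case: LA.
by move=> x Ax; rewrite normcM ler_wpM2r ?normc_ge0 ?GM.
Qed.

(* Near the face [g] has little mass, and away from it [P j] has. *)
Lemma weakly_null (G : Y -> C) (g : Y -> C) (M e : R) : 0 < M -> cmeasurable D G ->
  (forall x, D x -> normc (G x) <= M) -> L2m m4 D g -> 0 < e ->
  exists J, forall j, (J <= j)%N -> normc (ip m4 D g (fun x => G x * P j x)) <= e.
Proof.
move=> M0 mG GM Lg e0; have [mD mD0 sub r0 s0] := face_facts fE.
have [_ Lp _ pfar _] := cp; have [_ [[B HB] _]] := fE.
(* These slabs around height [w0] have empty intersection in [D], since [w0] itself is not attained
   there; hence the mass of [g] on them tends to 0. *)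
pose N i := D `\` Far i.+1%:R^-1.
have mN i : measurable (N i) by apply: measurableD => //; exact: measurable_far.
have ND i : N i `<=` D by exact: subDsetl.
have Nx x : D x -> exists K, forall i, (K <= i)%N -> ~ N i x.
  move=> Dx; have [_ ws] := HB _ Dx.
  have d0 : 0 < normc ((toCC x).2 - w0).
    by rewrite normc_gt0 subr_eq0; apply/eqP => E1; move: ws; rewrite E1 ltxx.
  have /cvgrPdist_lt/(_ _ d0)[K _ HK] := @cvg_harmonic R.
  exists K => i Ki [_]; apply; split => //=; apply/ltW; have := HK i Ki.
  by rewrite /= sub0r normrN ger0_norm// invr_ge0.
pose a := e / (4 * M).
have a0 : 0 < a by rewrite divr_gt0// mulr_gt0.
have ig := L2_integrable Lg.
have := vanishing_integral mD mN ND Nx ig (fun x _ => sqr_ge0 (normc (g x))).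
move/cvgrPdist_le => /(_ (a ^+ 2) (exprn_gt0 2 a0))[i _ /(_ i (leqnn i))].
have nNi : \int[m4]_(x in N i) normc (g x) ^+ 2 = nrm2 m4 (N i) g by [].
rewrite /= sub0r normrN nNi ger0_norm ?nrm2_ge0// => nN.
pose de : R := i.+1%:R^-1; have de0 : 0 < de by rewrite invr_gt0.
pose H := nrm2 m4 D g + 1; have H1 : 1 <= H by rewrite lerDr nrm2_ge0.
have H0 : 0 < H by exact: lt_le_trans H1.
pose b := e / (2 * H); have b0 : 0 < b by rewrite divr_gt0// mulr_gt0.
have [|J HJ] := pfar de ((b / M) ^+ 2) de0; first by rewrite exprn_gt0// divr_gt0.
exists J => j Jj.
have mF := measurable_far de; have FD : Far de `<=` D by exact: subIsetl.
have DE : D = N i `|` Far de by rewrite setUC setDUK.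
have dis : [disjoint N i & Far de] by apply/disj_setPS => x [[_ h1] h2].
have [LGP nGP] := multiplier j mD (@subset_refl _ D) (ltW M0) mG GM.
have mult A : measurable A -> A `<=` D -> L2m m4 A (fun x => G x * P j x) /\
    nrm2 m4 A (fun x => G x * P j x) <= M ^+ 2 * nrm2 m4 A (P j).
  move=> mA AD; apply: multiplier => //; [exact: ltW|exact: cmeasurableS mG|].
  by move=> x /AD; exact: GM.
have [LN nN2] := mult _ (mN i) (ND i); have [LF nF2] := mult _ mF FD.
have [LgN _] := L2_sub (mN i) mD (ND i) Lg; have [LgF ngF] := L2_sub mF mD FD Lg.
rewrite {1}DE ip_setU -?DE//; apply: le_trans (normcD _ _) _.
rewrite (splitr e); apply: lerD.
  have -> : e / 2 = a * (2 * M) by rewrite /a; field; rewrite gt_eqF.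
  apply: ip_bound => //; [exact: ltW|by rewrite mulr_ge0// ltW|].
  apply: le_trans nN2 _; rewrite exprMn mulrC; apply: ler_wpM2r; first exact: sqr_ge0.
  apply: le_trans (L2_sub (mN i) mD (ND i) (Lp j).1).2 _.
  by apply: le_trans (Lp j).2 _; rewrite expr2 ler_pMr ?ler1n.
have -> : e / 2 = H * b by rewrite /b; field; rewrite gt_eqF.
apply: ip_bound => //; [exact: ltW|exact: ltW| |].
  apply: le_trans ngF _; apply: (@le_trans _ _ H); first by rewrite lerDl.
  by rewrite expr2 ler_peMr// ltW.
apply: le_trans nF2 _; rewrite -ler_pdivlMl ?exprn_gt0//.
by apply: le_trans (HJ j Jj) _; rewrite expr_div_n mulrC.
Qed.

(* The integrand minus its mean in the first variable integrates to [0] on every slice. *)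
Lemma face_inner (W W' : C -> C) j : tame W -> tame W' ->
  ip m4 D0 (fun x => W (toC x.1) * P j x) (fun x => W' (toC x.1) * P j x) =
  cint (@lebesgue2 R) (disc r) (fun z => W (toC z) * (W' (toC z))^*) / (moment r 0)%:C.
Proof.
move=> tW tW'; have [mD mD0 sub r0 s0] := face_facts fE; have [_ Lp Np _ _] := cp.
have m0 : (moment r 0)%:C != 0 :> C.
  by rewrite (eq_complex _ 0) /= eqxx andbT gt_eqF// moment0 l2_disc_gt0.
set k := _ / _.
have LP := (L2_sub mD0 mD sub (Lp j).1).1.
have mult V : tame V -> L2m m4 D0 (fun x => V (toC x.1) * P j x).
  move=> tV; have [M M0 HM] := tV.2 r.
  apply: (multiplier (M := M) j mD0 sub M0 _ _).1; first exact: tame_cmeasurable.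
  by move=> x [/ltW h _]; exact: HM.
have i1 := L2_product mD0 (mult _ tW) (mult _ tW').
have i2 := L2_product mD0 LP LP.
have tWW : tame (fun z => W z * (W' z)^*) by apply: tameM => //; exact: tame_conj.
have tWk : tame (fun z => W z * (W' z)^* - k).
  by apply: tameD => //; exact: (tame_cst (- k)).
have EP (x : Y) : W (toC x.1) * P j x * (W' (toC x.1) * P j x)^* - k * (P j x * (P j x)^*) =
    (P j x * (P j x)^*) * (W (toC x.1) * (W' (toC x.1))^* - k) by rewrite cjM; ring.
have : cint m4 D0 (fun x => (P j x * (P j x)^*) * (W (toC x.1) * (W' (toC x.1))^* - k)) = 0.
  have mr := @measurable_disc R r; have ms := @measurable_disc R s.
  rewrite bidisc_prod; apply: cint_rect0 => //.
  - rewrite -bidisc_prod; apply: (eq_cintegrable mD0 (fun x _ => EP x)).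
    by apply: cintegrableB => //; exact: cintegrableZ.
  - move=> w _; exact: (cintegrableZ (p j (toC w) * (p j (toC w))^*) mr (tame_cintegrable r tWk)).
  move=> w _; transitivity (p j (toC w) * (p j (toC w))^* *
      cint (@lebesgue2 R) (disc r) (fun z => W (toC z) * (W' (toC z))^* - k)).
    exact: (cintZ (p j (toC w) * (p j (toC w))^*) mr (tame_cintegrable r tWk)).
  rewrite cintB//; [|exact: (tame_cintegrable _ tWW)|exact: (tame_cintegrable _ (tame_cst k))].
  have -> : cint (@lebesgue2 R) (disc r) (fun=> k) = k * (moment r 0)%:C.
    have := @disc_mean R (fun=> k^*) (r + 1) r.
    rewrite cjK => ->//; last by rewrite ltrDl.
  by rewrite /k divfK// subrr mulr0.
rewrite -(eq_cint m4 (fun x _ => EP x)) cintB//; last exact: cintegrableZ.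
rewrite cintZ// -[cint _ _ (fun x => P j x * _)]/(ip m4 D0 (P j) (P j)) ip_self// Np mulr1.
by move/eqP; rewrite subr_eq0 => /eqP.
Qed.

End TestFunctions.

Lemma unit_sequence (R : realType) : exists2 t : nat -> R, forall i, 0 < t i < 1 & t @ \oo --> (1 : R).
Proof.
exists (fun n => 1 - n.+2%:R^-1) => [n|].
  by rewrite subr_gt0 invf_lt1 ?ltr1n// gtrBl invr_gt0 ltr0n.
rewrite -[X in _ --> X](subr0 (1 : R)); apply: cvgB; first exact: cvg_cst.
by rewrite (cvg_shiftS (@harmonic R)); exact: cvg_harmonic.
Qed.

Lemma differentiable_fst_comp (R : realType) (f : R[i] -> R[i]) (x : R[i] * R[i]) :
  differentiable f x.1 -> differentiable (fun y : R[i] * R[i] => f y.1) x.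
Proof. by move=> df; apply: (@differentiable_comp _ _ _ _ fst f) => //; apply: linear_differentiable => y; exact: cvg_fst. Qed.

Lemma differentiable_snd_comp (R : realType) (f : R[i] -> R[i]) (x : R[i] * R[i]) :
  differentiable f x.2 -> differentiable (fun y : R[i] * R[i] => f y.2) x.
Proof. by move=> df; apply: (@differentiable_comp _ _ _ _ snd f) => //; apply: linear_differentiable => y; exact: cvg_snd. Qed.

(** * Orthogonality of residuals to the Bergman space *)

Section FaceOrthogonality.
Variable R : realType.
Notation C := R[i].
Notation T := (measurableTypeR R).
Notation Y := (T * T * (T * T))%type.
Notation m4 := (@lebesgue2 R \x @lebesgue2 R)%E.
Variables (E : set (C * C)) (r : R) (w0 : C) (p : nat -> C -> C).
Hypotheses (fE : face E r w0) (cp : concentrating E r w0 p).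
Notation s := (normc w0).
Notation D := (@toCC R @^-1` E).
Notation D0 := (@toCC R @^-1` bidisc r s).
Let P j := lift2 (p j).

Lemma gam_cvg (t : nat -> R) k m : t @ \oo --> (1 : R) ->
  (fun i => gam (t i * r) k m) @ \oo --> gam r k m.
Proof.
move=> t1; rewrite /gam; case: ifP => _; last exact: cvg_cst.
apply: cvgMl; apply: cvgMl; apply: cvg_pow.
by rewrite -[X in _ --> X]mul1r; apply: cvgMl.
Qed.

Lemma tame_multiplier (A : set Y) (G : C -> C) j : measurable A -> A `<=` D -> tame G ->
  L2m m4 A (fun x => G (toC x.1) * P j x).
Proof.
move=> mA AD tG; have [_ [[B HB] _]] := fE; have [M M0 HM] := tG.2 B.
apply: (multiplier fE cp (M := M) j mA AD M0 _ _).1; first exact: tame_cmeasurable.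
by move=> x /AD/HB[h _]; exact: HM.
Qed.

(** Each slice of [f] is holomorphic on the disc of radius [r], so on the strictly smaller radius
    [rho] the one-variable orthogonality applies, with the residual belonging to [rho]. *)
Lemma slice_orthogonal (f : C * C -> C) (rho sg : R) l n j : 0 < rho -> rho < r -> sg < s ->
  AA E f -> let Di := disc rho `*` disc sg in
  ip m4 Di (fun x => antihol rho l n (toC x.1) * P j x) (fun x => f (toCC x)) = 0.
Proof.
move=> rho0 rhor sgs [Lf df] Di; have [mD mD0 sub r0 s0] := face_facts fE.
have mr := @measurable_disc R rho; have ms := @measurable_disc R sg.
have mDi : measurable Di by exact: measurableX.
have DiD0 : Di `<=` D0.
  by move=> x [h1 h2]; split; [exact: lt_trans h1 rhor|exact: lt_trans h2 sgs].
have DiD := subset_trans DiD0 sub.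
have Lm := tame_multiplier j mDi DiD (tame_antihol rho l n).
have LfD := (L2_sub mDi mD DiD Lf).1.
apply: cint_rect0 => //; first exact: L2_product.
- move=> w ws.
  have dfw z : normc z < r -> differentiable (fun z => f (z, toC w)) z.
    move=> zr; have := @slice1_differentiable R f 0 (toC w) r.
    rewrite (_ : (fun z => f (0 + z, _)) = (fun z => f (z, toC w))); last by apply/funext => y; rewrite add0r.
    apply => // y yr; rewrite add0r; apply: df; have [[_ _ _ h] _] := fE.
    by apply: h; split => //; exact: lt_trans ws sgs.
  have i1 := disc_integrable_conj l n dfw rho0 rhor.
  have i2 := disc_integrable_conj 0 (n - l) dfw rho0 rhor.
  apply: (eq_cintegrable mr) (cintegrableB mr (cintegrableZ (p j (toC w)) mr i1)
    (cintegrableZ (p j (toC w) * (gam rho l n)%:C) mr i2)) => z _.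
  by rewrite /antihol /P /lift2 /toCC /= expr0; ring.
- move=> w ws.
  have dfw z : normc z < r -> differentiable (fun z => f (z, toC w)) z.
    move=> zr; have := @slice1_differentiable R f 0 (toC w) r.
    rewrite (_ : (fun z => f (0 + z, _)) = (fun z => f (z, toC w))); last by apply/funext => y; rewrite add0r.
    apply => // y yr; rewrite add0r; apply: df; have [[_ _ _ h] _] := fE.
    by apply: h; split => //; exact: lt_trans ws sgs.
  have i1 := disc_integrable_conj l n dfw rho0 rhor.
  have i2 := disc_integrable_conj 0 (n - l) dfw rho0 rhor.
  transitivity (cint (@lebesgue2 R) (disc rho) (fun z => p j (toC w) *
      (antihol rho l n (toC z) * (f (toC z, toC w))^*))).
    by apply: eq_cint => z _; rewrite /P /lift2 /toCC /=; ring.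
  have ia : cintegrable (@lebesgue2 R) (disc rho)
      (fun z => antihol rho l n (toC z) * (f (toC z, toC w))^*).
    apply: (eq_cintegrable mr) (cintegrableB mr i1 (cintegrableZ (gam rho l n)%:C mr i2)) => z _.
    by rewrite /antihol /= expr0; ring.
  by rewrite (cintZ _ mr ia) [X in _ * X](antihol_orthogonal l n dfw rho0 rhor) mulr0.
Qed.

(* [antihol r l n] is orthogonal to holomorphic functions on the discs of radius
   less than [r] only up to the difference of the [gam] constants. *)
Lemma face_orthogonal (f : C * C -> C) l n j : AA E f ->
  ip m4 D0 (fun x => f (toCC x)) (fun x => antihol r l n (toC x.1) * P j x) = 0.
Proof.
move=> Af; have [Lf df] := Af; have [mD mD0 sub r0 s0] := face_facts fE.
have [_ Lp _ _ _] := cp.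
have [t t01 t1] := unit_sequence R.
pose Di i : set Y := disc (t i * r) `*` disc (t i * s).
have mDi i : measurable (Di i) by apply: measurableX; exact: measurable_disc.
have tr i : t i * r < r by case/andP: (t01 i) => _ h; rewrite gtr_pMl.
have ts i : t i * s < s by case/andP: (t01 i) => _ h; rewrite gtr_pMl.
have DiD0 i : Di i `<=` D0.
  by move=> x [h1 h2]; split; [exact: lt_trans h1 (tr i)|exact: lt_trans h2 (ts i)].
have DiD i := subset_trans (DiD0 i) sub.
pose h x := antihol r l n (toC x.1) * P j x.
pose g x := toC x.1 ^+ (n - l) * P j x.
have Lh A : measurable A -> A `<=` D -> L2m m4 A h.
  by move=> mA AD; apply: tame_multiplier => //; exact: tame_antihol.
have Lg A : measurable A -> A `<=` D -> L2m m4 A g.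
  by move=> mA AD; apply: (tame_multiplier j mA AD (tame_pow _ (n - l))).
have LfA A mA AD := (@L2_sub _ _ _ m4 A D _ mA mD AD Lf).1.
have h0 := Lh _ mD0 sub; have f0 := LfA _ mD0 sub.
suff E0 : ip m4 D0 h (fun x => f (toCC x)) = 0 by rewrite (ip_conj mD0 h0 f0) E0 cj0.
pose a := Num.sqrt (nrm2 m4 D h) + 1; pose b := Num.sqrt (nrm2 m4 D g) + 1.
pose c := Num.sqrt (nrm2 m4 D (fun x => f (toCC x))) + 1.
have sq x : 0 <= x -> x <= (Num.sqrt x + 1) ^+ 2.
  move=> x0; rewrite -{1}(sqr_sqrtr x0) lerXn2r ?nnegrE ?addr_ge0 ?sqrtr_ge0//.
  by rewrite lerDl.
have a0 : 0 < a by rewrite ltr_wpDl ?sqrtr_ge0.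
have b0 : 0 < b by rewrite ltr_wpDl ?sqrtr_ge0.
have c0 : 0 < c by rewrite ltr_wpDl ?sqrtr_ge0.
apply/eqP; rewrite -normc_eq0 eq_le normc_ge0 andbT; apply/ler_addgt0Pr => e e0; rewrite add0r.
pose B i := D0 `\` Di i.
have mB i : measurable (B i) by exact: measurableD.
have BD0 i : B i `<=` D0 by exact: subDsetl.
have Bx x : D0 x -> exists N, forall i, (N <= i)%N -> ~ B i x.
  move=> [x1 x2].
  have near (u v : R) : 0 <= u -> u < v -> exists N, forall i, (N <= i)%N -> u < t i * v.
    move=> u0 uv; have v0 := le_lt_trans u0 uv.
    have uv1 : u / v < 1 by rewrite ltr_pdivrMr// mul1r.
    have [N _ HN] := cvgr_gt 1 t1 (u / v) uv1; exists N => i Ni.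
    by rewrite -ltr_pdivrMr//; exact: HN.
  have [N1 H1] := near _ _ (normc_ge0 _) x1; have [N2 H2] := near _ _ (normc_ge0 _) x2.
  exists (maxn N1 N2) => i; rewrite geq_max => /andP[i1 i2] [_]; apply; split.
    exact: H1.
  exact: H2.
have V := vanishing_integral mD0 mB BD0 Bx (L2_integrable f0) (fun x _ => sqr_ge0 _).
have ea : 0 < (e / (2 * a)) ^+ 2 by rewrite exprn_gt0// divr_gt0// mulr_gt0.
have [N1 _ H1] := (cvgrPdist_le _ _).1 V _ ea.
have G := @gam_cvg t l n t1; have eb : 0 < e / (2 * (b * c)) by rewrite divr_gt0// !mulr_gt0.
have [N2 _ H2] := (cvgrPdist_le _ _).1 G _ eb.
pose i := maxn N1 N2; have {H1} := H1 i (leq_maxl _ _); have {H2} := H2 i (leq_maxr _ _).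
have nBi : \int[m4]_(x in B i) normc (f (toCC x)) ^+ 2 = nrm2 m4 (B i) (fun x => f (toCC x)) by [].
move=> /= H2; rewrite sub0r normrN nBi ger0_norm ?nrm2_ge0// => H1.
have DE : D0 = Di i `|` B i by rewrite setDUK.
have dis : [disjoint Di i & B i] by apply/disj_setPS => x [k1 [_ k2]].
rewrite {1}DE ip_setU -?DE//; apply: le_trans (normcD _ _) _; rewrite (splitr e); apply: lerD.
  have /andP[ti0 _] := t01 i; have ri0 : 0 < t i * r by rewrite mulr_gt0.
  have S := slice_orthogonal l n j ri0 (tr i) (ts i) Af.
  have Lhi := tame_multiplier j (mDi i) (DiD i) (tame_antihol (t i * r) l n).
  have Lgi := Lg _ (mDi i) (DiD i); have Lfi := LfA _ (mDi i) (DiD i).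
  have -> : ip m4 (Di i) h (fun x => f (toCC x)) =
      (gam (t i * r) l n - gam r l n)%:C * ip m4 (Di i) g (fun x => f (toCC x)).
    pose hi x := antihol (t i * r) l n (toC x.1) * P j x.
    rewrite -ipZl; [|exact: mDi|exact: Lgi|exact: Lfi].
    rewrite -[RHS]add0r -S -ipDl; [|exact: mDi|exact: Lhi|exact: (L2Z _ (mDi i) Lgi).1|exact: Lfi].
    apply: eq_ip => // x _; rewrite /h /g /antihol rmorphB /=; ring.
  rewrite normcM normc_real distrC; apply: le_trans (ler_pM (normr_ge0 _) (normc_ge0 _) H2 _) _.
    apply: (ip_bound (a := b) (b := c)) => //; [exact: ltW|exact: ltW| |].
      by apply: le_trans (L2_sub (mDi i) mD (DiD i) (Lg _ mD (@subset_refl _ D))).2 _; exact/sq/nrm2_ge0.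
    by apply: le_trans (L2_sub (mDi i) mD (DiD i) Lf).2 _; exact/sq/nrm2_ge0.
  have bc : b * c != 0 by rewrite mulf_neq0// gt_eqF.
  have -> : e / (2 * (b * c)) = e / 2 / (b * c) by rewrite -[RHS]mulrA -invfM.
  by rewrite divfK.
have BD := subset_trans (BD0 i) sub.
rewrite (_ : e / 2 = a * (e / (2 * a))); last by rewrite invfM [RHS]mulrCA [X in _ = _ * X]mulrCA mulfV ?gt_eqF// mulr1.
apply: ip_bound => //; [exact: Lh|exact: LfA|exact: ltW|by rewrite divr_ge0 ?mulr_ge0 ?(ltW a0) ?(ltW e0)|].
by apply: le_trans (L2_sub (mB i) mD BD (Lh _ mD (@subset_refl _ D))).2 _; exact/sq/nrm2_ge0.
Qed.

End FaceOrthogonality.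

(** * Splitting a symbol near the face *)

Section SymbolSide.
Variable R : realType.
Notation C := R[i].
Notation T := (measurableTypeR R).
Notation Y := (T * T * (T * T))%type.
Notation m4 := (@lebesgue2 R \x @lebesgue2 R)%E.
Variables (E : set (C * C)) (r : R) (w0 : C) (p : nat -> C -> C).
Hypotheses (fE : face E r w0) (cp : concentrating E r w0 p).
Notation s := (normc w0).
Notation D := (@toCC R @^-1` E).
Notation D0 := (@toCC R @^-1` bidisc r s).
Notation Far de := (D `&` [set p | de <= normc ((toCC p).2 - w0)]).
Let P j := lift2 (p j).

Definition harm_poly (c0 : C) (a b : nat -> C) K (z : C) : C :=
  c0 + \sum_(k < K) (a k * z ^+ k.+1 + b k * z^* ^+ k.+1).

(** The projection of [harm_poly] times [z ^+ m] onto the holomorphic functions on the disc of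
    radius [r]; [anti_part] is the remainder. It is a polynomial, hence a competitor on all of
    [E]. *)
Definition hol_part (c0 : C) (a b : nat -> C) K m (z : C) : C :=
  c0 * z ^+ m + \sum_(k < K) (a k * z ^+ (k.+1 + m) + b k * (gam r k.+1 m)%:C * z ^+ (m - k.+1)).

Definition anti_part (b : nat -> C) K m (z : C) : C := \sum_(k < K) b k * antihol r k.+1 m z.

Lemma harm_poly_split c0 a b K m z :
  harm_poly c0 a b K z * z ^+ m = hol_part c0 a b K m z + anti_part b K m z.
Proof.
rewrite /harm_poly /hol_part /anti_part mulrDl mulr_suml -addrA; congr (_ + _).
rewrite -big_split; apply: eq_bigr => k _; rewrite /antihol exprD /=; ring.
Qed.

Lemma tame_harm_poly c0 a b K : tame (harm_poly c0 a b K).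
Proof.
apply: tameD; first exact: tame_cst.
apply: tame_sum => k; apply: tameD; apply: tameZ; [exact: tame_pow|exact: tame_cpow].
Qed.

Lemma tame_hol_part c0 a b K m : tame (hol_part c0 a b K m).
Proof.
apply: tameD; first by apply: tameZ; exact: tame_pow.
by apply: tame_sum => k; apply: tameD; apply: tameZ; exact: tame_pow.
Qed.

Lemma tame_anti_part b K m : tame (anti_part b K m).
Proof. by apply: tame_sum => k; apply: tameZ; exact: tame_antihol. Qed.

Lemma differentiable_Zpow (c : C) n z : differentiable (fun z : C => c * z ^+ n) z.
Proof. by apply: differentiableM; [exact: differentiable_cst'|exact: differentiable_cpow]. Qed.

Lemma differentiable_hol_part c0 a b K m z : differentiable (hol_part c0 a b K m) z.
Proof.
apply: differentiableD; first exact: differentiable_Zpow.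
elim: K => [|K IH].
  rewrite (_ : (fun _ => _) = fun=> 0); first exact: differentiable_cst'.
  by apply/funext => y; rewrite big_ord0.
rewrite (_ : (fun _ => _) = (fun z => \sum_(k < K) (a k * z ^+ (k.+1 + m) + b k * (gam r k.+1 m)%:C * z ^+ (m - k.+1)) +
  (a K * z ^+ (K.+1 + m) + b K * (gam r K.+1 m)%:C * z ^+ (m - K.+1)))); last first.
  by apply/funext => y; rewrite big_ord_recr.
apply: differentiableD; first exact: IH.
by apply: differentiableD; exact: differentiable_Zpow.
Qed.

Lemma test_AA (Q : C -> C) j : tame Q -> (forall z, differentiable Q z) ->
  AA E (fun y => Q y.1 * p j y.2).
Proof.
move=> tQ dQ; have [mD mD0 sub r0 s0] := face_facts fE; split.
  exact: (tame_multiplier fE cp j mD (@subset_refl _ D) tQ).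
have [dp _ _ _ _] := cp.
move=> x _; apply: differentiableM.
  by apply: (@differentiable_fst_comp R Q x).
by apply: (@differentiable_snd_comp R (p j) x).
Qed.

Lemma anti_part_orthogonal f b K m j : AA E f ->
  ip m4 D0 (fun x => f (toCC x)) (fun x => anti_part b K m (toC x.1) * P j x) = 0.
Proof.
move=> Af; have [mD mD0 sub r0 s0] := face_facts fE.
have Lf := (L2_sub mD0 mD sub Af.1).1.
have La k := tame_multiplier fE cp j mD0 sub (tame_antihol r k m).
transitivity (cint m4 D0 (fun x => \sum_(k < K) (b k)^* *
    (f (toCC x) * (antihol r k.+1 m (toC x.1) * P j x)^*))).
  apply: eq_cint => x _; rewrite /anti_part mulr_suml (rmorph_sum (@cj R)) mulr_sumr.
  by apply: eq_bigr => k _ /=; rewrite -mulrA cjM mulrCA.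
have ik k := L2_product mD0 Lf (La k).
rewrite cint_sum//; last by move=> k; exact: cintegrableZ.
rewrite big1// => k _; rewrite cintZ//.
by rewrite -[cint _ _ _]/(ip m4 D0 _ _) (face_orthogonal fE cp _ _ _ Af) mulr0.
Qed.

Variables (phi : C * C -> C) (m : nat) (M Mz : R).
Hypothesis mphi : cmeasurable D (fun x => phi (toCC x)).
Hypothesis phiM : forall y, E y -> normc (phi y) <= M.
Hypothesis powM : forall y, E y -> normc y.1 ^+ m <= Mz.
Hypotheses (M0 : 0 < M) (Mz0 : 0 < Mz).
Let F j x := phi (toCC x) * (toC x.1 ^+ m * P j x).

Lemma symbol_bound x : D x -> normc (phi (toCC x) * toC x.1 ^+ m) <= M * Mz.
Proof.
move=> Dx; rewrite normcM normcX; apply: ler_pM; rewrite ?exprn_ge0 ?normc_ge0//.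
  exact: phiM.
exact: (powM Dx).
Qed.

Lemma symbol_L2 A j : measurable A -> A `<=` D ->
  L2m m4 A (F j) /\ nrm2 m4 A (F j) <= (M * Mz) ^+ 2 * nrm2 m4 A (P j).
Proof.
move=> mA AD; have [mD _ _ _ _] := face_facts fE.
have -> : F j = (fun x => (phi (toCC x) * toC x.1 ^+ m) * P j x).
  by apply/funext => x; rewrite /F mulrA.
apply: (multiplier fE cp) => //; first by rewrite mulr_ge0// ltW.
  apply: cmeasurableM; first exact: cmeasurableS mphi.
  exact: (tame_cmeasurable _ (tame_pow R m)).
by move=> x /AD; exact: symbol_bound.
Qed.

Variables (c0 : C) (a b : nat -> C) (K : nat).
Notation q := (harm_poly c0 a b K).
Hypothesis qM : forall z, normc z < r -> normc (q z) <= M.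

(** Within distance [de] of height [w0] the symbol is within [e] of the polynomial; farther away the
    crude factor [2 M] is compensated by the small mass of the test function. *)
Lemma symbol_near (e de : R) : 0 < e -> 0 < de ->
  (forall y, bidisc r s y -> normc (y.2 - w0) < de -> normc (phi y - q y.1) <= e) ->
  exists J, forall j, (J <= j)%N -> nrm2 m4 D0 (fun x =>
    (F j x - hol_part c0 a b K m (toC x.1) * P j x) - anti_part b K m (toC x.1) * P j x) <= (2 * e * Mz) ^+ 2.
Proof.
move=> e0 de0 He; have [mD mD0 sub r0 s0] := face_facts fE.
have [_ Lp Np pfar _] := cp.
pose G x := (phi (toCC x) - q (toC x.1)) * toC x.1 ^+ m.
have GE j x : (F j x - hol_part c0 a b K m (toC x.1) * P j x) - anti_part b K m (toC x.1) * P j x = G x * P j x.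
  transitivity (F j x - (q (toC x.1) * toC x.1 ^+ m) * P j x); first by rewrite harm_poly_split; ring.
  by rewrite /F /G; ring.
have mG A : A `<=` D -> cmeasurable A G.
  move=> AD; apply: cmeasurableM; last exact: (tame_cmeasurable _ (tame_pow R m)).
  by apply: cmeasurableB; [exact: cmeasurableS mphi|exact: (tame_cmeasurable _ (tame_harm_poly c0 a b K))].
pose A1 := D0 `\` Far de; pose A2 := D0 `&` Far de.
have mF := measurable_far fE de.
have m1 : measurable A1 by exact: measurableD.
have m2 : measurable A2 by exact: measurableI.
have A1D0 : A1 `<=` D0 by exact: subDsetl.
have A2D0 : A2 `<=` D0 by exact: subIsetl.
have A12 : D0 = A1 `|` A2 by rewrite setUC setUIDK.
have dis : [disjoint A1 & A2] by apply/disj_setPS => x [[_ h1] [_ h2]].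
(* Chosen so that the far part, with multiplier [2 M Mz], contributes no more than the bound
   [(e Mz) ^ 2] of the near part. *)
have eM : 0 < (e / (2 * M)) ^+ 2 by rewrite exprn_gt0// divr_gt0// mulr_gt0.
have [J HJ] := pfar de _ de0 eM; exists J => j Jj.
have zb x : D0 x -> normc (toC x.1 ^+ m) <= Mz by move=> /sub h; rewrite normcX; exact: (powM h).
have [L1 n1] : L2m m4 A1 (fun x => G x * P j x) /\
    nrm2 m4 A1 (fun x => G x * P j x) <= (e * Mz) ^+ 2 * nrm2 m4 A1 (P j).
  apply: (multiplier fE cp) => //; [exact: subset_trans sub|by rewrite mulr_ge0// ltW|by apply: mG; exact: subset_trans sub|].
  move=> x A1x; have D0x := A1D0 _ A1x; rewrite normcM ler_pM ?normc_ge0//; last exact: zb.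
  apply: (He (toCC x)) => //; rewrite ltNge; apply/negP => h; have [_] := A1x; apply; split => //.
  exact: sub.
have [L2 n2] : L2m m4 A2 (fun x => G x * P j x) /\
    nrm2 m4 A2 (fun x => G x * P j x) <= (2 * M * Mz) ^+ 2 * nrm2 m4 A2 (P j).
  apply: (multiplier fE cp) => //; [exact: subset_trans sub|by rewrite !mulr_ge0// ltW|by apply: mG; exact: subset_trans sub|].
  move=> x A2x; have D0x := A2D0 _ A2x; rewrite normcM ler_pM ?normc_ge0//; last exact: zb.
  apply: le_trans (normcB _ _) _; rewrite (_ : 2 * M = M + M); last by ring.
  by apply: lerD; [apply: phiM; exact: sub|apply: qM; case: D0x].
have LG : L2m m4 D0 (fun x => G x * P j x).
  apply: (multiplier fE cp (M := 2 * M * Mz) j mD0 sub _ (mG _ sub) _).1; first by rewrite !mulr_ge0// ltW.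
  move=> x D0x; rewrite normcM ler_pM ?normc_ge0//; last exact: zb.
  apply: le_trans (normcB _ _) _; rewrite (_ : 2 * M = M + M); last by ring.
  by apply: lerD; [apply: phiM; exact: sub|apply: qM; case: D0x].
rewrite (_ : (fun x => _ - _) = (fun x => G x * P j x)); last by apply/funext => x; exact: GE.
have LP0 := (L2_sub mD0 mD sub (Lp j).1).1.
rewrite A12 nrm2_setU -?A12//.
apply: (@le_trans _ _ ((e * Mz) ^+ 2 + (e * Mz) ^+ 2)).
  apply: lerD.
    apply: le_trans n1 _; rewrite ler_piMr ?sqr_ge0// -(Np j).
    exact: (L2_sub m1 mD0 A1D0 LP0).2.
  apply: le_trans n2 _; apply: (@le_trans _ _ ((2 * M * Mz) ^+ 2 * (e / (2 * M)) ^+ 2)).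
    apply: ler_wpM2l; first exact: sqr_ge0.
    apply: le_trans (HJ j Jj); apply: (L2_sub m2 mF _ _).2; first by move=> x [].
    by apply: (L2_sub mF mD _ (Lp j).1).1; exact: subIsetl.
  have M2 : 2 * M != 0 by rewrite mulf_neq0// gt_eqF.
  rewrite -exprMn (_ : 2 * M * Mz * (e / (2 * M)) = e * Mz)//.
  by rewrite mulrC mulrA divfK.
rewrite (_ : (2 * e * Mz) ^+ 2 = 4 * (e * Mz) ^+ 2); last by ring.
have := sqr_ge0 (e * Mz); lra.
Qed.

Lemma symbol_outside (eta : R) : 0 < eta -> exists J, forall j, (J <= j)%N ->
  nrm2 m4 (D `\` D0) (fun x => F j x - hol_part c0 a b K m (toC x.1) * P j x) <= eta ^+ 2.
Proof.
move=> eta0; have [mD mD0 sub r0 s0] := face_facts fE.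
have [_ _ _ _ pout] := cp; have [_ [[B HB] _]] := fE.
have [H H0 HH] := (tame_hol_part c0 a b K m).2 B.
pose G x := phi (toCC x) * toC x.1 ^+ m - hol_part c0 a b K m (toC x.1).
pose N := M * Mz + H; have N0 : 0 < N by rewrite ltr_wpDr// mulr_gt0.
have eN : 0 < (eta / N) ^+ 2 by rewrite exprn_gt0// divr_gt0.
have [J HJ] := pout _ eN; exists J => j Jj.
have mX : measurable (D `\` D0) by exact: measurableD.
rewrite (_ : (fun x => _ - _) = (fun x => G x * P j x)); last by apply/funext => x; rewrite /G /F; ring.
have mG : cmeasurable (D `\` D0) G.
  apply: cmeasurableB => //; last exact: (tame_cmeasurable _ (tame_hol_part c0 a b K m)).
  apply: cmeasurableM; last exact: (tame_cmeasurable _ (tame_pow R m)).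
  by apply: cmeasurableS mphi => //; exact: subDsetl.
have [|_ h] := multiplier fE cp j mX (@subDsetl _ D D0) (ltW N0) mG.
  move=> x [Dx _]; apply: le_trans (normcB _ _) _; apply: lerD.
    exact: symbol_bound.
  by apply: HH; case: (HB _ Dx).
apply: le_trans h _; rewrite -ler_pdivlMl ?exprn_gt0//.
by apply: le_trans (HJ j Jj) _; rewrite expr_div_n mulrC.
Qed.

(** Pythagoras: the residual is orthogonal to the holomorphic part, and their sum is bounded through
    [qM]. *)
Lemma anti_part_norm j : nrm2 m4 D0 (fun x => anti_part b K m (toC x.1) * P j x) <= (M * Mz) ^+ 2.
Proof.
have [mD mD0 sub r0 s0] := face_facts fE; have [_ Lp Np _ _] := cp.
have Lq : L2m m4 D0 (fun x => (q (toC x.1) * toC x.1 ^+ m) * P j x) /\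
    nrm2 m4 D0 (fun x => (q (toC x.1) * toC x.1 ^+ m) * P j x) <= (M * Mz) ^+ 2 * nrm2 m4 D0 (P j).
  apply: (multiplier fE cp) => //; first by rewrite mulr_ge0// ltW.
    exact: (tame_cmeasurable _ (tameM (tame_harm_poly c0 a b K) (tame_pow R m))).
  move=> x [h1 h2]; rewrite normcM normcX ler_pM ?exprn_ge0 ?normc_ge0//; first exact: qM.
  by apply: (powM (sub x _)).
have [Lq1 nq] := Lq; apply: (le_trans _ (le_trans nq _)); last by rewrite Np mulr1.
have La := tame_multiplier fE cp j mD0 sub (tame_anti_part b K m).
have Lh := tame_multiplier fE cp j mD0 sub (tame_hol_part c0 a b K m).
have -> : (fun x => (q (toC x.1) * toC x.1 ^+ m) * P j x) =
    (fun x => anti_part b K m (toC x.1) * P j x + hol_part c0 a b K m (toC x.1) * P j x).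
  by apply/funext => x; rewrite harm_poly_split; ring.
have Ah := test_AA j (tame_hol_part c0 a b K m) (differentiable_hol_part c0 a b K m).
rewrite nrm2D// (ip_conj mD0 Lh La) (anti_part_orthogonal b K m j Ah) cj0 mulr0 addr0.
by rewrite lerDl nrm2_ge0.
Qed.

End SymbolSide.

(** * The dichotomy on a face *)

Section ResidualEstimate.
Variable R : realType.
Notation C := R[i].
Notation T := (measurableTypeR R).
Notation Y := (T * T * (T * T))%type.
Notation m4 := (@lebesgue2 R \x @lebesgue2 R)%E.
Variables (E : set (C * C)) (r : R) (w0 : C) (p : nat -> C -> C).
Hypotheses (fE : face E r w0) (cp : concentrating E r w0 p).
Notation s := (normc w0).
Notation D := (@toCC R @^-1` E).
Notation D0 := (@toCC R @^-1` bidisc r s).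

Definition test_function m j (y : C * C) : C := y.1 ^+ m * p j y.2.

Lemma test_function_AA m j : AA E (test_function m j).
Proof. by apply: (test_AA fE cp j (tame_pow R m)) => z; exact: differentiable_cpow. Qed.

(** An instance of [residual_comparison] with the explicit polynomial parts on the bidisc;
    [face_inner] then removes the test functions. The doubled constant [2 M Mz] absorbs the bound 2
    on the squared norms over the whole domain. *)
Lemma residual_estimate (phi psi : C * C -> C) (m n K K' : nat) (M Mz e de : R) c0 a b c0' a' b' :
  cmeasurable D (fun x => phi (toCC x)) -> cmeasurable D (fun x => psi (toCC x)) ->
  (forall y, E y -> normc (phi y) <= M) -> (forall y, E y -> normc (psi y) <= M) ->
  (forall y, E y -> normc y.1 ^+ m <= Mz) -> (forall y, E y -> normc y.1 ^+ n <= Mz) ->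
  0 < M -> 0 < Mz -> 0 < e -> 0 < de ->
  (forall z, normc z < r -> normc (harm_poly c0 a b K z) <= M) ->
  (forall z, normc z < r -> normc (harm_poly c0' a' b' K' z) <= M) ->
  (forall y, bidisc r s y -> normc (y.2 - w0) < de -> normc (phi y - harm_poly c0 a b K y.1) <= e) ->
  (forall y, bidisc r s y -> normc (y.2 - w0) < de -> normc (psi y - harm_poly c0' a' b' K' y.1) <= e) ->
  exists J, forall j, (J <= j)%N -> forall pu pv, AA E pu -> AA E pv ->
    (forall k, AA E k -> inn E (fun y => phi y * test_function m j y - pu y) k = 0) ->
    normc (inn E (fun y => phi y * test_function m j y - pu y) (fun y => psi y * test_function n j y - pv y) -
      cint (@lebesgue2 R) (disc r) (fun z => anti_part r b K m (toC z) * (anti_part r b' K' n (toC z))^*) /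
        (moment r 0)%:C) <= 3 * ((2 * M * Mz) * (2 * e * Mz)).
Proof.
move=> mphi mpsi phiM psiM zm zn M0 Mz0 e0 de0 qM qM' near near'.
have [mD mD0 sub r0 s0] := face_facts fE; have [_ Lp Np _ _] := cp.
have eta0 : 0 < 2 * e * Mz by rewrite !mulr_gt0.
have MM0 : 0 < 2 * M * Mz by rewrite !mulr_gt0.
have [J1 H1] := symbol_near fE cp mphi phiM zm M0 Mz0 qM e0 de0 near.
have [J2 H2] := symbol_near fE cp mpsi psiM zn M0 Mz0 qM' e0 de0 near'.
have [J3 H3] := symbol_outside fE cp mpsi psiM zn M0 Mz0 c0' a' b' K' eta0.
exists (maxn J1 (maxn J2 J3)) => j; rewrite !geq_max => /andP[j1 /andP[j2 j3]] pu pv Apu Apv ort.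
have mX : measurable (D `\` D0) by exact: measurableD.
have DE : D0 `|` (D `\` D0) = D by rewrite setDUK.
have dis : [disjoint D0 & D `\` D0] by apply/disj_setPS => x [h1 [_ h2]].
pose A (g : Y -> C) := exists2 f, AA E f & g = (fun x => f (toCC x)).
have [LF nF] := symbol_L2 fE cp mphi phiM zm M0 Mz0 j mD (@subset_refl _ D).
have [LF' nF'] := symbol_L2 fE cp mpsi psiM zn M0 Mz0 j mD (@subset_refl _ D).
have tA N b1 := tame_multiplier fE cp j mD0 sub (tame_anti_part r b1 N.1 N.2).
have AQ c1 a1 b1 N1 m1 := test_AA fE cp j (tame_hol_part r c1 a1 b1 N1 m1) (differentiable_hol_part r c1 a1 b1 N1 m1).
have [[oE _ _ _] _] := fE.
rewrite -(face_inner fE cp j (tame_anti_part r b K m) (tame_anti_part r b' K' n)) /inn.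
rewrite -{1}DE.
have sqM : (M * Mz) ^+ 2 <= (2 * M * Mz) ^+ 2.
  rewrite (_ : (2 * M * Mz) ^+ 2 = 4 * (M * Mz) ^+ 2); last by ring.
  by have := sqr_ge0 (M * Mz); move: ((M * Mz) ^+ 2) => v; lra.
apply: (@residual_comparison _ _ _ m4 D0 (D `\` D0) A (fun x => phi (toCC x) * test_function m j (toCC x))
  (fun x => psi (toCC x) * test_function n j (toCC x)) (fun x => pu (toCC x)) (fun x => pv (toCC x))
  (fun x => hol_part r c0 a b K m (toC x.1) * p j (toC x.2))
  (fun x => hol_part r c0' a' b' K' n (toC x.1) * p j (toC x.2))) => //; rewrite ?DE//.
- by move=> f [g [Lg _] ->].
- by move=> f g [f' Af ->] [g' Ag ->]; exists (fun y => f' y - g' y) => //; exact: AAB.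
- by exists pu.
- by exists pv.
- by exists (fun y => hol_part r c0 a b K m y.1 * p j y.2) => //; exact: AQ.
- by exists (fun y => hol_part r c0' a' b' K' n y.1 * p j y.2) => //; exact: AQ.
- by move=> k [k' Ak ->]; exact: ort.
- exact: (tA (K, m)).
- exact: (tA (K', n)).
- by move=> k [k' Ak ->]; exact: (anti_part_orthogonal fE cp).
- exact: ltW.
- exact: ltW.
- apply: le_trans nF _; rewrite (_ : (2 * M * Mz) ^+ 2 = (M * Mz) ^+ 2 * 4); last by ring.
  apply: ler_wpM2l; first exact: sqr_ge0.
  by apply: le_trans (Lp j).2 _; rewrite ler_nat.
- by apply: le_trans sqM; exact: (anti_part_norm fE cp zn M0 Mz0 qM').
- exact: H1.
- exact: H2.
- exact: H3.
Qed.

End ResidualEstimate.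

(** * Passage to the boundary radius *)

Section CoefficientLimit.
Variable R : realType.
Notation C := R[i].

Lemma tail_small (x : nat -> R) (S : R) : (forall k, 0 <= x k) -> (forall n, \sum_(k < n) x k <= S) ->
  forall e : R, 0 < e -> exists N, forall n K, (N <= n)%N -> (n <= K)%N -> \sum_(n <= k < K) x k <= e.
Proof.
move=> x0 xS e e0.
pose u n := \sum_(0 <= k < n) x k.
have uE n : u n = \sum_(k < n) x k by rewrite /u big_mkord.
have u_nd : nondecreasing_seq u.
  move=> m n mn; rewrite /u (big_cat_nat (n := m) (p := n))//= lerDl.
  by apply: sumr_ge0 => k _.
have u_ub : has_ubound (range u) by exists S => _ [n _ <-]; rewrite uE.
have u_cv := nondecreasing_cvgn u_nd u_ub.
have [N _ HN] := (cvgrPdist_le _ _).1 u_cv e e0.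
exists N => n K Nn nK.
have leu k : u k <= sup (range u) by apply: ub_le_sup => //; exists k.
have := HN n Nn; rewrite /= ger0_norm ?subr_ge0// => h.
have : u K = u n + \sum_(n <= k < K) x k by rewrite /u (big_cat_nat (n := n) (p := K)).
by move: (leu K) h; move: (u K) (u n) (sup _) => p q v; lra.
Qed.

Lemma normc_sum I (s : seq I) (F : I -> C) :
  normc (\sum_(i <- s) F i) <= \sum_(i <- s) normc (F i).
Proof.
elim: s => [|i s IH]; first by rewrite !big_nil normc0.
by rewrite !big_cons; apply: le_trans (normcD _ _) _; rewrite lerD2l.
Qed.

(** Absolute summability makes the tails small uniformly in [t], and a finite sum is continuous at
    [t = 1]. The threshold [K0] may depend on [t], as the degree of the truncation does. *)
Lemma abel_limit (f : nat -> C) (g : nat -> R) (h : nat -> nat) (S G : R) :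
  (forall n, \sum_(k < n) normc (f k) <= S) -> (forall k, 0 <= g k <= G) ->
  (forall e : R, 0 < e -> exists2 t0 : R, 0 < t0 < 1 & forall t, t0 <= t < 1 ->
     exists K0, forall K, (K0 <= K)%N -> normc (\sum_(k < K) f k * (t ^+ h k * g k)%:C) <= e) ->
  forall e : R, 0 < e -> exists N, forall n, (N <= n)%N -> normc (\sum_(k < n) f k * (g k)%:C) <= e.
Proof.
move=> fS gG H e e0.
have G0 : 0 <= G by case/andP: (gG 0%N) => a b; exact: le_trans a b.
have e20 : 0 < e / 2 by rewrite divr_gt0.
have G10 : 0 < G + 1 by rewrite ltr_wpDl.
have e3 : 0 < e / 2 / (G + 1) by rewrite divr_gt0.
have [N HN] := tail_small (fun k => normc_ge0 (f k)) fS e3.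
have [t0 /andP[t00 t01] Ht] := H _ e20.
exists N => n Nn.
have bound t : t0 <= t < 1 -> normc (\sum_(k < n) f k * (t ^+ h k * g k)%:C) <= e.
  move=> t1; have [K0 HK] := Ht t t1; pose K := maxn n K0.
  have tt : 0 <= t < 1 by case/andP: t1 => u1 ->; rewrite andbT; exact: le_trans (ltW t00) u1.
  have := HK K (leq_maxr _ _).
  rewrite -!(big_mkord xpredT (fun k => f k * (t ^+ h k * g k)%:C)).
  rewrite (big_cat_nat (n := n) (p := K))//=; last exact: leq_maxl.
  set A := \sum_(0 <= k < n) _; set B := \sum_(n <= k < K) _ => AB.
  have : normc B <= e / 2.
    apply: le_trans (normc_sum _ _) _.
    apply: (@le_trans _ _ (\sum_(n <= k < K) normc (f k) * (G + 1))).
      apply: ler_sum => k _; rewrite normcM; apply: ler_wpM2l; first exact: normc_ge0.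
      case/andP: tt => tt0 tt1; case/andP: (gG k) => g0 g1.
      rewrite normc_real ger0_norm ?mulr_ge0 ?exprn_ge0//.
      apply: (@le_trans _ _ G); last by rewrite lerDl.
      by rewrite -[leRHS]mul1r ler_pM ?exprn_ge0// exprn_ile1// ltW.
    rewrite -mulr_suml -ler_pdivlMr//; apply: HN => //; exact: leq_maxl.
  move=> hB; have -> : A = A + B - B by rewrite addrK.
  apply: le_trans (normcB _ _) _; rewrite (splitr e); exact: lerD.
have [t tt1 t1] := unit_sequence R.
have L (F : R -> nat -> R) : (forall k, (fun i => F (t i) k) @ \oo --> (F 1 k : R)) ->
    (fun i => \sum_(k < n) F (t i) k) @ \oo --> \sum_(k < n) F 1 k.
  by move=> cF; exact: (cvg_sum_ord (f := fun i k => F (t i) k) (l := F 1)).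
have ReS (c : R) (F : R -> nat -> C) : Rec (\sum_(k < n) F c k) = \sum_(k < n) Rec (F c k).
  by elim: (n) => [|n' IH]; rewrite ?big_ord0// !big_ord_recr/= ReD IH.
have ImS (c : R) (F : R -> nat -> C) : Imc (\sum_(k < n) F c k) = \sum_(k < n) Imc (F c k).
  by elim: (n) => [|n' IH]; rewrite ?big_ord0// !big_ord_recr/= ImD IH.
pose F c k := f k * (c ^+ h k * g k)%:C.
have tk k (x : R) : (fun i => x * (t i ^+ h k * g k)) @ \oo --> x * (1 ^+ h k * g k).
  by apply: cvgMr; apply: cvgMl; exact: cvg_pow.
have LR : (fun i => Rec (\sum_(k < n) F (t i) k)) @ \oo --> Rec (\sum_(k < n) F 1 k).
  rewrite ReS; under eq_fun do rewrite ReS.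
  apply: (L (fun c k => Rec (F c k))) => k.
  have E1 c : Rec (F c k) = Rec (f k) * (c ^+ h k * g k) by rewrite /F ReM /= mulr0 subr0.
  by rewrite E1; under eq_fun do rewrite E1; exact: tk.
have LI : (fun i => Imc (\sum_(k < n) F (t i) k)) @ \oo --> Imc (\sum_(k < n) F 1 k).
  rewrite ImS; under eq_fun do rewrite ImS.
  apply: (L (fun c k => Imc (F c k))) => k.
  have E1 c : Imc (F c k) = Imc (f k) * (c ^+ h k * g k) by rewrite /F ImM /= mulr0 add0r.
  by rewrite E1; under eq_fun do rewrite E1; exact: tk.
have -> : \sum_(k < n) f k * (g k)%:C = \sum_(k < n) F 1 k.
  by apply: eq_bigr => k _; rewrite /F expr1n mul1r.
have sqe : normc (\sum_(k < n) F 1 k) ^+ 2 <= e ^+ 2.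
  have L2 : (fun i => Rec (\sum_(k < n) F (t i) k) ^+ 2 + Imc (\sum_(k < n) F (t i) k) ^+ 2) @ \oo -->
      (Rec (\sum_(k < n) F 1 k) ^+ 2 + Imc (\sum_(k < n) F 1 k) ^+ 2 : R).
    by apply: cvgD; apply: cvg_pow.
  rewrite sqr_normcE; apply: (ler_cvg_to L2 (@cvg_cst _ (e ^+ 2) _ _ _)).
  have [N1 _ H1] := cvgr_ge 1 t1 t0 t01; exists N1 => // i Ni.
  rewrite /= -sqr_normcE lerXn2r ?nnegrE ?normc_ge0 ?(ltW e0)//.
  by apply: bound; rewrite H1//=; case/andP: (tt1 i).
by rewrite -(@ler_pXn2r _ 2)// ?nnegrE ?normc_ge0// ltW.
Qed.

End CoefficientLimit.

Section Gram.
Variable R : realType.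
Notation C := R[i].
Notation T := (measurableTypeR R).

(* The pairing of the antiholomorphic residuals of [conj z ^ k.+1 z ^ m] and
   [conj z ^ (k.+1 + d) z ^ (m + d)], up to factors independent of [k] and powers of
   the radius. *)
Definition gram_weight m d k : R :=
  (minn k.+1 m.+1 * (minn k.+1 m.+1 + d))%:R / (k.+1 + m.+1 + d)%:R.

Lemma gram_weight_bound m d k : 0 <= gram_weight m d k <= (m.+1 * (m.+1 + d))%:R.
Proof.
rewrite divr_ge0//= ler_pdivrMr ?ltr0n// -natrM ler_nat.
have h : (minn k.+1 m.+1 <= m.+1)%N by exact: geq_minr.
apply: (@leq_trans (m.+1 * (m.+1 + d))); last by rewrite leq_pmulr.
by apply: leq_mul => //; rewrite leq_add2r.
Qed.

(** By rotation only the pairs [l = k + d] survive. Cutting the second sum at [K + d] gives every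
    [k < K] its partner, and the factors [r^-1] undo the rescaling of the face to the unit disc. *)
Lemma anti_part_gram (r t : R) (b b' : nat -> C) K m d : 0 < r ->
  cint (@lebesgue2 R) (disc r) (fun z =>
     anti_part r (fun k => b k * t%:C ^+ k.+1 * (r^-1)%:C ^+ k.+1) K m (toC z) *
     (anti_part r (fun k => b' k * t%:C ^+ k.+1 * (r^-1)%:C ^+ k.+1) (K + d) (m + d) (toC z))^*) /
    (moment r 0)%:C =
  (r ^+ (m + m + d) / (m.+1%:R * (m.+1 + d)%:R))%:C *
  \sum_(k < K) (b k * (b' (k + d)%N)^*) * (t ^+ (k.+1 + (k + d).+1) * gram_weight m d k)%:C.
Proof.
move=> r0; have mr := @measurable_disc R r.
set B := fun k => b k * _ * _; set B' := fun k => b' k * _ * _.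
have ia k l n : cintegrable (@lebesgue2 R) (disc r)
    (fun z => antihol r k m (toC z) * (antihol r l n (toC z))^*).
  apply: (@tame_cintegrable R (fun z => antihol r k m z * (antihol r l n z)^*)).
  by apply: tameM; [exact: tame_antihol|apply: tame_conj; exact: tame_antihol].
have -> : cint (@lebesgue2 R) (disc r) (fun z => anti_part r B K m (toC z) *
     (anti_part r B' (K + d) (m + d) (toC z))^*) =
   \sum_(k < K) \sum_(l < K + d) (B k * (B' l)^*) *
     cint (@lebesgue2 R) (disc r) (fun z => antihol r k.+1 m (toC z) * (antihol r l.+1 (m + d) (toC z))^*).
  transitivity (cint (@lebesgue2 R) (disc r) (fun z => \sum_(k < K) \sum_(l < K + d) (B k * (B' l)^*) *
     (antihol r k.+1 m (toC z) * (antihol r l.+1 (m + d) (toC z))^*))).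
    apply: eq_cint => z _; rewrite /anti_part mulr_suml; apply: eq_bigr => k _.
    rewrite (rmorph_sum (@cj R)) mulr_sumr; apply: eq_bigr => l _ /=.
    by rewrite cjM; ring.
  rewrite cint_sum//; last by move=> k; apply: cintegrable_sum => // l; exact: cintegrableZ.
  apply: eq_bigr => k _; rewrite cint_sum//; last by move=> l; exact: cintegrableZ.
  by apply: eq_bigr => l _; rewrite cintZ.
have mu0 : moment r 0 != 0 by rewrite moment0 gt_eqF// l2_disc_gt0.
rewrite mulr_suml mulr_sumr; apply: eq_bigr => k _.
have kd : (k + d < K + d)%N by rewrite ltn_add2r.
rewrite (bigD1 (Ordinal kd))//= big1 ?addr0 => [|l lk]; last first.
  have E0 := @antihol_inner0 R r k.+1 m l.+1 (m + d) r0.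
  rewrite [cint _ _ _]E0 ?mulr0//; apply/negP => /eqP h; move/eqP: lk; apply.
  by apply: val_inj => /=; lia.
have E1 := @antihol_inner R r k.+1 m d r0.
rewrite [cint _ _ _]E1 /B /B' !cjM !cjX !cj_real.
have r1 : r != 0 by rewrite gt_eqF.
have -> : r ^+ (k.+1 + m + d + (k.+1 + m + d)) * ((minn k.+1 m.+1 * (minn k.+1 m.+1 + d))%:R / (k.+1 + m.+1 + d)%:R /
    (m.+1%:R * (m.+1 + d)%:R)) * moment r 0 =
  (r ^+ k.+1 * r ^+ (k + d).+1 * (r ^+ (m + m + d) / (m.+1%:R * (m.+1 + d)%:R)) * gram_weight m d k) * moment r 0.
  congr (_ * _); rewrite /gram_weight.
  rewrite (_ : (k.+1 + m + d + (k.+1 + m + d) = k.+1 + (k + d).+1 + (m + m + d))%N); last by lia.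
  by rewrite !exprD; ring.
rewrite (rmorphM (real_complex R)) /=.
rewrite [X in X / _]mulrA mulfK; last by rewrite (eq_complex _ 0) /= (negbTE mu0).
have rr n : (r^-1)%:C ^+ n * (r ^+ n)%:C = 1.
  by rewrite rmorphXn -exprMn -rmorphM /= mulVf// expr1n.
rewrite !rmorphM /= exprD !rmorphM !(rmorphXn (real_complex R)) /=.
have R1 := rr k.+1; have R2 := rr (k + d).+1; rewrite !(rmorphXn (real_complex R)) /= in R1 R2.
move: R1 R2; move: ((r^-1)%:C ^+ k.+1) ((r^-1)%:C ^+ (k + d).+1) (r%:C ^+ k.+1) (r%:C ^+ (k + d).+1) => u v u' v' R1 R2.
rewrite (_ : t%:C ^+ (k.+1 + (k + d).+1) = t%:C ^+ k.+1 * t%:C ^+ (k + d).+1); last exact: exprD.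
set Z := (X in _ = X).
transitivity ((u * u') * (v * v') * Z); last by rewrite R1 R2 !mul1r.
by rewrite /Z; ring.
Qed.

End Gram.

(** * Vanishing of the coefficient products *)

Section FaceDichotomy.
Variable R : realType.
Notation C := R[i].
Notation T := (measurableTypeR R).
Notation Y := (T * T * (T * T))%type.
Notation m4 := (@lebesgue2 R \x @lebesgue2 R)%E.
Variables (E : set (C * C)) (r : R) (w0 : C).
Hypothesis fE : face E r w0.
Notation s := (normc w0).
Notation D := (@toCC R @^-1` E).

(* What compactness of [H_psi^* H_phi] is used for, with arbitrary projections [pu]
   and [pv] in place of a chosen one; symmetric in [phi] and [psi] up to conjugation. *)
Definition hankel_small (phi psi : C * C -> C) := forall (u v pu pv : nat -> C * C -> C) (B : R),
  (forall j, AA E (u j) /\ AA E (v j)) -> (forall j, nn E (u j) <= B /\ nn E (v j) <= B) ->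
  (forall g, AA E g -> forall e : R, 0 < e -> exists J, forall j, (J <= j)%N ->
     normc (inn E g (u j)) <= e /\ normc (inn E g (v j)) <= e) ->
  (forall j, AA E (pu j) /\ AA E (pv j)) ->
  (forall j k, AA E k -> inn E (fun y => phi y * u j y - pu j y) k = 0 /\
     inn E (fun y => psi y * v j y - pv j y) k = 0) ->
  forall e : R, 0 < e -> forall N, exists2 j, (N <= j)%N &
    normc (inn E (fun y => phi y * u j y - pu j y) (fun y => psi y * v j y - pv j y)) <= e.

(* The data of a symbol near the face: bounded by [M], continuous up to the face, and
   with the expansion coefficients [a], [b] on it. *)
Definition face_symbol (phi : C * C -> C) (M : R) (a b : nat -> C) :=
  [/\ cmeasurable D (fun x => phi (toCC x)),
    forall y, E y -> normc (phi y) <= M,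
    forall z, normc z < r -> normc (phi (z, w0)) <= M,
    forall e : R, 0 < e -> exists2 de : R, 0 < de & forall x z, bidisc r s x -> normc z < r ->
      normc (x.2 - w0) < de -> normc (x.1 - z) < de -> normc (phi x - phi (z, w0)) <= e &
    forall rho : R, 0 < rho < 1 -> exists M : R, forall K z, normc z < rho ->
      normc (phi (r%:C * z, w0) - phi (r%:C * 0, w0) - \sum_(k < K) (a k * z ^+ k.+1 + b k * z^* ^+ k.+1)) <=
      M * (normc z / rho) ^+ K / (rho - normc z)].

(** Two approximations: [phi] near the face by the dilate [phi (t z, w0)], using uniform continuity,
    and the dilate by its truncated expansion. *)
Lemma face_approx phi M a b (e : R) : face_symbol phi M a b -> 0 < e ->
  exists2 t0 : R, 0 < t0 < 1 & forall t, t0 <= t < 1 -> exists K0, forall K, (K0 <= K)%N ->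
    let q := harm_poly (phi (r%:C * 0, w0)) (fun k => a k * t%:C ^+ k.+1 * (r^-1)%:C ^+ k.+1)
      (fun k => b k * t%:C ^+ k.+1 * (r^-1)%:C ^+ k.+1) K in
    (exists2 de : R, 0 < de & forall y, bidisc r s y -> normc (y.2 - w0) < de -> normc (phi y - q y.1) <= e) /\
    (forall z, normc z < r -> normc (q z) <= M + e).
Proof.
move=> [mphi phiM faceM cont expan] e0; have [_ _ _ r0 s0] := face_facts fE.
have e20 : 0 < e / 2 by rewrite divr_gt0.
have [de de0 Hde] := cont _ e20.
(* For [t >= t0] a point of the disc moves by at most [de / 2] under the dilation; the maximum with
   one half keeps [t0] positive. *)
pose t0 := Num.max 2^-1 (1 - de / (2 * r)).
have t00 : 0 < t0 by rewrite lt_max invr_gt0 ltr0n.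
have t01 : t0 < 1 by rewrite gt_max invf_lt1 ?ltr1n ?ltr0n//= gtrBl divr_gt0// mulr_gt0.
exists t0 => [|t /andP[tt0 t1]]; first by rewrite t00.
have tpos := lt_le_trans t00 tt0; have t01' : 0 < t < 1 by rewrite tpos.
have [K0 HK] := trunc_approx (Phi := fun z => phi (r%:C * z, w0)) expan t01' e20.
exists K0 => K KK q.
have r1 : r != 0 by rewrite gt_eqF.
have rr : r%:C * (r^-1)%:C = 1 :> C by rewrite -rmorphM /= mulfV.
have qE z : q z = trunc (fun z => phi (r%:C * z, w0)) a b t K ((r^-1)%:C * z).
  rewrite /q /harm_poly /trunc; congr (_ + _); apply: eq_bigr => k _.
  by rewrite cjM cj_real !exprMn; ring.
have near z : normc z < r -> normc (phi (t%:C * z, w0) - q z) <= e / 2.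
  move=> zr; rewrite qE; have := HK K KK ((r^-1)%:C * z).
  rewrite (_ : r%:C * (t%:C * ((r^-1)%:C * z)) = t%:C * z); last first.
    by rewrite -[RHS]mul1r -rr; ring.
  apply; rewrite normcM normc_real ger0_norm ?invr_ge0 ?(ltW r0)//.
  by rewrite mulrC ler_pdivrMr// mul1r ltW.
have tz z : normc z < r -> normc (t%:C * z) < r.
  move=> zr; rewrite normcM normc_real gtr0_norm//; apply: le_lt_trans zr.
  by rewrite ler_piMl ?normc_ge0// ltW.
split.
  exists de => // y [y1 y2] yw.
  have hz : normc (y.1 - t%:C * y.1) < de.
    rewrite (_ : y.1 - t%:C * y.1 = (1 - t)%:C * y.1); last by rewrite rmorphB /=; ring.
    rewrite normcM normc_real gtr0_norm ?subr_gt0//.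
    have h1 : 1 - t <= de / (2 * r).
      have h2 : 1 - de / (2 * r) <= t by apply: le_trans tt0; rewrite le_max lexx orbT.
      by move: h2; move: (de / (2 * r)) => v; lra.
    apply: (@le_lt_trans _ _ (de / (2 * r) * r)).
      by apply: ler_pM; rewrite ?normc_ge0 ?subr_ge0 ?(ltW t1) ?(ltW y1) ?h1.
    by rewrite invfM mulrA mulfVK//; lra.
  rewrite -(subrK (phi (t%:C * y.1, w0)) (phi y)) -addrA; apply: le_trans (normcD _ _) _.
  rewrite (splitr e); apply: lerD; last exact: near.
  by apply: (Hde y (t%:C * y.1)) => //; exact: tz.
move=> z zr; rewrite -(subrK (phi (t%:C * z, w0)) (q z)); apply: le_trans (normcD _ _) _.
rewrite addrC; apply: lerD; first by apply: faceM; exact: tz.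
by rewrite distcC; apply: le_trans (near _ zr) _; rewrite ler_pdivrMr// ler_peMr ?ler1n// ltW.
Qed.

Lemma face_square_summable phi M a b : face_symbol phi M a b ->
  forall K, \sum_(k < K) normc (b k) ^+ 2 <= (M + 1) ^+ 2.
Proof.
move=> [_ _ faceM _ expan]; have [_ _ _ r0 s0] := face_facts fE.
apply: (@square_summable R (fun z => phi (r%:C * z, w0)) a b expan) => u u1.
by apply: faceM; rewrite normcM normc_real gtr0_norm// -[ltRHS]mulr1 ltr_pM2l.
Qed.

(** Only products whose second index is the larger arise, because [n = m + d]. The residual estimate
    and the smallness of the Hankel pairing bound the damped Gram sum for each [m], [abel_limit]
    removes the damping, and [gram_injective] applies to real and imaginary parts. *)
Lemma half_dichotomy phi psi M a b a' b' : 0 < M -> face_symbol phi M a b -> face_symbol psi M a' b' ->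
  hankel_small phi psi -> forall d k, b k * (b' (k + d)%N)^* = 0.
Proof.
move=> M0 sphi spsi small d; have [p cp] := concentrating_sequence fE.
have [mD mD0 sub r0 s0] := face_facts fE; have [_ Lp Np _ _] := cp.
have [_ [[B HB] _]] := fE; have [[oE _ _ _] _] := fE.
pose ee k := b k * (b' (k + d)%N)^*.
have ee_sum : exists S : R, forall n, \sum_(k < n) normc (ee k) <= S.
  exists ((M + 1) ^+ 2) => n.
  apply: (@le_trans _ _ (\sum_(k < n) (normc (b k) ^+ 2 + normc (b' (k + d)%N) ^+ 2) / 2)).
    apply: ler_sum => k _; rewrite /ee normcM normc_conj.
    have := sqr_ge0 (normc (b k) - normc (b' (k + d)%N)); rewrite sqrrB; lra.
  rewrite -mulr_suml big_split /= ler_pdivrMr// mulr_natr mulr2n; apply: lerD.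
    exact: (face_square_summable sphi).
  apply: le_trans (face_square_summable spsi (d + n)).
  rewrite big_split_ord /= -[leLHS]add0r; apply: lerD.
    by apply: sumr_ge0 => i _; exact: sqr_ge0.
  by apply: ler_sum => i _; rewrite addnC.
have [S eeS] := ee_sum.
have key m : forall e : R, 0 < e -> exists N, forall n, (N <= n)%N ->
    normc (\sum_(k < n) ee k * (gram_weight R m d k)%:C) <= e.
  apply: (abel_limit (h := fun k => (k.+1 + (k + d).+1)%N) eeS (gram_weight_bound R m d)) => e e0.
  have [Mz1 _ Hz1] := (tame_pow R m).2 B; have [Mz2 _ Hz2] := (tame_pow R (m + d)).2 B.
  pose Mz := Num.max 1 (Num.max Mz1 Mz2).
  have Mz0 : 0 < Mz by rewrite lt_max ltr01.
  have zm y : E y -> normc y.1 ^+ m <= Mz.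
    move=> /HB[h _]; rewrite -normcX; apply: le_trans (Hz1 _ h) _.
    by rewrite !le_max lexx !orbT.
  have zn y : E y -> normc y.1 ^+ (m + d) <= Mz.
    move=> /HB[h _]; rewrite -normcX; apply: le_trans (Hz2 _ h) _.
    by rewrite !le_max lexx !orbT.
  pose cst := r ^+ (m + m + d) / (m.+1%:R * (m.+1 + d)%:R).
  have cst0 : 0 < cst by rewrite divr_gt0 ?exprn_gt0// mulr_gt0.
  pose M' := M + 1; have M'0 : 0 < M' by rewrite addr_gt0.
  (* The estimate costs [3 (2 M' Mz) (2 e1 Mz) = 12 M' Mz^2 e1], which must be at most
     [cst * e / 2]. The bound 1 keeps the approximating polynomials below [M + 1]. *)
  pose e1 := Num.min 1 (cst * e / (24 * M' * Mz ^+ 2)).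
  have dd : 0 < 24 * M' * Mz ^+ 2 by rewrite !mulr_gt0 ?exprn_gt0.
  have e10 : 0 < e1 by rewrite lt_min ltr01 divr_gt0// mulr_gt0.
  have [t1 /andP[t10 t11] H1] := face_approx sphi e10.
  have [t2 /andP[t20 t21] H2] := face_approx spsi e10.
  exists (Num.max t1 t2) => [|t /andP[tt tlt1]]; first by rewrite lt_max t10 gt_max t11.
  have tt1 : t1 <= t < 1 by rewrite tlt1 andbT; apply: le_trans tt; rewrite le_max lexx.
  have tt2 : t2 <= t < 1 by rewrite tlt1 andbT; apply: le_trans tt; rewrite le_max lexx orbT.
  have [K1 HK1] := H1 t tt1; have [K2 HK2] := H2 t tt2.
  exists (maxn K1 K2) => K; rewrite geq_max => /andP[k1 k2].
  have [[de1 de10 n1] q1] := HK1 K k1.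
  have [[de2 de20 n2] q2] := HK2 (K + d)%N (leq_trans k2 (leq_addr _ _)).
  pose de := Num.min de1 de2; have de0 : 0 < de by rewrite lt_min de10.
  have dle1 : de <= de1 by rewrite ge_min lexx.
  have dle2 : de <= de2 by rewrite ge_min lexx orbT.
  have e11 : e1 <= 1 by rewrite ge_min lexx.
  have MM y : y <= M + e1 -> y <= M' by move=> h; apply: le_trans h _; rewrite lerD2l.
  have [mphi phiM _ _ _] := sphi; have [mpsi psiM _ _ _] := spsi.
  have M1 y : y <= M -> y <= M' by move=> h; apply: le_trans h _; rewrite lerDl.
  have [J HJ] := residual_estimate fE cp mphi mpsi (fun y h => M1 _ (phiM y h)) (fun y h => M1 _ (psiM y h))
    zm zn M'0 Mz0 e10 de0 (fun z h => MM _ (q1 z h)) (fun z h => MM _ (q2 z h))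
    (fun y h1 h2 => n1 y h1 (lt_le_trans h2 dle1))
    (fun y h1 h2 => n2 y h1 (lt_le_trans h2 dle2)).
  pose u j := test_function p m j; pose v j := test_function p (m + d) j.
  have Au j : AA E (u j) by exact: (test_function_AA fE cp).
  have Av j : AA E (v j) by exact: (test_function_AA fE cp).
  have Lu j : LL E (fun y => phi y * u j y) by exact: (symbol_L2 fE cp mphi phiM zm M0 Mz0 j mD (@subset_refl _ D)).1.
  have Lv j : LL E (fun y => psi y * v j y) by exact: (symbol_L2 fE cp mpsi psiM zn M0 Mz0 j mD (@subset_refl _ D)).1.
  have /choice[pu Hpu] : forall j, exists h, AA E h /\
      forall k, AA E k -> inn E (fun y => phi y * u j y - h y) k = 0.
    by move=> j; have [h Ah oh] := bergman_projection_exists oE (Lu j); exists h.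
  have /choice[pv Hpv] : forall j, exists h, AA E h /\
      forall k, AA E k -> inn E (fun y => psi y * v j y - h y) k = 0.
    by move=> j; have [h Ah oh] := bergman_projection_exists oE (Lv j); exists h.
  have bz m' : (forall y, E y -> normc y.1 ^+ m' <= Mz) -> forall j,
      nn E (test_function p m' j) <= Mz ^+ 2 * 2.
    move=> zm' j; have [|_ h] := multiplier fE cp j mD (@subset_refl _ D) (ltW Mz0)
      (tame_cmeasurable D (tame_pow R m')); first by move=> x Dx; rewrite normcX; exact: (zm' _ Dx).
    apply: le_trans h _; apply: ler_wpM2l; [exact: sqr_ge0|exact: (Lp j).2].
  have wk m' : (forall y, E y -> normc y.1 ^+ m' <= Mz) -> forall g, AA E g -> forall e' : R, 0 < e' ->
      exists J', forall j, (J' <= j)%N -> normc (inn E g (test_function p m' j)) <= e'.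
    move=> zm' g [Lg _] e' e'0.
    apply: (weakly_null fE cp Mz0 (tame_cmeasurable D (tame_pow R m')) _ Lg e'0).
    by move=> x Dx; rewrite normcX; exact: (zm' _ Dx).
  have ce0 : 0 < cst * e / 2 by rewrite divr_gt0// mulr_gt0.
  have [j Jj sm] := small u v pu pv (Mz ^+ 2 * 2) (fun j => conj (Au j) (Av j))
    (fun j => conj (bz m zm j) (bz (m + d)%N zn j))
    (fun g Ag e' e'0 => ltac:(
       have [Ja Ha] := wk m zm g Ag e' e'0; have [Jb Hb] := wk (m + d)%N zn g Ag e' e'0;
       by exists (maxn Ja Jb) => j; rewrite geq_max => /andP[/Ha ja /Hb jb]))
    (fun j => conj (Hpu j).1 (Hpv j).1) (fun j k Ak => conj ((Hpu j).2 k Ak) ((Hpv j).2 k Ak)) _ ce0 J.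
  have := HJ j Jj _ _ (Hpu j).1 (Hpv j).1 (Hpu j).2.
  rewrite anti_part_gram// -/cst; set Z := \sum_(k < K) _ => est.
  have : normc (cst%:C * Z) <= cst * e.
    rewrite -(subKr (inn E (fun y => phi y * u j y - pu j y) (fun y => psi y * v j y - pv j y)) (cst%:C * Z)).
    apply: le_trans (normcB _ _) _; rewrite (splitr (cst * e)); apply: lerD => //.
    apply: le_trans est _; rewrite (_ : 3 * _ = e1 * (24 * M' * Mz ^+ 2) / 2); last by field.
    rewrite ler_pM2r ?invr_gt0// -ler_pdivlMr//.
    by rewrite ge_min lexx orbT.
  by rewrite normcM normc_real gtr0_norm// ler_pM2l.
have cut (f : C -> R) : (forall z w, f (z + w) = f z + f w) -> f 0 = 0 ->
    (forall z (x : R), f (z * x%:C) = f z * x) -> (forall z, `|f z| <= normc z) -> forall k, f (ee k) = 0.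
  move=> fD f0 fZ fN k.
  (* The shift by one restores the true exponents, since [b k] belongs to the power [k.+1]; it also
     provides the vanishing constant term. *)
  pose e k := if k is k'.+1 then f (ee k') else 0.
  apply: (@gram_injective R e d _ _ _ k.+1) => //.
    exists S => n; case: n => [|n]; first by rewrite big_ord0; have := eeS 0%N; rewrite big_ord0.
    rewrite big_ord_recl normr0 add0r; apply: le_trans (eeS n).
    by apply: ler_sum => i _ /=; exact: fN.
  case=> // m _; apply/cvgrPdist_le => eps eps0; have [N HN] := key m eps eps0.
  exists N.+1 => // -[//|n] /= Nn; rewrite sub0r normrN big_ord_recl mul0r add0r.
  have -> : \sum_(i < n) e (lift ord0 i) * ((minn (lift ord0 i) m.+1 * (minn (lift ord0 i) m.+1 + d))%:R /
      (lift ord0 i + m.+1 + d)%:R) = f (\sum_(k < n) ee k * (gram_weight R m d k)%:C).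
    elim: n {Nn} => [|n IH]; first by rewrite !big_ord0.
    by rewrite !big_ord_recr /= fD -IH fZ.
  by apply: le_trans (fN _) _; exact: HN.
move=> k; apply: eqC.
  apply: (cut (@complex.Re R)) => //; [exact: ReD|by move=> z x; rewrite ReM /= mulr0 subr0|exact: Re_le_normc].
apply: (cut (@complex.Im R)) => //; [exact: ImD|by move=> z x; rewrite ImM /= mulr0 add0r|exact: Im_le_normc].
Qed.

Lemma hankel_small_sym phi psi M a b a' b' : 0 < M -> face_symbol phi M a b -> face_symbol psi M a' b' ->
  hankel_small phi psi -> hankel_small psi phi.
Proof.
move=> M0 [mphi phiM _ _ _] [mpsi psiM _ _ _] small u v pu pv B Auv Buv wk Ap ort e e0 N.
have [mD _ _ _ _] := face_facts fE.
have [j Nj h] := small v u pv pu B (fun j => conj (Auv j).2 (Auv j).1) (fun j => conj (Buv j).2 (Buv j).1)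
  (fun g Ag e' e'0 => ltac:(have [J HJ] := wk g Ag e' e'0; by exists J => j /HJ[]))
  (fun j => conj (Ap j).2 (Ap j).1) (fun j k Ak => conj (ort j k Ak).2 (ort j k Ak).1) e e0 N.
exists j => //.
have L (chi f g : C * C -> C) : cmeasurable D (fun x => chi (toCC x)) -> (forall y, E y -> normc (chi y) <= M) ->
    AA E f -> AA E g -> L2m m4 D (fun x => chi (toCC x) * f (toCC x) - g (toCC x)).
  move=> mchi chiM [Lf _] [Lg _]; apply: L2B => //; apply: (nrm2_le (G := fun x => f (toCC x)) mD (ltW M0) _ Lf _).1.
    by apply: cmeasurableM => //; case: Lf.
  by move=> x Dx; rewrite normcM ler_wpM2r ?normc_ge0// chiM.
rewrite /inn (ip_conj mD (L _ _ _ mphi phiM (Auv j).2 (Ap j).2) (L _ _ _ mpsi psiM (Auv j).1 (Ap j).1)).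
by rewrite normc_conj.
Qed.

(** If some [b k] is nonzero, then each [b' l] is killed by one of the two families of products,
    according to whether [k <= l] or [l < k]. *)
Theorem face_dichotomy phi psi M a b a' b' : 0 < M -> face_symbol phi M a b -> face_symbol psi M a' b' ->
  hankel_small phi psi -> (forall k, b k = 0) \/ (forall k, b' k = 0).
Proof.
move=> M0 sphi spsi small.
have h1 := half_dichotomy M0 sphi spsi small.
have h2 := half_dichotomy M0 spsi sphi (hankel_small_sym M0 sphi spsi small).
have [|/existsNP[k bk]] := pselect (forall k, b k = 0); first by left.
right=> l; have [kl|lk] := leqP k l.
  have := h1 (l - k)%N k; rewrite subnKC// => /eqP; rewrite mulf_eq0 cj_eq0 => /orP[/eqP//|/eqP//].
have := h2 (k - l)%N l; rewrite subnKC ?(ltnW lk)// => /eqP; rewrite mulf_eq0 cj_eq0 => /orP[/eqP//|/eqP//].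
Qed.

End FaceDichotomy.

(** The measure on the first three coordinates of the left-nested product; one more factor gives the
    measure in which the operators are defined. *)
Definition lebesgue3 (R : realType) := (@lebesgue2 R \x @lebesgue_measure R)%E.
HB.instance Definition _ (R : realType) := Measure.on (@lebesgue3 R).
HB.instance Definition _ (R : realType) :=
  Measure_isSigmaFinite.Build _ _ _ (@lebesgue3 R)
    (sigma_finite_prod (@lebesgue2 R) (@lebesgue_measure R)).

(** * The operators of the theorem *)

Section Regroup.
Variable R : realType.
Notation C := R[i].
Notation T := (measurableTypeR R).
Notation leb := (@lebesgue_measure R).
Notation Y := (T * T * (T * T))%type.
Notation Z := (T * T * T * T)%type.
Notation m4 := (@lebesgue2 R \x @lebesgue2 R)%E.
Notation mu := (@lebesgue3 R \x leb)%E.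

Definition regroup (p : Y) : Z := (p.1, p.2.1, p.2.2).
Definition ungroup (q : Z) : Y := (q.1.1, (q.1.2, q.2)).

Lemma measurable_regroup : measurable_fun setT regroup.
Proof.
apply/measurable_fun_pairP; split; last exact: (measurableT_comp measurable_snd measurable_snd).
apply/measurable_fun_pairP; split; first exact: measurable_fst.
exact: (measurableT_comp measurable_fst measurable_snd).
Qed.

Lemma measurable_ungroup : measurable_fun setT ungroup.
Proof.
apply/measurable_fun_pairP; split; first exact: (measurableT_comp measurable_fst measurable_fst).
apply/measurable_fun_pairP; split; last exact: measurable_snd.
exact: (measurableT_comp measurable_snd measurable_fst).
Qed.

(** Associativity of the product measure, by iterating Tonelli's theorem on both sides. *)
Lemma regroup_mpres : mpres m4 mu regroup.
Proof.
apply: mpres_intro => [|f mf f0]; first exact: measurable_regroup.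
have mfr := measurableT_comp mf measurable_regroup.
rewrite (fubini_tonelli1 (m1 := @lebesgue3 R) (m2 := leb) f)//.
rewrite (fubini_tonelli1 (m1 := @lebesgue2 R) (m2 := leb) (fubini_F leb f))//; last 2 first.
- exact: measurable_fun_fubini_tonelli_F.
- by move=> x; apply: integral_ge0 => y _; exact: f0.
rewrite (fubini_tonelli1 (m1 := @lebesgue2 R) (m2 := @lebesgue2 R) (f \o regroup))//; last first.
  by move=> x; exact: f0.
apply: eq_integral => x _; rewrite /fubini_F /=.
rewrite (fubini_tonelli1 (m1 := leb) (m2 := leb) (fun q : T * T => f (x, q.1, q.2)))//.
exact: (measurableT_comp mfr (measurable_pair1 x)).
Qed.

Lemma toC2_regroup p : toC2 (regroup p) = toCC p :> C * C.
Proof. by case: p => [[a b] [c d]]. Qed.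

Lemma toCC_ungroup q : toCC (ungroup q) = toC2 q :> C * C.
Proof. by case: q => [[[a b] c] d]. Qed.

Variable E : set (C * C).
Hypothesis oE : copen2 E.
Notation D := (@toCC R @^-1` E).
Notation dom := (real_coords E : set Z).

Lemma regroup_dom : regroup @^-1` dom = D.
Proof. by apply/seteqP; split => p; rewrite /real_coords /preimage /mkset toC2_regroup. Qed.

Lemma ungroup_dom : ungroup @^-1` D = dom.
Proof. by apply/seteqP; split => p; rewrite /real_coords /preimage /mkset toCC_ungroup. Qed.

Lemma measurable_dom : measurable dom.
Proof.
rewrite -ungroup_dom -(setTI (_ @^-1` _)).
by apply: measurable_ungroup => //; exact: copen2_measurable.
Qed.

Lemma regroup_measurable (f : C * C -> R) :
  measurable_fun dom (fun q : Z => f (toC2 q)) <-> measurable_fun D (fun p => f (toCC p)).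
Proof.
have mD := copen2_measurable oE; have md := measurable_dom.
split=> mf.
  have := @mpres_measurable_fun _ _ _ _ _ m4 mu regroup dom _ _ _ regroup_mpres md mf.
  rewrite regroup_dom; congr (measurable_fun _ _).
  by apply/funext => p; exact: (congr1 f (toC2_regroup p)).
have : measurable_fun dom ((fun p => f (toCC p)) \o ungroup).
  apply: (measurable_comp mD) => //; last by apply: measurable_funTS; exact: measurable_ungroup.
  by move=> _ [q dq <-]; move: dq; rewrite -ungroup_dom.
by congr (measurable_fun _ _); apply/funext => p; rewrite /= toCC_ungroup.
Qed.

Lemma sqint_sqm F : LL E F -> sqint E F = sqm m4 D (fun p => F (toCC p)).
Proof.
move=> LF; have [mF _] := LF; have md := measurable_dom.
transitivity (\int[m4]_(p in regroup @^-1` dom) (normc (F (toC2 (regroup p))) ^+ 2)%:E)%E; last first.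
  by rewrite regroup_dom; apply: eq_integral => p _; rewrite toC2_regroup.
rewrite -(@mpres_ge0_integral _ _ _ _ _ m4 mu regroup dom (fun q => (normc (F (toC2 q)) ^+ 2)%:E))//.
- by apply: eq_integral => q _; rewrite sqr_normcE.
- exact: regroup_mpres.
- apply/measurable_EFinP; apply/(regroup_measurable (fun z => normc (F z) ^+ 2)).
  by apply/measurable_EFinP; exact: cmeasurable_sqr.
- by move=> q _; rewrite lee_fin sqr_ge0.
Qed.

Lemma L2_LL F : L2 E F <-> LL E F.
Proof.
have ReM := regroup_measurable (fun z => Rec (F z)).
have ImM := regroup_measurable (fun z => Imc (F z)).
split=> [[m1 m2 h]|LF].
  have mF : cmeasurable D (fun p => F (toCC p)) by split; [exact/ReM|exact/ImM].
  split => //; have md := measurable_dom.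
  rewrite /sqm (_ : \int[_]_(_ in _) _ = sqint E F)%E//; apply/esym.
  transitivity (\int[m4]_(p in regroup @^-1` dom) (normc (F (toC2 (regroup p))) ^+ 2)%:E)%E; last first.
    by rewrite regroup_dom; apply: eq_integral => p _; rewrite toC2_regroup.
  rewrite -(@mpres_ge0_integral _ _ _ _ _ m4 mu regroup dom (fun q => (normc (F (toC2 q)) ^+ 2)%:E))//.
  - by apply: eq_integral => q _; rewrite sqr_normcE.
  - exact: regroup_mpres.
  - apply/measurable_EFinP; apply/(regroup_measurable (fun z => normc (F z) ^+ 2)).
    by apply/measurable_EFinP; exact: cmeasurable_sqr.
  - by move=> q _; rewrite lee_fin sqr_ge0.
have [[m1 m2] h] := LF; split; [exact/ReM|exact/ImM|by rewrite sqint_sqm].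
Qed.

Lemma inner_inn F G : LL E F -> LL E G -> inner E F G = inn E F G.
Proof.
move=> LF LG; have mD := copen2_measurable oE; have md := measurable_dom.
pose H (q : Z) := F (toC2 q) * (G (toC2 q))^*.
have iH := L2_product mD LF LG.
have mH : cmeasurable D (fun p => F (toCC p) * (G (toCC p))^*).
  by apply: cmeasurableM; [case: LF|apply: cmeasurable_conj; case: LG].
have e1 (f : C -> R) : measurable_fun D (fun p => f (F (toCC p) * (G (toCC p))^*)) ->
    \int[mu]_(q in dom) f (H q) = \int[m4]_(p in D) f (F (toCC p) * (G (toCC p))^*).
  move=> mf; rewrite /Rintegral.
  rewrite (@mpres_integral _ _ _ _ _ m4 mu regroup dom (fun q => (f (H q))%:E))//.
  - by rewrite regroup_dom; congr (fine _); apply: eq_integral => p _; rewrite /H toC2_regroup.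
  - exact: regroup_mpres.
  - by apply/measurable_EFinP; exact/(regroup_measurable (fun z => f (F z * (G z)^*))).
apply: eqC; [exact: (e1 (@complex.Re R) mH.1)|exact: (e1 (@complex.Im R) mH.2)].
Qed.

Lemma A2_AA f : A2 E f <-> AA E f.
Proof. by split=> [[/L2_LL]|[/L2_LL]]. Qed.

Lemma L2norm_nn F : LL E F -> L2norm E F = Num.sqrt (nn E F).
Proof. by move=> LF; rewrite /L2norm sqint_sqm. Qed.

End Regroup.

(** * From compactness to small pairings of residuals *)

Section Compactness.
Variable R : realType.
Notation C := R[i].
Notation T := (measurableTypeR R).
Notation m4 := (@lebesgue2 R \x @lebesgue2 R)%E.
Variables (E : set (C * C)) (M : R).
Hypotheses (oE : copen2 E) (M0 : 0 <= M).
Notation D := (@toCC R @^-1` E).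

Definition bounded_symbol (phi : C * C -> C) :=
  cmeasurable D (fun x => phi (toCC x)) /\ forall y, E y -> normc (phi y) <= M.

Let mD : measurable D. Proof. exact: copen2_measurable. Qed.

Lemma innDl F G H : LL E F -> LL E G -> LL E H ->
  inn E (fun x => F x + G x) H = inn E F H + inn E G H.
Proof. by move=> LF LG LH; exact: (ipDl mD LF LG LH). Qed.

Lemma innDr F G H : LL E F -> LL E G -> LL E H ->
  inn E H (fun x => F x + G x) = inn E H F + inn E H G.
Proof. by move=> LF LG LH; exact: (ipDr mD LF LG LH). Qed.

Lemma inn_conj F G : LL E F -> LL E G -> inn E G F = (inn E F G)^*.
Proof. by move=> LF LG; exact: (ip_conj mD LF LG). Qed.

Lemma LLB F G : LL E F -> LL E G -> LL E (fun x => F x - G x).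
Proof. by move=> LF LG; exact: (L2B mD LF LG). Qed.

Lemma bounded_symbol_LL phi f : bounded_symbol phi -> LL E f -> LL E (fun y => phi y * f y).
Proof.
move=> [mphi phiM] Lf.
apply: (nrm2_le (G := fun x => f (toCC x)) mD M0 _ Lf _).1.
  by apply: cmeasurableM => //; case: Lf.
by move=> x Dx; rewrite normcM ler_wpM2r ?normc_ge0// phiM.
Qed.

Lemma bergman_projectionP F : LL E F -> AA E (bergman_projection E F) /\
  forall k, AA E k -> inn E (fun z => F z - bergman_projection E F z) k = 0.
Proof.
move=> LF; have [h Ah oh] := bergman_projection_exists oE LF.
have : [set h | A2 E h /\ forall k, A2 E k -> inner E (fun z => F z - h z) k = 0] (bergman_projection E F).
  rewrite /bergman_projection; apply: (@xgetPex _ (fun=> 0)); exists h; split; first exact/A2_AA.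
  move=> k /(A2_AA oE) Ak; rewrite inner_inn//; [exact: oh|by apply: L2B => //; case: Ah|by case: Ak].
move=> [/(A2_AA oE) Ap op]; split => // k Ak.
rewrite -inner_inn//; [by apply: op; exact/A2_AA|by apply: L2B => //; case: Ap|by case: Ak].
Qed.

Lemma hankel_LL phi f : bounded_symbol phi -> AA E f -> LL E (hankel E phi f) /\
  forall k, AA E k -> inn E (hankel E phi f) k = 0.
Proof.
move=> bphi [Lf _]; have [Ap op] := bergman_projectionP (bounded_symbol_LL bphi Lf).
by split=> [|k Ak]; [apply: L2B => //; [exact: bounded_symbol_LL|case: Ap]|exact: op].
Qed.

(* The adjoint sends [g] to the projection of [conj psi * g], because [g] is orthogonal
   to the holomorphic functions. *)
Lemma adjoint_hankelP phi psi f : bounded_symbol phi -> bounded_symbol psi -> AA E f ->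
  let S := adjoint E (hankel E psi) (hankel E phi f) in
  AA E S /\ forall k, AA E k -> inn E S k = inn E (hankel E phi f) (hankel E psi k).
Proof.
move=> bphi bpsi Af; have [Lg og] := hankel_LL bphi Af; set g := hankel E phi f in Lg og *.
move=> S.
have bpsi' : bounded_symbol (fun y => (psi y)^*).
  by case: bpsi => mp pM; split=> [|y /pM]; [exact: cmeasurable_conj|rewrite normc_conj].
have LF := bounded_symbol_LL bpsi' Lg; have [Ah oh] := bergman_projectionP LF.
set h := bergman_projection E _ in Ah oh.
have hk k : AA E k -> inn E h k = inn E g (hankel E psi k).
  move=> Ak; have [Lk _] := Ak; have [Ap op] := bergman_projectionP (bounded_symbol_LL bpsi Lk).
  have Lpk := bounded_symbol_LL bpsi Lk.
  have := oh k Ak; rewrite [inn E (fun z => _ - h z) k](ipBl mD LF Ah.1 Lk) => /eqP.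
  rewrite subr_eq0 => /eqP e1.
  rewrite [RHS](ipBr mD Lpk Ap.1 Lg) -[X in _ = _ - X]/(inn E g _) og// subr0.
  rewrite -[LHS]/(ip _ _ _ _) -e1; apply: eq_cint => x _.
  by rewrite cjM; ring.
have : [set h | A2 E h /\ forall k, A2 E k -> inner E h k = inner E g (hankel E psi k)] S.
  rewrite /S /adjoint; apply: (@xgetPex _ (fun=> 0)); exists h; split; first exact/A2_AA.
  move=> k /(A2_AA oE) Ak; have [LH _] := hankel_LL bpsi Ak.
  by rewrite !inner_inn//; [exact: hk|case: Ah|case: Ak].
move=> [/(A2_AA oE) AS oS]; split => // k Ak; have [LH _] := hankel_LL bpsi Ak.
rewrite -inner_inn//; [|by case: AS|by case: Ak].
by rewrite -(inner_inn oE Lg LH); apply: oS; exact/A2_AA.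
Qed.

(** The pairing of the residuals is the pairing of the operator applied to [u j] with [v j]. Along a
    subsequence the first argument converges in norm to some [g], and the pairing of [g] with [v j]
    tends to 0. *)
Lemma compact_hankel_small phi psi : bounded_symbol phi -> bounded_symbol psi ->
  compact_on_A2 E (fun h => adjoint E (hankel E psi) (hankel E phi h)) -> hankel_small E phi psi.
Proof.
move=> bphi bpsi cpt u v pu pv B Auv Buv wk Ap ort e e0 N.
have B0 : 0 <= B by case: (Buv 0%N) => h _; apply: le_trans h; exact: nrm2_ge0.
have [||s [g [s_inc /(A2_AA oE) Ag]]] := cpt u.
- by move=> n; apply/A2_AA => //; case: (Auv n).
- exists (Num.sqrt B) => n; have [[Lu _] _] := Auv n.
  by rewrite L2norm_nn// ler_sqrt//; case: (Buv n).
move=> lim.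
have e1 : 0 < e / (2 * (Num.sqrt B + 1)) by rewrite divr_gt0// mulr_gt0// ltr_wpDl ?sqrtr_ge0.
have [N1 _ H1] := (cvgrPdist_le _ _).1 lim _ e1.
have e2 : 0 < e / 2 by rewrite divr_gt0.
have [J HJ] := wk g Ag _ e2.
(* Guarantees that the index found in the subsequence exceeds the required bound [N]. *)
have sn n : (n <= s n)%N.
  by elim: n => // n IH; apply: leq_ltn_trans IH _; exact: s_inc.
pose n := maxn N (maxn N1 J); exists (s n); first exact: leq_trans (leq_maxl _ _) (sn n).
have nJ : (J <= s n)%N by apply: leq_trans (sn n); rewrite /n !leq_max leqnn !orbT.
have nN1 : (N1 <= n)%N by rewrite /n !leq_max leqnn !orbT.
set j := s n in nJ *.
have [[Au Av] [Apu Apv]] := (Auv j, Ap j).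
have [[Lu _] [Lv _]] := (Au, Av).
have [AS oS] := adjoint_hankelP bphi bpsi Au.
have [La' oa'] := hankel_LL bphi Au; have [Lb' ob'] := hankel_LL bpsi Av.
have [Ppu _] := bergman_projectionP (bounded_symbol_LL bphi Lu).
have [Ppv _] := bergman_projectionP (bounded_symbol_LL bpsi Lv).
have La : LL E (fun y => phi y * u j y - pu j y) by exact: LLB (bounded_symbol_LL bphi Lu) Apu.1.
have Lb : LL E (fun y => psi y * v j y - pv j y) by exact: LLB (bounded_symbol_LL bpsi Lv) Apv.1.
have -> : inn E (fun y => phi y * u j y - pu j y) (fun y => psi y * v j y - pv j y) =
    inn E (adjoint E (hankel E psi) (hankel E phi (u j))) (v j).
  rewrite oS//.
  have Ad := AAB oE Ppu Apu; have Ad' := AAB oE Ppv Apv.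
  (* The differences between the projections chosen by the operators and the given ones are
     holomorphic, so they are orthogonal to the residuals. *)
  set d := (fun x => _ - pu j x) in Ad; set d' := (fun x => _ - pv j x) in Ad'.
  set A := (fun y => phi y * u j y - pu j y) in La *; set B' := (fun y => psi y * v j y - pv j y) in Lb *.
  have h1 : inn E d B' = 0 by rewrite (inn_conj Lb Ad.1) (ort j _ Ad).2 cj0.
  have h2 := oa' _ Ad'.
  have EA : A = (fun x => hankel E phi (u j) x + d x).
    by apply/funext => x; rewrite /A /d /hankel; ring.
  have EB : B' = (fun x => hankel E psi (v j) x + d' x).
    by apply/funext => x; rewrite /B' /d' /hankel; ring.
  rewrite EA (innDl La' Ad.1 Lb) h1 addr0 EB (innDr Lb' Ad'.1 La').
  by rewrite [X in _ + X]h2 addr0.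
have LS := AS.1; have Lg := Ag.1.
set S := adjoint _ _ _ in AS oS LS *.
have -> : inn E S (v j) = inn E (fun y => S y - g y) (v j) + inn E g (v j).
  rewrite -(innDl (LLB LS Lg) Lg Lv); congr (inn E _ _).
  by apply/funext => x; rewrite subrK.
apply: le_trans (normcD _ _) _; rewrite (splitr e); apply: lerD; last by case: (HJ j nJ).
have LSg := LLB LS Lg.
apply: le_trans (cauchy_schwarz mD LSg Lv) _.
have := H1 n nN1; rewrite /= sub0r normrN L2norm_nn// ger0_norm ?sqrtr_ge0// => h.
have sB : Num.sqrt (nn E (v j)) <= Num.sqrt B + 1.
  by apply: (@le_trans _ _ (Num.sqrt B)); [rewrite ler_sqrt//; case: (Buv j)|rewrite lerDl].
apply: le_trans (ler_pM (sqrtr_ge0 _) (sqrtr_ge0 _) h sB) _.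
have q0 : Num.sqrt B + 1 != 0 by rewrite gt_eqF// ltr_wpDl ?sqrtr_ge0.
rewrite (_ : e / (2 * (Num.sqrt B + 1)) = e / 2 / (Num.sqrt B + 1)); first by rewrite divfK.
by rewrite -[RHS]mulrA -invfM.
Qed.

End Compactness.

(** * Exchange of the two coordinates *)

Section Swap.
Variable R : realType.
Notation C := R[i].
Notation T := (measurableTypeR R).
Notation Y := (T * T * (T * T))%type.
Notation m4 := (@lebesgue2 R \x @lebesgue2 R)%E.

Definition swap2 (x : C * C) : C * C := (x.2, x.1).

Lemma swap2K : involutive swap2. Proof. by case. Qed.

Lemma preswap2K (E : set (C * C)) : swap2 @^-1` (swap2 @^-1` E) = E.
Proof. by apply/seteqP; split => x; rewrite /preimage /mkset swap2K. Qed.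

Lemma m4_swap : mpres m4 m4 (fun p : Y => (p.2, p.1)).
Proof.
have ms : measurable_fun setT (fun p : Y => (p.2, p.1)) by exact: measurable_swap.
apply: mpres_intro => // f mf f0.
rewrite (fubini_tonelli1 (m1 := @lebesgue2 R) (m2 := @lebesgue2 R) f)//.
rewrite (fubini_tonelli2 (m1 := @lebesgue2 R) (m2 := @lebesgue2 R) (fun p : Y => f (p.2, p.1)))//.
exact: (measurableT_comp mf ms).
Qed.

Variable E : set (C * C).
Hypothesis oE : copen2 E.
Notation D := (@toCC R @^-1` E).
Notation E' := (swap2 @^-1` E).
Let mD : measurable D. Proof. exact: copen2_measurable. Qed.

Lemma copen2_swap : copen2 E'.
Proof. by move=> x /oE[e e0 H]; exists e => // y h1 h2; exact: H. Qed.

Lemma cmeasurable_swap (F : C * C -> C) : cmeasurable D (fun p => F (toCC p)) ->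
  cmeasurable (@toCC R @^-1` E') (fun p => F (swap2 (toCC p))).
Proof.
move=> [m1 m2]; split.
  exact: (@mpres_measurable_fun _ _ _ _ _ m4 m4 _ D _ _ _ m4_swap mD m1).
exact: (@mpres_measurable_fun _ _ _ _ _ m4 m4 _ D _ _ _ m4_swap mD m2).
Qed.

Lemma LL_swap F : LL E F -> LL E' (F \o swap2) /\ nn E' (F \o swap2) = nn E F.
Proof.
move=> [mF h].
have e1 : sqm m4 (@toCC R @^-1` E') (fun p => F (swap2 (toCC p))) = sqm m4 D (fun p => F (toCC p)).
  apply/esym; apply: (@mpres_ge0_integral _ _ _ _ _ m4 m4 _ D
    (fun p => (normc (F (toCC p)) ^+ 2)%:E) m4_swap mD) => //.
    exact: cmeasurable_sqr.
  by move=> y _; rewrite lee_fin sqr_ge0.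
split; last by rewrite /nn /nrm2; congr fine; exact: e1.
by split; [exact: cmeasurable_swap|rewrite [sqm _ _ _]e1].
Qed.

Lemma inn_swap F G : LL E F -> LL E G -> inn E' (F \o swap2) (G \o swap2) = inn E F G.
Proof.
by move=> LF LG; apply/esym; apply: (@mpres_cint _ _ _ _ _ m4 m4 _ D
  (fun p => F (toCC p) * (G (toCC p))^*) m4_swap mD); exact: L2_product.
Qed.

Lemma AA_swap f : AA E f -> AA E' (f \o swap2).
Proof.
move=> [Lf df]; split; first by case: (LL_swap Lf).
move=> x Ex; have /diff_cderiv2[l1 [l2 h]] := df _ Ex.
apply/diff_cderiv2; exists l2, l1 => e e0; have [d d0 H] := h e e0.
exists d => // h1 h2 a1 a2; have := H h2 h1 a2 a1.
by rewrite /= (addrC (l1 * h2)) (addrC (normc h2)).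
Qed.

End Swap.

Lemma hankel_small_swap (R : realType) (E : set (R[i] * R[i])) phi psi (M : R) : copen2 E -> 0 <= M ->
  bounded_symbol E M phi -> bounded_symbol E M psi ->
  hankel_small E phi psi -> hankel_small (@swap2 R @^-1` E) (phi \o @swap2 R) (psi \o @swap2 R).
Proof.
move=> oE M0 bphi bpsi small u v pu pv B Auv Buv wk Ap ort e e0 N.
have oE' := copen2_swap oE; pose E' := @swap2 R @^-1` E.
have back f : AA E' f -> AA E (f \o @swap2 R) by move=> /(AA_swap oE'); rewrite preswap2K.
have forth f : AA E f -> AA E' (f \o @swap2 R) by exact: AA_swap.
have swK (f : R[i] * R[i] -> R[i]) : (f \o @swap2 R) \o @swap2 R = f.
  by apply/funext => x; rewrite /= swap2K.
have innE F G : LL E F -> LL E G -> inn E' (F \o @swap2 R) (G \o @swap2 R) = inn E F G by exact: inn_swap.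
have nnE F : LL E F -> nn E' (F \o @swap2 R) = nn E F by move=> /(LL_swap oE)[].
have mD := copen2_measurable oE.
have Lres chi f g : bounded_symbol E M chi -> AA E f -> AA E g -> LL E (fun y => chi y * f y - g y).
  by move=> bchi [Lf _] [Lg _]; apply: L2B => //; exact: (bounded_symbol_LL oE M0).
have resE (chi f g : R[i] * R[i] -> R[i]) : (fun y => (chi \o @swap2 R) y * f y - g y) =
    (fun y => chi y * (f \o @swap2 R) y - (g \o @swap2 R) y) \o @swap2 R.
  by apply/funext => x; rewrite /= !swap2K.
have [| | | | |j Nj h] := small (fun j => u j \o @swap2 R) (fun j => v j \o @swap2 R)
    (fun j => pu j \o @swap2 R) (fun j => pv j \o @swap2 R) B _ _ _ _ _ e e0 N.
- by move=> j; have [a b] := Auv j; split; exact: back.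
- move=> j; have [a b] := Auv j; have [Lu _] := back _ a; have [Lv _] := back _ b.
  by rewrite -(nnE _ Lu) -(nnE _ Lv) !swK.
- move=> g Ag e' e'0; have [J HJ] := wk _ (forth _ Ag) e' e'0; exists J => j Jj.
  have [a b] := Auv j; have [Lu _] := back _ a; have [Lv _] := back _ b.
  have := HJ j Jj; rewrite -{1}(swK (u j)) -{1}(swK (v j)) !innE//; by case: Ag.
- by move=> j; have [a b] := Ap j; split; exact: back.
- move=> j k Ak; have [a b] := Auv j; have [c d] := Ap j.
  have [z1 z2] := ort j _ (forth _ Ak).
  rewrite !resE !innE in z1 z2; first by split.
  + exact: Lres (back _ b) (back _ d).
  + by case: Ak.
  + exact: Lres (back _ a) (back _ c).
  + by case: Ak.
exists j => //; have [a b] := Auv j; have [c d] := Ap j.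
rewrite !resE innE//; [exact: Lres (back _ a) (back _ c)|exact: Lres (back _ b) (back _ d)].
Qed.

(** * Discs in the boundary of a convex Reinhardt domain *)

Section Geometry.
Variable R : realType.
Notation C := R[i].

(** The hypotheses on the domain in metric form, with unimodular factors in place of angles; in this
    form they are stable under the exchange of coordinates. *)
Definition convex_reinhardt (E : set (C * C)) :=
  [/\ copen2 E, exists x, E x,
    exists B : R, forall x, E x -> normc x.1 <= B /\ normc x.2 <= B,
    forall x y (t : R), E x -> E y -> 0 <= t <= 1 ->
      E (t%:C * x.1 + (1 - t)%:C * y.1, t%:C * x.2 + (1 - t)%:C * y.2) &
    forall x u v, E x -> normc u = 1 -> normc v = 1 -> E (u * x.1, v * x.2)].

Lemma convex_reinhardt_swap E : convex_reinhardt E -> convex_reinhardt (@swap2 R @^-1` E).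
Proof.
move=> [oE [x Ex] [B HB] cvx rot]; split.
- exact: copen2_swap.
- by exists (swap2 x); rewrite /preimage /mkset swap2K.
- by exists B => y /HB[].
- by move=> y z t Ey Ez t01; exact: (cvx _ _ t Ey Ez t01).
- by move=> y u v Ey u1 v1; exact: (rot _ v u Ey v1 u1).
Qed.

Lemma unit_align (z : C) : exists2 u : C, normc u = 1 & u * z = (normc z)%:C.
Proof.
have [->|z0] := eqVneq z 0; first by exists 1; rewrite ?normc1// mulr0 normc0.
have n0 : (normc z)%:C != 0 by rewrite (eq_complex _ 0) /= eqxx andbT normc_eq0.
exists (z^* / (normc z)%:C).
  by rewrite normcM normcV normc_conj normc_real ger0_norm ?normc_ge0// mulfV// normc_eq0.
by rewrite mulrAC mulrC (mulrC z^*) mulcJ expr2 rmorphM /= mulrA mulVf// mul1r.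
Qed.

(** Rotation and convexity: [z] lies on the segment between two antipodal rotations of [x.1], with
    the second coordinate kept fixed. *)
Lemma complete_fst E x z : convex_reinhardt E -> E x -> normc z <= normc x.1 -> E (z, x.2).
Proof.
move=> [_ _ _ cvx rot] Ex zx.
have [u u1 uz] := unit_align z; have [v v1 vx] := unit_align x.1.
have uu : u^* * u = 1 by rewrite mulrC mulcJ u1 expr1n.
have [x0|x0] := eqVneq (normc x.1) 0.
  have z0 : z = 0 by apply/eqP; rewrite -normc_eq0 eq_le normc_ge0 andbT -x0.
  have x10 : x.1 = 0 by apply/eqP; rewrite -normc_eq0 x0.
  by rewrite z0 -x10 -surjective_pairing.
pose rho := normc z / normc x.1.
have xp : 0 < normc x.1 by rewrite lt0r x0 normc_ge0.
have rho0 : 0 <= rho by rewrite divr_ge0 ?normc_ge0.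
have rho1 : rho <= 1 by rewrite ler_pdivrMr// mul1r.
have Ea := rot _ (u^* * v) 1 Ex; have Eb := rot _ (- (u^* * v)) 1 Ex.
have t01 : 0 <= (1 + rho) / 2 <= 1 by apply/andP; split; lra.
have := cvx _ _ _ (Ea _ _) (Eb _ _) t01; rewrite normcNE normcM normc_conj u1 v1 mulr1 normc1 /= => /(_ erefl erefl erefl erefl).
rewrite !mul1r -mulrDl -rmorphD /= subrKC mul1r.
congr (E (_, _)).
rewrite -!mulrA !mulNr -mulrA vx mulrN -mulrBl -rmorphB /=.
rewrite (_ : (1 + rho) / 2 - (1 - (1 + rho) / 2) = rho); last by field.
rewrite mulrCA -rmorphM /= divfK// -uz mulrA uu mul1r //.
Qed.

Lemma complete_snd E x z : convex_reinhardt E -> E x -> normc z <= normc x.2 -> E (x.1, z).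
Proof.
move=> cE Ex zx; have := @complete_fst _ (swap2 x) z (convex_reinhardt_swap cE).
by rewrite /preimage /mkset swap2K; exact.
Qed.

Lemma complete E x y : convex_reinhardt E -> E x -> normc y.1 <= normc x.1 -> normc y.2 <= normc x.2 -> E y.
Proof.
move=> cE Ex h1 h2; have := complete_snd cE (complete_fst cE Ex h1) h2.
by rewrite /= -surjective_pairing.
Qed.

(** If the slopes were in the wrong order, the segment from [(a, b)] to [(c, d)] would pass strictly
    above [(s0, t0)] at abscissa [s0]; the witness is the parameter of that point. *)
Lemma slope_le (s0 t0 a b c d : R) : a < s0 -> t0 < b -> s0 < c ->
  (forall t, 0 <= t <= 1 -> ~ (s0 <= t * a + (1 - t) * c /\ t0 <= t * b + (1 - t) * d)) ->
  (b - t0) / (s0 - a) <= (t0 - d) / (c - s0).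
Proof.
move=> ha hb hc H; rewrite leNgt; apply/negP => h.
have ca : 0 < c - a by lra.
have p1 : 0 < s0 - a by lra.
have p2 : 0 < c - s0 by lra.
have p3 : (c - s0) / (c - a) <= 1 by rewrite ler_pdivrMr// mul1r; lra.
have p4 : 0 <= (c - s0) / (c - a) by rewrite divr_ge0 ?ltW.
apply: (H ((c - s0) / (c - a))); first by rewrite p4.
have q : c - a != 0 by rewrite gt_eqF.
have e1 : (c - s0) / (c - a) * a + (1 - (c - s0) / (c - a)) * c = s0 by field.
have e2 : (c - s0) / (c - a) * b + (1 - (c - s0) / (c - a)) * d =
    t0 + ((b - t0) * (c - s0) - (t0 - d) * (s0 - a)) / (c - a) by field.
split; first by rewrite e1.
rewrite e2 lerDl divr_ge0 ?(ltW ca)// subr_ge0 ltW//.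
by move: h; rewrite ltr_pdivlMr// mulrAC ltr_pdivrMr.
Qed.

(* The moduli of the points of [E] form a convex set in the quadrant; the slope of
   the support line is the supremum of the slopes seen from one side. *)
Lemma support_line E x0 : convex_reinhardt E -> ~ E x0 ->
  exists al be : R, [/\ 0 <= al, 0 <= be, 0 < al + be &
    forall x, E x -> al * normc x.1 + be * normc x.2 <= al * normc x0.1 + be * normc x0.2].
Proof.
move=> cE nE; have [_ _ _ cvx _] := cE.
have nd x : E x -> ~ (normc x0.1 <= normc x.1 /\ normc x0.2 <= normc x.2).
  by move=> Ex [h1 h2]; apply: nE; exact: complete h1 h2.
set s0 := normc x0.1 in nd *; set t0 := normc x0.2 in nd *.
have [[x1 Ex1 hx1]|nright] := pselect (exists2 x, E x & s0 < normc x.1); last first.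
  (* No point lies to the right of [x0], so the vertical line supports. *)
  exists 1, 0; split; rewrite ?ler01 ?addr0 ?ltr01// => x Ex.
  by rewrite !mul1r !mul0r !addr0 leNgt; apply/negP => h; apply: nright; exists x.
have slopes x y : E x -> E y -> normc x.1 < s0 -> t0 < normc x.2 -> s0 < normc y.1 ->
    (normc x.2 - t0) / (s0 - normc x.1) <= (t0 - normc y.2) / (normc y.1 - s0).
  move=> Ex Ey h1 h2 h3; apply: slope_le => // t t01 [k1 k2].
  have nn (r : R) : 0 <= r -> normc r%:C = r by move=> r0; rewrite normc_real ger0_norm.
  have abs z : E z -> E ((normc z.1)%:C, (normc z.2)%:C).
    by move=> Ez; apply: (complete cE Ez); rewrite nn ?normc_ge0.
  have := cvx _ _ t (abs _ Ex) (abs _ Ey) t01; move/nd; apply => /=.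
  case/andP: t01 => t00 t1; rewrite -!rmorphM -!rmorphD /= !nn//;
    by rewrite addr_ge0// mulr_ge0 ?normc_ge0// subr_ge0.
have below x : E x -> s0 <= normc x.1 -> normc x.2 < t0.
  by move=> Ex h; rewrite ltNge; apply/negP => h2; exact: (nd x Ex).
(* The slope 0 is included to keep the set nonempty and its supremum nonnegative when no point lies
   above and to the left. *)
pose S : set R := [set k | k = 0 \/ exists x, [/\ E x, normc x.1 < s0, t0 < normc x.2 &
  k = (normc x.2 - t0) / (s0 - normc x.1)]].
have ub y : E y -> s0 < normc y.1 -> ubound S ((t0 - normc y.2) / (normc y.1 - s0)).
  move=> Ey hy k [->|[x [Ex h1 h2 ->]]]; last exact: slopes.
  by have h := below _ Ey (ltW hy); rewrite divr_ge0// subr_ge0 ltW.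
have S0 : S !=set0 by exists 0; left.
have hS : has_sup S by split => //; exists ((t0 - normc x1.2) / (normc x1.1 - s0)); exact: ub.
have al0 : 0 <= sup S by apply: ub_le_sup; [case: hS|left].
exists (sup S), 1; split => //; first by rewrite ltr_wpDl.
move=> x Ex; rewrite !mul1r; have [h|h|h] := ltgtP (normc x.1) s0.
- have [h2|h2] := leP (normc x.2) t0.
    by apply: lerD => //; rewrite ler_wpM2l// ltW.
  have : (normc x.2 - t0) / (s0 - normc x.1) <= sup S.
    by apply: ub_le_sup; [case: hS|right; exists x].
  by rewrite ler_pdivrMr ?subr_gt0// mulrBr; lra.
- have : sup S <= (t0 - normc x.2) / (normc x.1 - s0) by apply: ge_sup => //; exact: ub.
  by rewrite ler_pdivlMr ?subr_gt0// mulrBr; lra.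
- by rewrite h lerD2l ltW// below// h.
Qed.

Lemma imaginary_constant (a : C) (g : C -> C) : a != 0 ->
  (forall z, normc z < 1 -> differentiable g z) -> (forall z, normc z < 1 -> Imc (a * g z) = 0) ->
  forall z, normc z < 1 -> g z = g 0.
Proof.
move=> a0 dg Ig z z1; pose h w := (0 +i* 1) * a * g w.
have i0 : (0 +i* 1 : C) * a != 0.
  by rewrite mulf_neq0// eq_complex /= eqxx oner_eq0.
have Rh w : normc w < 1 -> Rec (h w) = 0.
  by move=> /Ig; rewrite /h -mulrA ReM /= mul0r mul1r sub0r => ->; rewrite oppr0.
have n01 : normc (0 : C) < 1 by rewrite normc0.
apply: (mulfI i0); apply: (@re_max R h 0 z _ n01 _ z1).
- by move=> w w1; apply: differentiableM; [exact: differentiable_cst'|exact: dg].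
- by move=> w w1; rewrite !Rh.
Qed.

(** With the support line rotated so that both terms are nonnegative at 0, the function [h] has
    maximal real part at 0 and is constant. Equality throughout forces [a * (f z).1] and
    [b * (f z).2] to be real, hence constant. If [al = 0], the support line is horizontal and bounds
    the second coordinate of the whole set. *)
Lemma boundary_disc_flat E (f : C -> C * C) : convex_reinhardt E ->
  (forall z, normc z < 1 -> differentiable (fun z => (f z).1) z) ->
  (forall z, normc z < 1 -> differentiable (fun z => (f z).2) z) ->
  (forall z, normc z < 1 -> closure E (f z) /\ ~ E (f z)) ->
  (forall z, normc z < 1 -> (f z).1 = (f 0).1) \/
  ((forall z, normc z < 1 -> (f z).2 = (f 0).2) /\ forall x, E x -> normc x.2 <= normc (f 0).2).
Proof.
move=> cE d1 d2 bd.
have n01 : normc (0 : C) < 1 by rewrite normc0.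
have [_ nE0] := bd 0 n01.
have [al [be [al0 be0 ab0 H]]] := support_line cE nE0.
have [u u1 uz] := unit_align (f 0).1; have [v v1 vz] := unit_align (f 0).2.
pose a := al%:C * u; pose b := be%:C * v.
have na : normc a = al by rewrite normcM u1 mulr1 normc_real ger0_norm.
have nb : normc b = be by rewrite normcM v1 mulr1 normc_real ger0_norm.
have Hc x : closure E x -> al * normc x.1 + be * normc x.2 <= al * normc (f 0).1 + be * normc (f 0).2.
  move=> /closureC2P cx; apply/ler_addgt0Pr => e e0.
  have [y [Ey y1 y2]] := cx (e / (al + be)) (divr_gt0 e0 ab0).
  apply: le_trans (lerD (H y Ey) (lexx e)).
  have t1 : normc x.1 <= normc y.1 + e / (al + be).
    rewrite -(subrK y.1 x.1) addrC; apply: le_trans (normcD _ _) _.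
    by rewrite lerD2l distcC ltW.
  have t2 : normc x.2 <= normc y.2 + e / (al + be).
    rewrite -(subrK y.2 x.2) addrC; apply: le_trans (normcD _ _) _.
    by rewrite lerD2l distcC ltW.
  apply: le_trans (lerD (ler_wpM2l al0 t1) (ler_wpM2l be0 t2)) _.
  rewrite !mulrDr addrACA -mulrDl lerD2l mulrC divfK// gt_eqF//.
pose h z := a * (f z).1 + b * (f z).2.
have h0 : Rec (h 0) = al * normc (f 0).1 + be * normc (f 0).2.
  by rewrite /h /a /b -!mulrA uz vz -!rmorphM -rmorphD.
have bound z : normc z < 1 -> normc (a * (f z).1) + normc (b * (f z).2) <= Rec (h 0).
  by move=> z1; rewrite (normcM a) (normcM b) na nb h0; apply: Hc; case: (bd z z1).
have hE z : normc z < 1 -> h z = h 0.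
  move=> z1; apply: (@re_max R h 0 z _ n01 _ z1).
  - move=> w w1; apply: differentiableD; apply: differentiableM;
      [exact: differentiable_cst'|exact: d1|exact: differentiable_cst'|exact: d2].
  move=> w w1; apply: le_trans (bound w w1); rewrite ReD; apply: lerD;
    by apply: le_trans (Re_le_normc _); exact: ler_norm.
have imag (c : C) : Rec c = normc c -> Imc c = 0.
  move=> E1; have := sqr_normcE c; rewrite -E1 => /eqP.
  by rewrite eq_sym -subr_eq0 addrC addKr expf_eq0 /= => /eqP.
have real z : normc z < 1 -> Rec (a * (f z).1) = normc (a * (f z).1) /\ Rec (b * (f z).2) = normc (b * (f z).2).
  move=> z1; have := bound z z1; rewrite -(hE z z1) /h ReD.
  have r1 := le_trans (ler_norm _) (Re_le_normc (a * (f z).1)).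
  have r2 := le_trans (ler_norm _) (Re_le_normc (b * (f z).2)).
  by move=> q; split; apply/eqP; rewrite eq_le ?r1 ?r2 /=; move: r1 r2 q; move: (Rec _) (normc _) (Rec _) (normc _) => r3 r4 r5 r6; lra.
have [al00|al00] := eqVneq al 0; last first.
  left; apply: (@imaginary_constant a) => //; first by rewrite -normc_eq0 na.
  by move=> z /real[/imag].
have bep : 0 < be by move: ab0; rewrite al00 add0r.
right; split.
  apply: (@imaginary_constant b (fun z => (f z).2)) => //; first by rewrite -normc_eq0 nb gt_eqF.
  by move=> z /real[_ /imag].
by move=> x /H; rewrite al00 !mul0r !add0r ler_pM2l.
Qed.

(** The radius of the face is the largest modulus of a first coordinate at height [w0] in the
    closure. It is positive because the disc is not constant, and completeness fills in the
    bidisc. *)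
Lemma horizontal_face E (f1 : C -> C) (w0 : C) : convex_reinhardt E ->
  (forall z, normc z < 1 -> differentiable f1 z) ->
  (forall z, normc z < 1 -> closure E (f1 z, w0)) ->
  (forall x, E x -> normc x.2 <= normc w0) ->
  (exists2 z, normc z < 1 & f1 z != f1 0) ->
  exists r : R, [/\ face E r w0, forall z, normc z < 1 -> normc (f1 z) < r,
    forall x, E x -> normc x.2 < normc w0 &
    forall z, normc z < r -> closure E (z, w0)].
Proof.
move=> cE df bd top [z1 z11 nconst]; have [oE [x Ex] [B HB] cvx rot] := cE.
have strict y : E y -> normc y.2 < normc w0.
  (* An open set cannot contain a point of maximal second modulus: a small radial push would
     increase it. *)
  move=> Ey; rewrite lt_neqAle top// andbT; apply/negP => /eqP yw.
  have [e e0 He] := oE y Ey; have [u u1 uy] := unit_align y.2.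
  have uu : u * u^* = 1 by rewrite mulcJ u1 expr1n.
  have : E (y.1, y.2 + u^* * (e / 2)%:C).
    apply: He => /=; rewrite ?subrr ?normc0// addrC addKr normcM normc_conj u1 mul1r normc_real gtr0_norm.
      exact: half_lt.
    by rewrite divr_gt0.
  move/top => /=; rewrite -yw.
  have -> : normc (y.2 + u^* * (e / 2)%:C) = normc y.2 + e / 2.
    have -> : y.2 + u^* * (e / 2)%:C = u^* * (normc y.2 + e / 2)%:C.
      by rewrite rmorphD /= mulrDr -uy mulrA [u^* * u]mulrC uu mul1r.
    by rewrite normcM normc_conj u1 mul1r normc_real ger0_norm// addr_ge0 ?normc_ge0// divr_ge0// ltW.
  by rewrite gerDl leNgt divr_gt0.
have w00 : w0 != 0.
  by rewrite -normc_gt0; apply: le_lt_trans (strict x Ex); exact: normc_ge0.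
pose A : set R := [set rho | exists2 z, closure E (z, w0) & rho = normc z].
have n01 : normc (0 : C) < 1 by rewrite normc0.
have Aub : ubound A (B + 1).
  move=> _ [z /closureC2P /(_ 1 ltr01)[y [Ey y1 _]] ->].
  have [yB _] := HB y Ey; rewrite -(subrK y.1 z) addrC; apply: le_trans (normcD _ _) _.
  by apply: lerD => //; rewrite distcC; exact: ltW.
have hA : has_sup A.
  by split; [exists (normc (f1 0)), (f1 0) => //; exact: bd|exists (B + 1)].
pose r := sup A.
have Ar z : closure E (z, w0) -> normc z <= r.
  by move=> cz; apply: ub_le_sup; [case: hA|exists z].
have r0 : 0 < r.
  rewrite lt_neqAle; apply/andP; split; last by apply: le_trans (Ar _ (bd 0 n01)); exact: normc_ge0.
  apply/eqP => r0; have z0 w : normc w < 1 -> f1 w = 0.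
    by move=> /bd/Ar; rewrite -r0 => h; apply/eqP; rewrite -normc_eq0 eq_le h normc_ge0.
  by move/eqP: nconst; rewrite !z0.
have inE z w : normc z < r -> normc w < normc w0 -> E (z, w).
  move=> zr ww.
  have [_ [z' cz' ->] zz'] := sup_gt (proj1 hA) zr.
  pose e := Num.min (normc z' - normc z) (normc w0 - normc w).
  have e0 : 0 < e by rewrite lt_min !subr_gt0 zz'.
  have [y [Ey y1 y2]] := (closureC2P E (z', w0)).1 cz' e e0.
  apply: (complete cE Ey) => /=.
    have := normcB y.1 (y.1 - z'); rewrite (_ : y.1 - (y.1 - z') = z'); last by ring.
    have : e <= normc z' - normc z by rewrite ge_min lexx.
    by move: y1 => /=; lra.
  have := normcB y.2 (y.2 - w0); rewrite (_ : y.2 - (y.2 - w0) = w0); last by ring.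
  have : e <= normc w0 - normc w by rewrite ge_min lexx orbT.
  by move: y2 => /=; lra.
exists r; split => //.
- split; first by split => // y [y1 y2]; rewrite (surjective_pairing y); exact: inE.
  split; first by exists B => y Ey; split; [case: (HB y Ey)|exact: strict].
  (* Otherwise there are points of [E] at heights arbitrarily near [w0] with first modulus at least
     [r + eta]; completeness moves their first coordinate to [r + eta] itself, which puts
     [(r + eta, w0)] in the closure and contradicts the choice of [r]. *)
  move=> eta eta0; apply: contrapT => nde.
  have cl : closure E ((r + eta)%:C, w0).
    apply/closureC2P => e e0; apply: contrapT => ne; apply: nde; exists e => // y Ey ye.
    rewrite ltNge; apply/negP => hy; apply: ne; exists ((r + eta)%:C, y.2); split => //=.
      apply: (complete_fst cE Ey); rewrite normc_real ger0_norm//.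
      by rewrite addr_ge0 ?ltW.
    by rewrite subrr normc0.
  have := Ar _ cl; rewrite normc_real ger0_norm ?addr_ge0 ?(ltW r0) ?(ltW eta0)//.
  by rewrite gerDl leNgt eta0.
(* If the modulus [r] were attained at [z], the real part of [c * f1] would be maximal there and
   [f1] constant. *)
- move=> z z1'; rewrite lt_neqAle Ar ?andbT; last exact: bd.
  apply/eqP => fz; pose c := (f1 z)^*.
  have c0 : c != 0 by rewrite cj_eq0 -normc_eq0 fz gt_eqF.
  have Rcz : Rec (c * f1 z) = r ^+ 2 by rewrite mulrC mulcJ fz.
  have H w : normc w < 1 -> f1 w = f1 z.
    move=> w1; apply: (mulfI c0); apply: (@re_max R (fun w => c * f1 w) z w) => //.
      by move=> w' w'1; apply: differentiableM; [exact: differentiable_cst'|exact: df].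
    move=> w' w'1; rewrite Rcz; apply: le_trans (ler_norm _) _; apply: le_trans (Re_le_normc _) _.
    rewrite normcM normc_conj fz expr2; apply: ler_wpM2l; first exact: ltW.
    by apply: Ar; exact: bd.
  by move/eqP: nconst; rewrite !H.
- move=> z zr; apply/closureC2P => e e0.
  pose t := 1 - Num.min 1 (e / (2 * normc w0)).
  have s0 : 0 < normc w0 by rewrite normc_gt0.
  have m0 : 0 < Num.min 1 (e / (2 * normc w0)) by rewrite lt_min ltr01 divr_gt0// mulr_gt0.
  have m1 : Num.min 1 (e / (2 * normc w0)) <= 1 by rewrite ge_min lexx.
  have m2 : Num.min 1 (e / (2 * normc w0)) <= e / (2 * normc w0) by rewrite ge_min lexx orbT.
  exists (z, t%:C * w0); split => /=; last 1 first.
  + rewrite (_ : t%:C * w0 - w0 = - ((Num.min 1 (e / (2 * normc w0)))%:C * w0)); last first.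
      by rewrite /t rmorphB /=; ring.
    rewrite normcNE normcM normc_real ger0_norm ?(ltW m0)//.
    apply: (@le_lt_trans _ _ (e / (2 * normc w0) * normc w0)); first by rewrite ler_pM2r.
    rewrite (_ : e / (2 * normc w0) * normc w0 = e / 2); first exact: half_lt.
    by rewrite invfM mulrA divfK// gt_eqF.
  + apply: inE => //; rewrite normcM normc_real ger0_norm ?subr_ge0//.
    by rewrite gtr_pMl// /t; move: m0; lra.
  + by rewrite subrr normc0.
Qed.

End Geometry.

(** * Consequences of continuity on the closed domain *)

Section Translation.
Variable R : realType.
Notation C := R[i].
Implicit Types Omega E : set (C * C).

Lemma expi_surj (u : C) : normc u = 1 -> exists t : R, expi t = u.
Proof.
move=> u1; have := sqr_normcE u; rewrite u1 expr1n => e1.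
have x2 : Rec u ^+ 2 <= 1 by rewrite e1 lerDl sqr_ge0.
have x1 : -1 <= Rec u <= 1.
  by rewrite -ler_norml -(@ler_pXn2r _ 2)// ?nnegrE// expr1n real_normK// num_real.
have c := (acos_def x1).2; have s := sin_acos x1.
have y2 : Num.sqrt (1 - Rec u ^+ 2) = `|Imc u| by rewrite e1 addrC addKr sqrtr_sqr.
have [y0|y0] := leP 0 (Imc u).
  by exists (acos (Rec u)); apply: eqC; rewrite /expi /= ?c// s y2 ger0_norm.
exists (- acos (Rec u)); apply: eqC; rewrite /expi /= ?cosN ?c//.
by rewrite sinN s y2 ltr0_norm// opprK.
Qed.

Lemma convex_reinhardt_of Omega : domain Omega -> bounded_set Omega -> convex_set Omega ->
  reinhardt Omega -> convex_reinhardt Omega.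
Proof.
move=> [[x0 Ox0] /openC2P oO _] [M [_ HM]] cvx rein; split.
- exact: oO.
- by exists x0.
- exists (Rec (M + 1)) => x Ox.
  have : `|x| <= M + 1 by apply: (HM (M + 1)) => //; rewrite ltrDl.
  rewrite normrC2 lecE /= => /andP[_]; rewrite ge_max => /andP[h1 h2]; by split.
- move=> x y t Ox Oy /andP[t0 t1].
  have T0 : 0 <= t%:C :> C by rewrite lecR.
  have T1 : t%:C <= 1 :> C by rewrite -[1]/(1%:C) lecR.
  have := cvx x y (Itv01 T0 T1) (mem_set Ox) (mem_set Oy); move/set_mem.
  have eqO (p q : C * C) : p = q -> Omega p -> Omega q by move=> ->.
  apply: eqO; transitivity (t%:C *: x + (1 - t%:C) *: y) => //.
  by case: x {Ox} => x1 x2; case: y {Oy} => y1 y2; rewrite rmorphB.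
- move=> x u v Ox /expi_surj[s <-] /expi_surj[t <-].
  by apply: rein; rewrite -surjective_pairing.
Qed.

Definition ccont_on E (phi : C * C -> C) := forall x, E x -> forall e : R, 0 < e ->
  exists2 d : R, 0 < d & forall y, E y -> normc (y.1 - x.1) < d -> normc (y.2 - x.2) < d ->
    normc (phi y - phi x) < e.

Lemma within_ccont_on E phi : {within E, continuous phi} -> ccont_on E phi.
Proof.
move=> /subspace_continuousP c x Ex e e0.
have : nbhs (phi x) [set w | normc (w - phi x) < e] by apply/nbhsCP; exists e.
move=> /(c x Ex); rewrite nbhs_simpl /= => /nbhsC2P[d d0 H].
by exists d => // y Ey h1 h2; apply: H.
Qed.

Lemma closure_swap E x : closure (@swap2 R @^-1` E) x <-> closure E (swap2 x).
Proof.
split=> /closureC2P H; apply/closureC2P => e /H[y [Ey h1 h2]].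
  by exists (swap2 y).
by exists (swap2 y); split => //; rewrite /preimage /mkset swap2K.
Qed.

Lemma ccont_on_swap E phi : ccont_on (closure E) phi ->
  ccont_on (closure (@swap2 R @^-1` E)) (phi \o @swap2 R).
Proof.
move=> c x /closure_swap Ex e /(c _ Ex)[d d0 H]; exists d => // y /closure_swap Ey h1 h2.
exact: H.
Qed.

(** Compactness of the closure, through a cube in real coordinates that contains it: points of the
    cube off the closure have a neighbourhood that misses it, where the claim is vacuous. The index
    [n] makes one lemma serve boundedness and uniform continuity. *)
Lemma closure_uniform E (B : R) (P : nat -> C * C -> Prop) :
  (forall x, E x -> normc x.1 <= B /\ normc x.2 <= B) ->
  (forall x, closure E x -> exists2 d : R, 0 < d & exists N, forall n, (N <= n)%N -> forall y,
     closure E y -> normc (y.1 - x.1) < d -> normc (y.2 - x.2) < d -> P n y) ->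
  exists N, forall y, closure E y -> P N y.
Proof.
move=> HB HP; pose I : set R := `[- (B + 1), B + 1]%classic.
have cI : compact I by exact: segment_compact.
have cK := compact_setX (compact_setX cI cI) (compact_setX cI cI).
pose Q n (p : R * R * (R * R)) := closure E (toCC p) -> P n (toCC p).
have near (p q : R * R * (R * R)) (d : R) : ball p d q ->
    normc ((toCC q).1 - (toCC p).1) < d + d /\ normc ((toCC q).2 - (toCC p).2) < d + d.
  have gen (a b a' b' : R) : `|a - a'| < d -> `|b - b'| < d -> normc (a' +i* b' - (a +i* b)) < d + d.
    move=> h1 h2; apply: le_lt_trans (normc_le_ReIm _) _; rewrite ReD ImD ReN ImN /=.
    by apply: ltrD; rewrite distrC.
  by case: p q => [[p1 p2] [p3 p4]] [[q1 q2] [q3 q4]] [[b1 b2] [b3 b4]]; split; exact: gen.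
have /compact_near_coveringP/(_ nat \oo Q _)[|N _ HN] := cK.
  move=> p _; have [cp|ncp] := pselect (closure E (toCC p)).
    have [d d0 [N HN]] := HP _ cp.
    exists (ball p (d / 2), [set n | (N <= n)%N]) => /=.
      by split; [apply: nbhsx_ballx; rewrite divr_gt0|exists N].
    by move=> [q n] [/= /near[h1 h2] Nn] cq; apply: (HN n Nn) => //; rewrite (splitr d).
  have [e e0 He] : exists2 e : R, 0 < e & forall y, E y ->
      ~ (normc (y.1 - (toCC p).1) < e /\ normc (y.2 - (toCC p).2) < e).
    apply: contrapT => ne; apply: ncp; apply/closureC2P => e e0; apply: contrapT => nex.
    by apply: ne; exists e => // y Ey [h1 h2]; apply: nex; exists y.
  exists (ball p (e / 4), setT) => /=.
    by split; [apply: nbhsx_ballx; rewrite divr_gt0|exists 0%N].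
  move=> [q n] [/= /near[h1 h2] _] /closureC2P cq; exfalso.
  have e20 : 0 < e / 2 by rewrite divr_gt0.
  have [y [Ey k1 k2]] := cq _ e20; apply: (He y Ey).
  have e4 : e / 4 + e / 4 = e / 2 by field.
  rewrite e4 in h1 h2.
  by split; [apply: (halves_lt _ k1 h1)|apply: (halves_lt _ k2 h2)];
     (apply: le_trans (normcD _ _); rewrite addrA subrK).
exists N => y cy.
have yB : normc y.1 <= B + 1 /\ normc y.2 <= B + 1.
  have [z [Ez h1 h2]] := (closureC2P E y).1 cy 1 ltr01; have [b1 b2] := HB z Ez.
  split; [rewrite -(subrK z.1 y.1) addrC|rewrite -(subrK z.2 y.2) addrC];
    by apply: le_trans (normcD _ _) _; apply: lerD; [|rewrite distcC; exact: ltW].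
have inI (c : C) : normc c <= B + 1 -> I (Rec c) /\ I (Imc c).
  move=> h; split; rewrite /I /= in_itv /= -ler_norml; apply: le_trans h.
    exact: Re_le_normc.
  exact: Im_le_normc.
have := HN N (leqnn N) ((Rec y.1, Imc y.1), (Rec y.2, Imc y.2)).
have E1 : toCC ((Rec y.1, Imc y.1), (Rec y.2, Imc y.2)) = y.
  by case: (y) => -[a b] [c d].
rewrite /Q E1; apply => //.
by have [h1 h2] := yB; have [i1 i2] := inI _ h1; have [i3 i4] := inI _ h2.
Qed.

Lemma ccont_on_bounded E (B : R) phi : (forall x, E x -> normc x.1 <= B /\ normc x.2 <= B) ->
  ccont_on (closure E) phi -> exists M : R, forall y, closure E y -> normc (phi y) <= M.
Proof.
move=> HB c; have [|N HN] := @closure_uniform E B (fun n y => normc (phi y) <= n%:R) HB; last by exists N%:R.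
move=> x cx; have [d d0 H] := c x cx 1 ltr01; exists d => //.
pose N := (Num.bound (normc (phi x) + 1)); exists N => n Nn y cy h1 h2.
have h := H y cy h1 h2; rewrite -(subrK (phi x) (phi y)); apply: le_trans (normcD _ _) _.
apply: (@le_trans _ _ (normc (phi x) + 1)); first by rewrite addrC lerD2l ltW.
apply: (@le_trans _ _ N%:R); last by rewrite ler_nat.
by apply: ltW; apply: archi_boundP; rewrite addr_ge0 ?normc_ge0.
Qed.

Lemma ccont_on_uniform E (B : R) phi : (forall x, E x -> normc x.1 <= B /\ normc x.2 <= B) ->
  ccont_on (closure E) phi -> forall e : R, 0 < e -> exists2 d : R, 0 < d & forall x y,
    closure E x -> closure E y -> normc (x.1 - y.1) < d -> normc (x.2 - y.2) < d ->
    normc (phi x - phi y) <= e.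
Proof.
move=> HB c e e0.
pose P n y := forall x, closure E x -> normc (x.1 - y.1) < n.+1%:R^-1 ->
  normc (x.2 - y.2) < n.+1%:R^-1 -> normc (phi x - phi y) <= e.
have [|N HN] := @closure_uniform E B P HB; last first.
  exists N.+1%:R^-1; first by rewrite invr_gt0 ltr0n.
  by move=> x y cx cy h1 h2; exact: (HN y cy x cx h1 h2).
move=> x cx; have e20 : 0 < e / 2 by rewrite divr_gt0.
have [d d0 H] := c x cx _ e20; have d20 : 0 < d / 2 by rewrite divr_gt0.
exists (d / 2) => //; have /cvgrPdist_lt/(_ _ d20)[N _ HN] := @cvg_harmonic R.
exists N => n Nn y cy h1 h2 z cz k1 k2.
have hn : n.+1%:R^-1 < d / 2 :> R.
  by have := HN n Nn; rewrite /= sub0r normrN ger0_norm// invr_ge0.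
have tri (a b c' : C) : normc (a - b) < n.+1%:R^-1 -> normc (b - c') < d / 2 -> normc (a - c') < d.
  move=> j1 j2; apply: (halves_lt _ (lt_trans j1 hn) j2).
  by apply: le_trans (normcD _ _); rewrite addrA subrK.
have a1 := H z cz (tri _ _ _ k1 h1) (tri _ _ _ k2 h2).
have hd : d / 2 < d by exact: half_lt.
have a2 := H y cy (lt_trans h1 hd) (lt_trans h2 hd); rewrite distcC in a2.
apply: ltW; apply: (halves_lt _ a1 a2).
by apply: le_trans (normcD _ _); rewrite addrA subrK.
Qed.

Lemma differentiable_local (f g : C -> C) z : normc z < 1 ->
  (forall w, normc w < 1 -> f w = g w) -> differentiable g z -> differentiable f z.
Proof.
move=> z1 fg /diff_cderiv[l H]; apply/diff_cderiv; exists l => e e0.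
have [d d0 Hd] := H e e0; exists (Num.min d (1 - normc z)).
  by rewrite lt_min d0 subr_gt0.
move=> h; rewrite lt_min => /andP[hd h1]; rewrite !fg//; first exact: Hd.
by apply: le_lt_trans (normcD _ _) _; rewrite -ltrBrDl.
Qed.

(** The given disc is traded for the affine disc [z -> (r z, w0)], which fills the face and lies in
    the boundary too. Harmonicity is assumed along it, the dichotomy makes one symbol holomorphic on
    the face, and composition with [f1 / r] returns to the given disc. *)
Lemma horizontal_case E phi psi (f1 : C -> C) (w0 : C) : convex_reinhardt E ->
  ccont_on (closure E) phi -> ccont_on (closure E) psi ->
  (forall M : R, 0 <= M -> bounded_symbol E M phi -> bounded_symbol E M psi -> hankel_small E phi psi) ->
  (forall r : R, (forall z, normc z < 1 -> closure E (r%:C * z, w0) /\ ~ E (r%:C * z, w0)) ->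
    harmonic_on (@unit_disk R) (fun z => phi (r%:C * z, w0)) /\
    harmonic_on (@unit_disk R) (fun z => psi (r%:C * z, w0))) ->
  (forall z, normc z < 1 -> differentiable f1 z) ->
  (forall z, normc z < 1 -> closure E (f1 z, w0)) ->
  (forall x, E x -> normc x.2 <= normc w0) ->
  (exists2 z, normc z < 1 & f1 z != f1 0) ->
  (forall z, normc z < 1 -> differentiable (fun z => phi (f1 z, w0)) z) \/
  (forall z, normc z < 1 -> differentiable (fun z => psi (f1 z, w0)) z).
Proof.
move=> cE cphi cpsi small harm df bd top nconst.
have [r [fE f1r strict face_cl]] := horizontal_face cE df bd top nconst.
have [oE _ [B HB] _ _] := cE; have [_ _ _ r0 s0] := face_facts fE.
have nrz z : normc z < 1 -> normc (r%:C * z) < r.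
  by move=> z1; rewrite normcM normc_real gtr0_norm// -[ltRHS]mulr1 ltr_pM2l.
have [|hphi hpsi] := harm r.
  move=> z z1; split; first by apply: face_cl; exact: nrz.
  by move=> /strict; rewrite ltxx.
have [a [b [ea ha]]] := harmonic_expansion hphi; have [a' [b' [ea' ha']]] := harmonic_expansion hpsi.
have [M1 HM1] := ccont_on_bounded HB cphi; have [M2 HM2] := ccont_on_bounded HB cpsi.
pose M := Num.max 1 (Num.max M1 M2); have M0 : 0 < M by rewrite lt_max ltr01.
have sub : E `<=` closure E by exact: subset_closure.
have bphi y : closure E y -> normc (phi y) <= M.
  by move=> /HM1 h; apply: le_trans h _; rewrite !le_max lexx !orbT.
have bpsi y : closure E y -> normc (psi y) <= M.
  by move=> /HM2 h; apply: le_trans h _; rewrite !le_max lexx !orbT.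
have meas chi : ccont_on (closure E) chi -> cmeasurable (@toCC R @^-1` E) (fun x => chi (toCC x)).
  move=> c; apply: ccont2_cmeasurable => // x Ex e e0.
  have [d d0 H] := c x (sub _ Ex) e e0; have [d' d'0 H'] := oE x Ex.
  exists (Num.min d d') => [|y]; first by rewrite lt_min d0.
  rewrite !lt_min => /andP[h1 h1'] /andP[h2 h2'].
  by apply: H => //; apply: sub; exact: H'.
have bsphi : bounded_symbol E M phi by split; [exact: meas|move=> y /sub; exact: bphi].
have bspsi : bounded_symbol E M psi by split; [exact: meas|move=> y /sub; exact: bpsi].
have near chi : ccont_on (closure E) chi -> forall e : R, 0 < e -> exists2 de : R, 0 < de &
    forall x z, bidisc r (normc w0) x -> normc z < r -> normc (x.2 - w0) < de -> normc (x.1 - z) < de ->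
    normc (chi x - chi (z, w0)) <= e.
  move=> c e e0; have [d d0 H] := ccont_on_uniform HB c e0; exists d => // x z bx zr h1 h2.
  apply: H => //; last exact: face_cl.
  by apply: sub; have [[_ _ _ h] _] := fE; exact: h.
have sphi : face_symbol E r w0 phi M a b.
  split => //; [exact: meas|by move=> y /sub; exact: bphi|by move=> z /face_cl; exact: bphi|exact: near].
have spsi : face_symbol E r w0 psi M a' b'.
  split => //; [exact: meas|by move=> y /sub; exact: bpsi|by move=> z /face_cl; exact: bpsi|exact: near].
have rr : r%:C * (r^-1)%:C = 1 :> C by rewrite -rmorphM /= mulfV// gt_eqF.
have comp (chi : C * C -> C) : holomorphic_on (@unit_disk R) (fun z => chi (r%:C * z, w0)) ->
    forall z, normc z < 1 -> differentiable (fun z => chi (f1 z, w0)) z.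
  move=> hol z z1.
  rewrite (_ : (fun z => _) = (fun z => chi (r%:C * z, w0)) \o (fun z => (r^-1)%:C * f1 z)); last first.
    by apply/funext => w; rewrite /= mulrA rr mul1r.
  apply: differentiable_comp; first by apply: differentiableM; [exact: differentiable_cst'|exact: df].
  apply: hol; apply/in_unit_disk; rewrite normcM normc_real ger0_norm ?invr_ge0 ?(ltW r0)//.
  by rewrite mulrC ltr_pdivrMr// mul1r f1r.
have [b0|b0] := face_dichotomy fE M0 sphi spsi (small M (ltW M0) bsphi bspsi).
  by left; apply: comp; exact: ha.
by right; apply: comp; exact: ha'.
Qed.

End Translation.

(** * Affine boundary discs and the reduction to horizontal faces *)

Section Final.
Variable R : realType.
Notation C := R[i].
Implicit Types Omega E : set (C * C).

Lemma boundaryE Omega x : copen2 Omega -> boundary Omega x <-> closure Omega x /\ ~ Omega x.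
Proof.
move=> oO; split=> [[cx nx]|[cx nx]]; split => // Ox; apply: nx.
  by apply/interiorC2P; exact: oO.
by have [e e0 H] := (interiorC2P Omega x).1 Ox; apply: H; rewrite subrr normc0.
Qed.

Lemma differentiable_line (a b : C * C) (z : C) : differentiable (fun z : C => z *: a + b) z.
Proof. by apply: differentiableD; [apply: differentiableZl|exact: differentiable_cst]. Qed.

Lemma boundary_disk_line Omega (r : R) (w0 : C) : copen2 Omega ->
  (forall z, normc z < 1 -> closure Omega (r%:C * z, w0) /\ ~ Omega (r%:C * z, w0)) ->
  boundary_disk Omega (fun z => (r%:C * z, w0)).
Proof.
move=> oO H; split=> [z _|z /in_unit_disk z1]; last by apply/boundaryE => //; exact: H.
rewrite (_ : (fun z => _) = (fun z : C => z *: ((r%:C, 0) : C * C) + (0, w0))).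
  exact: differentiable_line.
apply/funext => w; congr (_, _); first by rewrite addr0 mulrC.
by transitivity (w * 0 + w0); first by rewrite mulr0 add0r.
Qed.

Lemma boundary_disk_line_swap Omega (r : R) (w0 : C) : copen2 Omega ->
  (forall z, normc z < 1 -> closure (@swap2 R @^-1` Omega) (r%:C * z, w0) /\
     ~ (@swap2 R @^-1` Omega) (r%:C * z, w0)) ->
  boundary_disk Omega (fun z => (w0, r%:C * z)).
Proof.
move=> oO H; split=> [z _|z /in_unit_disk z1]; last first.
  by apply/boundaryE => //; have [/closure_swap h1 h2] := H z z1.
rewrite (_ : (fun z => _) = (fun z : C => z *: ((0, r%:C) : C * C) + (w0, 0))).
  exact: differentiable_line.
apply/funext => w; congr (_, _); last by rewrite addr0 mulrC.
by transitivity (w * 0 + w0); first by rewrite mulr0 add0r.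
Qed.

End Final.

Theorem theorem3 (R : realType) (Omega : set (R[i] * R[i]))
    (Omega_domain : domain Omega)
    (Omega_bounded : bounded_set Omega)
    (Omega_convex : convex_set Omega)
    (Omega_reinhardt : reinhardt Omega)
    (Omega_smooth : piecewise_smooth Omega)
    (phi psi : R[i] * R[i] -> R[i])
    (phi_cont : {within closure Omega, continuous phi})
    (psi_cont : {within closure Omega, continuous psi})
    (phi_harmonic : forall f : R[i] -> R[i] * R[i],
      boundary_disk Omega f -> harmonic_on (@unit_disk R) (phi \o f))
    (psi_harmonic : forall f : R[i] -> R[i] * R[i],
      boundary_disk Omega f -> harmonic_on (@unit_disk R) (psi \o f))
    (HH_compact : compact_on_A2 Omega
      (fun h => adjoint Omega (hankel Omega psi) (hankel Omega phi h))) :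
  forall f : R[i] -> R[i] * R[i], boundary_disk Omega f ->
    holomorphic_on (@unit_disk R) (phi \o f) \/
    holomorphic_on (@unit_disk R) (psi \o f).
Proof.
have cE := convex_reinhardt_of Omega_domain Omega_bounded Omega_convex Omega_reinhardt.
have [oO _ _ _ _] := cE.
have cphi := within_ccont_on phi_cont; have cpsi := within_ccont_on psi_cont.
have small (M : R) (M0 : 0 <= M) bphi bpsi := @compact_hankel_small R Omega M oO M0 phi psi bphi bpsi HH_compact.
move=> f [hf bf].
have bd z : normc z < 1 -> closure Omega (f z) /\ ~ Omega (f z).
  by move=> /in_unit_disk /bf /boundaryE; exact.
have d1 z : normc z < 1 -> differentiable (fun z => (f z).1) z.
  move=> /in_unit_disk /hf df; apply: (@differentiable_comp _ _ _ _ f fst z df).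
  by apply: linear_differentiable => y; exact: cvg_fst.
have d2 z : normc z < 1 -> differentiable (fun z => (f z).2) z.
  move=> /in_unit_disk /hf df; apply: (@differentiable_comp _ _ _ _ f snd z df).
  by apply: linear_differentiable => y; exact: cvg_snd.
have n01 : normc (0 : R[i]) < 1 by rewrite normc0.
have hol chi (g : R[i] -> R[i]) : (forall z, normc z < 1 -> chi (f z) = g z) ->
    (forall z, normc z < 1 -> differentiable g z) -> holomorphic_on (@unit_disk R) (chi \o f).
  by move=> E dg z /in_unit_disk z1; exact: (differentiable_local z1 E (dg z z1)).
have cst : (forall z, normc z < 1 -> (f z).1 = (f 0).1) -> (forall z, normc z < 1 -> (f z).2 = (f 0).2) ->
    holomorphic_on (@unit_disk R) (phi \o f).
  move=> c1 c2; apply: (hol phi (fun=> phi (f 0))) => [z z1|z _]; last exact: differentiable_cst'.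
  by rewrite (surjective_pairing (f z)) c1// c2// -surjective_pairing.
(* Separates constant coordinates, for which both compositions are constant, from discs that really
   move inside a face. *)
have dich (g : R[i] -> R[i]) : (forall z, normc z < 1 -> g z = g 0) \/ (exists2 z, normc z < 1 & g z != g 0).
  have [h|h] := pselect (exists2 z, normc z < 1 & g z != g 0); first by right.
  by left=> z z1; apply: contrapT => /eqP gz; apply: h; exists z.
have [c1|[c2 top]] := boundary_disc_flat cE d1 d2 bd; last first.
  have [c1|nc1] := dich (fun z => (f z).1); first by left; exact: cst.
  have fE z : normc z < 1 -> f z = ((f z).1, (f 0).2).
    by move=> z1; rewrite -(c2 z z1) -surjective_pairing.
  have harm r : (forall z, normc z < 1 -> closure Omega (r%:C * z, (f 0).2) /\ ~ Omega (r%:C * z, (f 0).2)) ->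
      harmonic_on (@unit_disk R) (fun z => phi (r%:C * z, (f 0).2)) /\
      harmonic_on (@unit_disk R) (fun z => psi (r%:C * z, (f 0).2)).
    by move=> /(boundary_disk_line oO) h; split; [exact: (phi_harmonic _ h)|exact: (psi_harmonic _ h)].
  have cl z : normc z < 1 -> closure Omega ((f z).1, (f 0).2) by move=> z1; rewrite -fE//; case: (bd z z1).
  have [h|h] := horizontal_case cE cphi cpsi small harm d1 cl top nc1.
    by left; apply: hol h => z z1; rewrite {1}fE.
  by right; apply: hol h => z z1; rewrite {1}fE.
(* The first coordinate is constant, so the face is vertical; after the exchange of coordinates it
   becomes horizontal. *)
have cE' := convex_reinhardt_swap cE; have [oE' _ _ _ _] := cE'.
have bd' z : normc z < 1 -> closure (@swap2 R @^-1` Omega) (swap2 (f z)) /\ ~ (@swap2 R @^-1` Omega) (swap2 (f z)).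
  by move=> /bd[h1 h2]; split; [apply/closure_swap|]; rewrite /preimage /mkset swap2K.
have [c2|[_ top]] := boundary_disc_flat cE' (f := fun z => swap2 (f z)) d2 d1 bd'; first by left; exact: cst.
have [c2|nc2] := dich (fun z => (f z).2); first by left; exact: cst.
have fE z : normc z < 1 -> f z = ((f 0).1, (f z).2).
  by move=> z1; rewrite -(c1 z z1) -surjective_pairing.
have harm r : (forall z, normc z < 1 -> closure (@swap2 R @^-1` Omega) (r%:C * z, (f 0).1) /\
      ~ (@swap2 R @^-1` Omega) (r%:C * z, (f 0).1)) ->
    harmonic_on (@unit_disk R) (fun z => (phi \o @swap2 R) (r%:C * z, (f 0).1)) /\
    harmonic_on (@unit_disk R) (fun z => (psi \o @swap2 R) (r%:C * z, (f 0).1)).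
  by move=> /(boundary_disk_line_swap oO) h; split; [exact: (phi_harmonic _ h)|exact: (psi_harmonic _ h)].
have small' (M : R) : 0 <= M -> bounded_symbol (@swap2 R @^-1` Omega) M (phi \o @swap2 R) ->
    bounded_symbol (@swap2 R @^-1` Omega) M (psi \o @swap2 R) ->
    hankel_small (@swap2 R @^-1` Omega) (phi \o @swap2 R) (psi \o @swap2 R).
  have back chi : bounded_symbol (@swap2 R @^-1` Omega) M (chi \o @swap2 R) -> bounded_symbol Omega M chi.
    move=> [m b]; split=> [|y Oy].
      by have := cmeasurable_swap oE' m; rewrite preswap2K; congr (cmeasurable _ _).
    by rewrite -(swap2K y); apply: b; rewrite /preimage /mkset swap2K.
  by move=> M0 /back bphi /back bpsi; exact: (hankel_small_swap oO M0 bphi bpsi (small M M0 bphi bpsi)).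
have cl z : normc z < 1 -> closure (@swap2 R @^-1` Omega) ((f z).2, (f 0).1).
  by move=> z1; apply/closure_swap; rewrite -[swap2 _]/((f 0).1, (f z).2) -fE//; case: (bd z z1).
have [h|h] := horizontal_case cE' (ccont_on_swap cphi) (ccont_on_swap cpsi) small' harm d2 cl top nc2.
  by left; apply: hol h => z z1; rewrite {1}fE.
by right; apply: hol h => z z1; rewrite {1}fE.
Qed.
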